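(* Let $\{\mathfrak p_j\}_{j\in J}$ be a finite family of maximal ideals of $\mathcal O_K$, and let $\{P_i\}_{i\in I}$ be a family of rational points of $X$ such that for every $i\in I$ and $j\in J$ the reduction of $P_i$ modulo $\mathfrak p_j$ is one and the same non-singular point $\xi_j\in\mathscr X(\mathbb F_{\mathfrak p_j})$. If for a positive integer $D$ the inequality \[\sup_{i\in I}h(P_i)<\frac{\widehat\mu(\overline F_D)}{D}-\frac{\log r_1(D)}{2D}+\frac{1}{[K:\mathbb Q]}\sum_{j\in J}\frac{\mathcal R_{\xi_j}(F_D)}{D\,r_1(D)}\log N(\mathfrak p_j)\] holds, then there exists a section $s\in H^0(\mathbb P(\mathcal E_K),\mathcal O(D))$ vanishing at all the points $P_i$ but not vanishing identically on $X$; i.e. $\{P_i\}_{i\in I}$ is contained in a hypersurface of degree $D$ of $\mathbb P(\mathcal E_K)$ which does not contain the generic point of $X$.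
   Context: $K$ is a number field, $\mathcal O_K$ its ring of integers; for a maximal ideal $\mathfrak p$, $\mathbb F_{\mathfrak p}=\mathcal O_K/\mathfrak p$, $N(\mathfrak p)=\#\mathbb F_{\mathfrak p}$, $\mathcal O_{K,\mathfrak p}$ the localization. A Hermitian vector bundle $\overline F$ on $\mathrm{Spec}\,\mathcal O_K$ is a finitely generated projective $\mathcal O_K$-module $F$ together with, for each embedding $\sigma:K\to\mathbb C$, a Hermitian norm on $F\otimes_\sigma\mathbb C$, conjugate embeddings giving conjugate norms. Its Arakelov degree is $\widehat{\deg}(\overline F)=\log\#\big(F/(\mathcal O_Ks_1+\cdots+\mathcal O_Ks_r)\big)-\frac12\sum_\sigma\log\det(\langle s_i,s_l\rangle_\sigma)$ for any $s_1,\ldots,s_r\in F$ forming a $K$-basis of $F_K=F\otimes K$, and its slope is $\widehat\mu(\overline F)=\widehat{\deg}(\overline F)/([K:\mathbb Q]\,\mathrm{rk}F)$. Fix a Hermitian vector bundle $\overline{\mathcal E}$ of rank $n+1$; $\mathbb P(\mathcal E)$ is the projective space of rank-one projective quotients of $\mathcal E$, $\mathcal O(1)$ its tautological line bundle, equipped at each $\sigma$ with the Fubini–Study (quotient) metric. For $D\geqslant1$, $E_D=H^0(\mathbb P(\mathcal E),\mathcal O(D))$; for each $\sigma$, $\|s\|_{\sigma,\sup}=\sup_x\|s(x)\|_{\mathrm{FS}}$, and the John norm is the Hermitian norm whose unit ball is the maximal-volume ellipsoid contained in the unit ball of $\|\cdot\|_{\sigma,\sup}$. $X\subset\mathbb P(\mathcal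 E_K)$ is a closed integral subscheme and $\mathscr X$ its Zariski closure in $\mathbb P(\mathcal E)$. $F_D$ is the largest saturated (torsion-free quotient) sub-$\mathcal O_K$-module of $H^0(\mathscr X,\mathcal O(1)|_{\mathscr X}^{\otimes D})$ with $F_D\otimes K$ equal to the image of the restriction map $E_D\otimes K\to H^0(X,\mathcal O(1)|_X^{\otimes D})$; $\overline F_D$ is $F_D$ with, at each $\sigma$, the quotient norm of the John norm via this restriction map; $r_1(D)=\mathrm{rk}F_D$. For $P\in X(K)$ let $\mathcal P:\mathrm{Spec}\,\mathcal O_K\to\mathscr X$ be its unique extension; the height is $h(P)=\widehat{\deg}(\mathcal P^*\overline{\mathcal O(1)})/[K:\mathbb Q]$, and the reduction of $P$ modulo $\mathfrak p$ is the $\mathbb F_{\mathfrak p}$-point of $\mathscr X$ obtained by composing $\mathcal P$ with $\mathrm{Spec}\,\mathbb F_{\mathfrak p}\to\mathrm{Spec}\,\mathcal O_K$. A point $\xi$ is non-singular if $\mathcal O_{\mathscr X,\xi}$ is regular. Definition of $\mathcal R_{\xi_j}(F_D)$: fix $i_1\in I$; $\mathcal P_{i_1}$ induces a local homomorphism of $\mathcal O_{K,\mathfrak p_j}$-algebras $\mathcal O_{\mathscr X,\xi_j}\to\mathcal O_{K,\mathfrak p_j}$ with prime kernel $\mathfrak a$; let $R$ be the localization of $\mathcal O_{\mathscr X,\xi_j}$ at $\mathfrak a$ and $\mathfrak m=\mathfrak aR$. A local trivialization of $\mathcal O(1)^{\otimes D}$ at $\xi_j$ identifies $F_D\otimes_{\mathcal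 O_K}\mathcal O_{K,\mathfrak p_j}$ with a sub-$\mathcal O_{K,\mathfrak p_j}$-module of $\mathcal O_{\mathscr X,\xi_j}\subset R$; then $\mathcal R_{\xi_j}(F_D)=\sum_{k\geqslant1}\dim_K\big((F_D\otimes\mathcal O_{K,\mathfrak p_j})\cap\mathfrak m^k\big)\otimes K$.
   Formalization: The maximal ideals 𝔭_j in the finite family are required to be pairwise distinct, since with repetitions the right-hand side could be made arbitrarily large and the claim would fail; the family of points is non-empty, as the definition of R_ξ already requires. *)

(* Defs.v *)
From HB Require Import structures.
From mathcomp Require Import all_boot all_order all_algebra all_field.
(* mpoly has to be imported before the classical and analysis libraries: the
   other order makes the parser reject its postfix notations. *)
From mathcomp.multinomials Require Import mpoly.
From mathcomp Require Import generic_quotient ring_quotient.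
From mathcomp Require Import complex finmap.
From mathcomp Require Import all_classical all_reals ereal sequences exp.

Set Implicit Arguments.
Unset Strict Implicit.
Unset Printing Implicit Defensive.

Import Order.TTheory GRing.Theory Num.Theory.

Local Open Scope classical_set_scope.
Local Open Scope ring_scope.

Section Modules.
Variables (F : nzRingType) (V : lmodType F).
Implicit Types (A : set F) (M N : set V).

Definition lspan A (X : set V) : set V :=
  [set v | exists m (c : 'I_m -> F) (x : 'I_m -> V),
     [/\ forall i, A (c i), forall i, X (x i) & v = \sum_i c i *: x i]].

Definition submodule A M : Prop :=
  [/\ M 0, forall u v, M u -> M v -> M (u + v)
    & forall a u, A a -> M u -> M (a *: u)].

(* M is a direct factor of A^m: v |-> (phi_i v)_i is a section of the
   A-linear map A^m -> M, (a_i)_i |-> \sum_i a_i e_i. *)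
Definition fg_projective A M : Prop :=
  exists m (e : 'I_m -> V) (phi : 'I_m -> V -> F),
    [/\ forall i, M (e i),
        forall i v, M v -> A (phi i v),
        forall i u v, M u -> M v -> phi i (u + v) = phi i u + phi i v,
        forall i a v, A a -> M v -> phi i (a *: v) = a * phi i v
      & forall v, M v -> v = \sum_i phi i v *: e i].

Definition is_basis (W : set V) r (s : 'I_r -> V) : Prop :=
  (forall c : 'I_r -> F, \sum_i c i *: s i = 0 -> forall i, c i = 0)
  /\ W = lspan setT (range s).

Definition dimension (W : set V) : nat :=
  xget 0%N [set r | exists s : 'I_r -> V, is_basis W s].

End Modules.

(* #(M/N), or 0 if M/N is infinite *)
Definition card_quotient (V : zmodType) (M N : set V) : nat :=
  #|` fset_set ((fun v => [set w | N (w - v)]) @` M)|%fset.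

Section Ideals.
Variables (F : comNzRingType) (A : set F).

Definition ideal (J : set F) : Prop :=
  J `<=` A /\ @submodule F F^o A J.

Definition prime_ideal (P : set F) : Prop :=
  [/\ ideal P, ~ P 1 & forall a b, A a -> A b -> P (a * b) -> P a \/ P b].

Definition maximal_ideal (M : set F) : Prop :=
  [/\ ideal M, ~ M 1 & forall J, ideal J -> ~ J 1 -> M `<=` J -> J = M].

Definition generated_by m (g : 'I_m -> F) : set F := @lspan F F^o A (range g).

Definition ideal_power (J : set F) (k : nat) : set F :=
  @lspan F F^o A
    [set y | exists2 z : 'I_k -> F, forall i, J (z i) & y = \prod_i z i].

Definition noetherian : Prop :=
  forall J, ideal J -> exists m (g : 'I_m -> F), J = generated_by g.

Definition prime_chain (d : nat) : Prop :=
  exists q : nat -> set F, (forall i, (i <= d)%N -> prime_ideal (q i)) /\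
    (forall i, (i < d)%N -> q i `<` q i.+1).

Definition krull_dim (d : nat) : Prop :=
  prime_chain d /\ forall d', prime_chain d' -> (d' <= d)%N.

Definition regular_local : Prop :=
  noetherian /\ exists M, [/\ maximal_ideal M,
    forall M', maximal_ideal M' -> M' = M
    & exists d (g : 'I_d -> F), krull_dim d /\ M = generated_by g].

End Ideals.

Definition localize (F : fieldType) (A P : set F) : set F :=
  [set a / b | a in A & b in A `\` P].

Section QuotientDomain.
Variables (A : comNzRingType) (I : prime_idealr A).

Definition quot_domain : Type := {ideal_quot I}.
HB.instance Definition _ := GRing.ComNzRing.on quot_domain.

Definition quot_unit : pred quot_domain := fun x => `[< exists y, y * x = 1 >].
Definition quot_inv (x : quot_domain) : quot_domain :=
  if quot_unit x then xget x [set y | y * x = 1] else x.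

Lemma quot_mulVr : {in quot_unit, left_inverse 1 quot_inv *%R}.
Proof.
move=> x ux; rewrite /quot_inv; have -> : quot_unit x by exact: ux.
have /asboolP[y yx] : quot_unit x by exact: ux.
exact: (@xgetPex _ x [set y | y * x = 1]) (ex_intro _ y yx).
Qed.

Lemma quot_unitPl (x y : quot_domain) : y * x = 1 -> quot_unit x.
Proof. by move=> yx; apply/asboolP; exists y. Qed.

Lemma quot_inv_out : {in [predC quot_unit], quot_inv =1 id}.
Proof. by move=> x /negbTE ux; rewrite /quot_inv ifF. Qed.

HB.instance Definition _ := GRing.ComNzRing_hasMulInverse.Build quot_domain
  quot_mulVr quot_unitPl quot_inv_out.
HB.instance Definition _ := GRing.ComUnitRing_isIntegral.Build quot_domain
  (@Quotient.rquot_IdomainAxiom A I).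

End QuotientDomain.

Definition ring_of_integers (K : fieldExtType rat) : set K :=
  [set z | integralOver (intr : int -> K) z].
Arguments ring_of_integers : clear implicits.

Definition embedding (K : fieldExtType rat) (R : realType) : Type :=
  {rmorphism K -> R[i]}.
HB.instance Definition _ K R := gen_eqMixin (embedding K R).
HB.instance Definition _ K R := gen_choiceMixin (embedding K R).

(* so that a sum over embedding K R has one term for each map K -> R[i] *)
Lemma embedding_ext K R (s t : embedding K R) :
  (s : K -> R[i]) =1 (t : K -> R[i]) -> s = t.
Proof.
case: s t => [f [a b]] [g [a' b']] /= /funext fg; subst g.
case: a a' => [a] [a']; rewrite (Prop_irrelevance a a').
by case: b b' => [b] [b']; rewrite (Prop_irrelevance b b').
Qed.

Section HermitianNorms.
Variables (R : realType) (U : lmodType R[i]).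

Definition hnorm (q : {dot U for conjc}) (u : U) : R :=
  Num.sqrt (complex.Re (q u u)).

(* the scalar product, linear in u, of the Hermitian norm N *)
Definition polarization (N : U -> R) (u v : U) : R[i] :=
  4%:R^-1 * \sum_(k < 4)
    (Complex 0 1) ^+ k * ((N (u + (Complex 0 1) ^+ k *: v)) ^+ 2)%:C%C.

End HermitianNorms.

(* The Arakelov degree of an O_K-module M inside a K-vector space, where the
   metric at sigma is given by the scalar products ip sigma of the elements of
   M; the value does not depend on the choice of s. *)
Definition arakelov_degree (K : fieldExtType rat) (R : realType)
    (V : lmodType K) (M : set V) (ip : embedding K R -> V -> V -> R[i]) : R :=
  xget 0 [set d | exists r (s : 'I_r -> V),
    [/\ forall i, M (s i), is_basis (lspan setT M) s
      & d = ln (card_quotient M (lspan (ring_of_integers K) (range s)))%:R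
            - 2^-1 * \sum_(sigma \in [set: embedding K R])
                ln (complex.Re (\det (\matrix_(i, l) ip sigma (s i) (s l))))]].

Definition slope (K : fieldExtType rat) (R : realType)
    (V : lmodType K) (M : set V) (ip : embedding K R -> V -> V -> R[i]) : R :=
  arakelov_degree M ip / ((\dim {:K})%:R * (dimension (lspan setT M))%:R).

(* A Hermitian vector bundle E of rank n+1 is given by a finitely generated
   projective O_K-module E inside E_K = K^(n+1) and by a scalar product on
   C^(n+1) (the completion of E at sigma) for every embedding sigma. *)
Definition hermitian_bundle (K : fieldExtType rat) (R : realType) (n : nat)
    (E : set 'rV[K]_n.+1)
    (h : embedding K R -> {dot 'rV[R[i]]_n.+1 for conjc}) : Prop :=
  [/\ submodule (ring_of_integers K) E,
      fg_projective (ring_of_integers K) E,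
      lspan setT E = setT
    & forall sigma tau : embedding K R, (forall a, tau a = conjc (sigma a)) ->
        forall u v, h tau (map_mx conjc u) (map_mx conjc v)
                    = conjc (h sigma u v)].

Section Volume.
Variables (R : realType) (m : nat).
Implicit Types A : set 'rV[R]_m.

Definition box (a b : 'rV[R]_m) : set 'rV[R]_m :=
  [set v | forall j, a 0 j <= v 0 j <= b 0 j].

Definition box_volume (a b : 'rV[R]_m) : R :=
  \prod_j Num.max 0 (b 0 j - a 0 j).

(* Lebesgue outer measure on R^m *)
Definition volume A : \bar R :=
  ereal_inf [set v | exists a b : nat -> 'rV[R]_m,
    A `<=` \bigcup_k box (a k) (b k)
    /\ v = (\sum_(0 <= k <oo) (box_volume (a k) (b k))%:E)%E].

Definition ellipsoid A : Prop :=
  exists (c : 'rV[R]_m) (T : 'M[R]_m), T \in unitmx /\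
    A = [set c + u *m T | u in [set u : 'rV[R]_m | \sum_j u 0 j ^+ 2 <= 1]].

End Volume.

Definition real_coord (R : realType) (W : vectType R[i]) (w : W) :
    'rV[R]_(\dim {:W} + \dim {:W}) :=
  let z := \row_i coord (vbasis {:W}) i w in
  row_mx (map_mx (@complex.Re R) z) (map_mx (@complex.Im R) z).

Section FubiniStudy.
Variables (R : realType) (n : nat).
Local Notation C := R[i].
Variable q : {dot 'rV[C]_n.+1 for conjc}.

(* the norm of a in C for the quotient norm given by the linear form y *)
Definition quotient_norm (y : 'I_n.+1 -> C) (a : C) : R :=
  inf [set hnorm q u | u in [set u : 'rV[C]_n.+1 | \sum_k u 0 k * y k = a]].

(* The complex points of P(E) are the nonzero linear forms y on C^(n+1) up to
   scaling; the fibre of O(D) at y is C, with the D-th power of the quotient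
   norm. *)
Definition fs_norm D (s : dhomog n.+1 C D) (y : 'I_n.+1 -> C) : R :=
  Normc.normc (meval y s) * quotient_norm y 1 ^+ D.

Definition sup_norm D (s : dhomog n.+1 C D) : R :=
  sup [set fs_norm s y | y in [set y | exists k, y k != 0]].

Definition is_john_norm D (j : {dot dhomog n.+1 C D for conjc}) : Prop :=
  let B := @real_coord R _ @` [set s | hnorm j s <= 1] in
  let Bsup := @real_coord R _ @` [set s : dhomog n.+1 C D | sup_norm s <= 1] in
  [/\ ellipsoid B, B `<=` Bsup
    & forall B', ellipsoid B' -> B' `<=` Bsup -> (volume B' <= volume B)%E].

End FubiniStudy.

(* X is given by a homogeneous prime ideal of Sym(E_K) = K[T_0, ..., T_n] that
   does not contain the irrelevant ideal. *)
Definition integral_subscheme (K : fieldExtType rat) n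
    (I : prime_idealr {mpoly K[n.+1]}) : Prop :=
  (forall f d, f \in I -> pihomog mdeg d f \in I)
  /\ exists k : 'I_n.+1, ('X_k : {mpoly K[n.+1]}) \notin I.

(* The fraction field of the homogeneous coordinate ring Sym(E_K)/I of X. It
   contains the function field of X (elements of degree 0) and the stalks of
   all the sheaves O(D) (elements of degree D). *)
Section ConeField.
Variables (K : fieldExtType rat) (n : nat) (I : prime_idealr {mpoly K[n.+1]}).

Definition cone_field : Type := {fraction quot_domain I}.
HB.instance Definition _ := GRing.Field.on cone_field.

Definition restrict (f : {mpoly K[n.+1]}) : cone_field :=
  FracField.tofrac (\pi_({ideal_quot I})%qT f : quot_domain I).

Lemma restrictD f g : restrict (f + g) = restrict f + restrict g.
Proof.
rewrite /restrict (Quotient.pi_add I).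
exact: (rmorphD (@FracField.tofrac (quot_domain I))).
Qed.

Lemma restrictM f g : restrict (f * g) = restrict f * restrict g.
Proof.
rewrite /restrict (Quotient.pi_mul I).
exact: (rmorphM (@FracField.tofrac (quot_domain I))).
Qed.

Lemma restrict1 : restrict 1 = 1.
Proof.
rewrite /restrict.
have -> : (\pi_({ideal_quot I})%qT (1 : {mpoly K[n.+1]}) : quot_domain I) = 1.
  by have -> : (1 : quot_domain I) = Quotient.one I by []; unlock Quotient.one.
exact: (rmorph1 (@FracField.tofrac (quot_domain I))).
Qed.

Lemma restrict_eq0 f : (restrict f == 0) = (f \in I).
Proof.
rewrite /restrict tofrac_eq0 -[f in RHS]subr0 (Quotient.idealrBE I).
have -> : (0 : quot_domain I) = Quotient.zero I by [].
by unlock Quotient.zero.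
Qed.

Definition cone_scale (a : K) (v : cone_field) : cone_field :=
  restrict a%:MP * v.

Lemma cone_scaleA a b v :
  cone_scale a (cone_scale b v) = cone_scale (a * b) v.
Proof. by rewrite /cone_scale mulrA -restrictM -mpolyCM. Qed.
Lemma cone_scale1 : left_id 1 cone_scale.
Proof. by move=> v; rewrite /cone_scale mpolyC1 restrict1 mul1r. Qed.
Lemma cone_scaleDr : right_distributive cone_scale +%R.
Proof. by move=> a u v; rewrite /cone_scale mulrDr. Qed.
Lemma cone_scaleDl v : {morph cone_scale^~ v : a b / a + b}.
Proof. by move=> a b; rewrite /cone_scale mpolyCD restrictD mulrDl. Qed.

HB.instance Definition _ := GRing.Zmodule_isLmodule.Build K cone_field
  cone_scaleA cone_scale1 cone_scaleDr cone_scaleDl.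

End ConeField.

Section Model.
Variables (K : fieldExtType rat) (n : nat) (E : set 'rV[K]_n.+1).
Variable I : prime_idealr {mpoly K[n.+1]}.
Local Notation OK := (ring_of_integers K).
Local Notation L := (cone_field I).

(* E_K is identified with the space of linear forms in T_0, ..., T_n. *)
Definition linear_form (e : 'rV[K]_n.+1) : {mpoly K[n.+1]} :=
  \sum_k e 0 k *: 'X_k.

Definition sym (d : nat) : set {mpoly K[n.+1]} :=
  lspan OK [set f | exists2 e : 'I_d -> 'rV[K]_n.+1, forall i, E (e i)
                    & f = \prod_i linear_form (e i)].

(* The Zariski closure of X in P(E) = Proj Sym(E) is Proj of the quotient of
   Sym(E) by its intersection with I, i.e. of the image of Sym(E) in L; this
   is the image of degree d. *)
Definition model_ring (d : nat) : set L := @restrict K n I @` sym d.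

(* The points of the Zariski closure: homogeneous prime ideals, given by their
   homogeneous parts, that do not contain the irrelevant ideal *)
Definition model_point (eta : nat -> set L) : Prop :=
  [/\ forall d, eta d `<=` model_ring d,
      forall d, @submodule K L OK (eta d),
      forall d e a b, model_ring d a -> eta e b -> eta (d + e)%N (a * b),
      forall d e a b, model_ring d a -> model_ring e b ->
        eta (d + e)%N (a * b) -> eta d a \/ eta e b
    & exists2 d, (0 < d)%N & ~ model_ring d `<=` eta d].

(* the stalk at eta of O(D) restricted to the Zariski closure of X *)
Definition stalk (D : nat) (eta : nat -> set L) : set L :=
  [set v | exists d a b, [/\ model_ring (d + D)%N a, model_ring d b,
                             ~ eta d b & v = a / b]].

Definition local_ring := stalk 0.

Definition global_sections (D : nat) : set L :=
  [set v | forall eta, model_point eta -> stalk D eta v].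

Definition restriction_image (D : nat) : set L :=
  [set restrict I f | f in [set f | f \is D.-homog]].

Definition saturated_sections (D : nat) (F : set L) : Prop :=
  [/\ F `<=` global_sections D, submodule OK F,
      forall a v, OK a -> a != 0 -> global_sections D v -> F (a *: v) -> F v
    & lspan setT F = restriction_image D].

Definition is_FD (D : nat) (F : set L) : Prop :=
  saturated_sections D F /\
  forall F', saturated_sections D F' -> F' `<=` F.

Definition evaluate (x : 'rV[K]_n.+1) (f : {mpoly K[n.+1]}) : K :=
  meval (fun k => x 0 k) f.

(* The K-points of P(E) are the nonzero linear forms e |-> \sum_k e_k x_k on
   E_K, up to scaling. *)
Definition rational_point (x : 'rV[K]_n.+1) : Prop :=
  x != 0 /\ forall f, f \in I -> evaluate x f = 0.

(* The extension of x to Spec O_K is the quotient E -> x(E); the pull-back of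
   O(d) is x(E)^d, the image of Sym^d(E). *)
Definition pull_back (x : 'rV[K]_n.+1) (d : nat) : set K^o :=
  evaluate x @` sym d.

Definition height (R : realType)
    (h : embedding K R -> {dot 'rV[R[i]]_n.+1 for conjc})
    (x : 'rV[K]_n.+1) : R :=
  arakelov_degree (pull_back x 1)
    (fun sigma u v =>
       polarization (quotient_norm (h sigma) (fun k => sigma (x 0 k)) : R[i]^o -> R)
                    (sigma u) (sigma v))
  / (\dim {:K})%:R.

(* the homogeneous prime ideal of the sections of the O(d) that vanish at the
   reduction of x modulo p *)
Definition reduction (p : set K) (x : 'rV[K]_n.+1) (d : nat) : set L :=
  @restrict K n I @` [set f | sym d f /\ lspan p (pull_back x d) (evaluate x f)].

Section LocalInvariant.
Variables (p : set K) (xi : nat -> set L) (x : 'rV[K]_n.+1).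

(* the homomorphism from the local ring at xi to the localization of O_K at p
   that is induced by the extension of x *)
Definition local_evaluation (v : L) : K :=
  xget 0 [set c | exists d f g,
    [/\ sym d f, sym d g, ~ xi d (restrict I g),
        v = restrict I f / restrict I g & c = evaluate x f / evaluate x g]].

Definition local_kernel : set L :=
  [set v | local_ring xi v /\ local_evaluation v = 0].

Definition local_localization : set L := localize (local_ring xi) local_kernel.

Definition local_maximal_ideal : set L :=
  @lspan L L^o local_localization local_kernel.

(* t is a generator of the stalk at xi of O(D); the trivialization is v |-> v/t *)
Definition trivialization (D : nat) (t : L) : Prop :=
  stalk D xi t /\ stalk D xi = [set v * t | v in local_ring xi].

Definition trivialized_sections (F : set L) (t : L) : set L :=
  [set v / t | v in lspan (localize OK p) F].

Definition R_invariant (R : realType) (F : set L) (t : L) : \bar R :=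
  (\sum_(1 <= k <oo)
     (dimension (lspan (setT : set K) (trivialized_sections F t `&`
        ideal_power local_localization local_maximal_ideal k)))%:R%:E)%E.

End LocalInvariant.

Section QuotientMetric.
Variables (R : realType) (D : nat).
Local Notation C := R[i].
Variable j : embedding K R -> {dot dhomog n.+1 C D for conjc}.

Definition base_change (sigma : embedding K R) (f : dhomog n.+1 K D) :
    dhomog n.+1 C D :=
  indhomog D (map_mpoly sigma f).

(* the kernel of the restriction of sections to X, after extension of scalars
   along sigma *)
Definition restriction_kernel (sigma : embedding K R) :
    set (dhomog n.+1 C D) :=
  lspan setT (base_change sigma @`
    [set f : dhomog n.+1 K D | (f : {mpoly K[n.+1]}) \in I]).

(* the quotient norm of the class of g *)
Definition FD_norm (sigma : embedding K R) (g : dhomog n.+1 C D) : R :=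
  inf [set hnorm (j sigma) g' | g' in [set g' | restriction_kernel sigma (g' - g)]].

Definition lift_section (v : L) : dhomog n.+1 K D :=
  xget 0 [set f : dhomog n.+1 K D | restrict I f = v].

Definition FD_product (sigma : embedding K R) (v w : L) : C :=
  polarization (FD_norm sigma) (base_change sigma (lift_section v))
                               (base_change sigma (lift_section w)).

End QuotientMetric.

End Model.

Arguments reduction {K n} E I p x d.

(* Main.v *)
(** Suppose that no section of degree [D] vanishes at all the points [P i]
    without vanishing on [X]. Then [r = r1(D)] of these points separate the space
    of sections of [X]; evaluating a basis of [F] contained in [F] at them gives
    a determinant [Delta] which is not zero, and the product formula for [Delta]
    contradicts the hypothesis on the heights.

    At the archimedean places [Delta] is bounded by the Gram determinant of the
    basis, because evaluation at a point has norm at most 1 for the John norm and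
    for its quotient. At the finite places the index of the image of [F] in the
    direct sum of the [x_a(E)^D] is computed in two ways; its [p_j]-part is at
    least [N(p_j)^R_j]. Indeed a section in the [k]-th power of the maximal ideal
    [m] at the generic point of [P i1] belongs to the [k]-th power of the kernel
    of [P i1] in the local ring at [xi_j], hence takes values in [p_j^k] at every
    [P i]. This is where regularity is used: the symbolic powers of that kernel
    are its powers. In characteristic 0 this follows from the derivations dual to
    a regular system of parameters, which preserve the local ring by Nakayama's
    lemma. The filtration of the sections by the order of vanishing then gives the
    bound on the index. *)
Require Import Defs.
From HB Require Import structures.
From mathcomp Require Import all_boot all_order all_algebra all_field.
From mathcomp.multinomials Require Import mpoly.
From mathcomp Require Import generic_quotient ring_quotient.
From mathcomp Require Import complex finmap.
From mathcomp Require Import all_classical all_reals ereal sequences exp.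
From mathcomp Require Import topology normedtype.
From mathcomp Require Import ring lra zify.

Set Implicit Arguments.
Unset Strict Implicit.
Unset Printing Implicit Defensive.

Import Order.TTheory GRing.Theory Num.Theory.

Local Open Scope classical_set_scope.
Local Open Scope ring_scope.

(** * Spans, subrings and derivations *)

(** The series defining [R_invariant] is not summed directly. The arithmetic inequality is proved
    for the truncation at an arbitrary level [e], with a bound independent of [e]. The ranks are
    integers, nonincreasing from level 1, and each residue field has at least two elements, so they
    vanish from some level on and the series is a finite sum. The index computation takes place in
    [K^r]. The values at each point are divided by the D-th power of a fixed nonzero element [sa a]
    of the fibre [x_a(E)]; every fibre then becomes a module containing [O], so that all lattices
    can be compared with [O^r]. The choice of [sa] cancels at the end against the degrees of the
    fibres. Regularity acts through a count. A chain of primes of length [d] yields [d - 1]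
    algebraically independent elements, hence [d - 1] dual derivations; a system of [d] generators
    of the maximal ideal yields the uniformizer and [d - 1] generators of the kernel of [P i1].
    Because the two numbers agree, the matrix of derivatives is square and can be inverted. *)

Section Lspan.
Variables (F : nzRingType) (V : lmodType F).
Implicit Types (A : set F) (X : set V).

Lemma lspan_ind A X (P : V -> Prop) :
  P 0 -> (forall u v, P u -> P v -> P (u + v)) ->
  (forall a x, A a -> X x -> P (a *: x)) -> forall v, lspan A X v -> P v.
Proof.
move=> P0 PD PZ v [m [c [x [Ac Xx ->]]]].
by apply: (big_ind P) => // i _; apply: PZ.
Qed.

Lemma lspan0 A X : lspan A X 0.
Proof.
exists 0%N, (fun=> 0), (fun=> 0); split; [by case|by case|by rewrite big_ord0].
Qed.

Lemma lspanD A X u v : lspan A X u -> lspan A X v -> lspan A X (u + v).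
Proof.
move=> [m [c [x [Ac Xx ->]]]] [m' [c' [x' [Ac' Xx' ->]]]].
exists (m + m')%N,
  (fun i => match fintype.split i with inl j => c j | inr j => c' j end),
  (fun i => match fintype.split i with inl j => x j | inr j => x' j end).
split; [by move=> i; case: fintype.split|by move=> i; case: fintype.split|].
rewrite big_split_ord /=; congr (_ + _); apply: eq_bigr => i _.
  by rewrite -[lshift _ _]/(unsplit (inl i)) unsplitK.
by rewrite -[rshift _ _]/(unsplit (inr i)) unsplitK.
Qed.

Lemma lspan_smul A X a x : A a -> X x -> lspan A X (a *: x).
Proof.
by exists 1%N, (fun=> a), (fun=> x); split=> //; rewrite big_ord1.
Qed.

Lemma lspan_mem A X x : A 1 -> X x -> lspan A X x.
Proof. by move=> A1 Xx; rewrite -[x]scale1r; apply: lspan_smul. Qed.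

Lemma lspanZ A X a v : (forall b c, A b -> A c -> A (b * c)) ->
  A a -> lspan A X v -> lspan A X (a *: v).
Proof.
move=> AM Aa; elim/lspan_ind: v / => [|u v|b x Ab Xx].
- by rewrite scaler0; apply: lspan0.
- by rewrite scalerDr; apply: lspanD.
- by rewrite scalerA; apply: lspan_smul => //; apply: AM.
Qed.

Lemma lspan_sum A X I (r : seq I) (f : I -> V) :
  (forall i, lspan A X (f i)) -> lspan A X (\sum_(i <- r) f i).
Proof.
by move=> Xf; apply: big_ind => // [|u v]; [apply: lspan0|apply: lspanD].
Qed.

Lemma lspan_sub A X (M : set V) : submodule A M -> X `<=` M -> lspan A X `<=` M.
Proof.
move=> [M0 MD MZ] XM v; elim/lspan_ind: v / => // a x Aa Xx.
by apply: MZ => //; apply: XM.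
Qed.

Lemma lspan_range A m (g : 'I_m -> V) v : lspan A (range g) v -> A 0 ->
  (forall a b, A a -> A b -> A (a + b)) ->
  exists2 c : 'I_m -> F, forall i, A (c i) & v = \sum_i c i *: g i.
Proof.
move=> Xv A0 AD.
elim/lspan_ind: v / Xv => [|u v [c Ac ->] [d Ad ->]|a x Aa [i _ <-]].
- by exists (fun=> 0) => //; rewrite big1 // => i _; rewrite scale0r.
- exists (fun i => c i + d i) => [i|]; first exact: AD.
  by rewrite -big_split; apply: eq_bigr => i _; rewrite scalerDl.
- exists (fun j => if j == i then a else 0) => [j|]; first by case: ifP.
  rewrite (bigD1 i) //= eqxx big1 ?addr0 // => j /negbTE ->.
  by rewrite scale0r.
Qed.

End Lspan.

Definition subring (F : nzRingType) (A : set F) : Prop :=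
  [/\ A 1, forall a b, A a -> A b -> A (a - b)
    & forall a b, A a -> A b -> A (a * b)].

Section Subring.
Variables (F : nzRingType) (A : set F) (hA : subring A).

Lemma subring1 : A 1. Proof. by case: hA. Qed.
Lemma subringB a b : A a -> A b -> A (a - b). Proof. by case: hA => _ + _; apply. Qed.
Lemma subringM a b : A a -> A b -> A (a * b). Proof. by case: hA => _ _; apply. Qed.
Lemma subring0 : A 0.
Proof. by rewrite -(subrr 1); apply: subringB; apply: subring1. Qed.
Lemma subringN a : A a -> A (- a).
Proof. by rewrite -sub0r; apply: subringB; apply: subring0. Qed.
Lemma subringD a b : A a -> A b -> A (a + b).
Proof. by move=> Aa Ab; rewrite -[b]opprK; apply/subringB/subringN. Qed.
Lemma subringX a k : A a -> A (a ^+ k).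
Proof.
move=> Aa; elim: k => [|k IH]; first by rewrite expr0; apply: subring1.
by rewrite exprS; apply: subringM.
Qed.
Lemma subring_sum I (r : seq I) (P : pred I) (f : I -> F) :
  (forall i, P i -> A (f i)) -> A (\sum_(i <- r | P i) f i).
Proof.
by move=> Af; apply: big_ind => //; [apply: subring0|apply: subringD].
Qed.
Lemma subring_prod I (r : seq I) (P : pred I) (f : I -> F) :
  (forall i, P i -> A (f i)) -> A (\prod_(i <- r | P i) f i).
Proof.
by move=> Af; apply: big_ind => //; [apply: subring1|apply: subringM].
Qed.
Lemma subring_nat k : A k%:R.
Proof.
elim: k => [|k IH]; first exact: subring0.
by rewrite -addn1 natrD; apply: subringD => //; apply: subring1.
Qed.
End Subring.

Definition poly_over (F : nzRingType) (S : set F) (g : {poly F}) : Prop :=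
  forall i, S g`_i.

Section PolyOver.
Variables (F : nzRingType) (S : set F) (rS : subring S).
Implicit Types g h : {poly F}.

Lemma poly_overD g h : poly_over S g -> poly_over S h -> poly_over S (g + h).
Proof. by move=> Sg Sh i; rewrite coefD; apply: subringD. Qed.
Lemma poly_overN g : poly_over S g -> poly_over S (- g).
Proof. by move=> Sg i; rewrite coefN; apply: subringN. Qed.
Lemma poly_overM g h : poly_over S g -> poly_over S h -> poly_over S (g * h).
Proof.
by move=> Sg Sh i; rewrite coefM; apply: subring_sum => // j _; apply: subringM.
Qed.
Lemma poly_overC a : S a -> poly_over S a%:P.
Proof. by move=> Sa [|i]; rewrite coefC //=; apply: subring0. Qed.
Lemma poly_overX : poly_over S 'X.
Proof.
by move=> i; rewrite coefX; case: eqP => _; [apply: subring1|apply: subring0].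
Qed.
Lemma poly_overXn k : poly_over S 'X^k.
Proof.
by move=> i; rewrite coefXn; case: eqP => _; [apply: subring1|apply: subring0].
Qed.
Lemma poly_over_deriv g : poly_over S g -> poly_over S g^`().
Proof.
move=> Sg i; rewrite coef_deriv -mulr_natr; apply: subringM => //.
exact: subring_nat.
Qed.


Lemma poly_over_horner g x : poly_over S g -> S x -> S g.[x].
Proof.
move=> Sg Sx; rewrite horner_coef; apply: subring_sum => // i _.
by apply: subringM => //; apply: subringX.
Qed.

End PolyOver.

(** * Extending derivations to fields generated by finitely many elements *)

Section DerivationExtension.
Variable L : fieldType.
Hypothesis charL : forall k, k.+1%:R != 0 :> L.
Implicit Types (S : set L) (D : L -> L) (g h : {poly L}).

Definition subfield_set S : Prop := subring S /\ forall a, S a -> S a^-1.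

Definition derivation_on S D : Prop :=
  (forall a b, S a -> S b -> D (a + b) = D a + D b) /\
  (forall a b, S a -> S b -> D (a * b) = D a * b + a * D b).

Section Adjoin.
Variables (S : set L) (D : L -> L) (z w : L).
Hypothesis (hS : subfield_set S) (hD : derivation_on S D).

Let rS : subring S := hS.1.

Let poly_overD := poly_overD rS.
Let poly_overN := poly_overN rS.
Let poly_overM := poly_overM rS.
Let poly_overC := poly_overC rS.
Let poly_overX := poly_overX rS.

Lemma derivation0 : D 0 = 0.
Proof.
have S0 := subring0 rS.
by have := hD.1 _ _ S0 S0; rewrite addr0 => /eqP; rewrite -subr_eq subrr => /eqP.
Qed.

Lemma derivation_sum I (r : seq I) (f : I -> L) :
  (forall i, S (f i)) -> D (\sum_(i <- r) f i) = \sum_(i <- r) D (f i).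
Proof.
move=> Sf; elim: r => [|i r IH]; first by rewrite !big_nil derivation0.
by rewrite !big_cons hD.1 ?IH //; apply: subring_sum.
Qed.

(** The value at [g.[z]] forced on any extension of [D] that sends [z] to [w]: [D] acts on the
    coefficients, and the chain rule gives the second term. *)
Definition adjoin_der g : L := (map_poly D g).[z] + g^`().[z] * w.

Lemma adjoin_derD g h : poly_over S g -> poly_over S h ->
  adjoin_der (g + h) = adjoin_der g + adjoin_der h.
Proof.
move=> Sg Sh; rewrite /adjoin_der derivD hornerD mulrDl.
have -> : map_poly D (g + h) = map_poly D g + map_poly D h.
  apply/polyP => i; rewrite coefD !coef_map_id0 ?derivation0 //.
  by rewrite coefD hD.1.
by rewrite hornerD addrACA.
Qed.

Lemma adjoin_derM g h : poly_over S g -> poly_over S h ->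
  adjoin_der (g * h) = adjoin_der g * h.[z] + g.[z] * adjoin_der h.
Proof.
move=> Sg Sh; rewrite /adjoin_der derivM hornerD !hornerM.
have -> : map_poly D (g * h) = map_poly D g * h + g * map_poly D h.
  apply/polyP => i; rewrite coefD coef_map_id0 ?derivation0 // !coefM.
  rewrite derivation_sum => [|j]; last exact: subringM.
  rewrite -big_split; apply: eq_bigr => j _ /=.
  by rewrite !coef_map_id0 ?derivation0 // hD.2.
rewrite hornerD !hornerM; ring.
Qed.

Lemma adjoin_derN g : poly_over S g -> adjoin_der (- g) = - adjoin_der g.
Proof.
move=> Sg; apply/eqP; rewrite -addr_eq0 -adjoin_derD ?addNr //; last exact: poly_overN.
by rewrite /adjoin_der map_poly0 derivC !horner0 mul0r addr0.
Qed.

Hypothesis zw : forall g, poly_over S g -> g.[z] = 0 -> adjoin_der g = 0.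

Definition adjoin : set L :=
  [set a | exists g h, [/\ poly_over S g, poly_over S h, h.[z] != 0
                         & a = g.[z] / h.[z]]].

(** The quotient rule, applied to some fraction representing [a]; outside [adjoin] the value is the
    default [0]. The hypothesis [zw] is what makes the value independent of the fraction. *)
Definition adjoin_ext (a : L) : L :=
  xget 0 [set b | exists g h, [/\ poly_over S g, poly_over S h, h.[z] != 0,
    a = g.[z] / h.[z]
    & b = (adjoin_der g * h.[z] - g.[z] * adjoin_der h) / h.[z] ^+ 2]].

(** If [g/h] and [g'/h'] agree at [z], the polynomial [g * h' - g' * h] vanishes at [z], so [zw]
    gives a linear relation between the four values of [adjoin_der]; it is solved for
    [adjoin_der g']. *)
Lemma adjoin_extE g h : poly_over S g -> poly_over S h -> h.[z] != 0 ->
  adjoin_ext (g.[z] / h.[z])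
  = (adjoin_der g * h.[z] - g.[z] * adjoin_der h) / h.[z] ^+ 2.
Proof.
move=> Sg Sh hz; rewrite /adjoin_ext.
case: xgetP => [b _ [g' [h' [Sg' Sh' hz' e ->]]]|]; last first.
  by move/(_ _ (ex_intro _ g (ex_intro _ h (And5 Sg Sh hz erefl erefl)))).
have e' : g.[z] * h'.[z] = g'.[z] * h.[z].
  by rewrite -[g.[z]](divfK hz) e mulrAC -[in RHS](divfK hz' g'.[z]); ring.
have : adjoin_der (g * h' - g' * h) = 0.
  apply: zw; last by rewrite !hornerE e' subrr.
  by apply: poly_overD; [|apply: poly_overN]; apply: poly_overM.
rewrite adjoin_derD ?adjoin_derN; do ?[exact: poly_overM|apply: poly_overN].
rewrite !adjoin_derM //.
have -> : g'.[z] = g.[z] * h'.[z] / h.[z] by rewrite e' mulfK.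
move/eqP; rewrite addr_eq0 opprK => /eqP H.
have {H} -> : adjoin_der g' =
  (adjoin_der g * h'.[z] + g.[z] * adjoin_der h'
   - g.[z] * h'.[z] / h.[z] * adjoin_der h) / h.[z].
  by rewrite H addrK mulfK.
by field; rewrite ?hz ?hz'.
Qed.

Lemma map_poly_derC a : map_poly D a%:P = (D a)%:P.
Proof.
apply/polyP => i; rewrite coef_map_id0 ?derivation0 // !coefC.
by case: eqP; rewrite ?derivation0.
Qed.

Lemma adjoin_extC a : S a -> adjoin_ext a = D a.
Proof.
move=> Sa.
have S1 := poly_overC (subring1 rS).
rewrite -[in LHS](hornerC a z) -[a%:P.[z]]divr1 -[X in _ / X](hornerC 1 z).
rewrite adjoin_extE ?hornerC ?oner_eq0 //; last exact: poly_overC.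
have dC b : S b -> adjoin_der b%:P = D b.
  move=> Sb; rewrite /adjoin_der derivC horner0 mul0r addr0.
  by rewrite map_poly_derC hornerC.
rewrite !dC //; last exact: subring1.
have D1 : D 1 = 0.
  have S1' := subring1 rS.
  have := hD.2 _ _ S1' S1'; rewrite !mulr1 mul1r => /eqP.
  by rewrite -subr_eq subrr => /eqP.
by rewrite D1 mulr0 subr0 mulr1 expr1n divr1.
Qed.

Lemma adjoin_sub : S `<=` adjoin.
Proof.
move=> a Sa; exists a%:P, 1%:P; rewrite !hornerC oner_eq0 divr1.
by split=> //; apply: poly_overC => //; apply: subring1.
Qed.

Lemma adjoin_gen : adjoin z.
Proof.
exists 'X, 1%:P; rewrite hornerX hornerC oner_eq0 divr1; split=> //.
by apply: poly_overC; apply: subring1.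
Qed.

Lemma adjoin_ext_gen : adjoin_ext z = w.
Proof.
have S1 : poly_over S 1%:P by apply: poly_overC; apply: subring1.
have z1 : 1%:P.[z] != 0 :> L by rewrite hornerC oner_eq0.
have := adjoin_extE poly_overX S1 z1; rewrite hornerX hornerC divr1 => ->.
have D1 : D 1 = 0.
  have S1' := subring1 rS.
  have := hD.2 _ _ S1' S1'; rewrite !mulr1 mul1r => /eqP.
  by rewrite -subr_eq subrr => /eqP.
have dX : adjoin_der 'X = w.
  rewrite /adjoin_der derivX hornerC mul1r.
  have -> : map_poly D 'X = 0; last by rewrite horner0 add0r.
  apply/polyP => i; rewrite coef_map_id0 ?derivation0 // coefX coef0.
  by case: eqP => _; rewrite ?D1 ?derivation0.
have d1 : adjoin_der 1%:P = 0.
  by rewrite /adjoin_der derivC map_poly_derC D1 !horner0 mul0r addr0.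
by rewrite dX d1 mulr0 subr0 mulr1 expr1n divr1.
Qed.

Lemma adjoin_subfield : subfield_set adjoin.
Proof.
split; first split.
- exact: adjoin_sub (subring1 rS).
- move=> a b [g [h [Sg Sh hz ->]]] [g' [h' [Sg' Sh' hz' ->]]].
  exists (g * h' - g' * h), (h * h'); split.
  + by apply: poly_overD; [|apply: poly_overN]; apply: poly_overM.
  + exact: poly_overM.
  + by rewrite hornerM mulf_neq0.
  + by rewrite !(hornerD, hornerN, hornerM); field; rewrite ?hz ?hz'.
- move=> a b [g [h [Sg Sh hz ->]]] [g' [h' [Sg' Sh' hz' ->]]].
  exists (g * g'), (h * h'); split; try exact: poly_overM.
  + by rewrite hornerM mulf_neq0.
  + by rewrite !(hornerD, hornerN, hornerM); field; rewrite ?hz ?hz'.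
- move=> a [g [h [Sg Sh hz ->]]].
  have [gz|gz] := eqVneq g.[z] 0.
    by rewrite gz mul0r invr0; apply: (adjoin_sub (subring0 rS)).
  by exists h, g; rewrite invf_div.
Qed.

Lemma adjoin_derivation : derivation_on adjoin adjoin_ext.
Proof.
split=> a b [g [h [Sg Sh hz ->]]] [g' [h' [Sg' Sh' hz' ->]]].
- have -> : g.[z] / h.[z] + g'.[z] / h'.[z]
            = (g * h' + g' * h).[z] / (h * h').[z].
    by rewrite !(hornerD, hornerN, hornerM); field; rewrite ?hz ?hz'.
  rewrite !adjoin_extE ?hornerM ?mulf_neq0 //; try exact: poly_overM.
    rewrite hornerD adjoin_derD ?adjoin_derM ?hornerM //; try exact: poly_overM.
    by field; rewrite ?hz ?hz'.
  by apply: poly_overD; apply: poly_overM.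
- have -> : g.[z] / h.[z] * (g'.[z] / h'.[z]) = (g * g').[z] / (h * h').[z].
    by rewrite !(hornerD, hornerN, hornerM); field; rewrite ?hz ?hz'.
  rewrite !adjoin_extE ?hornerM ?mulf_neq0 //; try exact: poly_overM.
  by rewrite !adjoin_derM ?hornerM //; field; rewrite ?hz ?hz'.
Qed.

End Adjoin.

(** If [z] is transcendental over [S], any derivative is allowed and [0] is taken. If [z] is
    algebraic, a polynomial [f] of least degree vanishing at [z] forces the derivative: the formal
    derivative of [f] is nonzero in characteristic 0 and of smaller degree, so it does not vanish at
    [z]. *)
Lemma derivation_adjoin S D z : subfield_set S -> derivation_on S D ->
  exists S' D', [/\ subfield_set S', derivation_on S' D', S `<=` S', S' z
                  & forall a, S a -> D' a = D a].
Proof.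
move=> hS hD; have rS := hS.1.
suff [w zw] : exists w, forall g, poly_over S g -> g.[z] = 0 ->
    adjoin_der D z w g = 0.
  exists (adjoin S z), (adjoin_ext S D z w); split.
  - exact: adjoin_subfield.
  - exact: adjoin_derivation.
  - exact: adjoin_sub.
  - exact: adjoin_gen.
  - by move=> a; apply: adjoin_extC.
have [[f [Sf f0 fz]]|nf] := pselect (exists f, [/\ poly_over S f, f != 0 & f.[z] = 0]); last first.
  exists 0 => g Sg gz; have [->|g0] := eqVneq g 0.
    by rewrite /adjoin_der map_poly0 derivC !horner0 mul0r addr0.
  by exfalso; apply: nf; exists g.
pose Q n := `[< exists f, [/\ poly_over S f, f != 0, f.[z] = 0 & size f = n] >].
have exQ : exists n, Q n by exists (size f); apply/asboolP; exists f.
case: (ex_minnP exQ) => n /asboolP[{}f {Sf f0 fz} [Sf f0 fz sf]] minf.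
have minf' g : poly_over S g -> g.[z] = 0 -> g != 0 -> (n <= size g)%N.
  by move=> Sg gz g0; apply: minf; apply/asboolP; exists g.
have sf1 : (1 < size f)%N.
  rewrite ltnNge; apply/negP => /size1_polyC e.
  by move: fz f0; rewrite e hornerC => ->; rewrite eqxx.
have f'0 : f^`() != 0.
  apply: contraNneq f0 => f'0; have := congr1 (fun q : {poly L} => q`_(size f).-2) f'0.
  rewrite coef_deriv coef0 prednK; last by case: (size f) sf1 => [|[]].
  case: (size f) sf1 (lead_coefE f) => [|[|k]] //= _ <- /eqP.
  by rewrite -mulr_natr mulf_eq0 (negbTE (charL k)) orbF lead_coef_eq0.
have f'z : f^`().[z] != 0.
  apply/eqP => f'z; have := minf' _ (poly_over_deriv rS Sf) f'z f'0.
  by rewrite -sf leqNgt lt_size_deriv.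
(* The solution of [adjoin_der D z w f = 0]. A general [g] vanishing at [z] is treated by induction
   on its size: a multiple of [f] cancels its leading term without changing [adjoin_der]. *)
exists (- (map_poly D f).[z] / f^`().[z]); set w := _ / _ => g.
have df : adjoin_der D z w f = 0 by rewrite /adjoin_der mulrC divfK // subrr.
elim: {g}_.+1 {-2}g (ltnSn (size g)) => // m IH g.
rewrite ltnS => sg Sg gz; have [->|g0] := eqVneq g 0.
  by rewrite /adjoin_der map_poly0 derivC !horner0 mul0r addr0.
have sfg := minf' _ Sg gz g0; rewrite -sf in sfg.
pose q := (lead_coef g / lead_coef f)%:P * 'X^(size g - size f).
have Sq : poly_over S q.
  apply: poly_overM (poly_overXn rS _) => //; apply: poly_overC => //.
  by apply: subringM => //; [exact: Sg|apply: hS.2; exact: Sf].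
have Sqf := poly_overM rS Sq Sf.
have SNqf := poly_overN rS Sqf.
have -> : g = (g - q * f) + q * f by rewrite subrK.
have Sg1 := poly_overD rS Sg SNqf.
rewrite (adjoin_derD z w hS hD) // (adjoin_derM z w hS hD) // df fz !mulr0 !addr0.
apply: IH => //; last by rewrite !hornerE fz gz mulr0 subrr.
apply: leq_trans sg.
have sqf : size (q * f) = size g.

  have l0 : lead_coef g / lead_coef f != 0.
    by rewrite mulf_neq0 ?invr_eq0 ?lead_coef_eq0.
  rewrite /q -mulrA size_Cmul // mulrC size_mulXn // subnK //.
have lqf : lead_coef (q * f) = lead_coef g.
  by rewrite !lead_coefM lead_coefC lead_coefXn mulr1 divfK // lead_coef_eq0.
rewrite ltnNge; apply/negP => le.
have gs : (0 < size g)%N by rewrite size_poly_gt0.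
have : (g - q * f)`_(size g).-1 = 0.
  by rewrite coefB -{2}sqf -!lead_coefE lqf subrr.
have s1 : (size (g - q * f)%R <= size g)%N.
  by rewrite (leq_trans (size_polyD _ _)) // size_polyN sqf maxnn.
have es : size (g - q * f)%R = size g by apply/eqP; rewrite eqn_leq s1 le.
by rewrite -es -lead_coefE => /eqP; rewrite lead_coef_eq0 -size_poly_eq0 es -leqn0 leqNgt gs.
Qed.

Lemma derivation_extend S D (s : seq L) : subfield_set S -> derivation_on S D ->
  exists S' D', [/\ subfield_set S', derivation_on S' D', S `<=` S',
                  forall z, z \in s -> S' z & forall a, S a -> D' a = D a].
Proof.
elim: s S D => [|z s IH] S D hS hD; first by exists S, D; split.
have [S1 [D1 [hS1 hD1 sub1 S1z e1]]] := derivation_adjoin z hS hD.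
have [S2 [D2 [hS2 hD2 sub2 S2s e2]]] := IH _ _ hS1 hD1.
exists S2, D2; split=> //.
- exact: subset_trans sub2.
- by move=> y /[1!inE] /orP[/eqP->|]; [exact: sub2|exact: S2s].
- by move=> a Sa; rewrite e2 ?e1 //; apply: sub1.
Qed.

End DerivationExtension.

(** * Symbolic powers in regular local rings *)

Section IdealPower.
Variables (F : comNzRingType) (A J : set F) (hA : subring A) (JA : J `<=` A).
Local Notation ipow := (ideal_power A J).

Lemma ipow_zero k : ipow k 0.
Proof. exact: lspan0. Qed.

Lemma ipowD k x y : ipow k x -> ipow k y -> ipow k (x + y).
Proof. exact: lspanD. Qed.

Lemma ipowZ k a x : A a -> ipow k x -> ipow k (a * x).
Proof. exact: (lspanZ (V := F^o) (subringM hA)). Qed.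

Lemma ipowN k x : ipow k x -> ipow k (- x).
Proof.
move=> kx; rewrite -mulN1r; apply: ipowZ => //.
by apply: subringN => //; apply: subring1.
Qed.

Lemma ipowB k x y : ipow k x -> ipow k y -> ipow k (x - y).
Proof. by move=> kx ky; apply: ipowD => //; apply: ipowN. Qed.

Lemma ipow_sum k I (r : seq I) (f : I -> F) :
  (forall i, ipow k (f i)) -> ipow k (\sum_(i <- r) f i).
Proof. exact: (lspan_sum (V := F^o)). Qed.

Lemma ipow_prod k (z : 'I_k -> F) : (forall i, J (z i)) -> ipow k (\prod_i z i).
Proof.
move=> Jz; apply: (@lspan_mem F F^o); first exact: subring1.
by exists z.
Qed.

Lemma ipow_exp0 a : A a -> ipow 0 a.
Proof.
move=> Aa; rewrite -[a]mulr1; apply: ipowZ => //.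
by have := @ipow_prod 0 (fun=> 0); rewrite big_ord0; apply; case.
Qed.

Lemma ipow_subring k : ipow k `<=` A.
Proof.
apply: (@lspan_sub F F^o); first split.
- exact: subring0.
- exact: subringD.
- exact: subringM.
- by move=> _ [z Jz ->]; apply: subring_prod => // i _; apply: JA.
Qed.

Lemma ipowS k x y : J x -> ipow k y -> ipow k.+1 (x * y).
Proof.
move=> Jx; elim/(@lspan_ind F F^o): y / => [|u v|a _ Aa [z Jz ->]].
- by rewrite mulr0; apply: ipow_zero.
- by rewrite mulrDr; apply: ipowD.
- rewrite -[_ *: _]/(a * _) mulrCA; apply: ipowZ => //.
  have := @ipow_prod k.+1 (fun i => if unlift ord0 i is Some j then z j else x).
  rewrite big_ord_recl unlift_none.
  rewrite (eq_bigr z) => [|i _]; last by rewrite liftK.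
  by apply=> i; case: unlift.
Qed.

Lemma ipowS_ind k (P : F -> Prop) :
  P 0 -> (forall u v, P u -> P v -> P (u + v)) ->
  (forall x y, J x -> ipow k y -> P (x * y)) -> forall v, ipow k.+1 v -> P v.
Proof.
move=> P0 PD PM; apply: (@lspan_ind F F^o) => // a _ Aa [z Jz ->].
rewrite big_ord_recl -[_ *: _]/(a * _) mulrCA; apply: PM => //.
by apply: ipowZ => //; apply: ipow_prod.
Qed.

Lemma ipowM k l x y : ipow k x -> ipow l y -> ipow (k + l) (x * y).
Proof.
move=> kx ly; elim: k x kx => [|k IH] x.
  by move=> /ipow_subring Ax; apply: ipowZ.
elim/ipowS_ind: x / => [|u v|x z Jx kz].
- by rewrite mul0r; apply: ipow_zero.
- by rewrite mulrDl; apply: ipowD.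
- by rewrite -mulrA addSn; apply: ipowS => //; apply: IH.
Qed.

Lemma ipow_le k l : (k <= l)%N -> ipow l `<=` ipow k.
Proof.
move=> /subnK <-; elim: (l - k)%N => [//|m IH] x.
elim/ipowS_ind: x / => [|u v|x y Jx my]; first exact: ipow_zero.
  exact: ipowD.
by apply: ipowZ; [exact: JA|exact: IH].
Qed.

Lemma ipow1 x : J x -> ipow 1 x.
Proof.
move=> Jx; rewrite -[x]mulr1; apply: ipowS => //; apply: ipow_exp0.
exact: subring1.
Qed.

End IdealPower.

(** * A regular local ring with a section over a discrete valuation ring *)

Section RegularLocal.
Variables (K L : fieldType) (iota : {rmorphism K -> L}).
Variables (O : set K) (w : K) (A : set L) (pi : L -> K).
Hypothesis charK : forall k, k.+1%:R != 0 :> K.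
Hypotheses (hO : subring O) (Ow : O w) (w0 : w != 0) (wV : ~ O w^-1).
Hypothesis dvr : forall a, O a -> a != 0 ->
  exists k u, [/\ O u, O u^-1 & a = u * w ^+ k].
Hypothesis fracO : forall a, exists b c, [/\ O b, O c, c != 0 & a = b / c].
Hypotheses (hA : subring A) (AO : forall a, O a -> A (iota a)).
Hypothesis piA : forall a, A a -> O (pi a).
Hypothesis piD : forall a b, A a -> A b -> pi (a + b) = pi a + pi b.
Hypothesis piM : forall a b, A a -> A b -> pi (a * b) = pi a * pi b.
Hypothesis piO : forall a, O a -> pi (iota a) = a.
Hypothesis AV : forall a, A a -> pi a != 0 -> O (pi a)^-1 -> A a^-1.
Hypothesis noethA : noetherian A.

(** An element of [A] is invertible as soon as its image under [pi] is a unit of [O]. So [A] is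
    local with maximal ideal [maxM], the inverse image of [w O], and [ker] is the prime ideal of the
    section. *)
Let ker : set L := [set a | A a /\ pi a = 0].
Let maxM : set L := [set a | A a /\ exists2 o, O o & pi a = w * o].

Let charL k : k.+1%:R != 0 :> L.
Proof. by rewrite -(rmorph_nat iota) fmorph_eq0. Qed.

Let pi0 : pi 0 = 0.
Proof.
have A0 := subring0 hA; have := piD A0 A0.
by rewrite addr0 => /eqP; rewrite -subr_eq subrr => /eqP.
Qed.

Let piN a : A a -> pi (- a) = - pi a.
Proof.
move=> Aa; apply/eqP; rewrite -addr_eq0 -piD ?addNr ?pi0 //; exact: subringN.
Qed.

Let iw0 : iota w != 0. Proof. by rewrite fmorph_eq0. Qed.

Let kerA : ker `<=` A. Proof. by move=> a []. Qed.

Let ker_piB a : A a -> ker (a - iota (pi a)).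
Proof.
move=> Aa; have Ap := AO (piA Aa); split; first exact: subringB.
by rewrite piD ?piN ?piO ?subrr //; [exact: piA|exact: subringN].
Qed.

Let unit_or_max a : A a -> maxM a \/ (a != 0 /\ A a^-1).
Proof.
move=> Aa; have [p0|p0] := eqVneq (pi a) 0.
  by left; split=> //; exists 0; rewrite ?mulr0 //; apply: subring0.
have [k [u [Ou Ou' e]]] := dvr (piA Aa) p0; case: k e => [|k] e.
  right; split; first by apply: contraNneq p0 => ->; rewrite pi0.
  by apply: AV => //; rewrite e expr0 mulr1.
left; split=> //; exists (u * w ^+ k); first by apply: subringM => //; apply: subringX.
by rewrite e exprS mulrCA.
Qed.

Let maxMD a b : maxM a -> maxM b -> maxM (a + b).
Proof.
move=> [Aa [o Oo e]] [Ab [o' Oo' e']]; split; first exact: subringD.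
by exists (o + o'); rewrite ?piD // ?e ?e' ?mulrDr //; apply: subringD.
Qed.

Let maxMZ a b : A a -> maxM b -> maxM (a * b).
Proof.
move=> Aa [Ab [o Oo e]]; split; first exact: subringM.
exists (pi a * o); last by rewrite piM // e mulrCA.
by apply: subringM => //; apply: piA.
Qed.

Let maxM0 : maxM 0.
Proof.
by split; [exact: subring0|exists 0; rewrite ?mulr0 //; apply: subring0].
Qed.

Let maxM_sum I (r : seq I) (f : I -> L) :
  (forall i, maxM (f i)) -> maxM (\sum_(i <- r) f i).
Proof. by move=> Mf; apply: big_ind. Qed.

Let ker_max : ker `<=` maxM.
Proof.
by move=> a [Aa a0]; split=> //; exists 0; rewrite ?mulr0 //; apply: subring0.
Qed.

Let pi1 : pi 1 = 1.
Proof. by rewrite -(rmorph1 iota) piO //; apply: subring1. Qed.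

Let maxM1 : ~ maxM 1.
Proof.
move=> [_ [o Oo]]; rewrite pi1 => e; apply: wV.
suff -> : w^-1 = o by [].
by apply: (mulfI w0); rewrite divff // e.
Qed.

Let maxM_unit a : maxM a -> a != 0 -> A a^-1 -> False.
Proof.
by move=> Ma a0 Aa'; apply: maxM1; rewrite -(mulVf a0); apply: maxMZ.
Qed.

Let sub1_unit a : maxM a -> (1 - a != 0 /\ A (1 - a)^-1).
Proof.
move=> Ma; have A1 : A (1 - a) by apply: subringB (subring1 hA) Ma.1 => //.
have [M1|//] := unit_or_max A1.
by case: maxM1; rewrite -(subrK a 1); apply: maxMD.
Qed.

(** Elimination of the last vector, since [1 - c] is a unit for [c] in [maxM]. The set [N] and the
    [v i] live in [L] rather than in [A]: the lemma is applied to derivatives of elements of [A]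
    before these are known to lie in [A]. *)
Lemma nakayama (N : set L) m (v : 'I_m -> L) :
  N 0 -> (forall a b, N a -> N b -> N (a + b)) ->
  (forall a b, A a -> N b -> N (a * b)) ->
  (forall i, exists n c, [/\ N n, forall j, maxM (c j)
                           & v i = n + \sum_j c j * v j]) ->
  forall i, N (v i).
Proof.
move=> N0 ND NZ; elim: m v => [|m IH] v hv; first by case.
have [n [c [Nn Mc e]]] := hv ord_max.
have [u0 Au] := sub1_unit (Mc ord_max); set u := 1 - c ord_max in u0 Au.
pose v' j := v (widen_ord (leqnSn m) j).
pose c' j := c (widen_ord (leqnSn m) j).
have {}e : v ord_max = u^-1 * (n + \sum_j c' j * v' j).
  apply: (mulfI u0); rewrite mulVKf // mulrBl mul1r.
  by rewrite {1}e big_ord_recr /= addrA addrK.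
have Nv' i : N (v' i).
  apply: IH => {}i; have [n1 [c1 [Nn1 Mc1 e1]]] := hv (widen_ord (leqnSn m) i).
  exists (n1 + c1 ord_max * u^-1 * n),
    (fun j => c1 (widen_ord (leqnSn m) j) + c1 ord_max * u^-1 * c' j); split.
  - apply: (ND) => //; apply: (NZ) => //; apply: subringM => //.
    by case: (Mc1 ord_max).
  - move=> j; apply: maxMD => //; apply: maxMZ; last exact: Mc.
    by apply: subringM => //; case: (Mc1 ord_max).
  - rewrite /v' e1 big_ord_recr /= e -!addrA; congr (_ + _).
    rewrite addrC mulrA mulrDr -addrA; congr (_ + _).
    rewrite mulr_sumr -big_split; apply: eq_bigr => j _ /=.
    by rewrite addrC mulrDl mulrA.
move=> i; have [j ->|->] := unliftP ord_max i; last first.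
  rewrite e; apply: (NZ) => //; apply: (ND) => //.
  apply: (big_ind N) => // j _; apply: (NZ) => //.
  by case: (Mc (widen_ord (leqnSn m) j)).
have -> : lift ord_max j = widen_ord (leqnSn m) j; last exact: Nv'.
by apply: val_inj; rewrite /= /bump leqNgt ltn_ord.
Qed.

(** The ideals generated by the [a / w^k] increase with [k], so by noetherianity [a / w^(N+1)] is a
    multiple of [a / w^N] for some [N]; for nonzero [a] this would make [w] a unit of [A]. *)
Lemma uniformizer_separated a : (forall k, A (a / iota w ^+ k)) -> a = 0.
Proof.
move=> Aa; apply/eqP; apply/negPn/negP => a0.
pose J := [set x | exists k c, A c /\ x = c * (a / iota w ^+ k)].
have Jle k l c : (k <= l)%N -> A c -> exists2 c', A c' &
    c * (a / iota w ^+ k) = c' * (a / iota w ^+ l).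
  move=> kl Ac; exists (c * iota w ^+ (l - k)).
    by apply: subringM => //; apply: subringX => //; apply: AO.
  rewrite -{2}(subnKC kl) exprD -!mulrA; congr (_ * _).
  by field; rewrite !expf_neq0.
have idJ : ideal A J.
  split; first by move=> x [k [c [Ac ->]]]; apply: subringM.
  split.
  - by exists 0%N, 0; rewrite mul0r; split=> //; apply: subring0.
  - move=> x y [k [c [Ac ->]]] [l [d [Ad ->]]].
    have [c' Ac' ->] := Jle _ _ _ (leq_maxl k l) Ac.
    have [d' Ad' ->] := Jle _ _ _ (leq_maxr k l) Ad.
    by exists (maxn k l), (c' + d'); rewrite mulrDl; split=> //; apply: subringD.
  - move=> b x Ab [k [c [Ac ->]]]; exists k, (b * c).
    by split; [exact: subringM|rewrite -mulrA].
have [m [g Jg]] := noethA idJ.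
have hg i : J (g i).
  by rewrite Jg; apply: (@lspan_mem L L^o); [exact: subring1|exists i].
have [kk hk] := choice hg.
pose N := (\max_i kk i)%N.
have JN x : J x -> exists2 c, A c & x = c * (a / iota w ^+ N).
  rewrite Jg => /(@lspan_range L L^o)/(_ (subring0 hA) (subringD hA))[e Ae ->].
  have hg' i : exists c, A c /\ g i = c * (a / iota w ^+ N).
    have [c [Ac ->]] := hk i.
    have kN : (kk i <= N)%N by apply: (leq_bigmax i).
    by have [c' ? ->] := Jle _ _ _ kN Ac; exists c'.
  have [c hc] := choice hg'.
  exists (\sum_i e i * c i).
    by apply: subring_sum => // i _; apply: subringM => //; case: (hc i).
  rewrite mulr_suml; apply: eq_bigr => i _.
  by rewrite -[_ *: _]/(e i * _) -mulrA; congr (_ * _); case: (hc i).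
have [|c Ac] := JN (a / iota w ^+ N.+1).
  by exists N.+1, 1; rewrite mul1r; split=> //; apply: subring1.
have wN0 : iota w ^+ N != 0 by rewrite expf_neq0.
move=> e; have {}e : 1 = iota w * c.
  apply: (mulfI a0); apply: (@mulIf _ (iota w ^+ N.+1)^-1).
    by rewrite invr_eq0 expf_neq0.
  by rewrite mulr1 e exprS; field; rewrite wN0 iw0.
apply: maxM1; rewrite e mulrC; apply: maxMZ => //; split; first exact: AO.
by exists 1; rewrite ?piO ?mulr1 //; apply: subring1.
Qed.

Fixpoint gen_ring (s : seq L) : set L :=
  if s is x :: s' then
    [set a | exists2 g, poly_over (gen_ring s') g & a = g.[x]]
  else iota @` O.

(** Algebraic independence of the images of [s] in [A/q] over the image of [O]. Coefficients stay in
    the ring generated by the tail of [s], so that one notion serves both for primes containing [w]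
    and for the zero ideal. *)
Fixpoint indep (q : set L) (s : seq L) : Prop :=
  if s is x :: s' then
    indep q s' /\ forall g, poly_over (gen_ring s') g -> q g.[x] ->
                            forall k, q g`_k
  else True.

Lemma gen_ring_subring s : subring (gen_ring s).
Proof.
elim: s => [|x s IH] /=.
  split.
  - by exists 1; rewrite ?rmorph1 //; apply: subring1.
  - by move=> _ _ [a Oa <-] [b Ob <-]; exists (a - b); rewrite ?rmorphB //; apply: subringB.
  - by move=> _ _ [a Oa <-] [b Ob <-]; exists (a * b); rewrite ?rmorphM //; apply: subringM.
split.
- by exists 1%:P; rewrite ?hornerC //; apply: poly_overC => //; apply: subring1.
- move=> _ _ [g Sg ->] [h Sh ->]; exists (g - h); last by rewrite hornerD hornerN.
  by apply: poly_overD => //; apply: poly_overN.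
- move=> _ _ [g Sg ->] [h Sh ->]; exists (g * h); last by rewrite hornerM.
  exact: poly_overM.
Qed.

Lemma gen_ring_cons x s : gen_ring s `<=` gen_ring (x :: s).
Proof.
move=> a Sa; exists a%:P; rewrite ?hornerC //.
by apply: poly_overC => //; apply: gen_ring_subring.
Qed.

Lemma gen_ringO s a : O a -> gen_ring s (iota a).
Proof. by move=> Oa; elim: s => [|x s IH]; [exists a|exact: gen_ring_cons]. Qed.

Lemma gen_ring_mem s x : x \in s -> gen_ring s x.
Proof.
elim: s => [//|y s IH] /[1!inE] /orP[/eqP->|/IH]; last exact: gen_ring_cons.
exists 'X; rewrite ?hornerX //; apply: poly_overX; exact: gen_ring_subring.
Qed.

Definition seq_in (s : seq L) : Prop := forall x, x \in s -> A x.

Lemma seq_in_cons x s : seq_in (x :: s) -> A x /\ seq_in s.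
Proof.
move=> h; split; first by apply: h; rewrite mem_head.
by move=> y ys; apply: h; rewrite inE ys orbT.
Qed.

Lemma gen_ring_sub s : seq_in s -> gen_ring s `<=` A.
Proof.
elim: s => [_ _ [a Oa <-]|x s IH /seq_in_cons[Ax As] _ [g Sg ->]] /=.
  exact: AO.
by apply: poly_over_horner => // i; apply: (IH As _ (Sg i)).
Qed.

Section Primes.
Variable q : set L.
Hypothesis hq : prime_ideal A q.

Let qA : q `<=` A. Proof. by case: hq => -[]. Qed.
Let q0 : q 0. Proof. by case: hq => -[_ []]. Qed.
Let qD a b : q a -> q b -> q (a + b). Proof. by case: hq => -[_ [_ + _]] _ _; apply. Qed.
Let qZ a b : A a -> q b -> q (a * b). Proof. by case: hq => -[_ [_ _]] + _ _; apply. Qed.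
Let qB a b : q a -> q b -> q (a - b).
Proof.
move=> qa qb; apply: qD => //; rewrite -mulN1r; apply: qZ => //.
by apply: subringN => //; apply: subring1.
Qed.
Let qP a b : A a -> A b -> q (a * b) -> q a \/ q b. Proof. by case: hq => _ _; apply. Qed.
Let q1 : ~ q 1. Proof. by case: hq. Qed.

Let q_unit a : O a -> a != 0 -> O a^-1 -> ~ q (iota a).
Proof.
move=> Oa a0 Oa' qa; apply: q1; rewrite -(rmorph1 iota) -(mulVf a0) rmorphM.
by apply: qZ => //; apply: AO.
Qed.

Lemma prime_contr a : ~ q (iota w) -> O a -> q (iota a) -> a = 0.
Proof.
move=> qw Oa qa; apply/eqP/negPn/negP => a0.
have [k [u [Ou Ou' e]]] := dvr Oa a0.
have u0 : u != 0 by apply: contraNneq a0 => u0; rewrite e u0 mul0r.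
move: qa; rewrite e rmorphM rmorphXn.
case/(qP (AO Ou) (subringX hA k (AO Ow))); first exact: q_unit.
elim: k {e} => [|k IH]; first by rewrite expr0.
by rewrite exprS => /(qP (AO Ow) (subringX hA k (AO Ow)))[].
Qed.

(** A nonzero element of [O] is a unit times a power of [w], so the elements of [O] that lie in [q]
    are multiples of [w]; independence carries this to polynomials, coefficient by coefficient. *)
Lemma indep_w s b : q (iota w) -> seq_in s -> indep q s -> gen_ring s b -> q b ->
  exists2 c, gen_ring s c & b = iota w * c.
Proof.
move=> qw; elim: s b => [|x s IH] b.
  move=> _ _ [a Oa <-] qa; have [->|a0] := eqVneq a 0.
    by exists 0; rewrite ?rmorph0 ?mulr0 //; exists 0; rewrite ?rmorph0 //; apply: subring0.
  have [[|k] [u [Ou Ou' e]]] := dvr Oa a0.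
    by case: (q_unit _ a0 _ qa) => //; rewrite e mulr1.
  exists (iota (u * w ^+ k)); last by rewrite -rmorphM e exprS mulrCA.
  by exists (u * w ^+ k) => //; apply: subringM => //; apply: subringX.
move=> /seq_in_cons[Ax As] [Is Ix] [g Sg ->] qg.
exists ((iota w)^-1 *: g).[x]; last by rewrite hornerZ mulVKf.
exists ((iota w)^-1 *: g) => // i; rewrite coefZ.
by have [c Sc ->] := IH _ As Is (Sg i) (Ix _ Sg qg i); rewrite mulKf.
Qed.

Lemma indep_nw s b : ~ q (iota w) -> indep q s -> gen_ring s b -> q b -> b = 0.
Proof.
move=> qw; elim: s b => [|x s IH] b.
  by move=> _ [a Oa <-] qa; rewrite (prime_contr qw Oa qa) rmorph0.
move=> [Is Ix] [g Sg ->] qg.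
have -> : g = 0; last by rewrite horner0.
by apply/polyP => i; rewrite coef0; apply: (IH _ Is (Sg i) (Ix _ Sg qg i)).
Qed.

(** For [p x + c] in [q], the constant term lies in [q'] because [x] does, hence in [q]; then [p x]
    lies in [q], and [p] does because [x] is not in [q]. A strict inclusion of primes thus yields
    one more independent element. *)
Lemma indep_cons (q' : set L) s x : seq_in s -> q `<=` q' ->
  prime_ideal A q' -> q' x -> ~ q x ->
  (forall b, gen_ring s b -> q' b -> q b) -> indep q s -> indep q (x :: s).
Proof.
move=> As qq' hq' q'x qx sub Is; split=> //; elim/poly_ind => [|p c IH] Sg.
  by move=> _ k; rewrite coef0.
have Ax : A x by case: hq' => -[+ _] _ _; apply.
have Sp : poly_over (gen_ring s) p.
  by move=> i; have := Sg i.+1; rewrite coefD coefMX coefC /= addr0.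
have Sc : gen_ring s c by have := Sg 0%N; rewrite coefD coefMX coefC /= add0r.
have Apx : A p.[x].
  by apply: poly_over_horner => // i; apply: (gen_ring_sub As).
rewrite hornerD hornerM hornerX hornerC => qg.
have qc : q c.
  apply: sub => //; case: hq' => -[_ [_ q'D q'Z]] _ _.
  have -> : c = (p.[x] * x + c) + - p.[x] * x by ring.
  apply: q'D; first exact: qq'.
  by apply: q'Z => //; apply: subringN.
have qpx : q (p.[x] * x) by rewrite -(addrK c (p.[x] * x)); apply: qB.
case: (qP Apx Ax qpx) => // qp [|k]; rewrite coefD coefMX coefC /= ?add0r ?addr0 //.
exact: IH.
Qed.

(** A relation modulo [q] is one modulo [q'], so its coefficients are divisible by [w]. As [w] is
    not in [q], the relation divided by [w] is again one modulo [q]. Iterating, the coefficients are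
    divisible by all powers of [w] and vanish. *)
Lemma indep_vertical (q' : set L) s : seq_in s -> q `<=` q' ->
  prime_ideal A q' -> q' (iota w) -> ~ q (iota w) ->
  (forall s b, seq_in s -> indep q' s -> gen_ring s b -> q' b ->
     exists2 c, gen_ring s c & b = iota w * c) ->
  indep q' s -> indep q s.
Proof.
move=> As qq' hq' q'w qw sub; elim: s As => [//|x s IH] /seq_in_cons[Ax As] [Is Ix].
split=> [|g Sg qg k]; first exact: IH.
suff -> : g`_k = 0 by [].
apply: uniformizer_separated => n.
suff [c Sc ->] : exists2 c, gen_ring s c & g`_k = iota w ^+ n * c.
  by rewrite mulrC mulKf ?expf_neq0 //; apply: gen_ring_sub Sc.
elim: n g Sg qg k => [|n IHn] g Sg qg k.
  by exists g`_k => //; rewrite mul1r.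
pose g' := (iota w)^-1 *: g.
have Sg' : poly_over (gen_ring s) g'.
  move=> i; rewrite coefZ.
  have [c Sc ->] := sub _ _ As Is (Sg i) (Ix _ Sg (qq' _ qg) i).
  by rewrite mulKf.
have qg' : q g'.[x].
  have : q (iota w * g'.[x]) by rewrite hornerZ mulVKf.
  case/(qP (AO Ow)) => //.
  by apply: poly_over_horner => // i; apply: (gen_ring_sub As).
have [c Sc e] := IHn _ Sg' qg' k; exists c => //.
by rewrite exprS -mulrA -e coefZ mulVKf.
Qed.

End Primes.

Lemma indep_sub q q' s : q `<=` q' -> 
  (forall s b, seq_in s -> indep q' s -> gen_ring s b -> q' b -> q b) ->
  seq_in s -> indep q' s -> indep q s.
Proof.
move=> qq' sub; elim: s => [//|x s IH] /seq_in_cons[Ax As] [Is Ix].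
split=> [|g Sg qg k]; first exact: IH.
by apply: (sub s) => //; apply: Ix => //; apply: qq'.
Qed.

Lemma prime_ideal0 : prime_ideal A [set 0].
Proof.
split.
- split; first by move=> _ ->; apply: subring0.
  by split=> // [u v -> ->|a u _ ->]; rewrite ?addr0 ?scaler0.
- by move/eqP; rewrite oner_eq0.
- move=> a b _ _ /eqP; rewrite mulf_eq0 => /orP[]/eqP; by [left|right].
Qed.

Lemma prime_ideal_max : prime_ideal A maxM.
Proof.
split=> //.
- split; first by move=> a [].
  by split=> // a u Aa Mu; apply: maxMZ.
- move=> a b Aa Ab Mab.
  have [|[a0 Aa']] := unit_or_max Aa; first by left.
  have [|[b0 Ab']] := unit_or_max Ab; first by right.
  case: (maxM_unit Mab); first exact: mulf_neq0.
  by rewrite invfM; apply: subringM.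
Qed.

Lemma prime_sub_max q : prime_ideal A q -> q `<=` maxM.
Proof.
move=> [[qA [q0 qD qZ]] q1 _] a qa; have [//|[a0 Aa']] := unit_or_max (qA _ qa).
by case: q1; rewrite -(mulVf a0); apply: qZ.
Qed.

(** Going down a chain of maximal length, each step adds an independent element except the one at
    which [w] leaves the prime. This bounds the transcendence degree over [K] from below by the
    dimension minus one. *)
Lemma krull_dim_indep d : krull_dim A d ->
  exists s, [/\ seq_in s, indep [set 0] s & (size s).+1 = d].
Proof.
move=> [[q [qp qlt]] dmax].
(* Otherwise [maxM] could be appended to the chain. In the same way [q 0] is zero, or else the zero
   ideal could be put in front. *)
have qdw : q d (iota w).
  apply: contrapT => nw; suff : (d.+1 <= d)%N by rewrite ltnn.
  apply: dmax; exists (fun i => if (i <= d)%N then q i else maxM); split.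
    by move=> i _; case: ifP => id; [exact: qp|exact: prime_ideal_max].
  move=> i; rewrite ltnS leq_eqVlt => /orP[/eqP->|id].
    rewrite eqxx ltnn /=; have sub := prime_sub_max (qp d (leqnn d)).
    split=> // sub'; apply: nw; apply: sub'; split; first exact: AO.
    by exists 1; rewrite ?piO ?mulr1 //; apply: subring1.
  by rewrite id orbT; apply: qlt.
have q00 : q 0%N = [set 0].
  apply: contrapT => n0; suff : (d.+1 <= d)%N by rewrite ltnn.
  apply: dmax; exists (fun i => if i is j.+1 then q j else [set 0]); split.
    by move=> [|i] id; [exact: prime_ideal0|exact: qp].
  move=> [|i] id; last exact: qlt.
  have [[qA [qq0 _ _]] _ _] := qp 0%N isT.
  have sub : [set 0] `<=` q 0%N by move=> _ ->.
  by split=> // sub'; apply: n0; apply/seteqP.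
suff main k : (k <= d)%N -> exists s, [/\ seq_in s, indep (q (d - k)%N) s,
    q (d - k)%N (iota w) -> size s = k & ~ q (d - k)%N (iota w) -> (size s).+1 = k].
  have [s []] := main d (leqnn d); rewrite subnn q00 => As Is _ sz.
  by exists s; split=> //; apply: sz => /= /eqP; rewrite (negbTE iw0).
elim: k => [|k IH] kd.
  by exists [::]; rewrite subn0; split.
have [s [As Is s1 s2]] := IH (ltnW kd).
have e : (d - k = (d - k.+1).+1)%N by lia.
move: Is s1 s2; rewrite e; set i := (d - k.+1)%N => Is s1 s2.
have lti : (i < d)%N by rewrite /i; lia.
have pq : prime_ideal A (q i) by apply: qp; apply: ltnW.
have pq' : prime_ideal A (q i.+1) by apply: qp.
have [sub nsub] := qlt _ lti.
(* If [w] lies in both primes or in neither, they have the same trace on the ring generated by [s],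
   so any element of their difference may be added to [s]. *)
have horizontal : (q i (iota w) <-> q i.+1 (iota w)) ->
    exists2 x, A x & indep (q i) (x :: s).
  move=> qw; have [x q'x qx] : exists2 x, q i.+1 x & ~ q i x.
    apply: contrapT => no; apply: nsub => x q'x; apply: contrapT => qx.
    by apply: no; exists x.
  have contr s' b : seq_in s' -> indep (q i.+1) s' -> gen_ring s' b ->
      q i.+1 b -> q i b.
    move=> As' Is' Sb qb; have [w1|w1] := pselect (q i.+1 (iota w)).
      have [c Sc ->] := indep_w pq' w1 As' Is' Sb qb.
      case: pq => -[_ [_ _ qZ]] _ _; rewrite mulrC; apply: qZ; last exact/qw.
      exact: (gen_ring_sub As').
    rewrite (indep_nw pq' w1 Is' Sb qb).
    by case: pq => -[_ []].
  exists x; first by case: pq' => -[+ _] _ _; apply.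
  apply: (@indep_cons _ pq (q i.+1)) => //; first by move=> b; apply: contr.
  by apply: (@indep_sub _ (q i.+1)).
have [w1|w1] := pselect (q i (iota w)).
  have w1' := sub _ w1.
  have [//|x Ax Ix] := horizontal.
  exists (x :: s); split=> //; last by rewrite /= s1.
  by move=> y /[1!inE] /orP[/eqP->|]; last exact: As.
have [w2|w2] := pselect (q i.+1 (iota w)).
  exists s; split=> //; last by rewrite s1.
  apply: (@indep_vertical _ pq (q i.+1)) => // s' b As' Is' Sb qb.
  exact: (indep_w pq').
have [//|x Ax Ix] := horizontal.
exists (x :: s); split=> //; last by rewrite /= s2.
by move=> y /[1!inE] /orP[/eqP->|]; last exact: As.
Qed.

Hypothesis genL : exists s : seq L, forall S, subfield_set S ->
  (forall a, S (iota a)) -> (forall x, x \in s -> S x) -> forall y, S y.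

Definition frac_set (B : set L) : set L :=
  [set a | exists b c, [/\ B b, B c, c != 0 & a = b / c]].

Lemma frac_set_subfield B : subring B -> subfield_set (frac_set B).
Proof.
move=> hB; split; first split.
- by exists 1, 1; rewrite oner_eq0 divr1; split=> //; apply: subring1.
- move=> _ _ [a [b [Ba Bb b0 ->]]] [c [d [Bc Bd d0 ->]]].
  exists (a * d - c * b), (b * d); split.
  + by apply: subringB => //; apply: subringM.
  + exact: subringM.
  + exact: mulf_neq0.
  + by field; rewrite b0 d0.
- move=> _ _ [a [b [Ba Bb b0 ->]]] [c [d [Bc Bd d0 ->]]].
  exists (a * c), (b * d); split; do ?exact: subringM.
  + exact: mulf_neq0.
  + by field; rewrite b0 d0.
- move=> _ [a [b [Ba Bb b0 ->]]]; have [->|a0] := eqVneq a 0.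
    exists 0, 1; rewrite mul0r invr0 mul0r oner_eq0.
    by split=> //; [exact: subring0|exact: subring1].
  by exists b, a; rewrite invf_div.
Qed.

Lemma common_denominator B (g : {poly L}) : subring B -> poly_over (frac_set B) g ->
  exists c, [/\ B c, c != 0 & poly_over B (c *: g)].
Proof.
move=> hB; elim/poly_ind: g => [|p c IH] Sg.
  by exists 1; rewrite oner_eq0; split; [exact: subring1|by []|move=> i; rewrite scaler0 coef0; exact: subring0].
have [i|d [Bd d0 Sdp]] := IH.
  by have := Sg i.+1; rewrite coefD coefMX coefC /= addr0.
have := Sg 0%N; rewrite coefD coefMX coefC /= add0r => -[a [b [Ba Bb b0 ->]]].
exists (d * b); split; [exact: subringM|exact: mulf_neq0|].
move=> [|i]; rewrite coefZ coefD coefMX coefC /= ?add0r ?addr0.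
  by have -> : d * b * (a / b) = d * a by [field]; apply: subringM.
by rewrite mulrAC -coefZ; apply: subringM.
Qed.

(** Over the fractions of the ring generated by [s], the new element [x] is transcendental, so the
    zero derivation extends with value 1 at [x], and then to [L], which is finitely generated. The
    derivations found for [s] need not kill [x]; subtracting a multiple of this one corrects
    them. *)
Lemma indep_derivation s : indep [set 0] s ->
  forall i, (i < size s)%N -> exists D, [/\ derivation_on setT D,
    forall a, D (iota a) = 0 & forall j, (j < size s)%N -> D s`_j = (i == j)%:R].
Proof.
elim: s => [//|x s IH] [Is Ix] i.
pose S := frac_set (gen_ring s).
have rB := gen_ring_subring s.
have hS : subfield_set S by apply: frac_set_subfield.
have SB b : gen_ring s b -> S b.
  by move=> Bb; exists b, 1; rewrite oner_eq0 divr1; split=> //; apply: subring1.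
have hD : derivation_on S (fun=> 0) by split=> a b _ _; rewrite ?addr0 ?mul0r ?mulr0 ?addr0.
have tr g : poly_over S g -> g.[x] = 0 -> adjoin_der (fun=> 0) x 1 g = 0.
  move=> Sg gx; have [c [Bc c0 Scg]] := common_denominator rB Sg.
  have -> : g = 0; last by rewrite /adjoin_der map_poly0 derivC !horner0 mul0r addr0.
  apply/polyP => k; rewrite coef0; apply/eqP.
  have /(Ix _ Scg)/(_ k)/eqP : [set 0] (c *: g).[x] by rewrite hornerZ gx mulr0.
  by rewrite coefZ mulf_eq0 (negbTE c0).
have [gens hgens] := genL.
have [S' [E [hS' hE sub S'g e]]] := derivation_extend charL gens
  (adjoin_subfield x hS) (adjoin_derivation hS hD tr).
have SO a : S (iota a).
  have [b [c [Ob Oc c0 ->]]] := fracO a.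
  exists (iota b), (iota c); rewrite fmorph_eq0 c0 fmorph_div.
  by split=> //; apply: gen_ringO.
have S'T y : S' y.
  by apply: (hgens S') => // a; apply: sub; apply: adjoin_sub.
have {}hE : derivation_on setT E by split=> a b _ _; [apply: hE.1|apply: hE.2].
have Ex : E x = 1 by rewrite e ?adjoin_ext_gen //; apply: adjoin_gen.
have ES b : S b -> E b = 0.
  by move=> Sb; rewrite e ?(adjoin_extC hS hD tr) //; apply: adjoin_sub.
case: i => [|i] /= si.
  exists E; split=> //; first by move=> a; apply: ES.
  by move=> [|j] js //=; rewrite ES //; apply/SB/gen_ring_mem/mem_nth.
have [D [{}hD DO Ds]] := IH Is i si.
exists (fun y => D y - D x * E y); split.
- split=> a b _ _; first by rewrite hD.1 // hE.1 //; ring.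
  by rewrite hD.2 // hE.2 //; ring.
- by move=> a; rewrite DO ES // mulr0 subr0.
- move=> [|j] js /=; first by rewrite Ex mulr1 subrr.
  rewrite Ds // ES ?mulr0 ?subr0 //.
  by apply/SB/gen_ring_mem/mem_nth.
Qed.

(** The map [pi] sends the square of the maximal ideal into [w^2 O], so [w] is not in that square
    and can be exchanged for one of the generators. The others are moved into [ker] by subtracting
    the constants [iota (pi (gl j))], which are multiples of [w]. *)
Lemma regular_parameters d (g : 'I_d -> L) : maxM = generated_by A g ->
  exists e (t : 'I_e -> L), [/\ e.+1 = d, forall i, ker (t i) &
    forall a, maxM a -> exists c0 c, [/\ A c0, forall i, A (c i)
      & a = c0 * iota w + \sum_i c i * t i]].
Proof.
move=> eM.
have mg i : maxM (g i).
  by rewrite eM; apply: (@lspan_mem L L^o); [exact: subring1|exists i].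
have repr a : maxM a -> exists2 c : 'I_d -> L, forall i, A (c i) &
    a = \sum_i c i * g i.
  by rewrite eM => /(@lspan_range L L^o)/(_ (subring0 hA) (subringD hA)).
have Mw : maxM (iota w).
  split; first exact: AO.
  by exists 1; rewrite ?piO ?mulr1 //; apply: subring1.
have [c Ac ew] := repr _ Mw.
have [i0 [ci0 Aci]] : exists i0, c i0 != 0 /\ A (c i0)^-1.
  apply: contrapT => no.
  have Mc i : maxM (c i).
    by have [//|h] := unit_or_max (Ac i); case: no; exists i.
  have : maxM ((iota w)^-1 * iota w); last by rewrite mulVf.
  rewrite {2}ew mulr_sumr; apply: maxM_sum => i.
  have := Mc i; have := mg i; move=> [Ag [o Oo eg]] [_ [o' Oo' ec]].
  have Ago : ker (g i - iota (w * o)) by rewrite -eg; apply: ker_piB.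
  have Aco : ker (c i - iota (w * o')) by rewrite -ec; apply: ker_piB.
  exfalso; apply: maxM1.
  have [_ [z Oz]] : maxM (iota w) := Mw.
  have hs (I : seq 'I_d) : exists2 z, O z & pi (\sum_(i <- I) c i * g i) = w * (w * z).
    elim: I => [|j I [z1 Oz1 e1]]; first by exists 0; rewrite ?big_nil ?pi0 ?mulr0 //; apply: subring0.
    have [_ [a Oa ea]] := Mc j; have [Agj [b Ob eb]] := mg j.
    exists (a * b + z1); first by apply: subringD => //; apply: subringM.
    rewrite big_cons piD ?e1 ?piM // ?ea ?eb; first by ring.
      exact: subringM.
    by apply: subring_sum => // l _; apply: subringM => //; case: (mg l).
  have [z1 Oz1] := hs (index_enum _); rewrite -ew piO // => e1 _.
  split; first exact: subring1.
  exists z1 => //; rewrite pi1; apply: (mulfI w0); by rewrite mulr1.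
case: d => [|e] in g eM mg repr c Ac ew i0 ci0 Aci *; first by case: {ci0 Aci}i0.
pose gl j := g (lift i0 j).
exists e, (fun j => gl j - iota (pi (gl j))); split=> //.
  by move=> j; apply: ker_piB; case: (mg (lift i0 j)).
move=> a /repr[b Ab ->].
have ho j : exists o, O o /\ pi (gl j) = w * o.
  by have [_ [o Oo eo]] := mg (lift i0 j); exists o.
have [o hoo] := choice ho.
pose b' j := b (lift i0 j) - b i0 * (c i0)^-1 * c (lift i0 j).
have Ab' j : A (b' j).
  by apply: subringB => //; do ?[exact: Ab | exact: Ac | apply: subringM].
exists (b i0 * (c i0)^-1 + \sum_j b' j * iota (o j)), b'; split=> //.
  apply: subringD => //; first exact: subringM.
  apply: subring_sum => // j _; apply: subringM => //; apply: AO.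
  by case: (hoo j).
rewrite (bigD1_ord i0) //=.
have -> : g i0 = (c i0)^-1 * (iota w - \sum_j c (lift i0 j) * gl j).
  apply: (mulfI ci0); rewrite mulVKf // ew (bigD1_ord i0) //=.
  by rewrite /gl addrK.
rewrite mulrBr mulrBr !mulrDl -!addrA mulrA; congr (_ + _).
rewrite mulr_suml -big_split /= mulr_sumr mulr_sumr -sumrN -big_split /=.
apply: eq_bigr => j _; rewrite (hoo j).2 rmorphM /b' /gl; ring.
Qed.

Section Taylor.
Variables (e : nat) (t : 'I_e -> L).
Hypothesis tker : forall i, ker (t i).
Hypothesis kert : forall a, ker a ->
  exists2 c : 'I_e -> L, forall i, A (c i) & a = \sum_i c i * t i.

Lemma taylor1 a : A a -> exists o c, [/\ O o, forall i, A (c i)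
  & a = iota o + \sum_i c i * t i].
Proof.
move=> Aa; have [c Ac ec] := kert (ker_piB Aa).
exists (pi a), c; split=> //; first exact: piA.
by rewrite -ec addrC subrK.
Qed.

Variables (m : nat) (z : 'I_m -> L).
Hypothesis Az : forall i, A (z i).
Hypothesis hz : forall D, derivation_on setT D -> (forall a, D (iota a) = 0) ->
  forall a, A a -> exists2 c : 'I_m -> L, forall i, A (c i)
    & D a = \sum_i c i * D (z i).

(** Differentiate [a = o + sum c_i t_i]. The terms [t_i D(c_i)] are combinations of the [D (z k)]
    with coefficients in [ker], so modulo the maximal ideal the differentials of the [t_i] generate
    all of them. *)
Lemma der_repr D a : derivation_on setT D -> (forall b, D (iota b) = 0) -> A a ->
  exists2 c : 'I_e -> L, forall i, A (c i) & exists2 f : 'I_m -> L,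
    forall k, maxM (f k)
    & D a = \sum_i c i * D (t i) + \sum_k f k * D (z k).
Proof.
move=> hD DO Aa; have [o [c [Oo Ac ->]]] := taylor1 Aa.
exists c => //.
have hc i : exists f : 'I_m -> L, (forall k, A (f k)) /\
    D (c i) = \sum_k f k * D (z k).
  by have [f ? ?] := hz hD DO (Ac i); exists f.
have [f hf] := choice hc.
exists (fun k => \sum_i t i * f i k).
  move=> k; apply: maxM_sum => i; rewrite mulrC; apply: maxMZ.
    by case: (hf i).
  exact: ker_max.
rewrite hD.1 // DO add0r.
have hT : subfield_set [set: L] by [].
rewrite (derivation_sum hT hD) //.
under eq_bigr => i _ do rewrite hD.2 //.
rewrite big_split /= addrC; congr (_ + _).
under [RHS]eq_bigr => k _ do rewrite mulr_suml.
rewrite exchange_big /=; apply: eq_bigr => i _.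
rewrite (hf i).2 mulr_suml; apply: eq_bigr => k _; ring.
Qed.

(** Nakayama with [N = 0], applied to the [D (z k)]. *)
Lemma der_zero D : derivation_on setT D -> (forall b, D (iota b) = 0) ->
  (forall i, D (t i) = 0) -> forall a, A a -> D a = 0.
Proof.
move=> hD DO Dt.
have Dz : forall k, [set 0] (D (z k)).
  apply: nakayama => //; first by move=> a b -> ->; rewrite addr0.
    by move=> a b _ ->; rewrite mulr0.
  move=> k; have [c Ac [f Mf ->]] := der_repr hD DO (Az k).
  exists 0, f; split=> //; rewrite big1 // => i _.
  by rewrite Dt mulr0.
move=> a Aa; have [c Ac ->] := hz hD DO Aa.
by rewrite big1 // => k _; rewrite Dz mulr0.
Qed.

Variable y : 'I_e -> L.
Hypothesis Ay : forall i, A (y i).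
Variable Dy : 'I_e -> L -> L.
Hypothesis hDy : forall i, derivation_on setT (Dy i).
Hypothesis DyO : forall i a, Dy i (iota a) = 0.
Hypothesis Dyy : forall i j, Dy i (y j) = (i == j)%:R.

Definition comb (a : 'I_e -> L) (x : L) : L := \sum_i a i * Dy i x.

Lemma comb_der a : derivation_on setT (comb a).
Proof.
split=> b c _ _; rewrite /comb.
  by rewrite -big_split; apply: eq_bigr => i _; rewrite (hDy i).1 // mulrDr.
rewrite mulr_suml mulr_sumr -big_split; apply: eq_bigr => i _ /=.
by rewrite (hDy i).2 //; ring.
Qed.

Lemma combO a b : comb a (iota b) = 0.
Proof. by rewrite /comb big1 // => i _; rewrite DyO mulr0. Qed.

(** A nonzero [v] with [v M = 0] would give a derivation killing every [t j], hence all of [A],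
    although its value at [y j] is [v j]. So [M] is invertible and the rows of its inverse define
    the [d i]. Nakayama with [N = A] shows that they preserve [A]. *)
Lemma exists_partials : exists d : 'I_e -> L -> L,
  [/\ forall i, derivation_on setT (d i), forall i a, d i (iota a) = 0,
      forall i j, d i (t j) = (i == j)%:R & forall i a, A a -> A (d i a)].
Proof.
pose M := \matrix_(i, j) Dy i (t j) : 'M[L]_e.
have uM : M \in unitmx.
  rewrite unitmxE unitfE; apply/negP => /det0P[v v0 vM].
  case/negP: v0; apply/eqP/rowP => j; rewrite mxE.
  have <- : comb (fun i => v 0 i) (y j) = v 0 j.
    rewrite /comb (bigD1 j) //= Dyy eqxx mulr1 big1 ?addr0 // => i ij.
    by rewrite Dyy (negbTE ij) mulr0.
  apply: der_zero => //; [exact: comb_der|exact: combO|move=> i].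
  have := congr1 (fun B : 'rV_e => B 0 i) vM; rewrite !mxE => <-.
  by apply: eq_bigr => k _; rewrite !mxE.
pose d i := comb (fun k => invmx M i k).
have dt i j : d i (t j) = (i == j)%:R.
  have := congr1 (fun B : 'M_e => B i j) (mulVmx uM); rewrite !mxE => <-.
  by apply: eq_bigr => k _; rewrite !mxE.
exists d; split=> //; [by move=> i; apply: comb_der|by move=> i a; apply: combO|].
have dA i k : A (d i (z k)).
  move: k; apply: nakayama; [exact: subring0|exact: subringD|exact: subringM|].
  move=> k; have [c Ac [f Mf ez]] := der_repr (comb_der (fun k => invmx M i k)) (combO _) (Az k).
  exists (\sum_j c j * d i (t j)), f; split=> //.
  apply: subring_sum => // j _; rewrite dt; apply: subringM => //.
  exact: subring_nat.
move=> i a Aa; have [c Ac ea] := hz (comb_der (fun k => invmx M i k)) (combO _) Aa.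
rewrite [d i a]ea.
by apply: subring_sum => // k _; apply: subringM => //; apply: dA.
Qed.

End Taylor.

Section Symbolic.
Variables (e : nat) (t : 'I_e -> L).
Hypothesis tker : forall i, ker (t i).
Hypothesis kert : forall a, ker a ->
  exists2 c : 'I_e -> L, forall i, A (c i) & a = \sum_i c i * t i.
Variable d : 'I_e -> L -> L.
Hypothesis hd : forall i, derivation_on setT (d i).
Hypothesis dO : forall i a, d i (iota a) = 0.
Hypothesis dt : forall i j, d i (t j) = (i == j)%:R.
Hypothesis dA : forall i a, A a -> A (d i a).
Local Notation ipow := (ideal_power A ker).
Local Notation ev := (mmap iota t).

Let ipowA := ipow_subring hA kerA.

Lemma der_ipow i k v : ipow k.+1 v -> ipow k (d i v).
Proof.
elim: k v => [|k IH] v; first by move=> /ipowA/(dA i); apply: ipow_exp0.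
have hT : subfield_set [set: L] by [].
elim/(@ipowS_ind _ A ker hA k.+1): v / => [|u v|x v kx kv].
- by rewrite (derivation0 hT (hd i)); apply: ipow_zero.
- by rewrite (hd i).1 //; apply: ipowD.
- rewrite (hd i).2 //; apply: ipowD.
    by apply: ipowZ => //; apply/dA/kerA.
  by apply: ipowS => //; apply: IH.
Qed.

Lemma der_ev i G : d i (ev G) = ev G^`M(i).
Proof.
have hT : subfield_set [set: L] by [].
have d0 := derivation0 hT (hd i).
pose Q G := d i (ev G) = ev G^`M(i).
have QD G1 G2 : Q G1 -> Q G2 -> Q (G1 + G2).
  by rewrite /Q mderivD !rmorphD /= (hd i).1 // => -> ->.
have QM G1 G2 : Q G1 -> Q G2 -> Q (G1 * G2).
  by rewrite /Q mderivM !(rmorphD, rmorphM) /= (hd i).2 // => -> ->.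
have QC c : Q c%:MP by rewrite /Q mderivC mmapC rmorph0 dO.
have QX j : Q 'X_j.
  rewrite /Q mderivX mnm1E !mmapX mmap1U dt mmapZ mmapX eq_sym.
  rewrite rmorph_nat; case: eqP => [->|_]; last by rewrite mulr0n mul0r.
  have -> : (U_(i) - U_(i))%MM = 0%MM :> 'X_{1..e}.
    by apply/mnmP => k; rewrite mnmBE mnm0E subnn.
  by rewrite mul1r mmap11.
rewrite -/(Q G) (mpolyE G); apply: (big_ind Q) => //; first by rewrite -mpolyC0; apply: QC.
move=> mm _; rewrite -mul_mpolyC; apply: (QM) => //.
rewrite mpolyXE_id; apply: (big_ind Q) => //; first by rewrite -mpolyC1; apply: QC.
move=> j _; elim: (mm j) => [|k IH]; first by rewrite expr0 -mpolyC1; apply: QC.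
by rewrite exprS; apply: QM.
Qed.

Definition coef_in (G : {mpoly K[e]}) : Prop := forall mm, O G@_mm.

(** Induction on the degree by differentiation: [d i] lowers the order along [ker] by at most one,
    and in characteristic 0 a form of positive degree with zero partial derivatives is zero.
    Differentiating [u * ev G] also produces [d i u * ev G]; another factor [u] turns this term into
    a multiple of the given element, whence the multiplier [u * u] in the induction. *)
Lemma form_zero l (G : {mpoly K[e]}) u : G \is l.-homog -> coef_in G ->
  A u -> pi u != 0 -> ipow l.+1 (u * ev G) -> G = 0.
Proof.
elim: l G u => [|l IH] G u hG OG Au pu ku.
  have eG : G = (G@_0)%:MP.
    apply/mpolyP => mm; rewrite mcoeffC; have [->|n0] := eqVneq mm 0%MM.
      by rewrite mulr1.
    rewrite mulr0; apply: (dhomog_nemf_coeff hG).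
    by rewrite mdeg_eq0.
  have /=: ker (u * ev G).
    elim/(@ipowS_ind _ A ker hA 0): (u * ev G) / ku => [|a b [Aa ea] [Ab eb]|x v [Ax ex] /ipowA Av].
    - by split; [exact: subring0|].
    - by split; [exact: subringD|rewrite piD // ea eb addr0].
    - by split; [exact: subringM|rewrite piM // ex mul0r].
  rewrite eG mmapC => -[_]; rewrite piM ?piO //; last exact: AO.
  by move/eqP; rewrite mulf_eq0 (negbTE pu) => /eqP ->; rewrite mpolyC0.
have dG i : G^`M(i) = 0.
  apply: (IH _ (u * u)).
  - apply/dhomogP => mm; rewrite mcoeff_msupp mcoeff_deriv => h.
    have : G@_(mm + U_(i)) != 0 by apply: contraNneq h => ->; rewrite mul0rn.
    rewrite -mcoeff_msupp => /(dhomog_mf hG) dm.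
    have : mdeg (mm + U_(i))%MM = l.+1 by [].
    by rewrite mdegD mdeg1 addn1 => -[].
  - move=> mm; rewrite mcoeff_deriv -mulr_natr; apply: subringM => //.
    exact: subring_nat.
  - exact: subringM.
  - by rewrite piM // mulf_neq0.
  - have -> : u * u * ev G^`M(i) = u * d i (u * ev G) - d i u * (u * ev G).
      by rewrite (hd i).2 // der_ev; ring.
    apply: ipowB => //; first by apply: ipowZ => //; apply: der_ipow.
    apply: ipowZ => //; first exact: dA.
    by apply: ipow_le ku.
apply/mpolyP => mm; rewrite mcoeff0.
have [dm|/(dhomog_nemf_coeff hG)//] := eqVneq (mdeg mm) l.+1.
have [i mi] : exists i, mm i != 0%N.
  apply/existsP; rewrite -negb_forall; apply/negP => /forallP m0.
  have : mdeg mm = 0%N.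
    by apply/eqP; rewrite mdeg_eq0; apply/eqP/mnmP => i; rewrite mnm0E; apply/eqP.
  by rewrite dm.
have mmE : mm = (mm - U_(i) + U_(i))%MM.
  by rewrite submK //; apply/mnm_lepP => j; rewrite mnm1E; case: eqP => // <-; rewrite lt0n.
have := congr1 (mcoeff (mm - U_(i))) (dG i).
rewrite mcoeff_deriv -mmE mcoeff0 => /eqP.
by rewrite -mulr_natr mulf_eq0 (negbTE (charK _)) orbF => /eqP.
Qed.

(** Leading forms: replacing a coefficient [c] by the constant [pi c] changes the element by one of
    higher order, because [c - iota (pi c)] is in [ker]. *)
Lemma ipow_form l v : ipow l v -> exists G v', [/\ G \is l.-homog, coef_in G,
  ipow l.+1 v' & v = ev G + v'].
Proof.
elim: l v => [|l IH] v.
  move=> /ipowA Av; exists (pi v)%:MP, (v - iota (pi v)); split.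
  - by rewrite -(mulr1 _%:MP) mul_mpolyC; apply: dhomogZ; apply: dhomog1.
  - move=> mm; rewrite mcoeffC; apply: subringM => //; first exact: piA.
    exact: subring_nat.
  - by apply: ipow1 => //; apply: ker_piB.
  - by rewrite mmapC addrC subrK.
elim/(@ipowS_ind _ A ker hA l): v / => [|u v [G [u' [hG OG ku ->]]] [H [v' [hH OH kv ->]]]|x v kx kv].
- exists 0, 0; split; [exact: dhomog0| |exact: ipow_zero|by rewrite rmorph0 addr0].
  by move=> mm; rewrite mcoeff0; apply: subring0.
- exists (G + H), (u' + v'); split; [exact: dhomogD| |exact: ipowD|].
    by move=> mm; rewrite mcoeffD; apply: subringD.
  by rewrite rmorphD addrACA.
have [G [v' [hG OG kv' ev']]] := IH _ kv.
have [c Ac ex] := kert kx.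
pose Lx : {mpoly K[e]} := \sum_i pi (c i) *: 'X_i.
have hLx : Lx \is 1.-homog.
  apply: rpred_sum => i _; apply: dhomogZ; rewrite dhomogX; by rewrite /= mdeg1.
have OLx : coef_in Lx.
  move=> mm; rewrite /Lx raddf_sum; apply: subring_sum => // i _.
  rewrite /= mcoeffZ mcoeffX; apply: subringM => //; first exact: piA.
  exact: subring_nat.
have evLx : ev Lx = \sum_i iota (pi (c i)) * t i.
  by rewrite /Lx raddf_sum; apply: eq_bigr => i _; rewrite /= mmapZ mmapX mmap1U.
pose x2 := \sum_i (c i - iota (pi (c i))) * t i.
have kx2 : ipow 2 x2.
  apply: ipow_sum => i; apply: ipowS => //; first exact: ker_piB.
  by apply: ipow1.
have exx : x = ev Lx + x2.
  by rewrite evLx /x2 -big_split ex; apply: eq_bigr => i _ /=; ring.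
have kLx : ipow 1 (ev Lx).
  have -> : ev Lx = x - x2 by rewrite exx addrK.
  by apply: ipowB; [|exact: ipow1|exact: ipow_le kx2].
exists (Lx * G), (ev Lx * v' + x2 * v); split.
- by rewrite -(add1n l); apply: dhomogM.
- move=> mm; rewrite mcoeffM; apply: subring_sum => // k _; exact: subringM.
- apply: ipowD; first by rewrite -(add1n l.+1); apply: ipowM.
  by rewrite -(add2n l); apply: ipowM.
- by rewrite rmorphM /= ev' exx; ring.
Qed.

(** If [v] has order at least [l < k], its leading form times [u] has order at least [l + 1]; the
    form is therefore zero and [v] has order at least [l + 1]. *)
Lemma symbolic_power k u v : A u -> pi u != 0 -> A v -> ipow k (u * v) -> ipow k v.
Proof.
move=> Au pu Av kuv.
suff main l : (l <= k)%N -> ipow l v by apply: main.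
elim: l => [_|l IH lk]; first exact: ipow_exp0.
have [G [v' [hG OG kv' ev']]] := ipow_form (IH (ltnW lk)).
suff G0 : G = 0 by rewrite ev' G0 rmorph0 add0r.
apply: (form_zero hG OG Au pu).
have -> : u * ev G = u * v - u * v' by rewrite ev'; ring.
by apply: ipowB => //; [exact: ipow_le kuv|exact: ipowZ].
Qed.

End Symbolic.

Variables (m : nat) (z : 'I_m -> L).
Hypothesis Az : forall i, A (z i).
Hypothesis hz : forall D, derivation_on setT D -> (forall a, D (iota a) = 0) ->
  forall a, A a -> exists2 c : 'I_m -> L, forall i, A (c i)
    & D a = \sum_i c i * D (z i).

Theorem regular_symbolic_power d (g : 'I_d -> L) : krull_dim A d ->
  maxM = generated_by A g -> forall k u v, A u -> pi u != 0 -> A v ->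
  ideal_power A ker k (u * v) -> ideal_power A ker k v.
Proof.
move=> dimd eM k u v Au pu Av kuv.
have [s [As Is sz]] := krull_dim_indep dimd.
have [e [t [ed tker Mt]]] := regular_parameters eM.
(* Regularity is this equality: the independent elements come from the dimension, the parameters
   from the number of generators of the maximal ideal. *)
have se : size s = e by move: ed; rewrite -sz => -[].
(* An element of [ker] is [c0 w + sum c_i t_i], and applying [pi] gives [pi c0 = 0]. So [ker] is the
   span of the [t_i] plus [w ker], and Nakayama applies to a finite system of generators of
   [ker]. *)
have kert a : ker a -> exists2 c : 'I_e -> L, forall i, A (c i)
    & a = \sum_i c i * t i.
  have idk : ideal A ker.
    split=> //; split.
    - by split; [exact: subring0|].
    - by move=> x y [Ax ex] [Ay ey]; split; [exact: subringD|rewrite piD // ex ey addr0].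
    - by move=> x y Ax [Ay ey]; split; [exact: subringM|rewrite piM // ey mulr0].
  have [m' [h eh]] := noethA idk.
  pose N := [set a | exists2 c : 'I_e -> L, forall i, A (c i)
    & a = \sum_i c i * t i].
  have N0 : N 0.
    by exists (fun=> 0) => [_|]; [exact: subring0|rewrite big1 // => i _; rewrite mul0r].
  have ND x y : N x -> N y -> N (x + y).
    move=> [c Ac ->] [c' Ac' ->]; exists (fun i => c i + c' i).
      by move=> i; apply: subringD.
    by rewrite -big_split; apply: eq_bigr => i _; rewrite mulrDl.
  have NZ x y : A x -> N y -> N (x * y).
    move=> Ax [c Ac ->]; exists (fun i => x * c i); first by move=> i; apply: subringM.
    by rewrite mulr_sumr; apply: eq_bigr => i _; rewrite mulrA.
  have kerh x : ker x -> exists2 c : 'I_m' -> L, forall i, A (c i)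
      & x = \sum_i c i * h i.
    by rewrite eh => /(@lspan_range L L^o)/(_ (subring0 hA) (subringD hA)).
  have hN i : N (h i).
    move: i; apply: nakayama => // i.
    have ki : ker (h i).
      by rewrite eh; apply: (@lspan_mem L L^o); [exact: subring1|exists i].
    have [c0 [c [Ac0 Ac ec]]] := Mt _ (ker_max ki).
    have As' : A (\sum_j c j * t j).
      by apply: subring_sum => // j _; apply: subringM => //; apply: kerA.
    have kc0 : ker c0.
      split=> //; have [_ p0] := ki; have := p0; rewrite ec piD //; last first.
        by apply: subringM => //; apply: AO.
      rewrite piM ?piO //; last exact: AO.
      have -> : pi (\sum_j c j * t j) = 0.
        apply: (proj2 (_ : ker _)); case: idk => _ [k0 kD kZ].
        by apply: (big_ind ker) => // j _; apply: kZ.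
      by rewrite addr0 => /eqP; rewrite mulf_eq0 (negbTE w0) orbF => /eqP.
    have [f Af ef] := kerh _ kc0.
    exists (\sum_j c j * t j), (fun j => iota w * f j); split.
    + by exists c.
    + move=> j; rewrite mulrC; apply: maxMZ => //; split; first exact: AO.
      by exists 1; rewrite ?piO ?mulr1 //; apply: subring1.
    + rewrite {1}ec addrC {1}ef mulr_suml; congr (_ + _).
      by apply: eq_bigr => j _; rewrite mulrAC; congr (_ * _); rewrite mulrC.
  move=> /kerh[c Ac ->].
  by apply: (big_ind N) => // i _; apply: NZ.
have hD (i : 'I_e) : exists D, [/\ derivation_on setT D,
    forall a, D (iota a) = 0 & forall j : 'I_e, D s`_j = (i == j)%:R].
  have [|D [hD DO Ds]] := indep_derivation Is (i := i); first by rewrite se.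
  by exists D; split=> // j; rewrite Ds // se.
have [Dy hDy] := choice hD.
have [dd [hd dO dt dA]] := @exists_partials e t tker kert m z Az hz
  (fun i => s`_i) (fun i => As _ (mem_nth _ (eq_ind_r (fun n => i < n)%N (ltn_ord i) se)))
  Dy (fun i => let: And3 h _ _ := hDy i in h)
  (fun i => let: And3 _ h _ := hDy i in h)
  (fun i => let: And3 _ _ h := hDy i in h).
exact: (symbolic_power tker kert hd dO dt dA Au pu Av kuv).
Qed.

End RegularLocal.

(** * Number fields and their embeddings *)

Lemma integral_subring (F : fieldType) :
  subring [set x : F | integralOver (intr : int -> F) x].
Proof.
split.
- exact: (integral1 (intr : {rmorphism int -> F})).
- exact: (@integral_sub _ _ (intr : {rmorphism int -> F})).
- exact: (@integral_mul _ _ (intr : {rmorphism int -> F})).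
Qed.

Lemma integral_det (F : fieldType) m (B : 'M[F]_m) :
  (forall i j, integralOver (intr : int -> F) (B i j)) ->
  integralOver (intr : int -> F) (\det B).
Proof.
move=> intB; have hS := integral_subring F.
apply: (subring_sum hS) => s _; apply: (subringM hS).
  apply: (subringX hS); apply: (subringN hS); exact: (subring1 hS).
by apply: (subring_prod hS) => i _; exact: intB.
Qed.

(** The determinant trick: [u] is an eigenvalue of the transpose of an integer matrix, hence a root
    of a monic integer polynomial. *)
Lemma integral_eigen (F : fieldType) m (y : 'I_m -> F) (B : 'M[int]_m) u i0 :
  y i0 != 0 -> (forall i, u * y i = \sum_j (B i j)%:~R * y j) ->
  integralOver (intr : int -> F) u.
Proof.
move=> yi0 uy.
have : eigenvalue (map_mx intr B^T : 'M[F]_m) u.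
  apply/eigenvalueP; exists (\row_j y j).
    apply/rowP => i; rewrite !mxE uy; apply: eq_bigr => j _.
    by rewrite !mxE mulrC.
  by apply: contraNneq yi0 => /rowP/(_ i0); rewrite !mxE => ->.
rewrite eigenvalue_root_char -(map_char_poly (intr : {rmorphism int -> F})) => rt.
by exists (char_poly B^T); first exact: char_poly_monic.
Qed.

Lemma integral_int_morph (F F' : fieldType) (f : {rmorphism F -> F'}) x :
  integralOver (intr : int -> F) x -> integralOver (intr : int -> F') (f x).
Proof.
move=> [p mp rp]; exists p => //; have := rmorph_root f rp.
rewrite -map_poly_comp (eq_map_poly (g := intr)) // => z /=.
by rewrite rmorph_int.
Qed.

Lemma integral_rat q : integralOver (intr : int -> rat) q -> exists z : int, q = z%:~R.
Proof.
move/(integral_int_morph (ratr : {rmorphism rat -> algC})) => [p mp rp].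
have : ratr q \in Aint.
  apply: (root_monic_Aint rp); first exact: monic_map.
  by apply/polyOverP => i; rewrite coef_map /= intr_int.
move/(Cint_rat_Aint (Crat_rat q))/intrP => [z ez]; exists z.
apply: (fmorph_inj (ratr : {rmorphism rat -> algC})).
by rewrite /= ez ratr_int.
Qed.

Lemma integral_inj_rat (F : fieldType) (f : {rmorphism rat -> F}) q :
  integralOver (intr : int -> F) (f q) -> exists z : int, q = z%:~R.
Proof.
move=> [p mp rp]; apply: integral_rat; exists p => //.
rewrite -(fmorph_root f) -map_poly_comp.
by rewrite (eq_map_poly (g := intr)) // => z /=; rewrite rmorph_int.
Qed.

Lemma common_denom_rat (T : finType) (q : T -> rat) :
  exists2 n : nat, (0 < n)%N & forall i, exists z : int, n%:R * q i = z%:~R.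
Proof.
have hd i : exists m : nat, (0 < m)%N /\ exists z : int, m%:R * q i = z%:~R.
  have := denq_gt0 (q i); case e : (denq (q i)) => [m|//] m0; exists m; split=> //.
  exists (numq (q i)); rewrite -[q i in LHS]divq_num_den e.
  by rewrite mulrC divfK // intr_eq0 -e denq_neq0.
have [m hm] := choice hd.
exists (\prod_i m i)%N; first by apply/prodn_gt0 => i; case: (hm i).
move=> i; rewrite (bigD1 i) //= natrM mulrAC; have [_ [z ->]] := hm i.
by exists (z * (\prod_(j | j != i) m j)%:Z); rewrite rmorphM.
Qed.

Section NumberField.
Variable K : fieldExtType rat.
Local Notation O := (ring_of_integers K).
Local Notation d := (\dim {:K}).

Lemma charK0 k : k.+1%:R != 0 :> K.
Proof.
have : has_char0 K by move=> p; rewrite (pchar_lalg K) pchar_num.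
by move/pcharf0P => ->.
Qed.

Lemma OK_subring : subring O.
Proof. exact: integral_subring. Qed.

Lemma dimK_gt0 : (0 < d)%N.
Proof. by rewrite adim_gt0. Qed.

(** The integer [n] clears the denominators of the matrix of multiplication by [x] in a basis of
    [K]; that basis is the eigenvector for [n x]. *)
Lemma OK_multiple x : exists2 n : nat, (0 < n)%N & O (n%:R * x).
Proof.
pose y i := (vbasis {:K})`_i.
pose q (ij : 'I_d * 'I_d) := coord (vbasis {:K}) ij.2 (x * y ij.1).
have [n n0 hn] := common_denom_rat q; have [z hz] := choice hn.
exists n => //.
have [i0 yi0] : exists i : 'I_d, y i != 0.
  have lt := dimK_gt0; exists (Ordinal lt).
  have := basis_not0 (vbasisP {:K}); apply.
  by rewrite mem_nth // size_tuple.
apply: (@integral_eigen K d (fun i => y i) (\matrix_(i, j) z (i, j)) _ i0) => // i.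
rewrite -mulrA [x * _ in LHS](coord_vbasis (memvf _)) mulr_sumr.
apply: eq_bigr => j _; rewrite mxE -mulr_algl mulrA; congr (_ * _).
have := hz (i, j); rewrite /q /= => e.
have -> (a : rat) : n%:R * a%:A = (n%:R * a)%:A :> K.
  by rewrite -scalerA scaler_nat mulr_natl.
by rewrite e scaler_int.
Qed.

Lemma OK_frac x : exists b c, [/\ O b, O c, c != 0 & x = b / c].
Proof.
have [n n0 On] := OK_multiple x.
have n0' : n%:R != 0 :> K by case: n n0 {On} => // n _; apply: charK0.
exists (n%:R * x), n%:R; split=> //; last by rewrite mulrAC divff // mul1r.
exact: subring_nat OK_subring _.
Qed.

Lemma primitive_element : exists2 th, O th &
  forall y : K, exists g : {poly rat}, y = horner_alg th g.
Proof.
have c0 : has_char0 K by move=> p; rewrite (pchar_lalg K) pchar_num.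
have sep : separable 1%AS {:K}%AS.
  by apply/separableP => y _; apply: pcharf0_separable.
have eK := eq_adjoin_separable_generator sep (subvf _).
set t := separable_generator _ _ in eK.
have ht (y : K) : exists g : {poly rat}, y = horner_alg t g.
  have : y \in <<1; t>>%VS by rewrite -eK memvf.
  case/Fadjoin_polyP => p /polyOverP p1 ->.
  have hc i : exists a : rat, p`_i = a%:A by apply/vlineP; apply: p1.
  have [a ha] := choice hc.
  exists (\poly_(i < size p) a i); rewrite /horner_alg /horner_morph /=.
  congr (_.[_]); apply/polyP => i; rewrite coef_map coef_poly /=.
  by case: ltnP => hi; [rewrite ha|rewrite nth_default // scale0r].
have [n n0 On] := OK_multiple t.
have n0' : n%:R != 0 :> rat by case: n n0 {On}.
exists (n%:R * t) => // y; have [g ->] := ht y.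
exists (g \Po (n%:R^-1 *: 'X)).
have -> : horner_alg (n%:R * t) (g \Po (n%:R^-1 *: 'X)) =
          horner_alg t g; last by [].
rewrite /horner_alg /horner_morph /= map_comp_poly horner_comp.
congr (_.[_]); rewrite map_polyZ map_polyX hornerZ hornerX /=.
by rewrite mulr_algl mulr_natl -scaler_nat scalerA mulVf // scale1r.
Qed.

Section PrimitiveElement.
Variables (th : K) (Oth : O th).
Hypothesis hth : forall y : K, exists g : {poly rat}, y = horner_alg th g.

Definition pbasis : d.-tuple K := [tuple th ^+ i | i < d].

Lemma pbasisE i : (i < d)%N -> pbasis`_i = th ^+ i.
Proof.
move=> lt; have := tnth_mktuple (fun i : 'I_d => th ^+ i) (Ordinal lt).
by rewrite (tnth_nth 0).
Qed.

Lemma horner_alg_sum m (c : nat -> rat) :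
  horner_alg th (\poly_(i < m) c i) = \sum_(i < m) c i *: th ^+ i.
Proof.
rewrite poly_def raddf_sum; apply: eq_bigr => i _ /=.
by rewrite -mul_polyC rmorphM rmorphXn /= horner_algX horner_algC mulr_algl.
Qed.

Lemma exists_annihilator : exists f : {poly rat}, [/\ f != 0, (size f <= d.+1)%N
  & horner_alg th f = 0].
Proof.
pose Y := [tuple th ^+ i | i < d.+1].
have YE (i : 'I_d.+1) : Y`_i = th ^+ i by rewrite -tnth_nth tnth_mktuple.
have nfY : ~~ free Y.
  apply/negP => fY; have := dimvS (subvf <<Y>>%VS).
  by move: fY; rewrite /free size_tuple => /eqP ->; rewrite ltnn.
have [k [sk [i0 ki0]]] : exists k : 'I_d.+1 -> rat,
    \sum_i k i *: Y`_i = 0 /\ exists i, k i != 0.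
  apply: contrapT => no; case/negP: nfY; apply/freeP => k sk i.
  apply/eqP/negPn/negP => ki; apply: no; exists k; split=> //.
  by exists i.
pose f : {poly rat} := \poly_(i < d.+1) k (inord i).
exists f; split.
- apply: contraNneq ki0 => f0; have := congr1 (fun p : {poly rat} => p`_i0) f0.
  by rewrite coef_poly ltn_ord inord_val coef0 => ->.
- exact: size_poly.
- rewrite horner_alg_sum -[RHS]sk; apply: eq_bigr => i _.
  by rewrite inord_val YE.
Qed.

Lemma pbasis_basis : basis_of {:K} pbasis.
Proof.
rewrite basisEdim size_tuple leqnn andbT; apply/subvP => y _.
have [f [f0 sf fth]] := exists_annihilator.
have [g ->] := hth y.
rewrite (divp_eq g f) rmorphD rmorphM /= fth mulr0 add0r.
have sr : (size (g %% f)%R <= d)%N.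
  by rewrite -ltnS (leq_trans _ sf) // ltn_modp.
rewrite -[(g %% f)%R]coefK (_ : \poly_(i < _) _ = \poly_(i < d) (g %% f)`_i); last first.
  apply/polyP => i; rewrite !coef_poly; case: ltnP => h1; case: ltnP => h2 //.
    by move: (leq_trans h1 (leq_trans sr h2)); rewrite ltnn.
  by rewrite nth_default.
rewrite horner_alg_sum; apply: rpred_sum => i _; apply: rpredZ.
rewrite -pbasisE //; apply: memv_span; apply: mem_nth; by rewrite size_tuple.
Qed.

Definition crd (i : 'I_d) (y : K) : rat := coord pbasis i y.

Lemma crdE y : y = \sum_i crd i y *: th ^+ i.
Proof.
rewrite {1}(coord_basis pbasis_basis (memvf y)); apply: eq_bigr => i _.
by rewrite pbasisE.
Qed.

Lemma crdB i x y : crd i (x - y) = crd i x - crd i y.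
Proof. exact: raddfB. Qed.
Lemma crdZ i (a : rat) y : crd i (a *: y) = a * crd i y.
Proof. exact: linearZ. Qed.
Lemma crd_sum i I (r : seq I) (f : I -> K) :
  crd i (\sum_(j <- r) f j) = \sum_(j <- r) crd i (f j).
Proof. exact: raddf_sum. Qed.

Lemma crd_basis (i j : 'I_d) : crd i (th ^+ j) = (j == i)%:R.
Proof. by rewrite -pbasisE // /crd coord_free //; apply: basis_free pbasis_basis. Qed.

Lemma crd_lin i (c : 'I_d -> rat) : crd i (\sum_j c j *: th ^+ j) = c i.
Proof.
rewrite crd_sum (bigD1 i) //= crdZ crd_basis eqxx mulr1 big1 ?addr0 // => j ji.
by rewrite crdZ crd_basis (negbTE ji) mulr0.
Qed.

Lemma annihilator_size (g : {poly rat}) : horner_alg th g = 0 -> (size g <= d)%N ->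
  g = 0.
Proof.
move=> gth sg; apply/polyP => i; rewrite coef0.
have [lt|ge] := ltnP i d; last by rewrite nth_default // (leq_trans sg).
have eg : g = \poly_(i < d) g`_i.
  apply/polyP => j; rewrite coef_poly; case: ltnP => // h.
  by rewrite nth_default // (leq_trans sg).
have := crd_lin (Ordinal lt) (fun k : 'I_d => g`_k).
rewrite -(horner_alg_sum d (fun k => g`_k)) -eg gth => <-.
exact: raddf0.
Qed.

Section Embeddings.
Variable R : realType.
Local Notation C := R[i].
Local Notation toC := (map_poly (ratr : rat -> C)).

(** No nonzero polynomial of degree below [d] kills [th]. An annihilator of degree [d] is thus
    separable: a common factor with its derivative would split it into two factors of smaller
    degree, one of which kills [th]. *)
Lemma min_poly_roots : exists f (rs : seq C), [/\ horner_alg th f = 0,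
  size f = d.+1, uniq rs, size rs = d & forall z, (z \in rs) = root (toC f) z].
Proof.
have [f [f0 sf fth]] := exists_annihilator.
have sf' : size f = d.+1.
  apply/eqP; rewrite eqn_leq sf ltnNge; apply: contra f0 => h.
  by rewrite (annihilator_size fth h).
have sepf : separable_poly f.
  rewrite unlock; apply/negPn/negP => ncop.
  pose h := gcdp f f^`().
  have hf : h %| f := dvdp_gcdl _ _.
  have h0 : h != 0 by rewrite gcdp_eq0 negb_and f0.
  have f'0 : f^`() != 0.
    apply/eqP => /(congr1 (fun p : {poly rat} => p`_d.-1)).
    rewrite coef_deriv coef0 prednK ?dimK_gt0 // => /eqP.
    rewrite -mulr_natr mulf_eq0 pnatr_eq0 (gtn_eqF dimK_gt0) orbF.
    have -> : f`_d = lead_coef f by rewrite lead_coefE sf'.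
    by rewrite lead_coef_eq0 (negbTE f0).
  have sh : (size h <= d)%N.
    apply: leq_trans (dvdp_leq f'0 (dvdp_gcdr f f^`())) _.
    by rewrite -ltnS -sf' lt_size_deriv.
  have sh1 : (1 < size h)%N.
    by move: ncop; rewrite coprimep_def -/h; case: (size h) (size_poly_eq0 h) => [|[|n]] //; rewrite (negbTE h0).
  have : horner_alg th ((f %/ h) * h)%R = 0 by rewrite divpK.
  rewrite rmorphM /= => /eqP; rewrite mulf_eq0 => /orP[] /eqP.
    move/annihilator_size; rewrite size_divp // sf' => hq.
    have : (f %/ h)%R = 0 by apply: hq; move: sh1; case: (size h) => [|[|n]] //= _; rewrite subSS leq_subr.
    by move/eqP; rewrite divp_eq0 (negbTE f0) (negbTE h0) /= sf' ltnNge (leq_trans sh).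
  by move/annihilator_size/(_ sh)/eqP; rewrite (negbTE h0).
have [rs ers] := closed_field_poly_normal (toC f).
have lc0 : lead_coef (toC f) != 0 by rewrite lead_coef_eq0 map_poly_eq0.
have mem z : (z \in rs) = root (toC f) z.
  by rewrite ers rootZ // root_prod_XsubC.
exists f, rs; split=> //.
- rewrite -separable_prod_XsubC.
  have : separable_poly (toC f) by rewrite separable_map.
  by rewrite ers; rewrite (eqp_separable (eqp_scale _ lc0)).
- have := congr1 (fun p : {poly C} => size p) ers.
  by rewrite size_map_poly sf' size_scale // size_prod_XsubC => -[].
Qed.

Definition emb_fun (z : C) (y : K) : C := \sum_(i < d) ratr (crd i y) * z ^+ i.

Lemma emb_funE f z g : horner_alg th f = 0 -> size f = d.+1 -> root (toC f) z ->
  emb_fun z (horner_alg th g) = (toC g).[z].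
Proof.
move=> fth sf rz.
have f0 : f != 0 by rewrite -size_poly_gt0 sf.
pose p := \poly_(i < d) (if insub i is Some j then crd j (horner_alg th g) else 0).
have pE : horner_alg th p = horner_alg th g.
  rewrite horner_alg_sum [RHS]crdE; apply: eq_bigr => i _.
  by rewrite valK.
have -> : emb_fun z (horner_alg th g) = (toC p).[z].
  rewrite (@horner_coef_wide _ d); last by rewrite size_map_poly size_poly.
  by apply: eq_bigr => i _; rewrite coef_map coef_poly ltn_ord valK.
have fpg : f %| p - g.
  rewrite /dvdp; apply/eqP/annihilator_size; last first.
    by rewrite -ltnS -sf ltn_modp.
  have : horner_alg th (p - g) = 0 by rewrite rmorphB /= pE subrr.
  by rewrite {1}(divp_eq (p - g) f) rmorphD rmorphM /= fth mulr0 add0r.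
apply/eqP; rewrite -subr_eq0 -hornerN -hornerD -rmorphN -rmorphD /=.
rewrite -(divpK fpg) rmorphM hornerM.
by move: rz => /rootP ->; rewrite mulr0.
Qed.

Lemma emb_rmorph f z : horner_alg th f = 0 -> size f = d.+1 -> root (toC f) z ->
  exists s : embedding K R, forall y, s y = emb_fun z y.
Proof.
move=> fth sf rz; have E g := emb_funE g fth sf rz.
have aM : zmod_morphism (emb_fun z).
  move=> x y; have [g ->] := hth x; have [h ->] := hth y.
  by rewrite -rmorphB /= !E rmorphB /= hornerD hornerN.
have mM : monoid_morphism (emb_fun z).
  split=> [|x y].
    by rewrite -(rmorph1 (horner_alg th)) E rmorph1 hornerC.
  have [g ->] := hth x; have [h ->] := hth y.
  by rewrite -rmorphM /= !E rmorphM /= hornerM.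
pose aH := GRing.isZmodMorphism.Build K C (emb_fun z) aM.
pose mH := GRing.isMonoidMorphism.Build K C (emb_fun z) mM.
by exists (HB.pack (emb_fun z) aH mH : {rmorphism K -> C}).
Qed.

Lemma embedding_alg (s : embedding K R) (g : {poly rat}) :
  s (horner_alg th g) = (toC g).[s th].
Proof.
rewrite /horner_alg /horner_morph /= -(horner_map s) /= -map_poly_comp.
by congr (_.[_]); apply: eq_map_poly => q /=; rewrite alg_num_field fmorph_rat.
Qed.

Lemma embedding_crd (s : embedding K R) y :
  s y = \sum_(i < d) ratr (crd i y) * s th ^+ i.
Proof.
rewrite [in LHS](crdE y) rmorph_sum; apply: eq_bigr => i _.
by rewrite -mulr_algl rmorphM rmorphXn alg_num_field /= fmorph_rat.
Qed.

Lemma embeddings : exists emb : 'I_d -> embedding K R,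
  [/\ injective emb, forall s, exists k, s = emb k
    & injective (fun k => emb k th)].
Proof.
have [f [rs [fth sf urs srs mem]]] := min_poly_roots.
have hk (k : 'I_d) : exists s : embedding K R, forall y, s y = emb_fun rs`_k y.
  apply: (emb_rmorph fth sf); rewrite -mem mem_nth // srs; exact: ltn_ord.
have [emb hemb] := choice hk.
have embth k : emb k th = rs`_k.
  have rk : root (toC f) rs`_k by rewrite -mem mem_nth // srs; exact: ltn_ord.
  have := emb_funE 'X fth sf rk; rewrite horner_algX => e.
  by rewrite hemb e map_polyX hornerX.
have inj : injective (fun k => emb k th).
  move=> k l; rewrite !embth => /eqP; rewrite nth_uniq ?srs ?ltn_ord //.
  by move/eqP/val_inj.
exists emb; split=> //.
  by move=> k l e; apply: inj; rewrite e.
move=> s; have : s th \in rs.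
  rewrite mem; apply/rootP; rewrite -embedding_alg fth; exact: rmorph0.
move/(nthP 0) => [k kd ek].
rewrite srs in kd; exists (Ordinal kd); apply: embedding_ext => y.
rewrite (embedding_crd s y) (embedding_crd (emb (Ordinal kd)) y).
by rewrite embth ek.
Qed.

End Embeddings.

End PrimitiveElement.

End NumberField.

(** * Maximal ideals of the ring of integers *)

Lemma integral_eigen_fin (F : fieldType) (T : finType) (y : T -> F)
    (B : T -> T -> int) u i0 :
  y i0 != 0 -> (forall i, u * y i = \sum_j (B i j)%:~R * y j) ->
  integralOver (intr : int -> F) u.
Proof.
move=> yi0 uy.
apply: (@integral_eigen F #|T| (y \o enum_val)
  (\matrix_(i, j) B (enum_val i) (enum_val j)) u (enum_rank i0)) => [|i] /=.
  by rewrite enum_rankK.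
rewrite uy (reindex (@enum_val T T)) /=; last first.
  by exists enum_rank => x _; rewrite ?enum_rankK ?enum_valK.
by apply: eq_bigr => j _; rewrite mxE.
Qed.

Lemma one_neq_double (z : int) : 1 <> 2 * z :> int.
Proof. by lia. Qed.

Section OKLattice.
Variables (K : fieldExtType rat) (R : realType).
Local Notation O := (ring_of_integers K).
Local Notation d := (\dim {:K}).
Local Notation C := R[i].
Variables (th : K) (Oth : O th).
Hypothesis hth : forall y : K, exists g : {poly rat}, y = horner_alg th g.
Variable emb : 'I_d -> embedding K R.
Hypothesis emb_inj : injective (fun k => emb k th).

Definition vand : 'M[C]_d := \matrix_(i, k) emb k th ^+ i.

Lemma vand_unit : vand \in unitmx.
Proof.
rewrite unitmxE unitfE.
have -> : vand = Vandermonde d (\row_k emb k th).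
  by apply/matrixP => i k; rewrite !mxE.
rewrite det_Vandermonde; apply/prodf_neq0 => i _; apply/prodf_neq0 => j ij.
rewrite !mxE subr_eq0; apply: contraTneq ij => /emb_inj ->.
by rewrite ltnn.
Qed.

Definition mulmat (y : K) : 'M[rat]_d := \matrix_(i, j) crd th j (y * th ^+ i).

Lemma mulmat_vand y :
  map_mx ratr (mulmat y) *m vand = vand *m diag_mx (\row_k emb k y).
Proof.
apply/matrixP => i k; rewrite mul_mx_diag !mxE.
transitivity (emb k (y * th ^+ i)); last by rewrite rmorphM rmorphXn /= mulrC.
by rewrite (embedding_crd hth); apply: eq_bigr => j _; rewrite !mxE.
Qed.

Lemma trace_emb y : ratr (\tr (mulmat y)) = \sum_k emb k y.
Proof.
have := congr1 (fun M => \tr (M *m invmx vand)) (mulmat_vand y).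
rewrite mulmxK ?vand_unit //.
rewrite (mxtrace_mulC (vand *m _)) mulmxA mulVmx ?vand_unit // mul1mx.
rewrite mxtrace_diag => e; rewrite /mxtrace rmorph_sum /= in e *.
transitivity (\sum_i (map_mx ratr (mulmat y) : 'M[C]_d) i i).
  by apply: eq_bigr => i _; rewrite [in RHS]mxE.
by rewrite e; apply: eq_bigr => k _; rewrite mxE.
Qed.

(** The constant [c] is the absolute value of the discriminant [D] of the powers of [th]. By
    Cramer's rule [D * crd i y] is [det vand] times an integral combination of the conjugates of
    [y]; being integral and rational, it is an integer. *)
Lemma OK_lattice : exists2 c : nat, (0 < c)%N &
  forall y, O y -> forall i, exists z : int, c%:R * crd th i y = z%:~R.
Proof.
pose intC := integralOver (intr : int -> C).
have hS : subring [set x | intC x] := integral_subring C.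
pose D := \det (\matrix_(i < d, j < d) \tr (mulmat (th ^+ i * th ^+ j))).
have eD : ratr D = \det vand ^+ 2.
  rewrite -det_map_mx expr2 -[X in _ = _ * X]det_tr -det_mulmx; congr (\det _).
  apply/matrixP => i j; rewrite !mxE /= trace_emb; apply: eq_bigr => k _.
  by rewrite !mxE rmorphM !rmorphXn.
have intE k x : O x -> intC (emb k x).
  by move=> Ox; exact: (@integral_int_morph K C (emb k) x Ox).
have intV i k : intC (vand i k).
  by rewrite mxE; apply: (subringX hS); exact: intE.
have intdetV : intC (\det vand) by apply: integral_det.
have [z ez] : exists z : int, D = z%:~R.
  apply: (@integral_inj_rat C (ratr : {rmorphism rat -> C})).
  by rewrite /= eD; apply: (subringX hS).
have D0 : D != 0.
  have := vand_unit; rewrite unitmxE unitfE => V0.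
  by rewrite -(fmorph_eq0 (ratr : {rmorphism rat -> C})) /= eD expf_neq0.
have main y : O y -> forall i, exists z : int, D * crd th i y = z%:~R.
  move=> Oy i; apply: (@integral_inj_rat C (ratr : {rmorphism rat -> C})).
  rewrite rmorphM /= eD expr2 -mulrA; apply: (subringM hS) => //.
  pose q : 'rV[C]_d := \row_i ratr (crd th i y).
  have eq : q *m vand = \row_k emb k y.
    apply/rowP => k; rewrite !mxE (embedding_crd hth).
    by apply: eq_bigr => j _; rewrite !mxE.
  have := congr1 (fun v : 'rV_d => (v *m \adj vand) 0 i) eq.
  rewrite -mulmxA mul_mx_adj mul_mx_scalar !mxE => ->.
  apply: (subring_sum hS) => k _; rewrite !mxE; apply: (subringM hS).
    exact: intE.
  apply: (subringM hS).
    apply: (subringX hS); apply: (subringN hS); exact: (subring1 hS).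
  by apply: integral_det => a b; rewrite mxE mxE; apply: intV.
exists `|z|%N.
  by rewrite absz_gt0 -(intr_eq0 rat) -ez.
move=> y Oy i; have [z1 e1] := main y Oy i.
have [e|e] : ((`|z|%N%:R : rat) = z%:~R) \/ ((`|z|%N%:R : rat) = - z%:~R).
  by case: z {ez} => n; [left|right; rewrite NegzE abszN mulrNz opprK].
  by exists z1; rewrite e -ez.
by exists (- z1); rewrite e -ez mulNr e1 mulrNz.
Qed.

End OKLattice.

Section LatticeMod.
Variables (K : fieldExtType rat).
Local Notation O := (ring_of_integers K).
Local Notation d := (\dim {:K}).
Variables (th : K) (Oth : O th).
Hypothesis hth : forall y : K, exists g : {poly rat}, y = horner_alg th g.
Variable c : nat.
Hypothesis c0 : (0 < c)%N.
Hypothesis hc : forall y, O y -> forall i, exists z : int,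
  c%:R * crd th i y = z%:~R.

(** The map [kap] records the integers [c * crd i x] modulo [c n]; dividing the difference of two of
    them by [c] leaves a multiple of [n]. *)
Lemma OK_mod n : (0 < n)%N -> exists (T : finType) (kap : K -> T),
  forall x y, O x -> O y -> kap x = kap y ->
    exists z : 'I_d -> int, x - y = n%:R * \sum_i (z i)%:~R * th ^+ i.
Proof.
move=> n0; have cn0 : (0 < c * n)%N by rewrite muln_gt0 c0.
pose num x i := numq (c%:R * crd th i x).
have numE x i : O x -> (num x i)%:~R = c%:R * crd th i x.
  by move=> Ox; have [z e] := hc Ox i; rewrite /num e numq_int.
exists {ffun 'I_d -> 'I_(c * n).-1.+1},
  (fun x => [ffun i => inord `|(num x i %% (c * n)%N%:Z)%Z|%N]).
move=> x y Ox Oy /ffunP e.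
have hz i : exists w : int, crd th i (x - y) = n%:R * w%:~R.
  have := e i; rewrite !ffunE => /(congr1 val).
  have cnz : (c * n)%N%:Z != 0 by rewrite eqz_nat -lt0n.
  have lt a : (`|(a %% (c * n)%N%:Z)%Z| < (c * n).-1.+1)%N.
    rewrite prednK // -ltz_nat gez0_abs ?modz_ge0 //.
    by apply: ltz_pmod; rewrite ltz_nat.
  rewrite /= !inordK // => /(congr1 Posz); rewrite !gez0_abs ?modz_ge0 // => em.
  have : ((c * n)%N%:Z %| num x i - num y i)%Z.
    by rewrite -eqz_mod_dvd; apply/eqP.
  move/dvdzP => [w ew]; exists w.
  have c0' : c%:R != 0 :> rat by rewrite pnatr_eq0 -lt0n.
  apply: (mulfI c0'); rewrite crdB mulrBr -!numE // -rmorphB ew.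
  by rewrite rmorphM /= PoszM rmorphM /= mulrC mulrA.
have [w hw] := choice hz; exists w.
rewrite [LHS](crdE hth) mulr_sumr; apply: eq_bigr => i _.
by rewrite hw -scalerA scaler_nat scaler_int mulr_natl mulrzl.
Qed.

Section Maximal.
Variable p : set K.
Hypothesis hp : maximal_ideal O p.
Let hO : subring O := OK_subring K.

Lemma maxi_sub : p `<=` O. Proof. by case: hp => -[]. Qed.
Lemma maxi0 : p 0. Proof. by case: hp => -[_ []]. Qed.
Lemma maxiD a b : p a -> p b -> p (a + b). Proof. by case: hp => -[_ [_ + _]] _ _; apply. Qed.
Lemma maxiZ a b : O a -> p b -> p (a * b). Proof. by case: hp => -[_ [_ _]] + _ _; apply. Qed.
Lemma maxiB a b : p a -> p b -> p (a - b).
Proof.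
move=> pa pb; apply: maxiD => //; rewrite -mulN1r; apply: maxiZ => //.
by apply: subringN => //; apply: subring1.
Qed.
Lemma maxi1 : ~ p 1. Proof. by case: hp. Qed.

Lemma maxi_inv s : O s -> ~ p s -> exists s' x, [/\ O s', p x & s * s' = 1 - x].
Proof.
move=> Os ps.
pose J := [set y | exists a x, [/\ O a, p x & y = x + s * a]].
have idJ : ideal O J.
  split=> [_ [a [x [Oa px ->]]]|].
    by apply: subringD => //; [exact: maxi_sub|exact: subringM].
  split.
  - by exists 0, 0; rewrite mulr0 addr0; split=> //; [exact: subring0|exact: maxi0].
  - move=> _ _ [a [x [Oa px ->]]] [b [y [Ob py ->]]].
    exists (a + b), (x + y); rewrite mulrDr addrACA.
    by split=> //; [exact: subringD|exact: maxiD].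
  - move=> e _ Oe [a [x [Oa px ->]]]; exists (e * a), (e * x).
    rewrite -[_ *: _]/(e * _) mulrDr mulrCA.
    by split=> //; [exact: subringM|exact: maxiZ].
have pJ : p `<=` J.
  by move=> x px; exists 0, x; rewrite mulr0 addr0; split=> //; apply: subring0.
have Js : J s.
  by exists 1, 0; rewrite mulr1 add0r; split=> //; [exact: subring1|exact: maxi0].
have [[a [x [Oa px e]]]|J1] := pselect (J 1).
  by exists a, x; split=> //; apply/eqP; rewrite eq_sym subr_eq e addrC.
by case: hp => _ _ /(_ J idJ J1 pJ) e; case: ps; rewrite -e.
Qed.

Lemma maxi_prime a b : O a -> O b -> p (a * b) -> p a \/ p b.
Proof.
move=> Oa Ob pab; have [|pa] := pselect (p a); first by left.
right; have [a' [x [Oa' px e]]] := maxi_inv Oa pa.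
have -> : b = a' * (a * b) + b * x.
  have -> : x = 1 - a * a' by rewrite e opprB addrC subrK.
  by ring.
by apply: maxiD; apply: maxiZ.
Qed.

Local Notation Op := (localize O p).

Lemma localizeP x : Op x <-> exists a b, [/\ O a, O b, ~ p b & x = a / b].
Proof.
split=> [[a Oa [b [Ob pb] <-]]|[a [b [Oa Ob pb ->]]]].
  by exists a, b.
by exists a => //; exists b.
Qed.

Lemma notp_neq0 b : ~ p b -> b != 0.
Proof. by move=> pb; apply/eqP => b0; apply: pb; rewrite b0; exact: maxi0. Qed.

Lemma notpM a b : O a -> O b -> ~ p a -> ~ p b -> ~ p (a * b).
Proof. by move=> Oa Ob pa pb /(maxi_prime Oa Ob)[]. Qed.

Lemma loc_sub : O `<=` Op.
Proof.
move=> a Oa; apply/localizeP; exists a, 1; rewrite divr1.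
by split=> //; [exact: subring1|exact: maxi1].
Qed.

Lemma loc_subring : subring Op.
Proof.
split; first by apply: loc_sub; apply: subring1.
- move=> _ _ /localizeP[a [b [Oa Ob pb ->]]] /localizeP[a' [b' [Oa' Ob' pb' ->]]].
  apply/localizeP; exists (a * b' - a' * b), (b * b'); split.
  + by apply: subringB => //; apply: subringM.
  + exact: subringM.
  + exact: notpM.
  + by field; rewrite !notp_neq0.
- move=> _ _ /localizeP[a [b [Oa Ob pb ->]]] /localizeP[a' [b' [Oa' Ob' pb' ->]]].
  apply/localizeP; exists (a * a'), (b * b'); split.
  + exact: subringM.
  + exact: subringM.
  + exact: notpM.
  + by field; rewrite !notp_neq0.
Qed.

Lemma loc_inv b : O b -> ~ p b -> Op b^-1.
Proof.
move=> Ob pb; apply/localizeP; exists 1, b; rewrite div1r.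
by split=> //; apply: subring1.
Qed.

(** The ideal [2 O] is proper, because [1/2] is not an algebraic integer, and it strictly contains
    zero; so the zero ideal is not maximal. *)
Lemma maxi_neq0 : exists2 a, p a & a != 0.
Proof.
apply: contrapT => no.
have p0 x : p x -> x = 0.
  by move=> px; apply/eqP/negPn/negP => x0; apply: no; exists x.
pose J := [set 2 * x | x in O].
have idJ : ideal O J.
  split=> [_ [a Oa <-]|]; first by apply: subringM => //; apply: subring_nat.
  split.
  - by exists 0; rewrite ?mulr0 //; apply: subring0.
  - by move=> _ _ [a Oa <-] [b Ob <-]; exists (a + b); rewrite ?mulrDr //; apply: subringD.
  - move=> e _ Oe [a Oa <-]; exists (e * a); first exact: subringM.
    by rewrite -[_ *: _]/(e * (2 * a)) mulrCA.
have two0 : 2 != 0 :> K := charK0 K 1.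
have J1 : ~ J 1.
  move=> [x Ox e].
  have ex : x = in_alg K 2^-1.
    apply: (mulfI two0); rewrite e -(rmorph_nat (in_alg K)) -rmorphM.
    by rewrite divff // rmorph1.
  have [z ez] : exists z : int, 2^-1 = z%:~R :> rat.
    by apply: (@integral_inj_rat K (in_alg K)); move: Ox; rewrite ex.
  have : (1 : rat) = (2 * z)%:~R by rewrite rmorphM /= -ez divff.
  by move/eqP; rewrite -[1]/(1%:~R) eqr_int => /eqP; exact: one_neq_double.
have J2 : J 2 by exists 1; rewrite ?mulr1 //; apply: subring1.
have pJ : p `<=` J.
  by move=> x /p0 ->; exists 0; rewrite ?mulr0 //; apply: subring0.
case: hp => _ _ /(_ J idJ J1 pJ) e; move: J2; rewrite e => /p0/eqP.
by rewrite (negbTE two0).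
Qed.

Lemma maxi_nat : exists2 n : nat, (0 < n)%N & p n%:R.
Proof.
have [a pa a0] := maxi_neq0; have [n n0 On] := OK_multiple a^-1.
exists n => //; have -> : n%:R = (n%:R * a^-1) * a by rewrite divfK.
exact: maxiZ.
Qed.

End Maximal.

(* The sets of classes of O x + N decrease strictly along the steps of the
   search, which is finite because kap separates M modulo N. *)
Lemma exists_simple (M N : set K) (T : finType) (kap : K -> T) :
  submodule O (M : set K^o) -> submodule O (N : set K^o) ->
  (forall x y, M x -> M y -> kap x = kap y -> N (x - y)) ->
  (exists2 x, M x & ~ N x) ->
  exists x, [/\ M x, ~ N x & maximal_ideal O [set o | O o /\ N (o * x)]].
Proof.
move=> [M0 MD MZ] [N0 ND NZ] hk [x0 Mx0 Nx0].
have hO := OK_subring K.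
have MNZ o x : O o -> M x -> M (o * x) by apply: MZ.
have NNZ o x : O o -> N x -> N (o * x) by apply: NZ.
have NB a b : N a -> N b -> N (a - b).
  move=> Na Nb; apply: (ND) => //; rewrite -mulN1r; apply: NNZ => //.
  by apply: subringN => //; apply: subring1.
pose cl x := [set t | `[< exists o, O o /\ kap (o * x) = t >]]%SET.
pose Q n := `[< exists x, [/\ M x, ~ N x & #|cl x| = n] >].
have exQ : exists n, Q n by exists #|cl x0|; apply/asboolP; exists x0.
case: (ex_minnP exQ) => n /asboolP[x [Mx Nx ex]] minx.
exists x; split=> //; split.
- split=> [o []//|]; split.
  + by split; [exact: subring0|rewrite mul0r].
  + move=> a b [Oa Na] [Ob Nb]; split; first exact: subringD.
    by rewrite mulrDl; apply: (ND).
  + move=> a b Oa [Ob Nb]; split; first exact: subringM.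
    by rewrite -[_ *: _]/(a * b) -mulrA; apply: NNZ.
- by move=> [_]; rewrite mul1r.
- move=> J [JO [J0 JD JZ]] J1 sub; apply/seteqP; split=> // j Jj.
  have Oj := JO _ Jj; split=> //; apply: contrapT => Njx.
  have Mjx : M (j * x) by apply: MNZ.
  have : (n <= #|cl (j * x)%R|)%N.
    by apply: minx; apply/asboolP; exists (j * x).
  rewrite -ex leqNgt => /negP; apply; apply: proper_card; apply/properP; split.
    apply/fintype.subsetP => t; rewrite !finset.in_set => /asboolP[o [Oo <-]].
    apply/asboolP; exists (o * j); split; first exact: subringM.
    by rewrite mulrA.
  exists (kap x).
    by rewrite finset.in_set; apply/asboolP; exists 1; rewrite mul1r; split=> //; apply: subring1.
  rewrite finset.in_set; apply/negP => /asboolP[o [Oo e]].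
  apply: J1; have -> : 1 = (1 - o * j) + o * j by rewrite subrK.
  apply: (JD); last exact: (JZ).
  apply: sub; split; first by apply: subringB => //; [exact: subring1|exact: subringM].
  rewrite mulrBl mul1r -mulrA; apply: hk => //.
  by apply: MNZ.
Qed.

Section DVR.
Variable p : set K.
Hypothesis hp : maximal_ideal O p.
Let hO : subring O := OK_subring K.
Local Notation Op := (localize O p).
Let hOp : subring Op := loc_subring hp.

Lemma maxi_loc_inv x : Op x -> (exists s, [/\ O s, ~ p s & p (s * x)]) \/ (x != 0 /\ Op x^-1).
Proof.
move=> /localizeP[a [b [Oa Ob pb ->]]]; have b0 := notp_neq0 hp pb.
have [pa|pa] := pselect (p a).
  by left; exists b; split=> //; rewrite mulrC divfK.
right; have a0 := notp_neq0 hp pa; rewrite mulf_neq0 ?invr_eq0 //.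
by split=> //; rewrite invf_div; apply/localizeP; exists b, a.
Qed.

(** Take a positive integer [n] in [p]. Generators over the integers are the [n th^i] and one
    element of [p] for each value of [kap] attained on [p]. *)
Lemma maxi_fg : exists (T : finType) (y : T -> K), (forall i, p (y i)) /\
  forall x, p x -> exists z : T -> int, x = \sum_i (z i)%:~R * y i.
Proof.
have [n n0 pn] := maxi_nat hp; have [T [kap hk]] := OK_mod n0.
have ht t : exists y, p y /\ ((exists2 x, p x & kap x = t) -> kap y = t).
  have [[x px e]|no] := pselect (exists2 x, p x & kap x = t).
    by exists x.
  by exists 0; split=> //; apply: maxi0.
have [y hy] := choice ht.
exists (T + 'I_d : finType)%type, (fun i : T + 'I_d => match i with inl t => y t
  | inr i => n%:R * th ^+ i end); split.
  move=> [t|i]; first by case: (hy t).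
  by rewrite mulrC; apply: maxiZ => //; apply: subringX.
move=> x px; have [py ey] := hy (kap x).
have [|z ez] := hk x (y (kap x)) (maxi_sub hp px) (maxi_sub hp py).
  by rewrite ey //; exists x.
exists (fun i : T + 'I_d => match i with inl t => (t == kap x)%:R | inr i => z i end).
rewrite big_sumType /= (bigD1 (kap x)) //= eqxx mul1r big1 ?addr0; last first.
  by move=> t /negbTE ->; rewrite mul0r.
rewrite -[LHS](subrK (y (kap x))) addrC; congr (_ + _).
by rewrite ez mulr_sumr; apply: eq_bigr => i _; rewrite mulrCA.
Qed.

(** The argument for integrally closed noetherian rings. Given [a] in [p], some [b] outside [a Op]
    has annihilator [p] modulo [a Op], so [(b/a) p] lies in [Op]. If it lay in [p Op], a multiple of
    [b/a] by an element outside [p] would map the finitely generated [p] into itself, hence be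
    integral, and [b] would be in [a Op]. So [(b/a) w] is a unit for some [w] in [p]. *)
Lemma exists_uniformizer : exists w, [/\ p w, w != 0
  & forall x, p x -> Op (x / w)].
Proof.
have [a pa a0] := maxi_neq0 hp.
have [n n0 On] := OK_multiple a^-1.
have [T [kap hk]] := OK_mod n0.
pose N : set K := [set x | O x /\ Op (x / a)].
have [b [Ob Nb mb]] : exists b, [/\ O b, ~ N b & maximal_ideal O [set o | O o /\ N (o * b)]].
  apply: (@exists_simple O N T kap).
  - by split; [exact: subring0|exact: subringD|exact: subringM].
  - split.
    + by split; [exact: subring0|rewrite mul0r; exact: subring0].
    + move=> x y [Ox Nx] [Oy Ny]; split; first exact: subringD.
      by rewrite mulrDl; apply: subringD.
    + move=> e x Oe [Ox Nx]; split; first exact: subringM.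
      by rewrite -[_ *: _]/(e * x) -mulrA; apply: subringM => //; apply: loc_sub.
  - move=> x y Ox Oy /(hk _ _ Ox Oy)[z ez]; split; first exact: subringB.
    apply: loc_sub => //; rewrite ez mulrAC; apply: subringM => //.
    apply: subring_sum => // i _; apply: subringM => //; last exact: subringX.
    exact: (integral_id (intr : {rmorphism int -> K})).
  - exists 1; first exact: subring1.
    move=> [_]; rewrite div1r => /localizeP[u [v [Ou Ov pv e]]].
    have v0 := notp_neq0 hp pv; apply: pv.
    have -> : v = u * a by have -> : u = a^-1 * v; [rewrite e divfK|rewrite mulrC mulVKf].
    exact: maxiZ.
(* Elements outside [p] are invertible in [Op], so the annihilator of [b] is contained in [p]; as it
   is maximal, it equals [p]. *)
have ep : p = [set o | O o /\ N (o * b)].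
  case: hp => idp p1 pmax; case: mb => idb b1 bmax.
  apply: (bmax); [exact: idp|exact: p1|].
  move=> o [Oo [Oob /localizeP[u [v [Ou Ov pv e]]]]]; apply: contrapT => po.
  apply: Nb; split=> //.
  have -> : b / a = o^-1 * (o * b / a) by rewrite -mulrA mulKf // (notp_neq0 hp).
  by apply: subringM => //; [exact: loc_inv|apply/localizeP; exists u, v].
have cp x : p x -> Op (b / a * x).
  rewrite {1}ep => -[Ox [_]]; have -> : x * b / a = b / a * x by ring.
  by [].
have [w pw hw] : exists2 w, p w & ~ exists s, [/\ O s, ~ p s & p (s * (b / a * w))].
  apply: contrapT => no.
  have {}no x : p x -> exists s, [/\ O s, ~ p s & p (s * (b / a * x))].
    by move=> px; apply: contrapT => h; apply: no; exists x.
  have [T' [y [py hy]]] := maxi_fg.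
  have hs i := no _ (py i); have [s hs'] := choice hs.
  pose S := \prod_i s i.
  have [OS pS] : O S /\ ~ p S.
    rewrite /S; apply: (big_ind (fun x => O x /\ ~ p x)).
    - by split; [exact: subring1|exact: maxi1].
    - by move=> x y' [Ox px] [Oy py']; split; [exact: subringM|exact: notpM].
    - by move=> i _; case: (hs' i).
  have Sy i : p (S * (b / a) * y i).
    rewrite /S (bigD1 i) //= -mulrA mulrAC [s i * _]mulrC -mulrA.
    rewrite [X in p X](_ : _ = (\prod_(j | j != i) s j) * (s i * (b / a * y i))); last by ring.
    apply: maxiZ => //; last by case: (hs' i).
    by apply: subring_prod => // j _; case: (hs' j).
  have [B hB] := choice (fun i => hy _ (Sy i)).
  (* By [hB], multiplication by [S * (b / a)] maps the generators [y i] of [p] to integer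
     combinations of themselves. *)
  have Oc : O (S * (b / a)).
    have [i0 yi0] : exists i, y i != 0.
      apply: contrapT => ny; case/negP: a0; have [z ->] := hy _ pa.
      rewrite big1 // => i _; have [->|yi] := eqVneq (y i) 0; first by rewrite mulr0.
      by case: ny; exists i.
    exact: (integral_eigen_fin yi0 hB).
  apply: Nb; split=> //; apply/localizeP; exists (S * (b / a)), S; split=> //.
  by rewrite mulrAC divff ?mul1r // (notp_neq0 hp).
have [//|[u0 Ou]] := maxi_loc_inv (cp w pw).
have w0 : w != 0 by apply: contraNneq u0 => ->; rewrite mulr0.
exists w; split=> // x px.
have c0' : b / a != 0 by apply: contraNneq u0 => ->; rewrite mul0r.
have -> : x / w = (b / a * w)^-1 * (b / a * x).
  by rewrite invfM mulrACA mulVf // mul1r mulrC.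
by apply: subringM => //; apply: cp.
Qed.

(** Without a decomposition, [a] is divisible in [Op] by all powers of [w], and so is some positive
    integer [n], a multiple of [a]. By finiteness two powers [w^k] and [w^l] with [k < l] are
    congruent modulo [n]; dividing their difference by [w^(k+1)] puts [w^-1] in [Op]. *)
Lemma dvr_decomposition w : p w -> w != 0 -> (forall x, p x -> Op (x / w)) ->
  ~ Op w^-1 /\ forall a, Op a -> a != 0 ->
    exists k u, [/\ Op u, Op u^-1 & a = u * w ^+ k].
Proof.
move=> pw w0 hw.
have Ow := maxi_sub hp pw.
have wV : ~ Op w^-1.
  move=> /localizeP[a [b [Oa Ob pb e]]]; have b0 := notp_neq0 hp pb.
  apply: pb; have -> : b = a * w; last exact: maxiZ.
  have -> : a = w^-1 * b; [by rewrite e divfK|by rewrite mulrC mulVKf].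
split=> // a Oa a0; apply: contrapT => no.
have aw k : Op (a / w ^+ k).
  elim: k => [|k IH]; first by rewrite divr1.
  have ak0 : a / w ^+ k != 0 by rewrite mulf_neq0 // invr_eq0 expf_neq0.
  have [[s [Os ps psa]]|[_ inv]] := maxi_loc_inv IH; last first.
    by case: no; exists k, (a / w ^+ k); rewrite divfK ?expf_neq0.
  have s0 := notp_neq0 hp ps.
  have -> : a / w ^+ k.+1 = s^-1 * (s * (a / w ^+ k) / w).
    rewrite exprS; field; rewrite s0 w0 andbT /=; exact: expf_neq0.
  by apply: subringM => //; [exact: loc_inv|exact: hw].
have [n n0 On] := OK_multiple a^-1.
have nw k : Op (n%:R / w ^+ k).
  have -> : n%:R / w ^+ k = n%:R * a^-1 * (a / w ^+ k).
    by rewrite mulrA divfK.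
  by apply: subringM => //; apply: loc_sub.
have [T [kap hk]] := OK_mod n0.
have [k [l [kl ekl]]] : exists k l : nat, (k < l)%N /\ kap (w ^+ k) = kap (w ^+ l).
  pose f (i : 'I_#|T|.+1) := kap (w ^+ i).
  have : ~~ injectiveb f.
    apply/negP => /injectiveP inj; have := leq_card f inj.
    by rewrite card_ord ltnn.
  case/injectivePn => i [j ij ef].
  have [lt|gt|e] := ltngtP i j; [by exists i, j|by exists j, i|].
  by case/eqP: ij; apply: val_inj.
have [z ez] := hk _ _ (subringX hO k Ow) (subringX hO l Ow) ekl.
set S := \sum_i _ in ez.
have OS : O S.
  apply: subring_sum => // i _; apply: subringM => //; last exact: subringX.
  exact: (integral_id (intr : {rmorphism int -> K})).
apply: wV.
have -> : w^-1 = w ^+ (l - k.+1) + (n%:R / w ^+ k.+1) * S.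
  have wk0 : w ^+ k != 0 by rewrite expf_neq0.
  have -> : n%:R / w ^+ k.+1 * S = (w ^+ k - w ^+ l) / w ^+ k.+1.
    by rewrite ez; ring.
  rewrite -{2}(subnKC kl) exprD exprS; field; by rewrite w0 wk0.
apply: subringD => //; first by apply: loc_sub => //; apply: subringX.
by apply: subringM => //; apply: loc_sub.
Qed.

End DVR.
End LatticeMod.

(** * Indices of subgroups and filtrations *)

Section Index.
Variable V : zmodType.
Implicit Types M N P : set V.

Definition subgroup N : Prop := N 0 /\ forall x y, N x -> N y -> N (x - y).

(** An upper bound for the number of classes, by representatives that may lie outside [M]. Its
    counterpart [index_sep] bounds the same number by a map that separates the classes. Either is
    easier to establish than an exact index. *)
Definition index_cover M N (n : nat) : Prop := exists (T : finType) (s : T -> V),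
  (forall x, M x -> exists t, N (x - s t)) /\ (#|T| <= n)%N.

Definition index_sep M N (n : nat) : Prop := exists (T : finType) (kap : V -> T),
  (forall x y, M x -> M y -> kap x = kap y -> N (x - y)) /\ (#|T| <= n)%N.

Definition has_index M N (n : nat) : Prop := exists (T : finType) (s : T -> V),
  [/\ forall t, M (s t), forall t u, N (s t - s u) -> t = u,
      forall x, M x -> exists t, N (x - s t) & #|T| = n].

Lemma subgroupN N x : subgroup N -> N x -> N (- x).
Proof. by move=> [N0 NB] Nx; rewrite -sub0r; apply: NB. Qed.

Lemma subgroupD N x y : subgroup N -> N x -> N y -> N (x + y).
Proof. by move=> hN Nx Ny; rewrite -[y]opprK; apply: hN.2 => //; apply: subgroupN. Qed.

Lemma index_cover_sep M N n : subgroup N -> M 0 -> index_cover M N n -> index_sep M N n.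
Proof.
move=> hN M0 [T [s [hs sT]]]; have [t0 _] := hs 0 M0.
exists T, (fun x => xget t0 [set t | N (x - s t)]); split=> // x y Mx My e.
have Nx : N (x - s (xget t0 [set t | N (x - s t)])) := xgetPex _ (hs x Mx).
have Ny : N (y - s (xget t0 [set t | N (y - s t)])) := xgetPex _ (hs y My).
have -> : x - y = (x - s (xget t0 [set t | N (x - s t)]))
                - (y - s (xget t0 [set t | N (y - s t)])).
  by rewrite e opprB addrA subrK.
exact: hN.2.
Qed.

Lemma has_index_cover M N n : has_index M N n -> index_cover M N n.
Proof. by move=> [T [s [Ms inj hs <-]]]; exists T, s. Qed.

Lemma index_sep_ge M N n (T : finType) (s : T -> V) :
  index_sep M N n -> (forall t, M (s t)) -> (forall t u, N (s t - s u) -> t = u) ->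
  (#|T| <= n)%N.
Proof.
move=> [T' [kap [hk sT]]] Ms inj; apply: leq_trans sT.
by apply: (leq_card (kap \o s)) => t u /= e; apply: inj; apply: hk.
Qed.

(** The set of classes is finite, so [card_quotient] is its true cardinal and not the default
    [0]. *)
Lemma index_sep_has M N n : subgroup N -> index_sep M N n ->
  has_index M N (card_quotient M N) /\ (card_quotient M N <= n)%N.
Proof.
move=> hN hsep; have [T [kap [hk sT]]] := hsep.
pose cl v : set V := [set w | N (w - v)].
have clP x y : N (x - y) -> cl x = cl y.
  move=> Nxy; apply/seteqP; split=> z h; rewrite /cl /= in h *.
    by have -> : z - y = (z - x) + (x - y); [rewrite addrA subrK|exact: subgroupD].
  have -> : z - x = (z - y) - (x - y); last exact: hN.2.
  by rewrite opprB addrA subrK.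
have hy t : exists v, ((exists2 x, M x & kap x = t) -> M v /\ kap v = t).
  have [[x Mx e]|no] := pselect (exists2 x, M x & kap x = t).
    by exists x.
  by exists 0 => h; case: no.
have [y hy'] := choice hy.
have fin : finite_set (cl @` M).
  apply: (@sub_finite_set _ _ ((cl \o y) @` [set: T])); last first.
    by apply: finite_image; apply: finite_finset.
  move=> _ [x Mx <-]; exists (kap x) => //=.
  have [My ey] := hy' (kap x) (ex_intro2 _ _ x Mx erefl).
  by apply: clP; apply: hk.
have idx : has_index M N (card_quotient M N).
  pose Q := fset_set (cl @` M).
  have hQ (c : Q) : exists v, M v /\ cl v = val c.
    have : val c \in Q := valP c.
    by rewrite in_fset_set // inE => -[v Mv e]; exists v.
  have [s hs] := choice hQ.
  exists Q, s; split.
  - by move=> c; case: (hs c).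
  - move=> c e h; apply: val_inj; rewrite -(hs c).2 -(hs e).2; exact: clP.
  - move=> x Mx; have cx : cl x \in Q by rewrite in_fset_set // inE; exists x.
    exists [` cx]%fset; have [_ e] := hs [` cx]%fset.
    have : cl (s [` cx]%fset) x; last by [].
    by rewrite e /= /cl /= subrr; case: hN.
  - by rewrite -cardfE.
split=> //; have [T' [s [Ms inj _ <-]]] := idx.
exact: index_sep_ge hsep Ms inj.
Qed.

Lemma has_index_sep M N n : subgroup N -> M 0 -> has_index M N n ->
  index_sep M N n.
Proof. by move=> hN M0 /has_index_cover; apply: index_cover_sep. Qed.

Lemma has_index_uniq M N m n : subgroup N -> M 0 -> has_index M N m ->
  has_index M N n -> m = n.
Proof.
move=> hN M0 hm hn; apply/eqP; rewrite eqn_leq; apply/andP; split.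
  have [T [s [Ms inj _ <-]]] := hm.
  exact: index_sep_ge (has_index_sep hN M0 hn) Ms inj.
have [T [s [Ms inj _ <-]]] := hn.
exact: index_sep_ge (has_index_sep hN M0 hm) Ms inj.
Qed.

Lemma card_quotientE M N n : subgroup N -> M 0 -> has_index M N n ->
  card_quotient M N = n.
Proof.
move=> hN M0 hn; apply: (has_index_uniq hN M0) => //.
by have [] := index_sep_has hN (has_index_sep hN M0 hn).
Qed.

Lemma has_index_tower M N P a b : subgroup M -> subgroup N -> subgroup P ->
  N `<=` M -> P `<=` N -> has_index M N a -> has_index N P b ->
  has_index M P (a * b).
Proof.
move=> hM hN hP NM PN [T [s [Ms inj hs <-]]] [T' [s' [Ns' inj' hs' <-]]].
exists (T * T')%type, (fun t => s t.1 + s' t.2); split.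
- by move=> t; apply: subgroupD => //; apply: NM.
- move=> [t t'] [u u'] /= h.
  have e : t = u.
    apply: inj; have -> : s t - s u = (s t + s' t' - (s u + s' u')) - (s' t' - s' u').
      by rewrite opprD addrACA addrK.
    by apply: hN.2; [exact: PN|exact: hN.2].
  rewrite -e in h *; congr (_, _); apply: inj'.
  by have -> : s' t' - s' u' = s t + s' t' - (s t + s' u') by rewrite opprD addrACA subrr add0r.
- move=> x Mx; have [t Nt] := hs x Mx; have [t' Pt'] := hs' _ Nt.
  by exists (t, t'); rewrite /= opprD addrA.
- by rewrite card_prod.
Qed.

Lemma has_index_split M N P n : subgroup M -> subgroup N -> subgroup P ->
  N `<=` M -> P `<=` N -> has_index M P n ->
  exists a b, [/\ has_index M N a, has_index N P b & n = (a * b)%N].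
Proof.
move=> hM hN hP NM PN hn; have [T [kap [hk sT]]] := has_index_sep hP hM.1 hn.
have [iMN _] : has_index M N (card_quotient M N) /\ (card_quotient M N <= n)%N.
  apply: index_sep_has => //; exists T, kap; split=> // x y Mx My e.
  by apply: PN; apply: hk.
have [iNP _] : has_index N P (card_quotient N P) /\ (card_quotient N P <= n)%N.
  apply: index_sep_has => //; exists T, kap; split=> // x y Nx Ny.
  by apply: hk; apply: NM.
exists (card_quotient M N), (card_quotient N P); split=> //.
apply: (has_index_uniq hP hM.1 hn); exact: (has_index_tower hM hN hP).
Qed.

(** The first cover is one modulo [N + P], not modulo [N]: this is the form in which [cover_wpow]
    provides classes. *)
Lemma cover_mul M N P a b : (forall x y, P x -> P y -> P (x + y)) ->
  (exists (T : finType) (s : T -> V), (#|T| <= a)%N /\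
     forall x, M x -> exists t y z, [/\ N y, P z & x - s t = y + z]) ->
  index_cover N P b -> index_cover M P (a * b).
Proof.
move=> PD [T [s [sT hs]]] [T' [s' [hs' sT']]].
exists (T * T')%type, (fun t => s t.1 + s' t.2); split; last first.
  by rewrite card_prod leq_mul.
move=> x Mx; have [t [y [z [Ny Pz e]]]] := hs x Mx; have [t' Pt'] := hs' y Ny.
exists (t, t'); rewrite /= opprD addrA e addrAC; exact: PD.
Qed.

End Index.

Lemma has_index_image (V V' : zmodType) (f : V -> V') (M N : set V) n :
  subgroup M -> (forall x y, M x -> M y -> f (x - y) = f x - f y) ->
  (forall x, M x -> f x = 0 -> x = 0) -> N `<=` M ->
  has_index M N n -> has_index (f @` M) (f @` N) n.
Proof.
move=> hM fB inj NM [T [s [Ms injs hs <-]]].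
have finj x y : M x -> M y -> f x = f y -> x = y.
  move=> Mx My e; apply/eqP; rewrite -subr_eq0; apply/eqP; apply: inj.
    exact: hM.2.
  by rewrite fB // e subrr.
exists T, (f \o s); split=> //.
- by move=> t; exists (s t).
- move=> t u [x Nx e]; apply: injs.
  suff <- : x = s t - s u by [].
  by apply: finj; [exact: NM|exact: hM.2|rewrite fB].
- move=> _ [x Mx <-]; have [t Nt] := hs x Mx; exists t.
  by exists (x - s t); rewrite ?fB.
Qed.

Lemma has_index_ffun (V : zmodType) r (U : zmodType) (M N : 'I_r -> set V)
    (e : U -> 'I_r -> V) (n : nat) (T : finType) (s : 'I_r -> T -> V) :
  (forall f : 'I_r -> V, exists u, forall a, e u a = f a) ->
  (forall u v a, e (u - v) a = e u a - e v a) ->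
  (forall a t, M a (s a t)) -> (forall a t u, N a (s a t - s a u) -> t = u) ->
  (forall a x, M a x -> exists t, N a (x - s a t)) -> #|T| = n ->
  has_index [set u | forall a, M a (e u a)] [set u | forall a, N a (e u a)] (n ^ r).
Proof.
move=> surj eB Ms inj hs <-.
have [inve hinv] := choice surj.
exists {ffun 'I_r -> T}, (fun t : {ffun 'I_r -> T} => inve (fun a => s a (t a))); split.
- by move=> t a /=; rewrite hinv.
- move=> t u h; apply/ffunP => a; apply: (inj a).
  by have := h a; rewrite eB !hinv.
- move=> u Mu; have ht a : exists t, N a (e u a - s a t) by apply: hs; apply: Mu.
  have [t ht'] := choice ht; exists [ffun a => t a] => a /=.
  by rewrite eB hinv ffunE.
- by rewrite card_ffun card_ord.
Qed.

(** * Counting classes of modules over a discrete valuation ring *)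

Section DVRModule.
Variables (K : fieldType) (O : set K) (w : K).
Hypotheses (hO : subring O) (Ow : O w) (w0 : w != 0) (wV : ~ O w^-1).
Hypothesis dvr : forall a, O a -> a != 0 ->
  exists k u, [/\ O u, O u^-1 & a = u * w ^+ k].
Hypothesis fracO : forall a, exists b c, [/\ O b, O c, c != 0 & a = b / c].
Variables (Q : finType) (rho : Q -> K).
Hypothesis Orho : forall t, O (rho t).
Hypothesis rho_inj : forall t u, O ((rho t - rho u) / w) -> t = u.
Hypothesis rho_surj : forall a, O a -> exists t, O ((a - rho t) / w).

Lemma dvr_total x : O x \/ O x^-1.
Proof.
have [->|x0] := eqVneq x 0; first by left; apply: subring0.
have [b [c [Ob Oc c0 e]]] := fracO x.
have b0 : b != 0 by apply: contraNneq x0 => b0; rewrite e b0 mul0r.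
have [k [u [Ou Ou' eb]]] := dvr Ob b0; have [l [v [Ov Ov' ec]]] := dvr Oc c0.
have u0 : u != 0 by apply: contraNneq b0 => u0; rewrite eb u0 mul0r.
have v0 : v != 0 by apply: contraNneq c0 => v0; rewrite ec v0 mul0r.
have wn n : w ^+ n != 0 by rewrite expf_neq0.
have [kl|/ltnW kl] := leqP l k; [left|right].
  have -> : x = u * v^-1 * w ^+ (k - l).
    by rewrite e eb ec -{1}(subnK kl) exprD; field; rewrite v0 wn.
  by apply: subringM => //; [exact: subringM|exact: subringX].
have -> : x^-1 = v * u^-1 * w ^+ (l - k).
  rewrite e eb ec -{1}(subnK kl) exprD; field; by rewrite v0 u0 !wn.
by apply: subringM => //; [exact: subringM|exact: subringX].
Qed.

Lemma dvr_min (T : finType) (c : T -> K) : (exists i, c i != 0) ->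
  exists i0, c i0 != 0 /\ forall i, O (c i / c i0).
Proof.
move=> [i1 ci1].
suff main (s : seq T) : exists i0, c i0 != 0 /\ forall i, i \in s -> O (c i / c i0).
  have [i0 [ci0 h]] := main (enum T); exists i0; split=> // i.
  by apply: h; rewrite mem_enum.
elim: s => [|j s [i0 [ci0 h]]]; first by exists i1.
have [Oj|Oj] := dvr_total (c j / c i0).
  by exists i0; split=> // i /[1!inE] /orP[/eqP->|/h].
have [cj|cj] := eqVneq (c j) 0.
  exists i0; split=> // i /[1!inE] /orP[/eqP->|/h//].
  by rewrite cj mul0r; apply: subring0.
exists j; split=> // i /[1!inE] /orP[/eqP->|/h hi].
  by rewrite divff //; apply: subring1.
have -> : c i / c j = c i / c i0 * (c j / c i0)^-1 by field; rewrite cj ci0.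
exact: subringM.
Qed.

Lemma unit_or_w a : O a -> O (a / w) \/ (a != 0 /\ O a^-1).
Proof.
move=> Oa; have [->|a0] := eqVneq a 0; first by left; rewrite mul0r; apply: subring0.
have [[|k] [u [Ou Ou' e]]] := dvr Oa a0.
  by right; split=> //; rewrite e expr0 mulr1.
left; rewrite e exprSr mulrA mulfK //.
by apply: subringM => //; apply: subringX.
Qed.

Section Module.
Variable V : lmodType K.
Implicit Types N : set V.

Definition wpow N (i : nat) : set V := [set w ^+ i *: y | y in N].

Lemma submodule_sum N I (r : seq I) (P : pred I) (f : I -> V) : submodule O N ->
  (forall i, P i -> N (f i)) -> N (\sum_(i <- r | P i) f i).
Proof. by move=> [N0 ND NZ] Nf; apply: (big_ind N). Qed.

Lemma submoduleB N x y : submodule O N -> N x -> N y -> N (x - y).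
Proof.
move=> [N0 ND NZ] Nx Ny; rewrite -scaleN1r; apply: (ND) => //; apply: (NZ) => //.
by apply: subringN => //; apply: subring1.
Qed.

Lemma submodule_subgroup N : submodule O N -> subgroup N.
Proof. by move=> hN; split; [case: hN|move=> x y; apply: submoduleB]. Qed.

Variables N N' : set V.
Hypotheses (hN : submodule O N) (hN' : submodule O N').
Hypothesis sub : N' `<=` N.
Variable n : nat.
Hypothesis sat : forall a v, a != 0 -> N v -> N' (a *: v) -> N' v.
Hypothesis rk : forall v : 'I_n.+1 -> V, (forall i, N (v i)) ->
  exists c : 'I_n.+1 -> K, (exists i, c i != 0) /\ N' (\sum_i c i *: v i).

Let NZ a v : O a -> N v -> N (a *: v). Proof. by case: hN => _ _; apply. Qed.
Let NZ' a v : O a -> N' v -> N' (a *: v). Proof. by case: hN' => _ _; apply. Qed.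
Let ND u v : N u -> N v -> N (u + v). Proof. by case: hN => _ + _; apply. Qed.
Let ND' u v : N' u -> N' v -> N' (u + v). Proof. by case: hN' => _ + _; apply. Qed.

(** Linear independence over the residue field of the classes of the [v i] in [N / (N' + w N)]; the
    condition that [c i / w] is in [O] says that [c i] is zero in the residue field. *)
Definition indep_mod m (v : 'I_m -> V) : Prop :=
  (forall i, N (v i)) /\
  forall (c : 'I_m -> K) y, (forall i, O (c i)) -> N y ->
    N' (\sum_i c i *: v i - w *: y) -> forall i, O (c i / w).

(** A relation over [K] between [n + 1] elements, divided by a coefficient of least valuation, gets
    coefficients in [O], one of them equal to 1. Saturation of [N'] in [N] keeps the relation in
    [N']. *)
Lemma indep_mod_bound : ~ exists v : 'I_n.+1 -> V, indep_mod v.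
Proof.
move=> [v [Nv Iv]]; have [c [c0 rel]] := rk Nv.
have [i0 [ci0 hc]] := dvr_min c0.
have N0 : N 0 by case: hN.
have : O (c i0 / c i0 / w).
  apply: (Iv (fun i => c i / c i0) 0) => //; rewrite scaler0 subr0.
  apply: (sat ci0).
    by apply: submodule_sum => // i _; apply: NZ.
  rewrite scaler_sumr; congr (N' _): rel; apply: eq_bigr => i _.
  by rewrite scalerA mulrC divfK.
by rewrite divff // div1r.
Qed.

Lemma exists_span_mod : exists m (v : 'I_m -> V), [/\ (m <= n)%N,
  forall i, N (v i) & forall x, N x -> exists (a : 'I_m -> K) y,
    [/\ forall i, O (a i), N y & N' (x - \sum_i a i *: v i - w *: y)]].
Proof.
pose P m := exists v : 'I_m -> V, indep_mod v.
have P0 : P 0%N by exists (fun=> 0); split; [case|move=> c y _ _ _ []].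
have [m [mn [v [Nv Iv]] nP]] : exists m, [/\ (m <= n)%N, P m & ~ P m.+1].
  apply: contrapT => no; apply: indep_mod_bound; rewrite -/(P n.+1).
  have : forall k, (k <= n.+1)%N -> P k; last by apply.
  elim=> // k IH kn; apply: contrapT => nP; apply: no; exists k.
  by split=> //; apply: IH; apply: ltnW.
exists m, v; split=> // x Nx; apply: contrapT => no; apply: nP.
pose v' (i : 'I_m.+1) := if unlift ord_max i is Some j then v j else x.
have sumE (c : 'I_m.+1 -> K) : \sum_i c i *: v' i
    = \sum_i c (lift ord_max i) *: v i + c ord_max *: x.
  rewrite (bigD1_ord ord_max) //= addrC; congr (_ + _).
    by apply: eq_bigr => i _; rewrite /v' liftK.
  by rewrite /v' unlift_none.
exists v'; split; first by move=> i; rewrite /v'; case: unlift.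
move=> c y Oc Ny; rewrite sumE => rel.
have [Ocw|[cm0 Ocm]] := unit_or_w (Oc ord_max); last first.
  case: no; exists (fun i => - ((c ord_max)^-1 * c (lift ord_max i))),
    ((c ord_max)^-1 *: y); split.
  - by move=> i; apply: subringN => //; apply: subringM.
  - exact: NZ.
  - have := NZ' Ocm rel; rewrite scalerBr scalerDr scalerA mulVf // scale1r.
    rewrite [in X in _ -> X](_ : x - _ = (c ord_max)^-1 *: (\sum_i c (lift ord_max i) *: v i) + x); last first.
      rewrite scaler_sumr addrC -sumrN; congr (_ + _); apply: eq_bigr => i _.
      by rewrite scaleNr opprK scalerA.
    by rewrite !scalerA [w * _]mulrC.
have h i : O (c (lift ord_max i) / w).
  apply: (Iv (fun i => c (lift ord_max i)) (y - (c ord_max / w) *: x)) => //.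
    by apply: submoduleB => //; apply: NZ.
  rewrite scalerBr scalerA mulrCA divff // mulr1 opprB addrA.
  by congr (N' _): rel.
by move=> i; have [j ->|->] := unliftP ord_max i.
Qed.

(** The expected count for a torsion-free quotient [N/N'] of rank at most [n]. It is obtained
    without generators of [N]: a spanning family of [N / (N' + w N)] gives one digit, chosen among
    the representatives [rho], and the remainder is treated by induction. *)
Lemma cover_wpow i : index_cover N [set x | exists y z, [/\ N' y, N z & x = y + w ^+ i *: z]]
  (#|Q| ^ (n * i)).
Proof.
have N0 : N 0 by case: hN.
have N'0 : N' 0 by case: hN'.
have Q0 : (0 < #|Q|)%N.
  have [t _] := rho_surj (subring0 hO); by apply/card_gt0P; exists t.
have [m [v [mn Nv hv]]] := exists_span_mod.
elim: i => [|i [T [s [hs sT]]]].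
  exists unit, (fun=> 0); split; last by rewrite card_unit muln0.
  by move=> x Nx; exists tt; exists 0, x; rewrite expr0 scale1r subr0 add0r.
exists ({ffun 'I_m -> Q} * T)%type,
  (fun t : {ffun 'I_m -> Q} * T => \sum_j rho (t.1 j) *: v j + w *: s t.2); split; last first.
  rewrite card_prod card_ffun card_ord mulnS expnD leq_mul //.
  by rewrite leq_pexp2l.
move=> x Nx; have [a [y [Oa Ny rel]]] := hv x Nx.
have [t ht] := choice (fun j => rho_surj (Oa j)).
pose y' := y + \sum_j ((a j - rho (t j)) / w) *: v j.
have Ny' : N y'.
  by apply: (ND) => //; apply: submodule_sum => // j _; apply: NZ.
have [u [y1 [z1 [N'y1 Nz1 e1]]]] := hs y' Ny'.
exists ([ffun j => t j], u).
exists (x - \sum_i a i *: v i - w *: y + w *: y1), z1; split=> //.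
  by apply: (ND') => //; apply: NZ'.
rewrite /= exprS -scalerA -addrA -scalerDr -e1 scalerBr scalerDr scaler_sumr.
have -> : \sum_j w *: (((a j - rho (t j)) / w) *: v j)
    = \sum_j a j *: v j - \sum_j rho (t j) *: v j.
  rewrite -sumrB; apply: eq_bigr => j _.
  by rewrite scalerA mulrC divfK // scalerBl.
rewrite (eq_bigr (fun j => rho (t j) *: v j)); last by move=> j _; rewrite ffunE.
rewrite opprD !addrA; congr (_ - _).
by rewrite !subrK.
Qed.

End Module.

Section Filtration.
Variable V : lmodType K.
Variables (G : set V) (e : nat) (M : nat -> set V) (rk : nat -> nat) (r : nat).
Hypothesis hG : submodule O G.
Hypothesis idxG : has_index G (wpow G e) (#|Q| ^ (r * e)).
Hypothesis hM : forall k, (k <= e)%N -> submodule O (M k).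
Hypothesis MS : forall k, (k < e)%N -> M k.+1 `<=` M k.
Hypothesis MG : forall k, (k <= e)%N -> M k `<=` wpow G k.
Hypothesis sat : forall k a v, (k < e)%N -> a != 0 -> M k v -> M k.+1 (a *: v) ->
  M k.+1 v.
Hypothesis rk0 : rk 0%N = r.
Hypothesis rkS : forall k, (k < e)%N -> (rk k.+1 <= rk k)%N.
Hypothesis rkP : forall k (v : 'I_(rk k - rk k.+1).+1 -> V), (k < e)%N ->
  (forall i, M k (v i)) -> exists c, (exists i, c i != 0)
    /\ M k.+1 (\sum_i c i *: v i).

Let wG_sub : submodule O (wpow G e).
Proof.
case: hG => G0 GD GZ; split.
- by exists 0; rewrite ?scaler0.
- by move=> _ _ [x Gx <-] [y Gy <-]; exists (x + y); rewrite ?scalerDr //; apply: (GD).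
- move=> a _ Oa [x Gx <-]; exists (a *: x); first exact: (GZ).
  by rewrite !scalerA mulrC.
Qed.

(** With [q] the number of residues, [M k] modulo [M (k+1) + w^(e-k) M k] has at most [q] to the
    power [(e - k) * (rk k - rk (k+1))] classes, and [w^(e-k) M k] lies in [w^e G]. The sum is
    indexed by [i = e - k - 1]. *)
Lemma cover_filtration k : (k <= e)%N ->
  index_cover (M (e - k)%N) (wpow G e)
    (#|Q| ^ (\sum_(i < k) (i.+1 * (rk (e - i.+1) - rk (e - i)))))%N.
Proof.
elim: k => [_|k IH ke].
  exists unit, (fun=> 0); split; last by rewrite card_unit big_ord0.
  by rewrite subn0 => x Mx; exists tt; rewrite subr0; apply: (MG (leqnn e)).
have lt : (e - k.+1 < e)%N by lia.
have eS : (e - k.+1).+1 = (e - k)%N by lia.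
rewrite big_ord_recr /= addnC expnD.
apply: (@cover_mul _ _ (M (e - k)%N)); first by case: wG_sub.
- have rkP' (v : 'I_(rk (e - k.+1) - rk (e - k)).+1 -> V) :
    (forall i, M (e - k.+1)%N (v i)) -> exists c, (exists i, c i != 0)
    /\ M (e - k)%N (\sum_i c i *: v i).
    by move=> h; have := @rkP (e - k.+1)%N; rewrite eS => h2; exact: h2 v (leq_subr _ _) h.
  have [T [s [hs sT]]] := @cover_wpow V (M (e - k.+1)%N) (M (e - k)%N)
    (hM (ltnW lt)) (hM (leq_subr _ _)) (rk (e - k.+1) - rk (e - k))%N
    (fun a v a0 Mv => ltac:(rewrite -eS; exact: sat)) rkP' k.+1.
  exists T, s; split; first by rewrite mulnC.
  move=> x Mx; have [t [y [z [My Mz ez]]]] := hs x Mx.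
  exists t, y, (w ^+ k.+1 *: z); split=> //.
  have [z' Gz' <-] := MG (ltnW lt) Mz.
  exists z' => //; rewrite scalerA -exprD; congr (_ ^+ _ *: _); lia.
- exact: IH (ltnW ke).
Qed.

(** Summation by parts. For [k = e] it says that the exponent in the previous lemma is [e * rk 0]
    minus the sum of [rk 1], ..., [rk e]. *)
Lemma rank_sum k : (k <= e)%N ->
  (\sum_(i < k) (i.+1 * (rk (e - i.+1) - rk (e - i)))
   + \sum_(i < k) rk (e - i))%N = (k * rk (e - k))%N.
Proof.
elim: k => [_|k IH ke]; first by rewrite !big_ord0.
rewrite !big_ord_recr /= addnACA IH; last exact: ltnW.
have eS : (e - k.+1).+1 = (e - k)%N by lia.
have := @rkS (e - k.+1)%N; rewrite eS => h; have {h} le := h ltac:(lia).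
rewrite mulnBr -[X in (_ + (_ + X))%N]mul1n.
have := leq_mul (leqnn k.+1) le; rewrite !mulSn; lia.
Qed.

(** The index of [w^e G] in [G] is [q^(r e)]. The classes met by [M 0] are at most [q] to the
    exponent of the filtration, so the rest of the index is at least the quotient, in which only the
    sum of the ranks remains. *)
Lemma filtration_index : exists2 a, has_index G
    [set x | exists y z, [/\ M 0%N y, G z & x = y + w ^+ e *: z]] a
  & (#|Q| ^ (\sum_(1 <= k < e.+1) rk k) <= a)%N.
Proof.
have Q0 : (0 < #|Q|)%N.
  have [t _] := rho_surj (subring0 hO); by apply/card_gt0P; exists t.
set N := [set x | _].
have hM0 := hM (leq0n e).
have MG0 : M 0%N `<=` G by move=> x /(MG (leq0n e))[y Gy <-]; rewrite expr0 scale1r.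
have [G0 GD GZ] := hG; have [M0 MD MZ] := hM0.
have Owe : O (w ^+ e) by apply: subringX.
have NG : N `<=` G.
  by move=> _ [y [z [My Gz ->]]]; apply: (GD); [exact: MG0|exact: (GZ)].
have wGN : wpow G e `<=` N by move=> _ [z Gz <-]; exists 0, z; rewrite add0r.
have hN : subgroup N.
  split; first by exists 0, 0; rewrite scaler0 addr0.
  move=> _ _ [y [z [My Gz ->]]] [y' [z' [My' Gz' ->]]].
  exists (y - y'), (z - z'); rewrite scalerBr opprD addrACA.
  by split=> //; apply: submoduleB.
have sG := submodule_subgroup hG; have swG := submodule_subgroup wG_sub.
have [a [b [ia ib eab]]] := has_index_split sG hN swG NG wGN idxG.
exists a => //.
have cov := cover_filtration (leqnn e); rewrite subnn in cov.
set S := (\sum_(i < e) _)%N in cov.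
have bS : (b <= #|Q| ^ S)%N.
  have [T [s [Ns inj _ <-]]] := ib.
  apply: (@index_sep_ge _ N (wpow G e) _ T s) => //.
  apply: index_cover_sep => //; first by case: hN.
  have [T' [s' [hs' sT']]] := cov; exists T', s'; split=> // x [y [z [My Gz ->]]].
  have [t ht] := hs' y My; exists t; rewrite addrAC.
  by case: wG_sub => _ wGD _; apply: (wGD) => //; exists z.
have rs := rank_sum (leqnn e); rewrite subnn rk0 -/S in rs.
have -> : (\sum_(1 <= k < e.+1) rk k = \sum_(i < e) rk (e - i))%N.
  rewrite big_add1 /= big_mkord (reindex_inj rev_ord_inj) /=.
  by apply: eq_bigr => i _; congr rk; have := ltn_ord i; lia.
have QS : (0 < #|Q| ^ S)%N by rewrite expn_gt0 Q0.
rewrite -(leq_pmul2r QS) -expnD addnC rs mulnC eab leq_mul2l bS orbT //.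
Qed.

End Filtration.

End DVRModule.

(** * Index of a lattice under a linear map *)

Section PairIndex.
Variables (d r : nat).

Lemma pair_index_subproof (i : 'I_d) (a : 'I_r) : (i * r + a < d * r)%N.
Proof.
apply: (@leq_trans (i.+1 * r)); first by rewrite mulSn addnC ltn_add2r ltn_ord.
by rewrite leq_mul2r ltn_ord orbT.
Qed.

Definition pair_index i a : 'I_(d * r) := Ordinal (pair_index_subproof i a).

Lemma pair_index_surj (k : 'I_(d * r)) : exists i a, k = pair_index i a.
Proof.
have r0 : (0 < r)%N by case: r k => //; rewrite muln0 => -[].
have lt1 : (k %/ r < d)%N by rewrite ltn_divLR.
exists (Ordinal lt1), (Ordinal (ltn_pmod k r0)); apply: val_inj => /=.
by rewrite -divn_eq.
Qed.

Lemma pair_index_inj i a j b : pair_index i a = pair_index j b -> i = j /\ a = b.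
Proof.
move=> /(congr1 val) /= e.
have r0 : (0 < r)%N by apply: leq_ltn_trans (ltn_ord a).
have := congr1 (fun n => n %/ r)%N e; have := congr1 (fun n => n %% r)%N e.
rewrite !modnMDl !divnMDl // !modn_small ?ltn_ord // !divn_small ?ltn_ord // !addn0.
by move=> e1 e2; split; apply: val_inj.
Qed.

Lemma pair_index_sum (U : nmodType) (F : 'I_(d * r) -> U) :
  \sum_k F k = \sum_i \sum_a F (pair_index i a).
Proof.
rewrite pair_big /= (reindex (fun ia : 'I_d * 'I_r => pair_index ia.1 ia.2)) //=.
have hs k : exists ia : 'I_d * 'I_r, k = pair_index ia.1 ia.2.
  by have [i [a ->]] := pair_index_surj k; exists (i, a).
have [g hg] := choice hs.
exists g => [[i a] _|k _]; last by rewrite -hg.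
by move: (pair_index_inj (hg (pair_index i a))) => /=; case: (g _) => i' a' /= [-> ->].
Qed.

End PairIndex.

Lemma det_block_diag (R : comNzRingType) r d (f : 'I_d -> 'M[R]_r) (A : 'M[R]_(d * r)) :
  (forall i a j b, A (pair_index i a) (pair_index j b) = (i == j)%:R * f i a b) ->
  \det A = \prod_i \det (f i).
Proof.
elim: d f A => [|d IH] f A hA; first by rewrite big_ord0 det_mx00.
have lE (a : 'I_r) : lshift (d * r) a = pair_index (ord0 : 'I_d.+1) a :> 'I_(r + d * r).
  exact: val_inj.
have rE i (a : 'I_r) : rshift r (pair_index i a) = pair_index (lift ord0 i) a :> 'I_(r + d * r).
  by apply: val_inj; rewrite /= /bump leq0n add1n mulSn addnA.
pose A' : 'M[R]_(r + d * r) := A.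
rewrite -[\det A]/(\det A') -(submxK A') big_ord_recl.
have -> : ursubmx A' = 0.
  apply/matrixP => a l; have [i [b ->]] := pair_index_surj l.
  by rewrite !mxE lE rE hA mul0r.
rewrite det_lblock; congr (_ * _).
  by congr (\det _); apply/matrixP => a b; rewrite !mxE !lE hA mul1r.
apply: IH => i a j b; rewrite !mxE !rE hA; congr (_%:R * _).
Qed.

Section LatticeIndex.
Variables (K : fieldExtType rat) (R : realType).
Local Notation O := (ring_of_integers K).
Local Notation d := (\dim {:K}).
Local Notation C := R[i].
Variables (th : K) (Oth : O th).
Hypothesis hth : forall y : K, exists g : {poly rat}, y = horner_alg th g.
Variable emb : 'I_d -> embedding K R.
Hypothesis emb_inj : injective (fun k => emb k th).
Variables (r : nat) (T : 'M[K]_r).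

(** The rational matrix of [v |-> v *m T] on [K^r] in the basis of the [th^i e_a]; the indicators
    decode [k] and [l] into pairs of indices. *)
Definition scal_mx : 'M[rat]_(d * r) :=
  \matrix_(k, l) \sum_i \sum_a \sum_j \sum_b
    ((k == pair_index i a) && (l == pair_index j b))%:R * crd th j (th ^+ i * T a b).

Lemma pair_index_eq (i i' : 'I_d) (a a' : 'I_r) :
  (pair_index i a == pair_index i' a') = (i == i') && (a == a').
Proof.
apply/eqP/andP => [/pair_index_inj[-> ->]|[/eqP-> /eqP->]] //.
Qed.

Lemma scal_mxE i a j b :
  scal_mx (pair_index i a) (pair_index j b) = crd th j (th ^+ i * T a b).
Proof.
rewrite mxE (bigD1 i) //= (bigD1 a) //= (bigD1 j) //= (bigD1 b) //= !eqxx mul1r.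
rewrite !big1 ?addr0 //.
- move=> i' ii; do 3!(apply: big1 => ? _); rewrite !pair_index_eq eq_sym (negbTE ii) mul0r //.
- move=> a' aa; do 2!(apply: big1 => ? _); rewrite !pair_index_eq (eq_sym a) (negbTE aa) andbF mul0r //.
- move=> j' jj; apply: big1 => ? _; rewrite !pair_index_eq (eq_sym j) (negbTE jj) andbF mul0r //.
- by move=> b' bb; rewrite !pair_index_eq (eq_sym b) (negbTE bb) !andbF mul0r.
Qed.

Definition big_vand : 'M[C]_(d * r) :=
  \matrix_(k, l) \sum_j \sum_b \sum_i
    ((k == pair_index j b) && (l == pair_index i b))%:R * emb i th ^+ j.

Lemma big_vandE j b i a :
  big_vand (pair_index j b) (pair_index i a) = (b == a)%:R * emb i th ^+ j.
Proof.
rewrite mxE (bigD1 j) //= (bigD1 b) //= (bigD1 i) //= !eqxx !pair_index_eq eqxx.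
rewrite [a == b]eq_sym /= !big1 ?addr0 //.
- move=> j' jj; do 2!(apply: big1 => ? _); rewrite !pair_index_eq eq_sym (negbTE jj) mul0r //.
- move=> b' bb; apply: big1 => ? _; rewrite !pair_index_eq (eq_sym b) (negbTE bb) andbF mul0r //.
- by move=> i' ii; rewrite !pair_index_eq (eq_sym i) (negbTE ii) mul0r.
Qed.

Definition emb_mx : 'M[C]_(d * r) :=
  \matrix_(k, l) \sum_i \sum_a \sum_b
    ((k == pair_index i a) && (l == pair_index i b))%:R * emb i (T a b).

Lemma emb_mxE i a j b :
  emb_mx (pair_index i a) (pair_index j b) = (i == j)%:R * map_mx (emb i) T a b.
Proof.
rewrite !mxE (bigD1 i) //= (bigD1 a) //= (bigD1 b) //= !eqxx !pair_index_eq eqxx.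
rewrite [j == i]eq_sym andbT /= !big1 ?addr0 //.
- move=> i' ii; do 2!(apply: big1 => ? _); rewrite !pair_index_eq eq_sym (negbTE ii) mul0r //.
- move=> a' aa; apply: big1 => ? _; rewrite !pair_index_eq (eq_sym a) (negbTE aa) andbF mul0r //.
- by move=> b' bb; rewrite !pair_index_eq (eq_sym b) (negbTE bb) !andbF mul0r.
Qed.

Lemma big_vand_unit : big_vand \in unitmx.
Proof.
rewrite unitmxE unitfE; apply/negP => /det0P[v v0 vV].
case/negP: v0; apply/eqP/rowP => k; rewrite mxE.
have [j [b ->]] := pair_index_surj k.
pose q : {poly C} := \poly_(i < d) (if insub i is Some i' then v 0 (pair_index i' b) else 0).
have -> : v 0 (pair_index j b) = q`_j by rewrite coef_poly ltn_ord valK.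
suff -> : q = 0 by rewrite coef0.
apply: (@roots_geq_poly_eq0 _ _ [seq emb i th | i <- enum 'I_d]).
- apply/allP => _ /mapP[i _ ->]; apply/rootP.
  rewrite (@horner_coef_wide _ d) ?size_poly //.
  have := congr1 (fun u : 'rV_(d * r) => u 0 (pair_index i b)) vV.
  rewrite !mxE pair_index_sum => h; rewrite -[RHS]h; apply: eq_bigr => l _.
  rewrite (bigD1 b) //= big_vandE eqxx mul1r big1 ?addr0; last first.
    by move=> b' /negbTE bb; rewrite big_vandE bb mul0r mulr0.
  by rewrite coef_poly ltn_ord valK.
- by rewrite map_inj_uniq ?enum_uniq.
- by rewrite size_map size_enum_ord size_poly.
Qed.

(** The determinant is the norm of [det T]: a Vandermonde change of basis turns the matrix into the
    block diagonal matrix of the conjugates of [T]. *)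
Lemma det_scal_mx : ratr (\det scal_mx) = \prod_k emb k (\det T).
Proof.
have eq : map_mx ratr scal_mx *m big_vand = big_vand *m emb_mx.
  apply/matrixP => k l; have [i [a ->]] := pair_index_surj k.
  have [j [b ->]] := pair_index_surj l; rewrite !mxE !pair_index_sum.
  transitivity (emb j (th ^+ i * T a b)).
    rewrite (embedding_crd hth); apply: eq_bigr => l' _.
    rewrite (bigD1 b) //= big_vandE eqxx mul1r mxE scal_mxE big1 ?addr0 // => b' /negbTE bb.
    by rewrite big_vandE bb mul0r mulr0.
  rewrite (bigD1 j) //= (bigD1 a) //= big_vandE emb_mxE !eqxx !mul1r mxE.
  rewrite rmorphM rmorphXn /= !big1 ?addr0 //.
    move=> i' /negbTE ii; apply: big1 => a' _; by rewrite emb_mxE ii mul0r mulr0.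
  by move=> a' aa; rewrite big_vandE eq_sym (negbTE aa) !mul0r.
have := congr1 (fun M => \det M) eq; rewrite !det_mulmx det_map_mx [RHS]mulrC.
have V0 : \det big_vand != 0 by rewrite -unitfE -unitmxE big_vand_unit.
move/(mulIf V0) => /= ->; rewrite (det_block_diag emb_mxE).
by apply: eq_bigr => k _; rewrite det_map_mx.
Qed.

End LatticeIndex.

Lemma foldr_muln (s : seq nat) : foldr muln 1%N s = (\prod_(x <- s) x)%N.
Proof. by elim: s => [|x s IH]; rewrite ?big_nil // big_cons -IH. Qed.

(** The Smith normal form reduces to a diagonal matrix, for which the residues of the coordinates
    modulo the diagonal entries separate the classes. *)
Lemma int_lattice_sep m (Z : 'M[int]_m) : \det Z != 0 ->
  index_sep [set: 'rV[int]_m] [set x | exists y, x = y *m Z] `|\det Z|%N.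
Proof.
move=> dZ; have [L uL [R' uR [s _ eZ]]] := int_Smith_normal_form Z.
set D := \matrix_(i, j) _ in eZ.
have detD : \det D = \prod_(i < m) s`_i.
  have -> : D = diag_mx (\row_i s`_i).
    apply/matrixP => i j; rewrite !mxE; congr (_ *+ _); by rewrite -val_eqE.
  by rewrite det_diag; apply: eq_bigr => i _; rewrite mxE.
have absu (B : 'M[int]_m) : B \in unitmx -> `|\det B|%N = 1%N.
  by rewrite unitmxE unfold_in => /orP[] /eqP ->.
have absZ : `|\det Z|%N = (\prod_(i < m) `|(s`_i)%R|)%N.
  rewrite eZ !det_mulmx !abszM (absu _ uL) (absu _ uR) mul1n muln1 detD.
  by rewrite (big_morph absz abszM (erefl _)).
have s0 (i : 'I_m) : (0 < `|(s`_i)%R|)%N.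
  have : (0 < \prod_(i < m) `|(s`_i)%R|)%N by rewrite -absZ absz_gt0.
  by rewrite (bigD1 i) //= muln_gt0 => /andP[].
pose n (i : 'I_m) := (`|(s`_i)%R|.-1.+1)%N.
have nE i : n i = `|(s`_i)%R|%N by rewrite /n prednK.
pose u (x : 'rV[int]_m) i := (x *m invmx R') 0 i.
exists {dffun forall i : 'I_m, 'I_(n i)},
  (fun x => [ffun i : 'I_m => inord `|(u x i %% (s`_i)%R)%Z|%N : 'I_(n i)]).
split; last first.
  rewrite card_dep_ffun foldr_muln big_map big_enum /= absZ.
  by apply: eq_leq; apply: eq_bigr => i _; rewrite card_ord nE.
move=> x y _ _ /ffunP e.
have hw i : exists w : int, ((x - y) *m invmx R') 0 i = w * s`_i.
  have := e i; rewrite !ffunE => /(congr1 val).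
  have si0 : s`_i != 0 by rewrite -absz_gt0.
  have lt a : (`|(a %% (s`_i)%R)%Z| < `|(s`_i)%R|.-1.+1)%N.
    rewrite prednK // -ltz_nat gez0_abs ?modz_ge0 //.
    by have := ltz_mod a si0; rewrite abszE.
  rewrite /= !inordK // => /(congr1 Posz); rewrite !gez0_abs ?modz_ge0 // => em.
  have : ((s`_i)%R %| u x i - u y i)%Z.
    by rewrite -eqz_mod_dvd; apply/eqP.
  by move/dvdzP => [w ew]; exists w; rewrite -ew mulmxBl /u [LHS]mxE [X in _ + X]mxE.
have [w hw'] := choice hw.
exists ((\row_i w i) *m invmx L).
rewrite eZ !mulmxA mulmxKV //.
have -> : (\row_i w i) *m D = (x - y) *m invmx R'.
  apply/rowP => i; rewrite hw' mxE (bigD1 i) //= big1 ?addr0.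
    by rewrite !mxE eqxx mulr1n.
  by move=> j ji; rewrite !mxE val_eqE (negbTE ji) mulr0n mulr0.
by rewrite mulmxKV.
Qed.

Section GlobalIndex.
Variables (K : fieldExtType rat) (R : realType).
Local Notation O := (ring_of_integers K).
Local Notation d := (\dim {:K}).
Local Notation C := R[i].
Variables (th : K) (Oth : O th).
Hypothesis hth : forall y : K, exists g : {poly rat}, y = horner_alg th g.
Variable emb : 'I_d -> embedding K R.
Hypothesis emb_inj : injective (fun k => emb k th).
Variables (r : nat) (T : 'M[K]_r).
Hypothesis T0 : \det T != 0.

(** The lattice [Z[th]^r], a free stand-in for [O^r] on which [T] acts through the rational matrix
    [scal_mx]. *)
Definition lat : set 'rV[K]_r :=
  [set v | forall a i, exists z : int, crd th i (v 0 a) = z%:~R].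

Lemma lat_subgroup : subgroup lat.
Proof.
split=> [a i|x y hx hy a i]; first by exists 0; rewrite mxE /crd raddf0.
have [z ez] := hx a i; have [z' ez'] := hy a i.
by exists (z - z'); rewrite !mxE crdB ez ez' rmorphB.
Qed.

Definition lat_coord (v : 'rV[K]_r) : 'rV[int]_(d * r) :=
  \row_k numq (\sum_i \sum_a (k == pair_index i a)%:R * crd th i (v 0 a)).

Lemma lat_coordE v i a : lat v ->
  (lat_coord v 0 (pair_index i a))%:~R = crd th i (v 0 a).
Proof.
move=> hv; rewrite mxE (bigD1 i) //= (bigD1 a) //= eqxx mul1r !big1 ?addr0.
- by have [z ->] := hv a i; rewrite numq_int.
- by move=> i' ii; apply: big1 => ? _; rewrite pair_index_eq eq_sym (negbTE ii) mul0r.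
- by move=> a' aa; rewrite pair_index_eq (eq_sym a) (negbTE aa) andbF mul0r.
Qed.

Lemma lat_sep (c : nat) (Z : 'M[int]_(d * r)) : (0 < c)%N ->
  (forall k l, c%:R * scal_mx th T k l = (Z k l)%:~R) ->
  index_sep lat [set c%:R *: (v *m T) | v in lat] `|\det Z|%N
  /\ [set c%:R *: (v *m T) | v in lat] `<=` lat.
Proof.
move=> c0 eZ.
have c0' : c%:R != 0 :> rat by rewrite pnatr_eq0 -lt0n.
have eZ' : map_mx intr Z = c%:R *: scal_mx th T :> 'M[rat]_(d * r).
  by apply/matrixP => k l; rewrite !mxE -eZ mxE.
have dZ : \det Z != 0.
  rewrite -(intr_eq0 rat) -det_map_mx eZ' detZ mulf_neq0 ?expf_neq0 //.
  rewrite -(fmorph_eq0 (ratr : {rmorphism rat -> C})) /= (det_scal_mx hth emb_inj).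
  by apply/prodf_neq0 => k _; rewrite fmorph_eq0.
have key (v : 'rV[K]_r) (q : 'rV[int]_(d * r)) :
    (forall i a, crd th i (v 0 a) = (q 0 (pair_index i a))%:~R) ->
    forall j b, crd th j ((c%:R *: (v *m T)) 0 b) = ((q *m Z) 0 (pair_index j b))%:~R.
  move=> hv j b; rewrite mxE.
  have -> : (c%:R * (v *m T) 0 b) = (c%:R : rat) *: (v *m T) 0 b.
    by rewrite scaler_nat mulr_natl.
  rewrite crdZ mxE crd_sum [in RHS]mxE rmorph_sum /= pair_index_sum exchange_big /=.
  rewrite mulr_sumr; apply: eq_bigr => a _.
  rewrite [v 0 a in LHS](crdE hth) mulr_suml crd_sum mulr_sumr.
  apply: eq_bigr => i _; rewrite -scalerAl crdZ rmorphM /= -eZ scal_mxE hv; ring.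
split; last first.
  move=> _ [v hv <-] b j.
  exists ((lat_coord v *m Z) 0 (pair_index j b)).
  by apply: key => i a; rewrite lat_coordE.
have [T' [kap [hk sT]]] := int_lattice_sep dZ.
exists T', (kap \o lat_coord); split=> // x y lx ly /= /(hk _ _ I I)[q eq].
pose u : 'rV[K]_r := \row_a \sum_i (q 0 (pair_index i a))%:~R *: th ^+ i.
have crdu i a : crd th i (u 0 a) = (q 0 (pair_index i a))%:~R.
  by rewrite mxE (crd_lin hth).
exists u; first by move=> a i; exists (q 0 (pair_index i a)).
apply/rowP => b; rewrite [LHS](crdE hth) [RHS](crdE hth).
apply: eq_bigr => j _; rewrite (key u q) // -eq.
have -> k : (lat_coord x - lat_coord y) 0 k = lat_coord x 0 k - lat_coord y 0 k.
  by rewrite !mxE.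
by rewrite rmorphB /= !lat_coordE // [in RHS]mxE [X in crd th j (_ + X)]mxE crdB.
Qed.

Lemma lat_index_ge (c : nat) m : (0 < c)%N ->
  has_index lat [set c%:R *: v | v in lat] m -> (c ^ (d * r) <= m)%N.
Proof.
move=> c0 im.
have hcl : subgroup [set c%:R *: v | v in lat].
  split; first by exists 0; rewrite ?scaler0 //; case: lat_subgroup.
  move=> _ _ [x lx <-] [y ly <-]; exists (x - y); rewrite ?scalerBr //.
  by case: lat_subgroup => _; apply.
pose s (t : {ffun 'I_d * 'I_r -> 'I_c}) : 'rV[K]_r :=
  \row_a \sum_i (t (i, a) : nat)%:R *: th ^+ i.
have crds t i a : crd th i (s t 0 a) = (t (i, a) : nat)%:R.
  by rewrite mxE (crd_lin hth).
have -> : (c ^ (d * r) = #|{ffun 'I_d * 'I_r -> 'I_c}|)%N.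
  by rewrite card_ffun card_prod !card_ord.
apply: (index_sep_ge (has_index_sep hcl lat_subgroup.1 im) (s := s)).
  by move=> t a i; exists (t (i, a) : nat)%:Z; rewrite crds.
move=> t u [v lv e]; apply/ffunP => -[i a].
have [z ez] := lv a i.
have := congr1 (fun x : 'rV_r => crd th i (x 0 a)) e.
rewrite mxE (_ : c%:R * v 0 a = (c%:R : rat) *: v 0 a); last by rewrite scaler_nat mulr_natl.
rewrite crdZ ez [in RHS]mxE [X in crd th i (_ + X)]mxE crdB !crds => e1.
have {}e1 : c%:Z * z = (t (i, a))%:Z - (u (i, a))%:Z.
  by apply/eqP; rewrite -(eqr_int rat) rmorphM rmorphB /= e1.
apply: val_inj => /=; have := ltn_ord (t (i, a)); have := ltn_ord (u (i, a)).
move: e1; set x' := nat_of_ord (t _); set y' := nat_of_ord (u _).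
move: x' y' => x' y' e1 yc xc.
have [z0|[z1|z1]] : z = 0 \/ 1 <= z \/ z <= -1 by lia.
- by move: e1; rewrite z0 mulr0; lia.
- by nia.
- by nia.
Qed.

Variable c1 : nat.
Hypothesis c10 : (0 < c1)%N.
Hypothesis hc1 : forall y, O y -> forall i, exists z : int,
  c1%:R * crd th i y = z%:~R.

Definition Orow : set 'rV[K]_r := [set v | forall a, O (v 0 a)].

Lemma Orow_subgroup : subgroup Orow.
Proof.
have hO := OK_subring K.
split=> [a|x y hx hy a]; first by rewrite mxE; apply: subring0.
by rewrite !mxE; apply: subringB.
Qed.

Lemma lat_Orow : lat `<=` Orow.
Proof.
have hO := OK_subring K.
move=> v lv a; rewrite (crdE hth (v 0 a)); apply: subring_sum => // i _.
have [z ->] := lv a i; rewrite scaler_int -mulrzl; apply: subringM => //.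
  exact: (integral_id (intr : {rmorphism int -> K})).
exact: subringX.
Qed.

Lemma Orow_lat_index : exists2 m, (0 < m)%N & has_index Orow lat m.
Proof.
have [T' [kap hk]] := OK_mod hth c10 hc1 (ltn0Sn 0).
have [im _] : has_index Orow lat (card_quotient Orow lat)
    /\ (card_quotient Orow lat <= #|{ffun 'I_r -> T'}|)%N.
  apply: index_sep_has; first exact: lat_subgroup.
  exists {ffun 'I_r -> T'}, (fun v : 'rV[K]_r => [ffun a => kap (v 0 a)]).
  split=> // x y Ox Oy /ffunP e a i.
  have := e a; rewrite !ffunE => /(hk _ _ (Ox a) (Oy a))[z ez].
  exists (z i); rewrite !mxE ez mul1r.
  rewrite (eq_bigr (fun j => ((z j)%:~R : rat) *: th ^+ j)); last first.
    by move=> j _; rewrite scaler_int mulrzl.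
  by rewrite (crd_lin hth).
exists (card_quotient Orow lat) => //.
have [T2 [s [_ _ hs <-]]] := im; have [t _] := hs 0 Orow_subgroup.1.
by apply/card_gt0P; exists t.
Qed.

(** Everything is compared with [c T Z[th]^r], where [c] clears the denominators of [T]. Its index
    in [Z[th]^r] is at most [c^(d r)] times the norm of [det T], and its index in [T Z[th]^r] is at
    least [c^(d r)]. The index of [Z[th]^r] in [O^r] occurs a second time for the images under [T].
    Both auxiliary factors cancel. *)
Lemma global_index (G M : set 'rV[K]_r) g0 : subgroup G -> subgroup M ->
  Orow `<=` G -> M `<=` G -> [set v *m T | v in Orow] `<=` M ->
  has_index G Orow g0 ->
  exists m1 m2, [/\ has_index G M m1, has_index M [set v *m T | v in Orow] m2
    & (m1 * m2)%:R <= g0%:R * \prod_k Normc.normc (emb k (\det T))].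
Proof.
move=> hG hM OG MG SM ig.
have [c c0 hc] := common_denom_rat (fun kl : 'I_(d * r) * 'I_(d * r) => scal_mx th T kl.1 kl.2).
have [Zf hZf] := choice hc.
pose Z : 'M[int]_(d * r) := \matrix_(k, l) Zf (k, l).
have eZ k l : c%:R * scal_mx th T k l = (Z k l)%:~R by rewrite [in RHS]mxE -hZf.
have [sepZ subL] := lat_sep c0 eZ.
set cS := [set c%:R *: (v *m T) | v in lat] in sepZ subL.
set S := [set v *m T | v in Orow] in SM *.
pose SL := [set v *m T | v in lat].
have lB x y : lat x -> lat y -> lat (x - y) by case: lat_subgroup => _; apply.
have l0 : lat 0 by case: lat_subgroup.
have c0K : c%:R != 0 :> K by case: c c0 {hc Zf hZf Z eZ sepZ subL cS} => // c _; apply: charK0.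
have hcS : subgroup cS.
  split; first by exists 0; rewrite // mul0mx scaler0.
  by move=> _ _ [x lx <-] [y ly <-]; exists (x - y); rewrite ?mulmxBl ?scalerBr //; apply: lB.
have hSL : subgroup SL.
  split; first by exists 0; rewrite // mul0mx.
  by move=> _ _ [x lx <-] [y ly <-]; exists (x - y); rewrite ?mulmxBl //; apply: lB.
have hS : subgroup S.
  split; first by exists 0; rewrite ?mul0mx //; case: Orow_subgroup.
  move=> _ _ [x lx <-] [y ly <-]; exists (x - y); rewrite ?mulmxBl //.
  by case: Orow_subgroup => _; apply.
have cSSL : cS `<=` SL.
  move=> _ [v lv <-]; exists (c%:R *: v); last by rewrite scalemxAl.
  move=> a i; have [z ez] := lv a i; exists (c%:Z * z).
  rewrite mxE (_ : c%:R * v 0 a = (c%:R : rat) *: v 0 a); last by rewrite scaler_nat mulr_natl.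
  by rewrite crdZ ez rmorphM.
have SLS : SL `<=` S by move=> _ [v lv <-]; exists v => //; apply: lat_Orow.
have [iz zle] := index_sep_has hcS sepZ; set z := card_quotient _ _ in iz zle.
have [m m0 im] := Orow_lat_index.
have i1 := has_index_tower Orow_subgroup lat_subgroup hcS lat_Orow subL im iz.
have i2 := has_index_tower hG Orow_subgroup hcS OG (subset_trans subL lat_Orow) ig i1.
have cSM : cS `<=` M by apply: subset_trans SM; apply: subset_trans SLS.
have [a [b [ia ib eab]]] := has_index_split hG hM hcS MG cSM i2.
have [b1 [b2 [ib1 ib2 eb]]] := has_index_split hM hS hcS SM (subset_trans cSSL SLS) ib.
have [b3 [b4 [ib3 ib4 eb2]]] := has_index_split hS hSL hcS SLS cSSL ib2.
have uT : T \in unitmx by rewrite unitmxE unitfE.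
have fB (x y : 'rV[K]_r) : (x - y) *m T = x *m T - y *m T by rewrite mulmxBl.
have finj (x : 'rV[K]_r) : x *m T = 0 -> x = 0.
  by move=> e; rewrite -(mulmxK uT x) e mul0mx.
have e3 : b3 = m.
  apply: (has_index_uniq hSL hS.1 ib3).
  exact: (@has_index_image _ _ (fun v : 'rV[K]_r => v *m T) Orow lat m
    Orow_subgroup (fun x y _ _ => fB x y) (fun x _ => finj x) lat_Orow im).
have e4 : (c ^ (d * r) <= b4)%N.
  apply: (lat_index_ge c0).
  have := @has_index_image _ _ (fun x : 'rV[K]_r => x *m invmx T) SL cS b4 hSL.
  have -> : (fun x : 'rV[K]_r => x *m invmx T) @` SL = lat.
    apply/seteqP; split=> [_ [_ [v lv <-] <-]|v lv]; first by rewrite mulmxK.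
    by exists (v *m T); rewrite ?mulmxK //; exists v.
  have -> : (fun x : 'rV[K]_r => x *m invmx T) @` cS = [set c%:R *: v | v in lat].
    apply/seteqP; split=> [_ [_ [v lv <-] <-]|_ [v lv <-]].
      by exists v => //; rewrite scalemxAl mulmxK.
    by exists (c%:R *: (v *m T)); [exists v|rewrite scalemxAl mulmxK].
  apply=> // [x y _ _|x _ e]; first by rewrite mulmxBl.
  by rewrite -(mulmxKV uT x) e mul0mx.
exists a, b1; split=> //.
have nZ : (`|\det Z|%N)%:R = c%:R ^+ (d * r) * \prod_k Normc.normc (emb k (\det T)) :> R.
  have nI (y : int) : Normc.normc (y%:~R : C) = (`|y|%N)%:R.
    case: y => y; first by rewrite -[_%:~R]/(1 *+ y) normcMn Normc.normc1.
    by rewrite NegzE mulrNz normcN abszN -[_%:~R]/(1 *+ y.+1) normcMn Normc.normc1.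
  have eZ' : map_mx intr Z = c%:R *: scal_mx th T :> 'M[rat]_(d * r).
    by apply/matrixP => k l; rewrite mxE -eZ [RHS]mxE.
  have eq : (\det Z)%:~R = c%:R ^+ (d * r) * \prod_k emb k (\det T) :> C.
    rewrite -(det_scal_mx hth emb_inj) -(rmorph_nat (ratr : {rmorphism rat -> C})).
    by rewrite -rmorphXn -rmorphM /= -detZ -eZ' det_map_mx ratr_int.
  rewrite -nI eq Normc.normcM; congr (_ * _).
    by rewrite -natrX -[_%:R]/((Posz (c ^ (d * r)))%:~R) nI natrX.
  exact: (big_morph _ (@Normc.normcM R) (Normc.normc1 R)).
have le : (a * b1 * c ^ (d * r) <= g0 * `|\det Z|%N)%N.
  have : (m * (a * b1 * c ^ (d * r)) <= m * (g0 * `|\det Z|%N))%N; last by rewrite leq_pmul2l.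
  apply: (@leq_trans (m * (g0 * z))%N); last by rewrite !leq_mul2l zle !orbT.
  have -> : (m * (g0 * z) = a * b1 * (m * b4))%N.
    by rewrite mulnCA eab eb eb2 e3; ring.
  by rewrite mulnCA leq_mul2l leq_mul2l e4 !orbT.
have ck : 0 < c%:R ^+ (d * r) :> R by rewrite exprn_gt0 // ltr0n.
rewrite -(ler_pM2r ck) -natrX -natrM.
have : ((a * b1 * c ^ (d * r))%:R : R) <= (g0 * `|\det Z|%N)%:R by rewrite ler_nat.
by rewrite natrM (natrM _ g0) nZ natrX -mulrA [X in _ <= _ * X]mulrC mulrA.
Qed.

End GlobalIndex.

(** * Chinese remainders and powers of ideals *)

Lemma has_index_ord (V : zmodType) (M N : set V) n : has_index M N n ->
  exists s : 'I_n -> V, [/\ forall t, M (s t), forall t u, N (s t - s u) -> t = u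
    & forall x, M x -> exists t, N (x - s t)].
Proof.
move=> [T [s [Ms inj hs <-]]]; exists (s \o enum_val); split.
- by move=> t; apply: Ms.
- by move=> t u /inj/enum_val_inj.
- by move=> x /hs[t Nt]; exists (enum_rank t); rewrite /= enum_rankK.
Qed.

Lemma has_index_gt0 (V : zmodType) (M N : set V) n : M 0 -> has_index M N n ->
  (0 < n)%N.
Proof.
by move=> M0 [T [s [_ _ hs <-]]]; have [t _] := hs 0 M0; apply/card_gt0P; exists t.
Qed.

Section Residue.
Variables (K : fieldExtType rat) (R : realType).
Local Notation O := (ring_of_integers K).
Let hO : subring O := OK_subring K.

Lemma OK_sep_nat n : (0 < n)%N -> exists (T : finType) (kap : K -> T),
  forall x y, O x -> O y -> kap x = kap y -> exists2 o, O o & x - y = n%:R * o.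
Proof.
move=> n0; have [th Oth hth] := primitive_element K.
have [emb [_ _ emb_inj]] := embeddings hth R.
have [c c0 hc] := OK_lattice Oth hth emb_inj.
have [T [kap hk]] := OK_mod hth c0 hc n0; exists T, kap => x y Ox Oy e.
have [z ->] := hk x y Ox Oy e; eexists; last by [].
apply: subring_sum => // i _; apply: subringM => //; last exact: subringX.
exact: (integral_id (intr : {rmorphism int -> K})).
Qed.

Variable p : set K.
Hypothesis hp : maximal_ideal O p.
Local Notation Op := (localize O p).
Let hOp : subring Op := loc_subring hp.

Lemma dvr_at : exists w, [/\ p w, w != 0, ~ Op w^-1,
  forall a, Op a -> a != 0 -> exists k u, [/\ Op u, Op u^-1 & a = u * w ^+ k]
  & forall x, p x -> Op (x / w)].
Proof.
have [th Oth hth] := primitive_element K.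
have [emb [_ _ emb_inj]] := embeddings hth R.
have [c c0 hc] := OK_lattice Oth hth emb_inj.
have [w [pw w0 hw]] := exists_uniformizer Oth hth c0 hc hp.
have [wV dvr] := dvr_decomposition Oth hth c0 hc hp pw w0 hw.
by exists w.
Qed.

Lemma loc_frac a : exists b c, [/\ Op b, Op c, c != 0 & a = b / c].
Proof.
have [b [c [Ob Oc c0 e]]] := OK_frac a.
by exists b, c; split=> //; apply: loc_sub.
Qed.

Lemma maxi_subgroup : subgroup p.
Proof. by split; [exact: maxi0|move=> x y; exact: maxiB]. Qed.

Lemma residue_index : has_index O p (card_quotient O p).
Proof.
have [n n0 pn] := maxi_nat hp; have [T [kap hk]] := OK_sep_nat n0.
apply: (@index_sep_has _ O p #|T| maxi_subgroup _).1.
exists T, kap; split=> // x y Ox Oy /(hk _ _ Ox Oy)[o Oo ->].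
by rewrite mulrC; apply: maxiZ.
Qed.

Lemma residue_gt1 : (1 < card_quotient O p)%N.
Proof.
have := has_index_ord residue_index; move: (card_quotient O p) => [|[|//]] [s [Os inj hs]].
  by have [[]] := hs 0 (subring0 hO).
have [t0 h0] := hs 0 (subring0 hO); have [t1 h1] := hs 1 (subring1 hO).
case: (maxi1 hp); have -> : 1 = (1 - s t1) - (0 - s t0).
  by rewrite (ord1 t0) (ord1 t1) opprB subr0 subrK.
exact: maxiB.
Qed.

Variable w : K.
Hypotheses (pw : p w) (w0 : w != 0) (wV : ~ Op w^-1).
Hypothesis dvr : forall a, Op a -> a != 0 ->
  exists k u, [/\ Op u, Op u^-1 & a = u * w ^+ k].
Hypothesis hw : forall x, p x -> Op (x / w).

Lemma maxi_of_loc x : O x -> Op (x / w) -> p x.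
Proof.
move=> Ox /localizeP[a [b [Oa Ob pb e]]].
have b0 := notp_neq0 hp pb.
have : p (b * x).
  have -> : b * x = a * w; last exact: maxiZ.
  by rewrite -[x](divfK w0) e mulrA [b * _]mulrC divfK.
by case/(maxi_prime hp Ob Ox).
Qed.

(** With [v v' = 1 - x] and [x] in [p], a geometric sum inverts [1 - x] modulo [x^e], so [v'] times
    this sum approximates [1/v]. *)
Lemma loc_dense e a : Op a -> exists2 o, O o & Op ((a - o) / w ^+ e).
Proof.
move=> /localizeP[u [v [Ou Ov pv ->]]]; have v0 := notp_neq0 hp pv.
have [v' [x [Ov' px ex]]] := maxi_inv hp Ov pv.
have Ox := maxi_sub hp px.
exists (u * v' * \sum_(i < e) x ^+ i).
  apply: subringM => //; first exact: subringM.
  by apply: subring_sum => // i _; apply: subringX.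
have -> : u / v - u * v' * (\sum_(i < e) x ^+ i) = u * x ^+ e / v.
  have e1 : v * v' * (\sum_(i < e) x ^+ i) = 1 - x ^+ e.
    by rewrite ex -[in RHS](opprB (x ^+ e)) subrX1 -mulNr opprB.
  apply: (mulfI v0); rewrite mulrBr [v * (u / v)]mulrC divfK //.
  have -> : v * (u * v' * (\sum_(i < e) x ^+ i)) = u * (v * v' * (\sum_(i < e) x ^+ i)) by ring.
  by rewrite e1; field.
have -> : u * x ^+ e / v / w ^+ e = u * v^-1 * (x / w) ^+ e.
  by rewrite expr_div_n; field; rewrite v0 expf_neq0.
apply: subringM => //; last by apply: subringX => //; apply: hw.
by apply: subringM => //; [exact: loc_sub|exact: loc_inv].
Qed.

Lemma residue_reps : exists rho : 'I_(card_quotient O p) -> K,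
  [/\ forall t, O (rho t), forall t u, Op ((rho t - rho u) / w) -> t = u,
      forall a, Op a -> exists t, Op ((a - rho t) / w)
    & forall a, O a -> exists t, p (a - rho t)].
Proof.
have [rho [Orho inj hs]] := has_index_ord residue_index.
exists rho; split=> //.
  by move=> t u h; apply: inj; apply: maxi_of_loc => //; apply: subringB.
move=> a Oa; have [o Oo ho] := loc_dense 1 Oa; have [t ht] := hs o Oo; exists t.
have -> : (a - rho t) / w = (a - o) / w ^+ 1 + (o - rho t) / w.
  by rewrite expr1 -mulrDl addrA subrK.
by apply: subringD => //; apply: hw.
Qed.

End Residue.

Section CRT.
Variables (K : fieldExtType rat) (R : realType).
Local Notation O := (ring_of_integers K).
Let hO : subring O := OK_subring K.
Variables (J : finType) (p : J -> set K) (w : J -> K) (e : nat).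
Hypothesis hp : forall j, maximal_ideal O (p j).
Hypothesis pinj : injective p.
Hypothesis w0 : forall j, w j != 0.
Hypothesis hw : forall j x, p j x -> localize O (p j) (x / w j).
Local Notation Op j := (localize O (p j)).

Lemma crt_pair i j : i != j -> exists X, [/\ O X, Op i (X / w i ^+ e)
  & Op j ((X - 1) / w j ^+ e)].
Proof.
move=> ij; have hOi := loc_subring (hp i); have hOj := loc_subring (hp j).
have [x pix pjx] : exists2 x, p i x & ~ p j x.
  apply: contrapT => no; case/eqP: ij; apply: pinj; apply/esym.
  have [_ _ pmax] := hp i; have [idj p1 _] := hp j.
  apply: (pmax _ idj p1) => x px; apply: contrapT => npx; apply: no; by exists x.
have Ox := maxi_sub (hp i) pix.
have [x' [y [Ox' pjy exy]]] := maxi_inv (hp j) Ox pjx.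
pose a := x * x'.
have pia : p i a by rewrite /a mulrC; apply: (maxiZ (hp i)).
have Oa := maxi_sub (hp i) pia.
have pjb : p j (1 - a ^+ e) \/ e = 0%N.
  case: e => [|n]; [by right|left].
  have -> : 1 - a ^+ n.+1 = (\sum_(k < n.+1) a ^+ k) * y.
    have -> : y = 1 - a by rewrite /a exy opprB addrC subrK.
    by rewrite mulrC -[LHS]opprB subrX1 -mulNr opprB.
  apply: (maxiZ (hp j)) => //; apply: subring_sum => // k _; exact: subringX.
(* Here [a] is in [p i] and [1 - a] in [p j]. The witness is divisible by [a^e], and its difference
   from 1 by [(1 - a)^e]. *)
exists (1 - (1 - a ^+ e) ^+ e).
have Oae : O (a ^+ e) by apply: subringX.
have Ob : O (1 - a ^+ e) by apply: subringB => //; apply: subring1.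
split.
- by apply: subringB => //; [exact: subring1|exact: subringX].
- have -> : 1 - (1 - a ^+ e) ^+ e = a ^+ e * \sum_(k < e) (1 - a ^+ e) ^+ k.
    by rewrite -[LHS]opprB subrX1 -mulNr opprB opprD addrA subrr add0r opprK.
  have -> s : a ^+ e * s / w i ^+ e = (a / w i) ^+ e * s by rewrite expr_div_n mulrAC.
  apply: subringM => //; first by apply: subringX => //; apply: hw.
  by apply: loc_sub => //; apply: subring_sum => // k _; apply: subringX.
- rewrite addrAC subrr add0r mulNr -expr_div_n; apply: subringN => //.
  case: pjb => [pjb|->]; last by rewrite expr0; apply: subring1.
  by apply: subringX => //; apply: hw.
Qed.

Lemma crt_idempotents : exists eps : J -> K, [/\ forall j, O (eps j),
  forall j, Op j ((eps j - 1) / w j ^+ e)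
  & forall i j, i != j -> Op i (eps j / w i ^+ e)].
Proof.
have hX ij : exists X, ij.1 != ij.2 -> [/\ O X, Op ij.1 (X / w ij.1 ^+ e)
    & Op ij.2 ((X - 1) / w ij.2 ^+ e)].
  have [E|ne] := eqVneq ij.1 ij.2; first by exists 0.
  by have [X hX] := crt_pair ne; exists X.
have [X hX'] := choice hX.
have OX j i : i != j -> O (X (i, j)) by move=> ij; have [] := hX' (i, j) ij.
exists (fun j => \prod_(i | i != j) X (i, j)); split.
- by move=> j; apply: subring_prod => // i ij; apply: OX.
- move=> j; have hOj := loc_subring (hp j).
  have wn : w j ^+ e != 0 by rewrite expf_neq0.
  suff [] : O (\prod_(i | i != j) X (i, j)) /\
    Op j ((\prod_(i | i != j) X (i, j) - 1) / w j ^+ e) by [].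
  apply: (big_ind (fun x => O x /\ Op j ((x - 1) / w j ^+ e))).
  + by split; [exact: subring1|rewrite subrr mul0r; exact: subring0].
  + move=> x y [Ox hx] [Oy hy]; split; first exact: subringM.
    have -> : (x * y - 1) / w j ^+ e
        = x * ((y - 1) / w j ^+ e) + (x - 1) / w j ^+ e by field.
    by apply: subringD => //; apply: subringM => //; apply: loc_sub.
  + by move=> i ij; have [OXi _ h] := hX' (i, j) ij.
- move=> i j ij; have hOi := loc_subring (hp i).
  rewrite (bigD1 i) //= mulrAC; apply: subringM => //.
    by have [] := hX' (i, j) ij.
  by apply: loc_sub => //; apply: subring_prod => // k /andP[kj _]; apply: OX.
Qed.

Variables (r : nat) (g : 'I_r -> set K) (gam : J -> 'I_r -> K).
Hypothesis hg : forall a, submodule O (g a : set K^o).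
Hypothesis ggam : forall j a, g a (gam j a).
Hypothesis gam0 : forall j a, gam j a != 0.
Hypothesis gloc : forall j a x, g a x -> Op j (x / gam j a).

Definition rowset (h : 'I_r -> set K) : set 'rV[K]_r := [set v | forall a, h a (v 0 a)].
Definition locrow j : set 'rV[K]_r := [set v | forall a, Op j (v 0 a / gam j a)].

(** Local representatives are approximated by global elements, since [O] is dense in its
    localizations, and glued by means of the [eps j]. Each [N j] contains [w^e] times the local
    module, so neither operation changes a class. *)
Lemma crt_index (M : set 'rV[K]_r) (N : J -> set 'rV[K]_r) (n : J -> nat) m :
  subgroup M -> (forall j, subgroup (N j)) ->
  (forall j, [set w j ^+ e *: v | v in locrow j] `<=` N j) ->
  (forall j, M `<=` N j) -> (forall j, has_index (locrow j) (N j) (n j)) ->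
  has_index (rowset g) M m -> (\prod_j n j <= m)%N.
Proof.
move=> hM hN wN MN idx im.
have [eps [Oeps eps1 eps0]] := crt_idempotents.
have hs j := has_index_ord (idx j).
have hs' j : exists s : 'I_(n j) -> 'rV[K]_r,
    (forall t, rowset g (s t)) /\ (forall t u, N j (s t - s u) -> t = u).
  have [s [Ms inj _]] := hs j.
  have hd t : exists v, rowset g v /\ N j (s t - v).
    have hda a : exists x, g a x /\ Op j ((s t 0 a - x) / gam j a / w j ^+ e).
      have [o Oo ho] := loc_dense (hp j) (w0 j) (@hw j) e (Ms t a).
      exists (o * gam j a); split; first by case: (hg a) => _ _; apply.
      have -> : (s t 0 a - o * gam j a) / gam j a = s t 0 a / gam j a - o.
        by rewrite mulrBl mulfK.
      by [].
    have [x hx] := choice hda; exists (\row_a x a); split.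
      by move=> a; rewrite mxE; case: (hx a).
    apply: wN; exists ((w j ^+ e)^-1 *: (s t - \row_a x a)).
      move=> a; rewrite !mxE; have [_] := hx a; congr (Op j _).
      by rewrite mulrC mulrA.
    by rewrite scalerA divff ?expf_neq0 // scale1r.
  have [v hv] := choice hd; exists v; split; first by move=> t; case: (hv t).
  move=> t u h; apply: inj.
  have -> : s t - s u = (s t - v t) + (v t - v u) - (s u - v u).
    by rewrite addrA subrK opprB addrA subrK.
  by apply: (hN j).2; [apply: subgroupD => //|]; case: (hv u) => //; case: (hv t).
have [s hs2] : exists s : forall j, 'I_(n j) -> 'rV[K]_r, forall j,
    (forall t, rowset g (s j t)) /\ (forall t u, N j (s j t - s j u) -> t = u).
  by exists (fun j => projT1 (cid (hs' j))) => j; apply: (projT2 (cid (hs' j))).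
have -> : (\prod_j n j = #|{dffun forall j : J, 'I_(n j)}|)%N.
  by rewrite card_dep_ffun foldr_muln big_map big_enum; apply: eq_bigr => j _; rewrite card_ord.
pose S (f : {dffun forall j : J, 'I_(n j)}) := \sum_j eps j *: s j (f j).
have rowZ a v : O a -> rowset g v -> rowset g (a *: v).
  by move=> Oa hv b; rewrite mxE; case: (hg b) => _ _ h; exact: h Oa (hv b).
have row0 : rowset g 0 by move=> b; rewrite mxE; case: (hg b).
have rowD u v : rowset g u -> rowset g v -> rowset g (u + v).
  by move=> hu hv b; rewrite mxE; case: (hg b) => _ h _; exact: h (hu b) (hv b).
apply: (@index_sep_ge _ (rowset g) M m _ S).
- exact: has_index_sep.
- move=> f; apply: (big_ind (rowset g)) => // j _; apply: rowZ => //.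
  by case: (hs2 j).
- move=> f f' h; apply/ffunP => j; apply: (hs2 j).2.
  have locr v : rowset g v -> locrow j v by move=> hv a; apply: gloc.
  have hOj := loc_subring (hp j).
  have wn : w j ^+ e != 0 by rewrite expf_neq0.
  have Nsc x v : Op j (x / w j ^+ e) -> rowset g v -> N j (x *: v).
    move=> hx hv; apply: wN; exists ((x / w j ^+ e) *: v).
      by move=> a; rewrite mxE -mulrA; apply: subringM => //; apply: locr.
    by rewrite scalerA mulrC divfK.
  have Nf (f0 : {dffun forall j : J, 'I_(n j)}) : N j (S f0 - s j (f0 j)).
    rewrite /S (bigD1 j) //= addrAC -{2}(scale1r (s j (f0 j))) -scalerBl.
    apply: subgroupD => //; first by apply: Nsc => //; case: (hs2 j).
    apply: (big_ind (N j)); first by case: (hN j).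
      by move=> x y; apply: subgroupD.
    move=> i ij; apply: Nsc; last by case: (hs2 i).
    by apply: eps0; rewrite eq_sym.
  have -> : s j (f j) - s j (f' j)
      = (S f - S f') - (S f - s j (f j)) + (S f' - s j (f' j)).
    by apply/rowP => k; rewrite !mxE; ring.
  apply: subgroupD => //; apply: (hN j).2 => //; exact: MN.
Qed.

End CRT.

(** * Indices of products and powers of locally principal modules *)

Section PowerIndex.
Variables (K : fieldExtType rat) (R : realType).
Local Notation O := (ring_of_integers K).
Let hO : subring O := OK_subring K.
Implicit Types A B : set K.

Definition prodset A B : set K :=
  @lspan K K^o O [set z | exists x y, [/\ A x, B y & z = x * y]].

Lemma prodset_sub A B : submodule O (prodset A B : set K^o).
Proof.
split; [exact: lspan0|exact: lspanD|].
by move=> a u Oa hu; apply: lspanZ => //; apply: subringM.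
Qed.

Lemma prodset_mem A B x y : A x -> B y -> prodset A B (x * y).
Proof.
by move=> Ax By; apply: (@lspan_mem K K^o); [exact: subring1|exists x, y].
Qed.

Lemma submodule_subgroupO A : submodule O (A : set K^o) -> subgroup A.
Proof. exact: (@submodule_subgroup K O hO K^o). Qed.

(** One element generates [A / p A] for every [p]: the form of invertibility used in counting
    classes. *)
Definition locally_principal A : Prop := forall p, maximal_ideal O p ->
  exists2 c, A c & forall y, A y -> exists o y', [/\ O o,
    @lspan K K^o p A y' & y = o * c + y'].

(** Induction along a chain from [A'] to [A] with simple quotients. For [A'' = A' + O x] with
    [A''/A'] isomorphic to [O/p], the classes of [A'' B] modulo [A' B] are represented by the
    [rho t * x * c], where [c] generates [B] modulo [p B] and [rho] runs over the residues modulo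
    [p]. *)
Lemma prodset_index A A' B n : submodule O (A : set K^o) ->
  submodule O (A' : set K^o) -> A' `<=` A -> submodule O (B : set K^o) ->
  locally_principal B -> has_index A A' n ->
  index_cover (prodset A B) (prodset A' B) n.
Proof.
move=> hA + + hB lpB; elim/ltn_ind: n A' => n IH A' hA' sub idx.
have sgA := submodule_subgroupO hA; have sgA' := submodule_subgroupO hA'.
have sgP := submodule_subgroupO (prodset_sub A' B).
have [AA'|nAA'] := pselect (A `<=` A').
  exists unit, (fun=> 0); split; last by rewrite card_unit (has_index_gt0 sgA.1 idx).
  move=> x hx; exists tt; rewrite subr0; elim/(@lspan_ind K K^o): x / hx.
  - exact: sgP.1.
  - by move=> u v; apply: subgroupD.
  - move=> a _ Oa [x [y [Ax By ->]]]; case: (prodset_sub A' B) => _ _; apply=> //.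
    by apply: prodset_mem => //; apply: AA'.
have [T [kap [hk sT]]] := has_index_sep sgA' sgA.1 idx.
have [x [Ax nA'x mp]] : exists x, [/\ A x, ~ A' x & maximal_ideal O [set o | O o /\ A' (o * x)]].
  apply: (@exists_simple K A A' T kap) => //.
  apply: contrapT => no; apply: nAA' => x Ax; apply: contrapT => nx.
  by apply: no; exists x.
set p := [set o | _] in mp.
pose A'' : set K := [set z | exists y o, [/\ A' y, O o & z = y + o * x]].
have [A'0 A'D A'Z] := hA'; have [A0 AD AZ] := hA.
have hA'' : submodule O (A'' : set K^o).
  split.
  - by exists 0, 0; rewrite mul0r addr0; split=> //; apply: subring0.
  - move=> _ _ [y [o [A'y Oo ->]]] [y' [o' [A'y' Oo' ->]]].
    exists (y + y'), (o + o'); rewrite mulrDl addrACA.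
    by split=> //; [exact: (A'D)|exact: subringD].
  - move=> a _ Oa [y [o [A'y Oo ->]]]; exists (a * y), (a * o).
    rewrite -[_ *: _]/(a * _) mulrDr mulrA.
    by split=> //; [exact: (A'Z)|exact: subringM].
have subA'' : A'' `<=` A.
  by move=> _ [y [o [A'y Oo ->]]]; apply: (AD); [exact: sub|exact: (AZ)].
have subA' : A' `<=` A''.
  by move=> y A'y; exists y, 0; rewrite mul0r addr0; split=> //; apply: subring0.
have [a [b [ia ib eab]]] := has_index_split sgA (submodule_subgroupO hA'') sgA' subA'' subA' idx.
have A''x : A'' x by exists 0, 1; rewrite add0r mul1r; split=> //; apply: subring1.
have ridx := residue_index R mp.
have [rho [Orho rinj rsurj]] := has_index_ord ridx.
have qb : (card_quotient O p <= b)%N.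
  rewrite -[X in (X <= _)%N]card_ord.
  apply: (@index_sep_ge _ A'' A' b _ (fun t => rho t * x)).
  - exact: (has_index_sep sgA' (submodule_subgroupO hA'').1 ib).
  - by move=> t; case: hA'' => _ _; apply.
  - move=> t u; rewrite -mulrBl => h; apply: rinj; split=> //.
    exact: subringB.
have b1 : (1 < b)%N by apply: leq_trans (residue_gt1 R mp) qb.
have a0 := has_index_gt0 sgA.1 ia.
have an : (a < n)%N by rewrite eab -{1}(muln1 a) ltn_pmul2l.
have [T1 [s1 [hs1 sT1]]] := IH a an A'' hA'' subA'' ia.
rewrite eab; apply: (@cover_mul _ _ (prodset A'' B)).
- by move=> u v; apply: subgroupD.
- exists T1, s1; split=> // z /hs1[t ht]; exists t, (z - s1 t), 0.
  by split=> //; [exact: sgP.1|rewrite addr0].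
have [c Bc hc] := lpB p mp.
exists 'I_(card_quotient O p), (fun t => rho t * x * c); split; last by rewrite card_ord.
have xpB y : @lspan K K^o p B y -> prodset A' B (x * y).
  elim/(@lspan_ind K K^o): y / => [|u v hu hv|o y [Oo A'o] By].
  - by rewrite mulr0; apply: sgP.1.
  - by rewrite mulrDr; apply: subgroupD.
  - by rewrite -[_ *: _]/(o * y) mulrCA mulrA; apply: prodset_mem.
move=> z hz.
have [y [By Pz]] : exists y, B y /\ prodset A' B (z - x * y).
  have [B0 BD BZ] := hB.
  elim/(@lspan_ind K K^o): z / hz.
  - by exists 0; rewrite mulr0 subr0; split=> //; apply: sgP.1.
  - move=> u v [y1 [By1 h1]] [y2 [By2 h2]]; exists (y1 + y2); split; first exact: (BD).
    by rewrite mulrDr opprD addrACA; apply: subgroupD.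
  - move=> o _ Oo [_ [y [[y' [o' [A'y' Oo' ->]]] By ->]]].
    exists (o * o' * y); split; first by apply: (BZ) => //; apply: subringM.
    have -> : o *: ((y' + o' * x) * y : K^o) - x * (o * o' * y) = o * (y' * y).
      by rewrite -[_ *: _]/(o * _); ring.
    by case: (prodset_sub A' B) => _ _; apply=> //; apply: prodset_mem.
have [o [y' [Oo py' ey]]] := hc y By; have [t [Ot A't]] := rsurj o Oo.
exists t.
have -> : z - rho t * x * c = (z - x * y) + ((o - rho t) * x * c + x * y').
  by rewrite ey; ring.
apply: subgroupD => //; apply: subgroupD => //; last exact: xpB.
exact: prodset_mem.
Qed.

(** One factor at a time: replacing [B 1] by [s O] in the product with [B d] costs at most [n].
    Applied to a fibre [x(E)], it bounds the finite part of the degree of the D-th power by [D]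
    times that of the fibre. *)
Lemma power_index (B : nat -> set K) s n D : s != 0 -> B 1%N s ->
  B 0%N = O -> (forall d, submodule O (B d : set K^o)) ->
  (forall d, B d.+1 = prodset (B 1%N) (B d)) -> (forall d, locally_principal (B d)) ->
  has_index (B 1%N) [set s * o | o in O] n ->
  exists2 m, has_index (B D) [set s ^+ D * o | o in O] m & (m <= n ^ D)%N.
Proof.
move=> s0 Bs B0 hB BS lp idx.
have sgB d := submodule_subgroupO (hB d).
have hsO x : submodule O ([set x * o | o in O] : set K^o).
  split.
  - by exists 0; rewrite ?mulr0 //; apply: subring0.
  - by move=> _ _ [a Oa <-] [b Ob <-]; exists (a + b); rewrite ?mulrDr //; apply: subringD.
  - move=> e _ Oe [a Oa <-]; exists (e * a); first exact: subringM.
    by rewrite -[_ *: _]/(e * (x * a)) mulrCA.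
have sgs x := submodule_subgroupO (hsO x).
have Bx d x : B d x -> [set x * o | o in O] `<=` B d.
  by move=> Bdx _ [o Oo <-]; rewrite mulrC; case: (hB d) => _ _; apply.
have Bsd d : B d (s ^+ d).
  elim: d => [|d IH]; first by rewrite B0 expr0; apply: subring1.
  by rewrite BS exprS; apply: prodset_mem.
elim: D => [|d [m im mle]].
  exists 1%N => //; rewrite expr0; exists unit, (fun=> 0); split.
  - by move=> _; case: (sgB 0%N).
  - by move=> [] [].
  - by move=> x; rewrite B0 => Ox; exists tt; rewrite subr0; exists x; rewrite ?mul1r.
  - by rewrite card_unit.
pose sB := [set s * y | y in B d].
have sgsB : subgroup sB.
  split; first by exists 0; rewrite ?mulr0 //; apply: (sgB d).1.
  by move=> _ _ [x Bx' <-] [y By <-]; exists (x - y); rewrite ?mulrBr //; apply: (sgB d).2.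
have cov := prodset_index (hB 1%N) (hsO s) (Bx _ _ Bs) (hB d) (lp d) idx.
have eP : prodset [set s * o | o in O] (B d) = sB.
  apply/seteqP; split=> [z|_ [y By <-]].
    elim/(@lspan_ind K K^o): z / => [|u v|o _ Oo [_ [y [[o' Oo' <-] By ->]]]].
    - exact: sgsB.1.
    - exact: subgroupD.
    - exists (o * o' * y); first by case: (hB d) => _ _; apply=> //; apply: subringM.
      by rewrite -[_ *: _]/(o * _); ring.
  by apply: prodset_mem => //; exists 1; rewrite ?mulr1 //; apply: subring1.
rewrite eP -BS in cov.
have [i1 l1] := index_sep_has sgsB (index_cover_sep sgsB (sgB d.+1).1 cov).
have i2 : has_index sB [set s ^+ d.+1 * o | o in O] m.
  have := @has_index_image _ _ ( *%R s) (B d) _ m (sgB d) (fun x y _ _ => mulrBr s x y) _ (Bx _ _ (Bsd d)) im.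
  have -> : ( *%R s) @` [set s ^+ d * o | o in O] = [set s ^+ d.+1 * o | o in O].
    apply/seteqP; split=> [_ [_ [o Oo <-] <-]|_ [o Oo <-]].
      by exists o => //; rewrite exprS mulrA.
    by exists (s ^+ d * o); [exists o|rewrite exprS mulrA].
  by apply=> x _ /eqP; rewrite mulf_eq0 (negbTE s0) => /eqP.
have sBB : sB `<=` B d.+1 by move=> _ [y By <-]; rewrite BS; apply: prodset_mem.
have ssB : [set s ^+ d.+1 * o | o in O] `<=` sB.
  move=> _ [o Oo <-]; exists (s ^+ d * o); last by rewrite exprS mulrA.
  by apply: (Bx _ _ (Bsd d)); exists o.
exists (card_quotient (B d.+1) sB * m)%N.
  exact: (has_index_tower (sgB d.+1) sgsB (sgs _) sBB ssB i1 i2).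
by rewrite expnS leq_mul.
Qed.

End PowerIndex.

(** * Hermitian forms *)

Section ComplexNorm.
Variable R : realType.
Local Notation C := R[i].

Lemma normcE_C (z : C) : `|z| = (Normc.normc z)%:C%C.
Proof. by case: z. Qed.

Lemma normc_ge0 (z : C) : 0 <= Normc.normc z.
Proof. by case: z => a b; apply: sqrtr_ge0. Qed.

Lemma normc_sq (z : C) : z * conjc z = ((Normc.normc z) ^+ 2)%:C%C.
Proof. by rewrite rmorphXn /= -normcE_C sqr_normc. Qed.

Lemma normc_gt0 (z : C) : z != 0 -> 0 < Normc.normc z.
Proof. by move=> z0; rewrite -ltcR -normcE_C normr_gt0. Qed.

Lemma normc_real (x : R) : 0 <= x -> Normc.normc x%:C%C = x.
Proof. by move=> x0; rewrite /Normc.normc /= expr0n addr0 sqrtr_sqr ger0_norm. Qed.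

End ComplexNorm.

Section Hermitian.
Variables (R : realType) (U : lmodType R[i]) (q : {dot U for conjc}).
Local Notation C := R[i].

Lemma dotDl u v w : q (u + v) w = q u w + q v w. Proof. by rewrite linearDl. Qed.
Lemma dotDr u v w : q w (u + v) = q w u + q w v. Proof. by rewrite linearD. Qed.
Lemma dotZl a u v : q (a *: u) v = a * q u v. Proof. by rewrite linearZl_LR. Qed.
Lemma dotZr a u v : q v (a *: u) = conjc a * q v u. Proof. by rewrite linearZ. Qed.
Lemma dotC u v : q u v = conjc (q v u). Proof. by rewrite hermC expr0 mul1r. Qed.
Lemma dotNl u v : q (- u) v = - q u v. Proof. by rewrite -scaleN1r dotZl mulN1r. Qed.
Lemma dot0l v : q 0 v = 0. Proof. by rewrite -(scale0r (0 : U)) dotZl mul0r. Qed.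
Lemma dot_suml I (r : seq I) (P : pred I) (f : I -> U) v :
  q (\sum_(i <- r | P i) f i) v = \sum_(i <- r | P i) q (f i) v.
Proof.
apply: (big_morph (fun u => q u v)); [by move=> x y; exact: dotDl|exact: dot0l].
Qed.
Lemma dot_sumr I (r : seq I) (P : pred I) (f : I -> U) v :
  q v (\sum_(i <- r | P i) f i) = \sum_(i <- r | P i) q v (f i).
Proof. by rewrite dotC dot_suml rmorph_sum; apply: eq_bigr => i _; rewrite [RHS]dotC. Qed.

Lemma dot_ge0 u : 0 <= q u u.
Proof.
have [->|h] := eqVneq u 0; first by rewrite dot0l.
exact: ltW (neq0_dnorm_gt0 _ h).
Qed.

Lemma dot_eq0 u : q u u = 0 -> u = 0.
Proof.
move=> e; apply/eqP/negPn/negP => u0.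
have : 0 < q u u by exact: (neq0_dnorm_gt0 _ u0).
by rewrite e ltxx.
Qed.

Lemma hnorm_ge0 u : 0 <= hnorm q u. Proof. exact: sqrtr_ge0. Qed.

Lemma hnorm_sqC u : ((hnorm q u) ^+ 2)%:C%C = q u u.
Proof.
have := dot_ge0 u; rewrite lecE /= => /andP[/eqP im re].
rewrite /hnorm sqr_sqrtr //; move: im re; case: (q u u) => a b /= -> _.
by [].
Qed.

Lemma hnormZ a u : hnorm q (a *: u) = Normc.normc a * hnorm q u.
Proof.
have : (hnorm q (a *: u)) ^+ 2 = (Normc.normc a * hnorm q u) ^+ 2.
  apply: (fmorph_inj (real_complex R)); rewrite /= hnorm_sqC dotZl dotZr mulrA normc_sq.
  by rewrite exprMn [in RHS]rmorphM /= hnorm_sqC.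
move/eqP; rewrite eqrXn2 // ?hnorm_ge0 ?mulr_ge0 ?normc_ge0 ?hnorm_ge0 //.
by move/eqP.
Qed.

Lemma hnorm_eq0 u : hnorm q u = 0 -> u = 0.
Proof. by move=> e; apply: dot_eq0; rewrite -hnorm_sqC e expr0n. Qed.

Lemma hnorm_orth u v : q u v = 0 -> hnorm q u <= hnorm q (u + v).
Proof.
move=> uv; rewrite -(ler_pXn2r (n := 2)) ?nnegrE ?hnorm_ge0 // -lecR !hnorm_sqC.
rewrite dotDl !dotDr uv (dotC v) uv conjc0 !addr0 add0r lerDl.
exact: dot_ge0.
Qed.

(** Gram-Schmidt, one vector at a time. If [v = 0] the last vector depends on the others, and its
    coefficient is set to 0. *)
Lemma orthogonal_projection m (z : 'I_m -> U) g :
  exists c : 'I_m -> C, forall i, q (g - \sum_j c j *: z j) (z i) = 0.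
Proof.
elim: m z g => [|m IH] z g; first by exists (fun=> 0); case.
pose z' i := z (lift ord_max i).
have [c hc] := IH z' g; have [e he] := IH z' (z ord_max).
pose v := z ord_max - \sum_j e j *: z' j.
pose a := if q v v == 0 then 0 else q (g - \sum_j c j *: z' j) v / q v v.
exists (fun i => if unlift ord_max i is Some j then c j - a * e j else a).
have sE : \sum_i (if unlift ord_max i is Some j then c j - a * e j else a) *: z i
    = \sum_j c j *: z' j + a *: v.
  rewrite (bigD1_ord ord_max) //= unlift_none.
  rewrite (eq_bigr (fun j => c j *: z' j - a *: (e j *: z' j))); last first.
    by move=> j _; rewrite liftK scalerBl scalerA.
  by rewrite sumrB -scaler_sumr scalerBr addrCA.
have orth i : q (g - \sum_j c j *: z' j - a *: v) (z' i) = 0.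
  by rewrite dotDl dotNl dotZl hc he mulr0 subr0.
have orthv : q (g - \sum_j c j *: z' j - a *: v) v = 0.
  rewrite dotDl dotNl dotZl /a; case: eqP => [/dot_eq0 v0|/eqP v0].
    by rewrite v0 mul0r subr0 dotC dot0l conjc0.
  by rewrite divfK // subrr.
move=> i; rewrite sE opprD addrA.
have [j ->|->] := unliftP ord_max i; first exact: orth.
have -> : z ord_max = v + \sum_j e j *: z' j by rewrite subrK.
rewrite dotDr orthv add0r dot_sumr big1 // => j _.
by rewrite dotZr orth mulr0.
Qed.

Lemma polarization_form (N : U -> R) (b : U -> U -> C) u v :
  (forall x y z, b (x + y) z = b x z + b y z) ->
  (forall a x z, b (a *: x) z = a * b x z) ->
  (forall x y, b x y = conjc (b y x)) ->
  (forall x, ((N x) ^+ 2)%:C%C = b x x) -> polarization N u v = b u v.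
Proof.
move=> bD bZ bC bN.
have bDr x y z : b z (x + y) = b z x + b z y by rewrite bC bD rmorphD /= -!bC.
have bZr a x z : b z (a *: x) = conjc a * b z x by rewrite bC bZ rmorphM /= -bC.
rewrite /polarization; set im := Complex 0 1 : C.
have i2 : im * im = -1 by exact: sqr_i.
have ci : conjc im = - im by apply/eqP; rewrite eq_complex /= oppr0 !eqxx.
have p2 : im ^+ 2 = -1 by rewrite expr2.
have p3 : im ^+ 3 = - im by rewrite exprS p2 mulrN1.
rewrite !big_ord_recl big_ord0 !bN /= /bump /= expr0 !add1n expr1 p2 p3.
have cN1 : conjc (-1 : C) = -1 by rewrite rmorphN rmorph1.
have cNi : conjc (- im) = im by apply/eqP; rewrite eq_complex /= oppr0 opprK !eqxx.
rewrite !bD !bDr !bZ !bZr cN1 cNi ci conjc1.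
set x := b u u; set y := b v v; set s := b u v; set t := b v u.
have f4 : 4%:R != 0 :> C by rewrite pnatr_eq0.
apply: (mulfI f4); rewrite mulVKf //.
transitivity ((2 - 2 * (im * im)) * s + (2 + 2 * (im * im)) * t); first by ring.
by rewrite i2; ring.
Qed.

End Hermitian.

Section DetInequality.
Variables (R : realType) (U : lmodType R[i]) (q : {dot U for conjc}).
Local Notation C := R[i].
Variables (r : nat) (u : 'I_r -> U) (l : 'I_r -> U -> C).
Hypothesis lD : forall a x y, l a (x + y) = l a x + l a y.
Hypothesis lZ : forall a c x, l a (c *: x) = c * l a x.
Hypothesis lb : forall a x, Normc.normc (l a x) <= hnorm q x.
Let Lam : 'M[C]_r := \matrix_(b, a) l a (u b).
Let G : 'M[C]_r := \matrix_(i, j) q (u i) (u j).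
Hypothesis uL : \det Lam != 0.

Let adj m n (A : 'M[C]_(m, n)) : 'M[C]_(n, m) := map_mx conjc A^T.

Let adjM m n p (A : 'M[C]_(m, n)) (B : 'M[C]_(n, p)) : adj (A *m B) = adj B *m adj A.
Proof. by rewrite /adj trmx_mul map_mxM. Qed.
Let adjK m n (A : 'M[C]_(m, n)) : adj (adj A) = A.
Proof. by apply/matrixP => i j; rewrite !mxE conjcK. Qed.

Let comb (x : 'rV[C]_r) : U := \sum_i x 0 i *: u i.

Let l_comb a x : l a (comb x) = (x *m Lam) 0 a.
Proof.
have l0 : l a 0 = 0 by rewrite -(scale0r (0 : U)) lZ mul0r.
rewrite /comb (big_morph (l a) (lD a) l0) mxE.
by apply: eq_bigr => i _; rewrite lZ mxE.
Qed.

Let q_comb x y : q (comb x) (comb y) = (x *m G *m adj y) 0 0.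
Proof.
rewrite dot_suml mxE; under [RHS]eq_bigr => j _ do rewrite mxE mulr_suml.
rewrite exchange_big; apply: eq_bigr => i _ /=; rewrite dotZl dot_sumr mulr_sumr.
by apply: eq_bigr => j _; rewrite dotZr !mxE; ring.
Qed.

Lemma gram_unit : G \in unitmx.
Proof.
rewrite unitmxE unitfE; apply/negP => /det0P[x x0 xG]; case/negP: x0.
have c0 : comb x = 0 by apply: (dot_eq0 (q := q)); rewrite q_comb xG mul0mx mxE.
have xL : x *m Lam = 0.
  apply/rowP => a; rewrite -l_comb c0 mxE.
  by rewrite -(scale0r (0 : U)) lZ mul0r.
have uLam : Lam \in unitmx by rewrite unitmxE unitfE.
by rewrite -(mulmxK uLam x) xL mul0mx.
Qed.

(* [H = Lam^* G^-1 Lam] is positive with diagonal entries at most 1, so the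
   inequality of the means bounds its determinant by 1. *)
Lemma det_le_gram : (Normc.normc (\det Lam)) ^+ 2 <= complex.Re (\det G).
Proof.
have uG := gram_unit.
pose H := adj Lam *m invmx G *m Lam.
have GG : adj G = G by apply/matrixP => i j; rewrite !mxE -dotC.
have iGG : adj (invmx G) = invmx G.
  have h : adj (invmx G) *m G = 1%:M.
    by rewrite -{2}GG -adjM mulmxV // /adj trmx1 map_mx1.
  by rewrite -[LHS](mulmxK uG) h mul1mx.
have HH : adj H = H by rewrite /H !adjM adjK iGG mulmxA.
have qH (s s' : 'rV[C]_r) : (s *m H *m adj s') 0 0
    = q (comb (s *m adj Lam *m invmx G)) (comb (s' *m adj Lam *m invmx G)).
  by rewrite q_comb !adjM adjK iGG /H !mulmxA mulmxKV.
have Hdiag a : H a a <= 1.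
  pose s : 'rV[C]_r := delta_mx 0 a.
  have Hs (B : 'M[C]_r) : B a a = (s *m B *m adj s) 0 0.
    by rewrite -rowE mxE (bigD1 a) //= !mxE !eqxx conjc1 mulr1 big1 ?addr0 // => j ja;
       rewrite !mxE (negbTE ja) andbF conjc0 mulr0.
  pose x := s *m adj Lam *m invmx G.
  have Hx : H a a = q (comb x) (comb x) by rewrite Hs qH.
  have lx : l a (comb x) = H a a.
    by rewrite l_comb /x /H -!mulmxA -rowE mxE !mulmxA.
  have h0 : 0 <= H a a by rewrite Hx; apply: dot_ge0.
  have := lb a (comb x); rewrite lx -lecR -normcE_C ger0_norm // => h1.
  have [->|hp] := eqVneq (H a a) 0; first exact: ler01.
  have h2 : (H a a) ^+ 2 <= H a a.
    rewrite {2}Hx -hnorm_sqC rmorphXn /= ler_pXn2r // ?nnegrE //.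
    by rewrite lecR hnorm_ge0.
  by move: h2; rewrite expr2 -[X in _ <= X]mulr1 ler_pM2l // lt_def hp h0.
have nH : H \is normalmx.
  apply/hermitian_normalmx/is_hermitianmxP; rewrite expr0 scale1r; exact: esym HH.
have /orthomx_spectralP := nH.
set P := spectralmx H; set sp := spectral_diag H => eH.
have uP := spectral_unitarymx H; rewrite -/P in uP.
have unP := unitarymx_unit uP.
have iP : invmx P = adj P by rewrite invmx_unitary.
have spE i : sp 0 i = (row i P *m H *m adj (row i P)) 0 0.
  have -> : (row i P *m H *m adj (row i P)) 0 0 = (P *m H *m adj P) i i.
    rewrite -[in RHS]mulmxA [in RHS]mxE -[in LHS]mulmxA [in LHS]mxE.
    apply: eq_bigr => j _; rewrite !mxE; congr (_ * _).
    by apply: eq_bigr => k _; rewrite !mxE.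
  rewrite eH !mulmxA mulmxV // mul1mx -iP mulmxK // mxE eqxx mulr1n //.
have sp0 i : 0 <= sp 0 i by rewrite spE qH; apply: dot_ge0.
have trH : \sum_i sp 0 i <= r%:R.
  have -> : \sum_i sp 0 i = \tr H.
    by rewrite eH mxtrace_mulC mulmxA mulmxV // mul1mx mxtrace_diag.
  rewrite /mxtrace -[X in _ <= X%:R]card_ord -sum1_card natr_sum; apply: ler_sum => i _.
  exact: Hdiag.
have detH : \det H = \prod_i sp 0 i.
  rewrite eH !det_mulmx det_diag mulrAC -det_mulmx mulVmx // det1 mul1r //.
have detH1 : \det H <= 1.
  have [r0|r0] := eqVneq r 0%N.
    by rewrite detH; move: sp {spE sp0 trH eH detH}; rewrite r0 => sp; rewrite big_ord0.
  have /leifP := @leif_AGM C 'I_r predT (fun i => sp 0 i) (fun i _ => sp0 i).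
  rewrite cardT size_enum_ord => hAG.
  have le1 : \prod_i sp 0 i <= ((\sum_i sp 0 i) / r%:R) ^+ r.
    by move: hAG; case: ifP => _; [move/eqP->|move/ltW].
  rewrite detH; apply: le_trans le1 _; apply: exprn_ile1.
    by rewrite divr_ge0 ?sumr_ge0 // ler0n.
  by rewrite ler_pdivrMr ?ltr0n ?lt0n // mul1r.
have detH0 : 0 <= \det H by rewrite detH; apply: prodr_ge0.
have eq : \det G * \det H = ((Normc.normc (\det Lam)) ^+ 2)%:C%C.
  rewrite -normc_sq /H !det_mulmx det_inv det_map_mx det_tr.
  have G0 : \det G != 0 by rewrite -unitfE -unitmxE.
  by field.
have L0 : 0 < ((Normc.normc (\det Lam)) ^+ 2)%:C%C :> C.
  by rewrite ltcR exprn_gt0 // normc_gt0.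
have H0 : 0 < \det H.
  rewrite lt_def detH0 andbT; apply: contraTneq L0 => h0.
  by rewrite -eq h0 mulr0 ltxx.
have G0 : 0 < \det G by rewrite -(pmulr_lgt0 _ H0) eq.
have : ((Normc.normc (\det Lam)) ^+ 2)%:C%C <= \det G.
  by rewrite -eq -[X in _ <= X]mulr1 ler_pM2l.
by rewrite lecE /= => /andP[].
Qed.

End DetInequality.

Section QuotientNorm.
Variables (R : realType) (n : nat).
Local Notation C := R[i].
Variables (q : {dot 'rV[C]_n.+1 for conjc}) (y : 'I_n.+1 -> C).
Hypothesis y0 : exists k, y k != 0.

Let ev (u : 'rV[C]_n.+1) : C := \sum_k u 0 k * y k.

(** The infimum is attained at the vector orthogonal to the kernel of the linear form [y], which the
    [z i] span; hence the quotient norm on the line is a multiple of the absolute value. *)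
Lemma quotient_norm_min : exists w : 'rV[C]_n.+1, ev w = 1 /\ forall a,
  quotient_norm q y a = Normc.normc a * hnorm q w.
Proof.
have [k yk] := y0.
have evD u v : ev (u + v) = ev u + ev v.
  by rewrite /ev -big_split; apply: eq_bigr => i _; rewrite mxE mulrDl.
have evZ a u : ev (a *: u) = a * ev u.
  by rewrite /ev mulr_sumr; apply: eq_bigr => i _; rewrite mxE mulrA.
have evN u : ev (- u) = - ev u by rewrite -scaleN1r evZ mulN1r.
have evd i : ev (delta_mx 0 i) = y i.
  rewrite /ev (bigD1 i) //= mxE !eqxx mul1r big1 ?addr0 // => j ji.
  by rewrite mxE (negbTE ji) mul0r.
have evs m (c : 'I_m -> C) (v : 'I_m -> 'rV[C]_n.+1) :
    ev (\sum_j c j *: v j) = \sum_j c j * ev (v j).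
  have ev0 : ev 0 = 0 by rewrite -(scale0r (0 : 'rV[C]_n.+1)) evZ mul0r.
  by rewrite (big_morph ev evD ev0); apply: eq_bigr => j _; rewrite evZ.
pose z i : 'rV[C]_n.+1 := delta_mx 0 i - (y i / y k) *: delta_mx 0 k.
have evz i : ev (z i) = 0 by rewrite evD evN evZ !evd divfK // subrr.
have [c hc] := orthogonal_projection q z ((y k)^-1 *: delta_mx 0 k).
set w := _ - _ in hc.
have evw : ev w = 1.
  by rewrite evD evN evZ evd mulVf // evs big1 ?subr0 // => j _; rewrite evz mulr0.
have orth u : ev u = 0 -> q w u = 0.
  move=> u0; have -> : u = \sum_i u 0 i *: z i.
    apply/rowP => j; rewrite summxE; transitivity (u 0 j - (ev u / y k) * (j == k)%:R).
      by rewrite u0 !mul0r subr0.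
    rewrite /ev mulr_suml mulr_suml -sumrN.
    rewrite {1}[u](row_sum_delta u) summxE -big_split; apply: eq_bigr => i _ /=.
    by rewrite !mxE !eqxx /=; ring.
  by rewrite dot_sumr big1 // => i _; rewrite dotZr hc mulr0.
exists w; split=> // a; rewrite -hnormZ.
have evaw : ev (a *: w) = a by rewrite evZ evw mulr1.
have lbnd : lbound [set hnorm q u | u in [set u | ev u = a]] (hnorm q (a *: w)).
  move=> _ [u eu <-]; rewrite -[u](subrK (a *: w)) addrC; apply: hnorm_orth.
  by rewrite dotZl orth ?mulr0 // evD evN evaw eu subrr.
apply/eqP; rewrite eq_le; apply/andP; split.
  apply: ge_inf; first by exists (hnorm q (a *: w)).
  by exists (a *: w).
by apply: lb_le_inf => //; exists (hnorm q (a *: w)), (a *: w).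
Qed.

Lemma quotient_normE a : quotient_norm q y a = Normc.normc a * quotient_norm q y 1.
Proof.
by have [w [_ hw]] := quotient_norm_min; rewrite !hw Normc.normc1 mul1r.
Qed.

Lemma quotient_norm_gt0 : 0 < quotient_norm q y 1.
Proof.
have [w [ew hw]] := quotient_norm_min; rewrite hw Normc.normc1 mul1r.
rewrite lt_def hnorm_ge0 andbT; apply/eqP => /hnorm_eq0 w0.
move: ew; rewrite w0 /ev big1; first by move/eqP; rewrite eq_sym oner_eq0.
by move=> k _; rewrite mxE mul0r.
Qed.

Lemma quotient_norm_le u : ev u = 1 -> quotient_norm q y 1 <= hnorm q u.
Proof.
move=> eu; apply: ge_inf; last by exists u.
by exists 0 => _ [v _ <-]; apply: hnorm_ge0.
Qed.

Lemma quotient_polarization (a b : C) :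
  polarization (quotient_norm q y : C^o -> R) a b
  = ((quotient_norm q y 1) ^+ 2)%:C%C * a * conjc b.
Proof.
have cM (z w : C) : conjc (z * w) = conjc z * conjc w by exact: rmorphM.
apply: (polarization_form (U := C^o) (N := quotient_norm q y)
  (b := fun a b : C => ((quotient_norm q y 1) ^+ 2)%:C%C * a * conjc b)).
- by move=> u v w; rewrite mulrDr mulrDl.
- by move=> c u w; rewrite -[_ *: _]/(c * u); ring.
- by move=> u v; rewrite !cM conjcK conjc_real -mulrA (mulrC u) mulrA.
- move=> x; rewrite quotient_normE exprMn rmorphM /= -normc_sq; ring.
Qed.

End QuotientNorm.

(** * The archimedean inequality *)

Section FiniteSpan.
Variables (F : fieldType) (V : vectType F) (X : set V).

Lemma lspan_fg : exists m (z : 'I_m -> V), (forall i, lspan setT X (z i)) /\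
  forall v, lspan setT X v -> exists c : 'I_m -> F, v = \sum_i c i *: z i.
Proof.
pose P (d : nat) := `[< exists2 s : seq V, forall x, x \in s -> lspan setT X x & \dim <<s>> = d >].
have exP : exists d, P d by exists 0%N; apply/asboolP; exists [::] => //; rewrite span_nil dimv0.
have ubP d : P d -> (d <= \dim {:V})%N.
  by move=> /asboolP[s _ <-]; apply: dimvS; apply: subvf.
case: (ex_maxnP exP ubP) => d /asboolP[s hs ds] dmax.
exists (size s), (fun i => s`_i); split=> [i|v Xv]; first by apply: hs; apply: mem_nth.
have vs : v \in <<s>>%VS.
  have sub : (<<s>> <= <<v :: s>>)%VS by apply: sub_span => x xs; rewrite inE xs orbT.
  have dle : (\dim <<v :: s>> <= d)%N.
    apply: dmax; apply/asboolP; exists (v :: s) => // x.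
    by rewrite inE => /orP[/eqP->|/hs].
  have /eqP -> : <<s>>%VS == <<v :: s>>%VS by rewrite eqEdim sub ds.
  by apply: memv_span; rewrite mem_head.
by exists (fun i => coord (in_tuple s) i v); apply: (coord_span (X := in_tuple s)).
Qed.

End FiniteSpan.

Section QuotientForm.
Variables (R : realType) (U : vectType R[i]) (q : {dot U for conjc}) (X : set U).
Local Notation C := R[i].
Local Notation Ker := (lspan (setT : set C) X).

(** In each class modulo [Ker] the vector of least norm is the one orthogonal to [Ker]. It depends
    linearly on the class, so the quotient norm comes from a Hermitian form, and the polarization
    recovers that form. *)
Lemma quotient_form : exists P : U -> U,
  (forall g, Ker (P g - g)) /\
  forall u v, polarization (fun g => inf [set hnorm q g' | g' in [set g' | Ker (g' - g)]]) u v
    = q (P u) (P v).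
Proof.
have [m [z [Xz zX]]] := lspan_fg X.
have Ker0 : Ker 0 by apply: lspan0.
have KerD u v : Ker u -> Ker v -> Ker (u + v) by apply: lspanD.
have KerZ a u : Ker u -> Ker (a *: u) by move=> hu; apply: lspanZ.
have KerN u : Ker u -> Ker (- u) by rewrite -scaleN1r; apply: KerZ.
have exP g : exists p, Ker (p - g) /\ forall k, Ker k -> q p k = 0.
  have [c hc] := orthogonal_projection q z g.
  exists (g - \sum_j c j *: z j); split.
    rewrite addrAC subrr add0r; apply: KerN.
    by apply: (big_ind Ker) => // j _; apply: KerZ.
  move=> k /zX[e ->]; rewrite dot_sumr big1 // => i _.
  by rewrite dotZr hc mulr0.
pose P g := xget 0 [set p | Ker (p - g) /\ forall k, Ker k -> q p k = 0].
have hP g : Ker (P g - g) /\ forall k, Ker k -> q (P g) k = 0.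
  exact: (@xgetPex _ 0 [set p | Ker (p - g) /\ forall k, Ker k -> q p k = 0] (exP g)).
have uniqP g p : Ker (p - g) -> (forall k, Ker k -> q p k = 0) -> P g = p.
  move=> h1 h2; have [h3 h4] := hP g.
  have hk : Ker (P g - p).
    have -> : P g - p = (P g - g) - (p - g) by rewrite opprB addrA subrK.
    by apply: KerD => //; apply: KerN.
  apply/eqP; rewrite -subr_eq0; apply/eqP; apply: (dot_eq0 (q := q)).
  by rewrite dotDl dotNl h4 // h2 // subrr.
have PD u v : P (u + v) = P u + P v.
  have [u1 u2] := hP u; have [v1 v2] := hP v; apply: uniqP => [|k hk].
    by rewrite opprD addrACA; apply: KerD.
  by rewrite dotDl u2 // v2 // addr0.
have PZ a u : P (a *: u) = a *: P u.
  have [u1 u2] := hP u; apply: uniqP => [|k hk].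
    by rewrite -scalerBr; apply: KerZ.
  by rewrite dotZl u2 // mulr0.
exists P; split=> [g|u v]; first by have [] := hP g.
apply: (polarization_form (b := fun u v => q (P u) (P v))).
- by move=> x y w; rewrite PD dotDl.
- by move=> a x w; rewrite PZ dotZl.
- by move=> x y; apply: dotC.
move=> g; rewrite -hnorm_sqC; congr ((_ ^+ 2)%:C%C).
have [g1 g2] := hP g.
have lbnd : lbound [set hnorm q g' | g' in [set g' | Ker (g' - g)]] (hnorm q (P g)).
  move=> _ [g' hg' <-]; rewrite -[g'](subrK (P g)) addrC; apply: hnorm_orth.
  apply: g2; have -> : g' - P g = (g' - g) - (P g - g) by rewrite opprB addrA subrK.
  by apply: KerD => //; apply: KerN.
apply/eqP; rewrite eq_le; apply/andP; split.
  apply: ge_inf; first by exists (hnorm q (P g)).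
  by exists (P g).
by apply: lb_le_inf => //; exists (hnorm q (P g)), (P g).
Qed.

End QuotientForm.

Section DHomog.
Variables (n d : nat) (R : nzRingType).
Implicit Types u v : dhomog n.+1 R d.

Lemma dhomog0E : (0 : dhomog n.+1 R d) = 0 :> {mpoly R[n.+1]}.
Proof. by []. Qed.
Lemma dhomogDE u v : u + v = (u : {mpoly R[n.+1]}) + v :> {mpoly R[n.+1]}.
Proof. by []. Qed.
Lemma dhomogZE c u : c *: u = c *: (u : {mpoly R[n.+1]}) :> {mpoly R[n.+1]}.
Proof. by []. Qed.

End DHomog.

Section JohnNorm.
Variables (R : realType) (n D : nat).
Local Notation C := R[i].
Variables (q : {dot 'rV[C]_n.+1 for conjc}) (j : {dot dhomog n.+1 C D for conjc}).

Lemma real_coord_inj (W : vectType C) : injective (@real_coord R W).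
Proof.
move=> u v /eq_row_mx[/rowP hre /rowP him].
have cE i : coord (vbasis {:W}) i u = coord (vbasis {:W}) i v.
  apply/eqP; rewrite eq_complex.
  by move: (hre i) (him i); rewrite !mxE => -> ->; rewrite !eqxx.
rewrite (coord_vbasis (memvf u)) (coord_vbasis (memvf v)).
by apply: eq_bigr => i _; rewrite cE.
Qed.

Lemma meval_bound (s : dhomog n.+1 C D) (y : 'I_n.+1 -> C) (M : C) :
  0 <= M -> (forall k, `|y k| <= M) ->
  `|meval y s| <= (\sum_(m <- msupp s) `|s@_m|) * M ^+ D.
Proof.
move=> M0 hM; rewrite mevalE mulr_suml; apply: le_trans (ler_norm_sum _ _ _) _.
rewrite !big_seq; apply: ler_sum => m ms; rewrite normrM ler_wpM2l // normr_prod.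
have -> : D = (\sum_i m i)%N.
  by rewrite -mdegE; have /dhomogP -> := dhomog_is_dhomog s.
rewrite expr_sum; apply: ler_prod => i _; rewrite normrX exprn_ge0 //=.
by rewrite lerXn2r // nnegrE.
Qed.

(** A [sup] is an upper bound only for a set that is bounded above. If [y k] is the coordinate of
    largest modulus, the quotient norm at [y] is at most the norm of the k-th basis vector divided
    by the modulus of [y k], which compensates the growth of the polynomial. *)
Lemma fs_norm_le_sup (s : dhomog n.+1 C D) y : (exists k, y k != 0) ->
  fs_norm q s y <= sup_norm q s.
Proof.
move=> y0; apply: ub_le_sup; last by exists y.
exists ((\sum_(m <- msupp s) Normc.normc s@_m)
  * \sum_k (hnorm q (delta_mx 0 k)) ^+ D) => _ [{y0}y y0 <-].
have [k _ hk] : exists2 k, true & forall i, Normc.normc (y i) <= Normc.normc (y k).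
  case: (Order.TotalTheory.arg_maxP (i0 := ord0) (P := xpredT)
     (fun i => Normc.normc (y i)) isT) => k _ hk.
  by exists k => // i; apply: hk.
have yk0 : y k != 0.
  have [i yi] := y0; apply: contraNneq yi => yk; have := hk i.
  rewrite yk Normc.normc0 => h; apply/eqP/Normc.eq0_normc.
  by apply/eqP; rewrite eq_le h normc_ge0.
have Nk := normc_gt0 yk0.
have h1 : Normc.normc (meval y s)
    <= (\sum_(m <- msupp s) Normc.normc s@_m) * Normc.normc (y k) ^+ D.
  have := @meval_bound s y `|y k| (normr_ge0 _).
  rewrite -lecR rmorphM rmorphXn rmorph_sum /= -!normcE_C => hb.
  apply: le_trans (hb _) _; last by rewrite ler_wpM2r ?exprn_ge0 // ler_sum // => m _; rewrite normcE_C.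
  by move=> i; rewrite !normcE_C lecR.
have h2 : quotient_norm q y 1 <= hnorm q (delta_mx 0 k) / Normc.normc (y k).
  rewrite mulrC -Normc.normcV -hnormZ; apply: quotient_norm_le.
  rewrite (bigD1 k) //= !mxE !eqxx mulr1 mulVf // big1 ?addr0 // => i ik.
  by rewrite !mxE (negbTE ik) mulr0 mul0r.
have q0 := ltW (quotient_norm_gt0 q y0).
rewrite /fs_norm; apply: le_trans (ler_pM _ _ h1 (lerXn2r D _ _ h2)) _;
  rewrite ?nnegrE ?normc_ge0 ?exprn_ge0 ?divr_ge0 ?hnorm_ge0 ?normc_ge0 //.
rewrite expr_div_n -mulrA [X in _ * X]mulrCA divff ?expf_neq0 ?gt_eqF // mulr1.
rewrite ler_wpM2l ?sumr_ge0 //; first by move=> *; apply: normc_ge0.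
by rewrite (bigD1 k) //= lerDl sumr_ge0 // => i _; rewrite exprn_ge0 // hnorm_ge0.
Qed.

Hypothesis hj : is_john_norm q j.

(** The John ball is contained in the unit ball of the sup norm, and [s] is scaled into it.
    Injectivity of [real_coord] brings the inclusion back from real coordinates to sections. *)
Lemma john_evaluation (s : dhomog n.+1 C D) y : (exists k, y k != 0) ->
  Normc.normc (meval y s) * quotient_norm q y 1 ^+ D <= hnorm j s.
Proof.
move=> y0; have [_ sub _] := hj.
have unit (u : dhomog n.+1 C D) : hnorm j u <= 1 -> fs_norm q u y <= 1.
  move=> hu; have [|u' hu' /real_coord_inj e] := sub (real_coord u); first by exists u.
  by rewrite -e; apply: le_trans (fs_norm_le_sup _ y0) hu'.
have [->|s0] := eqVneq s 0.
  by rewrite dhomog0E meval0 Normc.normc0 mul0r hnorm_ge0.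
have c0 : 0 < hnorm j s.
  by rewrite lt_def hnorm_ge0 andbT; apply: contraNneq s0 => /hnorm_eq0 ->.
have nc : Normc.normc ((hnorm j s)^-1)%:C%C = (hnorm j s)^-1.
  by rewrite normc_real // invr_ge0 ltW.
have := unit (((hnorm j s)^-1)%:C%C *: s).
rewrite hnormZ nc mulVf ?gt_eqF // => /(_ (lexx _)).
by rewrite /fs_norm dhomogZE mevalZ Normc.normcM nc -mulrA ler_pdivrMl // mulr1.
Qed.

End JohnNorm.

Section ArchimedeanBound.
Variables (R : realType) (K : fieldExtType rat) (n D : nat).
Variable I : prime_idealr {mpoly K[n.+1]}.
Local Notation C := R[i].
Variable h : embedding K R -> {dot 'rV[C]_n.+1 for conjc}.
Variable john : embedding K R -> {dot dhomog n.+1 C D for conjc}.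
Hypothesis hjohn : forall sigma, is_john_norm (h sigma) (john sigma).

Lemma meval_map_mpoly (sigma : {rmorphism K -> C}) (x : 'I_n.+1 -> K) f :
  meval (fun k => sigma (x k)) (map_mpoly sigma f) = sigma (meval x f).
Proof.
rewrite [in LHS](mpolyE f) [in RHS]mevalE [RHS]rmorph_sum.
rewrite (raddf_sum (map_mpoly sigma)) (raddf_sum (meval _)); apply: eq_bigr => m _.
transitivity (meval (fun k => sigma (x k)) (sigma f@_m *: 'X_[m])).
  congr (meval _ _); apply/mpolyP => k; rewrite -[LHS]/(map_mpoly sigma (f@_m *: 'X_[m]))@_k.
  by rewrite mcoeff_map_mpoly !mcoeffZ !mcoeffX [LHS]rmorphM /= [X in _ * X]rmorph_nat.
rewrite mevalZ mevalX [RHS]rmorphM /= [X in _ = _ * X]rmorph_prod; congr (_ * _).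
by apply: eq_bigr => i _; rewrite rmorphXn.
Qed.

Lemma base_changeE (sigma : embedding K R) (f : dhomog n.+1 K D) :
  base_change sigma f = map_mpoly sigma f :> {mpoly C[n.+1]}.
Proof.
rewrite /base_change /indhomog -[LHS]/(val _) insubdK //.
apply/dhomogP => m; rewrite mcoeff_msupp mcoeff_map_mpoly fmorph_eq0 -mcoeff_msupp.
by have /dhomogP := dhomog_is_dhomog f; apply.
Qed.

Lemma meval_base_change (sigma : embedding K R) (x : 'rV[K]_n.+1) (f : dhomog n.+1 K D) :
  meval (fun k => sigma (x 0 k)) (base_change sigma f) = sigma (evaluate x f).
Proof. by rewrite base_changeE meval_map_mpoly. Qed.

(** The forms [l a], evaluation at [x a] scaled by the metric there, have norm at most 1 and vanish
    on the sections that vanish on [X]. They take the same values on the lifts of least norm [u b],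
    and [FD_product] is the Gram matrix of these lifts. *)
Lemma archimedean_bound (sigma : embedding K R) r (v : 'I_r -> cone_field I)
    (x : 'I_r -> 'rV[K]_n.+1) :
  let Delta := \det (\matrix_(b, a) evaluate (x a) (lift_section D (v b))) in
  (forall a, rational_point I (x a)) -> Delta != 0 ->
  (Normc.normc (sigma Delta) *
   \prod_a (quotient_norm (h sigma) (fun k => sigma (x a 0 k)) 1) ^+ D) ^+ 2
  <= complex.Re (\det (\matrix_(i, l) FD_product john sigma (v i) (v l))).
Proof.
move=> Delta hx D0.
pose nu a := (quotient_norm (h sigma) (fun k => sigma (x a 0 k)) 1) ^+ D.
have x0 a : exists k, sigma (x a 0 k) != 0.
  have [/rV0Pn[k xk] _] := hx a.
  by exists k; rewrite fmorph_eq0.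
have nu0 a : 0 < nu a by rewrite exprn_gt0 // quotient_norm_gt0.
pose l a (g : dhomog n.+1 C D) : C := (nu a)%:C%C * meval (fun k => sigma (x a 0 k)) g.
have lD a g g' : l a (g + g') = l a g + l a g'.
  by rewrite /l dhomogDE mevalD mulrDr.
have lZ a c g : l a (c *: g) = c * l a g.
  by rewrite /l dhomogZE mevalZ; ring.
have lb a g : Normc.normc (l a g) <= hnorm (john sigma) g.
  rewrite /l Normc.normcM normc_real ?(ltW (nu0 a)) // mulrC.
  exact: (john_evaluation (hjohn sigma) g (x0 a)).
have [P [hP hpol]] := quotient_form (john sigma) (base_change sigma @`
    [set f : dhomog n.+1 K D | (f : {mpoly K[n.+1]}) \in I]).
have lP a g : l a (P g) = l a g.
  rewrite -[P g](subrK g) lD; suff -> : l a (P g - g) = 0 by rewrite add0r.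
  have l0 : l a 0 = 0 by rewrite -(scale0r (0 : dhomog n.+1 C D)) lZ mul0r.
  apply: (lspan_ind (P := fun k => l a k = 0) _ _ _ (hP g)) => //.
    by move=> u w e1 e2; rewrite lD e1 e2 addr0.
  move=> c _ _ [f fI <-]; rewrite lZ /l meval_base_change.
  by have [_ ->] := hx a; rewrite // rmorph0 !mulr0.
pose u b := P (base_change sigma (lift_section D (v b))).
have detE : \det (\matrix_(b, a) l a (u b)) = sigma Delta * (\prod_a nu a)%:C%C.
  have -> : \matrix_(b, a) l a (u b)
      = map_mx sigma (\matrix_(b, a) evaluate (x a) (lift_section D (v b)))
        *m diag_mx (\row_a (nu a)%:C%C).
    apply/matrixP => b a; rewrite mul_mx_diag !mxE lP /l meval_base_change mulrC //.
  rewrite det_mulmx det_map_mx det_diag rmorph_prod; congr (_ * _).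
  by apply: eq_bigr => a _; rewrite mxE.
have := @det_le_gram R _ (john sigma) r u l lD lZ lb.
rewrite detE Normc.normcM normc_real ?prodr_ge0 // => [|a _]; last exact: ltW.
have -> : \matrix_(i, l) FD_product john sigma (v i) (v l)
   = \matrix_(i, k) john sigma (u i) (u k).
  by apply/matrixP => i k; rewrite !mxE; apply: hpol.
apply; rewrite mulf_neq0 // ?fmorph_eq0 //.
by apply/prodf_neq0 => a _; rewrite gt_eqF.
Qed.

End ArchimedeanBound.

(** * Evaluation at rational points *)

Section Evaluation.
Variables (K : fieldExtType rat) (n : nat) (x : 'rV[K]_n.+1).

Lemma evaluateD f g : evaluate x (f + g) = evaluate x f + evaluate x g.
Proof. exact: mevalD. Qed.
Lemma evaluateB f g : evaluate x (f - g) = evaluate x f - evaluate x g.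
Proof. exact: mevalB. Qed.
Lemma evaluateM f g : evaluate x (f * g) = evaluate x f * evaluate x g.
Proof. exact: mevalM. Qed.
Lemma evaluateZ c f : evaluate x (c *: f) = c * evaluate x f.
Proof. exact: mevalZ. Qed.
Lemma evaluate1 : evaluate x 1 = 1. Proof. exact: meval1. Qed.
Lemma evaluate0 : evaluate x 0 = 0. Proof. exact: meval0. Qed.
Lemma evaluateC c : evaluate x c%:MP = c. Proof. exact: mevalC. Qed.
Lemma evaluateX f k : evaluate x (f ^+ k) = evaluate x f ^+ k.
Proof. by elim: k => [|k IH]; rewrite ?expr0 ?evaluate1 // !exprS evaluateM IH. Qed.
Lemma evaluate_prod m (f : 'I_m -> {mpoly K[n.+1]}) :
  evaluate x (\prod_i f i) = \prod_i evaluate x (f i).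
Proof. exact: (big_morph _ evaluateM evaluate1). Qed.
Lemma evaluate_linear e : evaluate x (linear_form e) = \sum_k e 0 k * x 0 k.
Proof.
rewrite /linear_form (big_morph _ evaluateD evaluate0).
by apply: eq_bigr => k _; rewrite evaluateZ /evaluate mevalXU.
Qed.

End Evaluation.

Section Restrict.
Variables (K : fieldExtType rat) (n : nat) (I : prime_idealr {mpoly K[n.+1]}).
Local Notation L := (cone_field I).
Local Notation rs := (Defs.restrict I).

Lemma restrict0 : rs 0 = 0.
Proof. by apply: (addrI (rs 0)); rewrite -restrictD !addr0. Qed.
Lemma restrictN f : rs (- f) = - rs f.
Proof. by apply: (addrI (rs f)); rewrite -restrictD !subrr restrict0. Qed.
Lemma restrictB f g : rs (f - g) = rs f - rs g.
Proof. by rewrite restrictD restrictN. Qed.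
Lemma cone_scaleE c (v : L) : c *: v = rs c%:MP * v. Proof. by []. Qed.
Lemma restrictZ c f : rs (c *: f) = c *: rs f.
Proof. by rewrite cone_scaleE -Defs.restrictM mul_mpolyC. Qed.
Lemma restrictX f k : rs (f ^+ k) = rs f ^+ k.
Proof. by elim: k => [|k IH]; rewrite ?expr0 ?Defs.restrict1 // !exprS Defs.restrictM IH. Qed.
Lemma restrict_prod m (f : 'I_m -> {mpoly K[n.+1]}) :
  rs (\prod_i f i) = \prod_i rs (f i).
Proof. exact: (big_morph _ (@Defs.restrictM _ _ I) (@Defs.restrict1 _ _ I)). Qed.

Definition cone_const (a : K) : L := rs a%:MP.

Lemma cone_const_is_zmod_morphism : zmod_morphism cone_const.
Proof. by move=> a b; rewrite /cone_const mpolyCB restrictB. Qed.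
Lemma cone_const_is_monoid_morphism : monoid_morphism cone_const.
Proof.
by split=> [|a b]; rewrite /cone_const ?mpolyC1 ?Defs.restrict1 // mpolyCM Defs.restrictM.
Qed.
HB.instance Definition _ :=
  GRing.isZmodMorphism.Build K L cone_const cone_const_is_zmod_morphism.
HB.instance Definition _ :=
  GRing.isMonoidMorphism.Build K L cone_const cone_const_is_monoid_morphism.

Variable x : 'rV[K]_n.+1.
Hypothesis hx : rational_point I x.

Lemma evaluate_restrict f g : rs f = rs g -> evaluate x f = evaluate x g.
Proof.
move=> e; apply/eqP; rewrite -subr_eq0 -evaluateB; apply/eqP.
by case: hx => _; apply; rewrite -restrict_eq0 restrictB e subrr.
Qed.

Lemma evaluate_restrict_neq0 f : evaluate x f != 0 -> rs f != 0.
Proof.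
by apply: contraNneq => e; apply/eqP; rewrite -[RHS](evaluate0 x); apply: evaluate_restrict; rewrite restrict0.
Qed.

End Restrict.

Section Sym.
Variables (K : fieldExtType rat) (n : nat) (E : set 'rV[K]_n.+1).
Local Notation O := (ring_of_integers K).
Local Notation lf := (@linear_form K n).
Let hO : subring O := OK_subring K.
Hypothesis hE : submodule O E.

Lemma symD d f g : sym E d f -> sym E d g -> sym E d (f + g).
Proof. exact: lspanD. Qed.
Lemma symZ d c f : O c -> sym E d f -> sym E d (c *: f).
Proof. by move=> Oc; apply: lspanZ => // a b; apply: subringM. Qed.
Lemma symN d f : sym E d f -> sym E d (- f).
Proof. by rewrite -scaleN1r; apply: symZ; apply: (subringN hO); apply: (subring1 hO). Qed.
Lemma symB d f g : sym E d f -> sym E d g -> sym E d (f - g).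
Proof. by move=> hf hg; apply: symD => //; apply: symN. Qed.
Lemma sym_zero d : sym E d 0. Proof. exact: lspan0. Qed.

Lemma symM d e f g : sym E d f -> sym E e g -> sym E (d + e) (f * g).
Proof.
move=> hf hg; apply: (lspan_ind (P := fun f => sym E (d + e) (f * g)) _ _ _ hf).
- by rewrite mul0r; apply: sym_zero.
- by move=> u v hu hv; rewrite mulrDl; apply: symD.
move=> a _ Oa [l El ->]; rewrite -scalerAl; apply: symZ => //.
apply: (lspan_ind (P := fun g => sym E (d + e) (_ * g)) _ _ _ hg).
- by rewrite mulr0; apply: sym_zero.
- by move=> u v hu hv; rewrite mulrDr; apply: symD.
move=> b _ Ob [l' El' ->]; rewrite -scalerAr; apply: symZ => //.
apply: lspan_mem; first exact: (subring1 hO).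
exists (fun i => match fintype.split i with inl j => l j | inr j => l' j end).
  by move=> i; case: fintype.split.
rewrite big_split_ord; congr (_ * _); apply: eq_bigr => i _.
  by rewrite -[lshift _ _]/(unsplit (inl i)) unsplitK.
by rewrite -[rshift _ _]/(unsplit (inr i)) unsplitK.
Qed.

Lemma sym0P f : sym E 0 f <-> exists2 c, O c & f = c%:MP.
Proof.
split=> [|[c Oc ->]].
  move: f; apply: (lspan_ind (P := fun f => exists2 c, O c & f = c%:MP))
    => [|_ _ [c Oc ->] [c' Oc' ->]|a _ Oa [l _ ->]].
  - by exists 0; rewrite ?mpolyC0 //; apply: (subring0 hO).
  - by exists (c + c'); rewrite ?mpolyCD //; apply: (subringD hO).
  - by exists a; rewrite // big_ord0 -mul_mpolyC mulr1.
rewrite -[c%:MP]mulr1 mul_mpolyC; apply: lspan_smul => //.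
exists (fun=> 0); last by rewrite big_ord0.
by case.
Qed.

Lemma linear_formD e e' : lf (e + e') = lf e + lf e'.
Proof. by rewrite /linear_form -big_split; apply: eq_bigr => k _; rewrite mxE scalerDl. Qed.
Lemma linear_formZ c e : lf (c *: e) = c *: lf e.
Proof. by rewrite /linear_form scaler_sumr; apply: eq_bigr => k _; rewrite mxE scalerA. Qed.

Lemma sym1P f : sym E 1 f <-> exists2 e, E e & f = lf e.
Proof.
have [E0 ED EZ] := hE.
split=> [|[e Ee ->]].
  move: f; apply: (lspan_ind (P := fun f => exists2 e, E e & f = lf e))
    => [|_ _ [c Oc ->] [c' Oc' ->]|a _ Oa [l El ->]].
  - by exists 0 => //; rewrite -(scale0r (0 : 'rV_n.+1)) linear_formZ scale0r.
  - by exists (c + c'); rewrite ?linear_formD //; apply: (ED).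
  - by exists (a *: l ord0); rewrite ?linear_formZ ?big_ord1 //; apply: (EZ).
apply: lspan_mem; first exact: (subring1 hO).
by exists (fun=> e); rewrite ?big_ord1.
Qed.

Lemma symX e d : E e -> sym E d (lf e ^+ d).
Proof.
move=> Ee; apply: lspan_mem; first exact: (subring1 hO).
by exists (fun=> e) => //; rewrite prodr_const card_ord.
Qed.

Lemma symS_ind d (P : {mpoly K[n.+1]} -> Prop) :
  P 0 -> (forall u v, P u -> P v -> P (u + v)) ->
  (forall e g, E e -> sym E d g -> P (lf e * g)) -> forall f, sym E d.+1 f -> P f.
Proof.
move=> P0 PD PM f; apply: lspan_ind => // a _ Oa [l El ->].
rewrite big_ord_recl scalerAr; apply: PM => //; apply: lspan_smul => //.
by exists (fun i => l (lift ord0 i)).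
Qed.

Section PullBack.
Variable x : 'rV[K]_n.+1.
Local Notation ev := (evaluate x).

Lemma pull_back_submodule d : submodule O (pull_back E x d).
Proof.
split.
- by exists 0; [exact: sym_zero|rewrite evaluate0].
- by move=> _ _ [f hf <-] [g hg <-]; exists (f + g); [exact: symD|rewrite evaluateD].
- by move=> c _ Oc [f hf <-]; exists (c *: f); [exact: symZ|rewrite evaluateZ].
Qed.

Lemma pull_back0 : pull_back E x 0 = O.
Proof.
apply/seteqP; split=> [_ [f /sym0P[c Oc ->] <-]|c Oc]; first by rewrite evaluateC.
by exists c%:MP; [apply/sym0P; exists c|rewrite evaluateC].
Qed.

Lemma pull_backM d e a b : pull_back E x d a -> pull_back E x e b ->
  pull_back E x (d + e) (a * b).
Proof.
by move=> [f hf <-] [g hg <-]; exists (f * g); [exact: symM|rewrite evaluateM].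
Qed.

Lemma pull_backS d : pull_back E x d.+1 = prodset (pull_back E x 1) (pull_back E x d).
Proof.
apply/seteqP; split.
  move=> _ [f hf <-]; move: f hf.
  have [q0 qD qZ] := prodset_sub (pull_back E x 1) (pull_back E x d).
  apply: symS_ind => [|u v hu hv|e g Ee hg].
  - by rewrite evaluate0.
  - by rewrite evaluateD; apply: (qD).
  rewrite evaluateM; apply: prodset_mem; last by exists g.
  by exists (lf e) => //; apply/sym1P; exists e.
apply: lspan_sub; first exact: pull_back_submodule.
by move=> _ [a [b [ha hb ->]]]; rewrite -add1n; apply: pull_backM.
Qed.

End PullBack.

End Sym.

(** If [y] were not in [B], some [u y] with [u] in [O] would have a maximal ideal as annihilator
    modulo [B]; the [c] belonging to that ideal lies in the annihilator, a contradiction. The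
    element [b] provides a positive integer [m] with [m y] in [B], which makes the number of classes
    finite. *)
Lemma local_global (R : realType) (K : fieldExtType rat) (B : set K) (b y : K) :
  let O := ring_of_integers K in
  submodule O (B : set K^o) -> B b -> b != 0 ->
  (forall p, maximal_ideal O p -> exists c, [/\ O c, ~ p c & B (c * y)]) -> B y.
Proof.
move=> O hB Bb b0 hloc; apply: contrapT => nB.
have hO : subring O := OK_subring K.
have [B0 BD BZ] := hB.
have [m m0 Om] := OK_multiple (y / b).
have Bm : B (m%:R * y).
  by have := BZ _ _ Om Bb; rewrite -[_ *: _]/(_ * _) -mulrA divfK.
pose N : set K := [set o | O o /\ B (o * y)].
have hN : submodule O (N : set K^o).
  split.
  - by split; [exact: (subring0 hO)|rewrite mul0r].
  - by move=> u v [Ou Bu] [Ov Bv]; split; [exact: (subringD hO)|rewrite mulrDl; apply: (BD)].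
  - move=> a u Oa [Ou Bu]; split; first exact: (subringM hO).
    by rewrite -[a *: u]/(a * u) -mulrA; apply: (BZ).
have OO : submodule O (O : set K^o).
  by split; [exact: (subring0 hO)|exact: (subringD hO)|exact: (subringM hO)].
have [T [kap hkap]] := OK_sep_nat K R m0.
have [u [Ou nu hmax]] : exists u, [/\ O u, ~ N u & maximal_ideal O [set o | O o /\ N (o * u)]].
  apply: (exists_simple (kap := kap) OO hN) => [u v Ou Ov e|].
  have [o Oo ->] := hkap u v Ou Ov e; split.
      by apply: (subringM hO) => //; apply: (subring_nat hO).
    by rewrite mulrAC mulrC; apply: (BZ).
  by exists 1; [exact: (subring1 hO)|case=> _; rewrite mul1r].
have [c [Oc npc Bc]] := hloc _ hmax; apply: npc; split=> //; split.
  exact: (subringM hO).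
by rewrite mulrAC mulrC; apply: (BZ).
Qed.

Section Reduction.
Variables (R : realType) (K : fieldExtType rat) (n : nat) (E : set 'rV[K]_n.+1).
Variable I : prime_idealr {mpoly K[n.+1]}.
Local Notation O := (ring_of_integers K).
Local Notation lf := (@linear_form K n).
Local Notation L := (cone_field I).
Local Notation rs := (Defs.restrict I).
Let hO : subring O := OK_subring K.
Hypothesis hE : submodule O E.
Hypothesis projE : fg_projective O E.
Hypothesis genE : lspan setT E = setT.
Variables (p : set K) (w : K).
Local Notation Op := (localize O p).
Hypotheses (hp : maximal_ideal O p) (pw : p w) (w0 : w != 0) (wV : ~ Op w^-1).
Hypothesis dvr : forall a, Op a -> a != 0 ->
  exists k u, [/\ Op u, Op u^-1 & a = u * w ^+ k].
Hypothesis hw : forall y, p y -> Op (y / w).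
Let hOp : subring Op := loc_subring hp.
Let Ow : Op w := loc_sub hp (maxi_sub hp pw).

Definition local_gen (x e0 : 'rV[K]_n.+1) : Prop :=
  [/\ E e0, evaluate x (lf e0) != 0
    & forall e, E e -> Op (evaluate x (lf e) / evaluate x (lf e0))].

(** One of the values at [x] of a finite generating family of [E] has least valuation; they do not
    all vanish because [E] spans [K^(n+1)] and [x] is not zero. *)
Lemma exists_local_gen x : x != 0 -> exists e0, local_gen x e0.
Proof.
move=> x0; have [m [e [phi [Ee Ophi _ _ eE]]]] := projE.
have evE v : E v -> evaluate x (lf v) = \sum_i phi i v * evaluate x (lf (e i)).
  move=> /eE {1}->; rewrite evaluate_linear.
  under [RHS]eq_bigr => i _ do rewrite evaluate_linear mulr_sumr.
  rewrite exchange_big; apply: eq_bigr => k _ /=.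
  by rewrite summxE mulr_suml; apply: eq_bigr => i _; rewrite mxE mulrA.
have [|i0 [n0 hi0]] := dvr_min hOp Ow w0 dvr (loc_frac hp)
    (c := fun i : 'I_m => evaluate x (lf (e i))).
  apply: contrapT => /forallNP h; case/negP: x0; apply/eqP/rowP => k.
  have h0 v : E v -> evaluate x (lf v) = 0.
    move=> /evE ->; rewrite big1 // => i _; have /negP := h i.
    by rewrite negbK => /eqP ->; rewrite mulr0.
  have hk : lspan setT E (delta_mx 0 k) by rewrite genE.
  rewrite [RHS]mxE.
  have : evaluate x (lf (delta_mx 0 k)) = 0.
    apply: (lspan_ind (P := fun v => evaluate x (lf v) = 0) _ _ _ hk).
    - by rewrite evaluate_linear big1 // => i _; rewrite mxE mul0r.
    - by move=> u v hu hv; rewrite linear_formD evaluateD hu hv addr0.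
    - by move=> a v _ Ev; rewrite linear_formZ evaluateZ h0 // mulr0.
  rewrite evaluate_linear (bigD1 k) //= mxE !eqxx mul1r big1 ?addr0 // => j jk.
  by rewrite mxE (negbTE jk) andbF mul0r.
exists (e i0); split=> // v Ev; rewrite evE // mulr_suml.
apply: (subring_sum hOp) => i _; rewrite -mulrA; apply: (subringM hOp); last exact: hi0.
by apply: (loc_sub hp); apply: Ophi.
Qed.

Lemma not_loc_unit a : a != 0 -> Op a^-1 -> ~ Op (a / w).
Proof.
move=> a0 Oa Oaw; apply: wV.
by rewrite -[w^-1](mulKf a0); apply: (subringM hOp).
Qed.

Section LocalGen.
Variables (x e0 : 'rV[K]_n.+1).
Hypothesis hx : rational_point I x.
Hypothesis he0 : local_gen x e0.
Local Notation ev := (evaluate x).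
Local Notation l0 := (evaluate x (lf e0)).

Let l0n : l0 != 0. Proof. by case: he0. Qed.
Let l0d d : l0 ^+ d != 0. Proof. by rewrite expf_neq0. Qed.

Lemma pull_back_loc d y : pull_back E x d y -> Op (y / l0 ^+ d).
Proof.
move=> [f hf <-].
apply: (lspan_ind (P := fun f => Op (ev f / l0 ^+ d)) _ _ _ hf).
- by rewrite evaluate0 mul0r; apply: (subring0 hOp).
- by move=> u v hu hv; rewrite evaluateD mulrDl; apply: (subringD hOp).
move=> a _ Oa [l El ->]; rewrite evaluateZ -mulrA; apply: (subringM hOp).
  exact: (loc_sub hp).
rewrite evaluate_prod -[d in X in _ / X]card_ord -prodr_const -prodf_div.
by apply: (subring_prod hOp) => i _; case: he0 => _ _; apply.
Qed.

Lemma sym_loc d f : sym E d f -> Op (ev f / l0 ^+ d).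
Proof. by move=> hf; apply: pull_back_loc; exists f. Qed.

Lemma pull_back_gen d : pull_back E x d (l0 ^+ d).
Proof.
by exists (lf e0 ^+ d); [apply: symX; case: he0|rewrite evaluateX].
Qed.

(** For the converse, write [c y = w b l0^d] with [c] outside [p], and [c c' = 1 - z] with [z] in
    [p]. Then [y = c' w b l0^d + z y], where both coefficients are in [p]. *)
Lemma pull_back_max d y : pull_back E x d y ->
  (@lspan K K^o p (pull_back E x d) y <-> Op (y / l0 ^+ d / w)).
Proof.
move=> hy; split=> [|Oy].
  apply: (lspan_ind (P := fun y : K^o => Op (y / l0 ^+ d / w))).
  - by rewrite !mul0r; apply: (subring0 hOp).
  - by move=> u v hu hv; rewrite !mulrDl; apply: (subringD hOp).
  move=> a v pa hv; have -> : (a *: v) / l0 ^+ d / w = a / w * (v / l0 ^+ d).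
    by rewrite -[a *: v]/(a * v); ring.
  by apply: (subringM hOp); [exact: hw|exact: pull_back_loc].
have [b [c [Ob Oc nc e]]] := (localizeP p _).1 Oy.
have c0 := notp_neq0 hp nc.
have yE : c * y = w * b * l0 ^+ d.
  have -> : y = (y / l0 ^+ d / w) * w * l0 ^+ d by rewrite !divfK.
  by rewrite e; field.
have [c' [z [Oc' pz ez]]] := maxi_inv hp Oc nc.
have -> : y = (c' * w * b) *: (l0 ^+ d : K^o) + z *: (y : K^o).
  rewrite -[_ *: _]/(c' * w * b * l0 ^+ d) -[z *: y]/(z * y).
  rewrite -!mulrA (mulrA w) -yE mulrCA mulrA ez; ring.
apply: lspanD; apply: lspan_smul => //; last exact: pull_back_gen.
by rewrite -mulrA mulrCA mulrC; apply: (maxiZ hp) => //; apply: (subringM hO).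
Qed.

Lemma reductionP d f : sym E d f ->
  (reduction E I p x d (rs f) <-> Op (ev f / l0 ^+ d / w)).
Proof.
move=> hf; split=> [[g [hg hg' e]]|Of].
  rewrite -(evaluate_restrict hx e); apply/pull_back_max => //.
  by exists g.
exists f => //; split=> //; apply/pull_back_max => //.
by exists f.
Qed.

Lemma reduction_unit d g : sym E d g -> ~ reduction E I p x d (rs g) ->
  ev g != 0 /\ Op (l0 ^+ d / ev g).
Proof.
move=> hg ng; case: (unit_or_w hOp Ow w0 dvr (sym_loc hg)) => [h|[h1 h2]].
  by case: ng; apply/reductionP.
by move: h1 h2; rewrite mulf_eq0 negb_or invf_div => /andP[].
Qed.

Lemma unit_reduction d g : sym E d g -> ev g != 0 -> Op (l0 ^+ d / ev g) ->
  ~ reduction E I p x d (rs g).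
Proof.
move=> hg g0 Og /(reductionP hg); apply: not_loc_unit; last by rewrite invf_div.
by rewrite mulf_neq0 // invr_neq0 // l0d.
Qed.

Lemma reduction_model_point : model_point E (reduction E I p x).
Proof.
split.
- by move=> d _ [f [hf _] <-]; exists f.
- move=> d; split.
  + exists 0; rewrite ?restrict0 //; split; first exact: sym_zero.
    by rewrite evaluate0; apply: lspan0.
  + move=> _ _ [f [hf hf'] <-] [g [hg hg'] <-]; exists (f + g); last by rewrite restrictD.
    by split; [exact: symD|rewrite evaluateD; apply: lspanD].
  + move=> a _ Oa [f [hf hf'] <-]; exists (a *: f); last by rewrite restrictZ.
    split; first exact: symZ.
    apply/pull_back_max; first by exists (a *: f) => //; apply: symZ.
    rewrite evaluateZ -!mulrA; apply: (subringM hOp); first exact: (loc_sub hp).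
    by rewrite mulrA; apply/pull_back_max => //; exists f.
- move=> d e _ _ [f hf <-] [g [hg hg'] <-]; rewrite -Defs.restrictM.
  apply/reductionP; first exact: symM.
  rewrite evaluateM exprD.
  have -> : ev f * ev g / (l0 ^+ d * l0 ^+ e) / w
      = (ev f / l0 ^+ d) * (ev g / l0 ^+ e / w) by rewrite invfM; ring.
  apply: (subringM hOp); first exact: sym_loc.
  by apply/pull_back_max => //; exists g.
- move=> d e _ _ [f hf <-] [g hg <-]; rewrite -Defs.restrictM => h.
  apply: contrapT => /not_orP[/(reduction_unit hf)[f0 Of] /(reduction_unit hg)[g0 Og]].
  move: h; apply: unit_reduction; first exact: symM.
    by rewrite evaluateM mulf_neq0.
  by rewrite evaluateM exprD -mulf_div; apply: (subringM hOp).
- exists 1%N => // h.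
  have hl : sym E 1 (lf e0) by apply/sym1P => //; exists e0 => //; case: he0.
  have : reduction E I p x 1 (rs (lf e0)) by apply: h; exists (lf e0).
  by apply: unit_reduction; rewrite // expr1 divff //; apply: (subring1 hOp).
Qed.

Lemma stalk_loc D f : stalk E D (reduction E I p x) (rs f) -> Op (ev f / l0 ^+ D).
Proof.
move=> [d [_ [_ [[g hg <-] [g' hg' <-] ng e]]]].
have [g0 Og] := reduction_unit hg' ng.
have e1 : ev f * ev g' = ev g.
  rewrite -evaluateM; apply: (evaluate_restrict hx); rewrite Defs.restrictM e divfK //.
  exact: (evaluate_restrict_neq0 hx).
have -> : ev f / l0 ^+ D = (ev g / l0 ^+ (d + D)) * (l0 ^+ d / ev g').
  rewrite -e1 exprD; field; by rewrite g0 !l0d.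
by apply: (subringM hOp) => //; apply: sym_loc.
Qed.

Lemma pull_back_locally_principal d y : pull_back E x d y -> exists o y',
  [/\ O o, @lspan K K^o p (pull_back E x d) y' & y = o * l0 ^+ d + y'].
Proof.
move=> hy; have [o Oo ho] := loc_dense hp w0 hw 1 (pull_back_loc hy).
exists o, (y - o * l0 ^+ d); split=> //; last by rewrite subrKC.
have [_ qD qZ] := pull_back_submodule E x d.
apply/pull_back_max.
  apply: (qD) => //; rewrite -mulNr; apply: (qZ); last exact: pull_back_gen.
  exact: (subringN hO).
by rewrite mulrBl mulfK // -[w in X in _ / X]expr1.
Qed.

End LocalGen.

(** Whether [e] generates the fibre at [p] depends only on the reduction of the point, so one [e]
    serves for all the [P i]. *)
Lemma local_gen_of_reduction x e : rational_point I x -> E e ->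
  ~ reduction E I p x 1 (rs (lf e)) -> local_gen x e.
Proof.
move=> hx Ee ne; have [e0 he0] := exists_local_gen (proj1 hx).
have hl : sym E 1 (lf e) by apply/sym1P => //; exists e.
have [le0 Ole] := reduction_unit hx he0 hl ne; rewrite expr1 in Ole.
split=> // e' Ee'; have l0n : evaluate x (lf e0) != 0 by case: he0.
have -> : evaluate x (lf e') / evaluate x (lf e)
    = (evaluate x (lf e') / evaluate x (lf e0)) * (evaluate x (lf e0) / evaluate x (lf e)).
  by rewrite mulrA divfK.
apply: (subringM hOp) => //.
by case: he0 => _ _; apply.
Qed.

End Reduction.

(** * The local ring at a regular point *)

Section Localization.
Variables (F : fieldType) (A k0 : set F).
Hypothesis hA : subring A.
Hypothesis hk0 : ideal A k0.
Hypothesis k01 : ~ k0 1.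
Hypothesis prime0 : forall a b, A a -> A b -> k0 (a * b) -> k0 a \/ k0 b.
Local Notation Loc := (localize A k0).
Local Notation Max := (@lspan F F^o Loc k0).

Let k0A : k0 `<=` A. Proof. by case: hk0. Qed.
Let k00 : k0 0. Proof. by case: hk0 => _ []. Qed.
Let k0D a b : k0 a -> k0 b -> k0 (a + b). Proof. by case: hk0 => _ [_ + _]; apply. Qed.
Let k0Z a b : A a -> k0 b -> k0 (a * b). Proof. by case: hk0 => _ [_ _]; apply. Qed.
Let sM a b : A a -> A b -> ~ k0 a -> ~ k0 b -> ~ k0 (a * b).
Proof. by move=> Aa Ab na nb /(prime0 Aa Ab)[]. Qed.
Let s0 a : ~ k0 a -> a != 0. Proof. by apply: contra_notN => /eqP ->. Qed.

Lemma localize_mem a b : A a -> A b -> ~ k0 b -> Loc (a / b).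
Proof. by move=> Aa Ab nb; exists a => //; exists b. Qed.

Lemma localize_sub : A `<=` Loc.
Proof.
by move=> a Aa; rewrite -[a]divr1; apply: localize_mem => //; apply: (subring1 hA).
Qed.

Lemma localize_subring : subring Loc.
Proof.
split; first by apply: localize_sub; apply: (subring1 hA).
  move=> _ _ [a Aa [b [Ab nb] <-]] [a' Aa' [b' [Ab' nb'] <-]].
  have b0 := s0 nb; have b0' := s0 nb'.
  have -> : a / b - a' / b' = (a * b' - a' * b) / (b * b') by field; rewrite b0 b0'.
  apply: localize_mem; [|exact: (subringM hA)|exact: sM].
  by apply: (subringB hA); apply: (subringM hA).
move=> _ _ [a Aa [b [Ab nb] <-]] [a' Aa' [b' [Ab' nb'] <-]].
by rewrite mulf_div; apply: localize_mem; [exact: (subringM hA)..|exact: sM].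
Qed.

Lemma localize_max_sub : Max `<=` Loc.
Proof.
have hL := localize_subring.
move=> v; apply: (lspan_ind (V := F^o) (P := Loc)) => [|u u'|a x La kx].
- exact: (subring0 hL).
- exact: (subringD hL).
- by apply: (subringM hL) => //; apply: localize_sub; apply: k0A.
Qed.

Lemma localize_max_clear m : Max m -> exists s, [/\ A s, ~ k0 s & k0 (s * m)].
Proof.
move=> hm.
apply: (lspan_ind (V := F^o) (P := fun m => exists s, [/\ A s, ~ k0 s & k0 (s * m)]) _ _ _ hm).
- by exists 1; rewrite mulr0; split=> //; apply: (subring1 hA).
- move=> u v [s [As ns hs]] [s' [As' ns' hs']]; exists (s * s'); split.
  + exact: (subringM hA).
  + exact: sM.
  have -> : s * s' * (u + v) = s' * (s * u) + s * (s' * v) by ring.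
  by apply: k0D; apply: k0Z.
move=> _ x [a Aa [b [Ab nb] <-]] kx; exists b; split=> //.
rewrite -[_ *: _]/(a / b * x).
have -> : b * (a / b * x) = a * x by field; rewrite s0.
exact: k0Z.
Qed.

(** Finitely many denominators outside the prime [k0] occur, and their product clears them all. *)
Lemma localize_ideal_power k v : ideal_power Loc Max k v ->
  exists s, [/\ A s, ~ k0 s & ideal_power A k0 k (s * v)].
Proof.
move=> hv.
apply: (lspan_ind (V := F^o) (P := fun v => exists s, [/\ A s, ~ k0 s & ideal_power A k0 k (s * v)]) _ _ _ hv).
- by exists 1; rewrite mulr0; split; rewrite ?mulr0 //; [exact: (subring1 hA)|exact: ipow_zero].
- move=> u u' [s [As ns hs]] [s' [As' ns' hs']]; exists (s * s'); split.
  + exact: (subringM hA).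
  + exact: sM.
  rewrite mulrDr; apply: ipowD; first by rewrite -mulrA mulrCA; apply: (ipowZ hA).
  by rewrite -mulrA; apply: (ipowZ hA).
move=> _ _ [a Aa [b [Ab nb] <-]] [z hz ->].
have [s hs] : exists s : 'I_k -> F, forall i, [/\ A (s i), ~ k0 (s i) & k0 (s i * z i)].
  have h i := localize_max_clear (hz i).
  by exists (fun i => projT1 (cid (h i))) => i; case: (cid (h i)).
exists (b * \prod_i s i); split.
- by apply: (subringM hA) => //; apply: (subring_prod hA) => i _; have [] := hs i.
- apply: sM => //; first by apply: (subring_prod hA) => i _; have [] := hs i.
  suff [] : A (\prod_i s i) /\ ~ k0 (\prod_i s i) by [].
  apply: (big_ind (fun x => A x /\ ~ k0 x)).
  + by split=> //; apply: (subring1 hA).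
  + by move=> x y [Ax nx] [Ay ny]; split; [exact: (subringM hA)|exact: sM].
  + by move=> i _; have [] := hs i.
rewrite -[_ *: _]/(a / b * \prod_i z i).
have -> : b * \prod_i s i * (a / b * \prod_i z i) = a * \prod_i (s i * z i).
  rewrite big_split /=; field; exact: s0.
apply: (ipowZ hA) => //; apply: (ipow_prod hA) => i.
by have [] := hs i.
Qed.

End Localization.

Lemma frac_numden (A : idomainType) (y : {fraction A}) : exists a b : A,
  b != 0 /\ y = FracField.tofrac a / FracField.tofrac b.
Proof.
elim/quotW: y => x; have dx := denom_ratioP x.
exists (frac x).1, (frac x).2; split=> //.
apply: (canRL (mulfK _)); first by rewrite tofrac_eq0.
rewrite -[_ * _]/(FracField.mul _ _) !piE.
apply/eqmodP; rewrite /= FracField.equivfE /FracField.mulf !numden_Ratio ?mulf_neq0 ?oner_neq0 //.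
by rewrite !mulr1 mulrC.
Qed.

Lemma cone_field_generated (K : fieldExtType rat) n (I : prime_idealr {mpoly K[n.+1]}) :
  exists s : seq (cone_field I), forall S, subfield_set S ->
  (forall a, S (cone_const I a)) -> (forall x, x \in s -> S x) -> forall y, S y.
Proof.
exists [seq Defs.restrict I 'X_k | k : 'I_n.+1] => S [hS SV] SK Sx y.
have Sr f : S (Defs.restrict I f).
  rewrite (mpolyE f); elim/big_ind: _ => [|u v hu hv|m _].
  - by rewrite restrict0; apply: (subring0 hS).
  - by rewrite restrictD; apply: (subringD hS).
  rewrite -mul_mpolyC Defs.restrictM; apply: (subringM hS); first exact: SK.
  rewrite mpolyXE_id restrict_prod; apply: (subring_prod hS) => i _.
  rewrite restrictX; apply: (subringX hS); apply: Sx.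
  by apply/mapP; exists i => //; rewrite mem_enum.
have [a [b [b0 ->]]] := @frac_numden (quot_domain I) y.
have Sq (c : quot_domain I) : S (FracField.tofrac c).
  by elim/(@quotW _ {ideal_quot I}): c => f; exact: (Sr f).
by apply: (subringM hS) => //; apply: SV.
Qed.

Section Fractions.
Variable F : fieldType.
Implicit Types a b c d : F.

Lemma fracD a b c d : b != 0 -> d != 0 -> a / b + c / d = (a * d + c * b) / (b * d).
Proof. by move=> b0 d0; field; rewrite b0 d0. Qed.
Lemma fracB a b c d : b != 0 -> d != 0 -> a / b - c / d = (a * d - c * b) / (b * d).
Proof. by move=> b0 d0; field; rewrite b0 d0. Qed.
Lemma frac_cross a b c d : b != 0 -> d != 0 -> a / b = c / d -> a * d = c * b.
Proof. by move=> b0 d0 e; apply/eqP; rewrite -eqr_div // e. Qed.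
Lemma frac_comp a b c : b != 0 -> a / b * (b / c) = a / c.
Proof. by move=> b0; rewrite mulrA divfK. Qed.

Variables (A : set F) (hA : subring A) (D : F -> F) (hD : derivation_on setT D).
Variables (m : nat) (z : 'I_m -> F).

(** The differential of [a] is a combination of those of the [z i]. Sums, products and inverses in
    [A] preserve this property. *)
Definition der_in (a : F) : Prop :=
  A a /\ exists2 c : 'I_m -> F, forall i, A (c i) & D a = \sum_i c i * D (z i).

Lemma der_in_gen i : A (z i) -> der_in (z i).
Proof.
move=> Az; split=> //; exists (fun j => (j == i)%:R) => [j|]; first exact: (subring_nat hA).
rewrite (bigD1 i) //= eqxx mul1r big1 ?addr0 // => j /negbTE ->.
by rewrite mul0r.
Qed.

Lemma der_in0 a : A a -> D a = 0 -> der_in a.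
Proof.
move=> Aa Da; split=> //; exists (fun=> 0) => [i|]; first exact: (subring0 hA).
by rewrite Da big1 // => i _; rewrite mul0r.
Qed.

Lemma der_inD a b : der_in a -> der_in b -> der_in (a + b).
Proof.
move=> [Aa [c Ac ea]] [Ab [c' Ac' eb]]; split; first exact: (subringD hA).
exists (fun i => c i + c' i) => [i|]; first exact: (subringD hA).
by rewrite hD.1 // ea eb -big_split; apply: eq_bigr => i _; rewrite mulrDl.
Qed.

Lemma der_inM a b : der_in a -> der_in b -> der_in (a * b).
Proof.
move=> [Aa [c Ac ea]] [Ab [c' Ac' eb]]; split; first exact: (subringM hA).
exists (fun i => c i * b + a * c' i) => [i|].
  by apply: (subringD hA); apply: (subringM hA).
rewrite hD.2 // ea eb mulr_suml mulr_sumr -big_split; apply: eq_bigr => i _ /=.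
by ring.
Qed.

Lemma der_inV a : der_in a -> a != 0 -> A a^-1 -> der_in a^-1.
Proof.
move=> [Aa [c Ac ea]] a0 Av; split=> //; exists (fun i => - (a^-1 ^+ 2) * c i) => [i|].
  by apply: (subringM hA) => //; apply: (subringN hA); apply: (subringX hA).
have D1 : D 1 = 0.
  have := hD.2 1 1 Logic.I Logic.I; rewrite !mulr1 mul1r => /eqP.
  by rewrite -subr_eq subrr => /eqP.
have h : D a * a^-1 + a * D a^-1 = 0 by rewrite -hD.2 // mulfV.
have -> : D a^-1 = - (a^-1 ^+ 2) * D a.
  by apply: (mulfI a0); apply: (addrI (D a / a)); rewrite h; field.
by rewrite ea mulr_sumr; apply: eq_bigr => i _; rewrite mulrA.
Qed.

End Fractions.

Local Opaque Defs.restrict FracField.add FracField.mul FracField.opp FracField.inv.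

Section LocalRing.
Variables (R : realType) (K : fieldExtType rat) (n : nat) (E : set 'rV[K]_n.+1).
Variable I : prime_idealr {mpoly K[n.+1]}.
Local Notation O := (ring_of_integers K).
Local Notation lf := (@linear_form K n).
Local Notation L := (cone_field I).
Local Notation rs := (Defs.restrict I).
Local Notation iota := (cone_const I).
Let hO : subring O := OK_subring K.
Hypothesis hE : submodule O E.
Hypothesis projE : fg_projective O E.
Hypothesis genE : lspan setT E = setT.
Variables (p : set K) (w : K).
Local Notation Op := (localize O p).
Hypotheses (hp : maximal_ideal O p) (pw : p w) (w0 : w != 0) (wV : ~ Op w^-1).
Hypothesis dvr : forall a, Op a -> a != 0 ->
  exists k u, [/\ Op u, Op u^-1 & a = u * w ^+ k].
Hypothesis hw : forall y, p y -> Op (y / w).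
Let hOp : subring Op := loc_subring hp.
Let Ow : Op w := loc_sub hp (maxi_sub hp pw).
Variables (T : Type) (P : T -> 'rV[K]_n.+1) (xi : nat -> set L) (i1 : T).
Hypothesis hP : forall i, rational_point I (P i).
Hypothesis hxi : forall i, reduction E I p (P i) = xi.
Variable e0 : 'rV[K]_n.+1.
Hypothesis he1 : local_gen E p (P i1) e0.
Hypothesis hreg : regular_local (local_ring E xi).

Local Notation A := (local_ring E xi).
Local Notation ev i := (evaluate (P i)).
Local Notation pi i := (local_evaluation E xi (P i)).
Local Notation l0 := (rs (lf e0)).

Let Ee0 : E e0. Proof. by case: he1. Qed.
Let hl0 : sym E 1 (lf e0). Proof. by apply/sym1P => //; exists e0. Qed.

Lemma local_gen_all i : local_gen E p (P i) e0.
Proof.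
apply: (local_gen_of_reduction hE projE genE hp pw w0 dvr hw (hP i) Ee0).
rewrite hxi -(hxi i1).
apply: (unit_reduction hp pw w0 wV hw (hP i1) he1) => //; first by case: he1.
by rewrite expr1 divff; [exact: (subring1 hOp)|case: he1].
Qed.

Let ln i : ev i (lf e0) != 0. Proof. by case: (local_gen_all i). Qed.
Let lnd i d : ev i (lf e0) ^+ d != 0. Proof. exact: expf_neq0. Qed.
Let l00 : l0 != 0. Proof. exact: (evaluate_restrict_neq0 (hP i1) (ln i1)). Qed.

Let l0d d : l0 ^+ d != 0. Proof. exact: (expf_neq0 d l00). Qed.

Lemma xi_unit i d g : sym E d g -> ~ xi d (rs g) ->
  ev i g != 0 /\ Op (ev i (lf e0) ^+ d / ev i g).
Proof.
move=> hg; rewrite -(hxi i).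
exact: (reduction_unit hp pw w0 dvr hw (hP i) (local_gen_all i) hg).
Qed.

Lemma unit_xi i d g : sym E d g -> ev i g != 0 -> Op (ev i (lf e0) ^+ d / ev i g) ->
  ~ xi d (rs g).
Proof.
move=> hg; rewrite -(hxi i).
exact: (unit_reduction hp pw w0 wV hw (hP i) (local_gen_all i) hg).
Qed.

Lemma xiM d d' g g' : sym E d g -> sym E d' g' -> ~ xi d (rs g) -> ~ xi d' (rs g') ->
  ~ xi (d + d')%N (rs (g * g')).
Proof.
move=> hg hg' /(xi_unit i1 hg)[g0 Og] /(xi_unit i1 hg')[g0' Og'].
apply: (unit_xi (i := i1)); first exact: symM.
  by rewrite evaluateM mulf_neq0.
by rewrite evaluateM exprD -mulf_div; apply: (subringM hOp).
Qed.

Lemma xiX d : ~ xi d (rs (lf e0 ^+ d)).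
Proof.
apply: (unit_xi (i := i1)); first exact: symX.
  by rewrite evaluateX.
by rewrite evaluateX divff //; apply: (subring1 hOp).
Qed.

Lemma xi_neq0 d g : sym E d g -> ~ xi d (rs g) -> rs g != 0.
Proof. by move=> hg /(xi_unit i1 hg)[g0 _]; apply: (evaluate_restrict_neq0 (hP i1)). Qed.

Lemma local_ringP v : A v <-> exists d f g, [/\ sym E d f, sym E d g, ~ xi d (rs g)
  & v = rs f / rs g].
Proof.
split=> [[d [_ [_ [[f hf <-] [g hg <-] ng ->]]]]|[d [f [g [hf hg ng ->]]]]].
  by exists d, f, g; split=> //; move: hf; rewrite addn0.
by exists d, (rs f), (rs g); split=> //; [exists f; rewrite ?addn0|exists g].
Qed.

Lemma local_ring_mem d f g : sym E d f -> sym E d g -> ~ xi d (rs g) -> A (rs f / rs g).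
Proof. by move=> *; apply/local_ringP; exists d, f, g. Qed.

(** The value picked by [xget] does not depend on the fraction: elements with the same image in the
    cone field have the same value at [P i], because this point lies on [X]. *)
Lemma local_evaluationE i d f g : sym E d f -> sym E d g -> ~ xi d (rs g) ->
  pi i (rs f / rs g) = ev i f / ev i g.
Proof.
move=> hf hg ng; rewrite /local_evaluation; case: xgetP => [c -> /=|/(_ (ev i f / ev i g))]; last first.
  by case; exists d, f, g.
move=> [d' [f' [g' [hf' hg' ng' e ->]]]].
have [g0 _] := xi_unit i hg ng; have [g0' _] := xi_unit i hg' ng'.
have r0 := xi_neq0 hg ng; have r0' := xi_neq0 hg' ng'.
apply/eqP; rewrite eqr_div // -!evaluateM; apply/eqP; apply: (evaluate_restrict (hP i)).
by rewrite !Defs.restrictM; apply: (frac_cross r0' r0); rewrite e.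
Qed.

Lemma local_ring_subring : subring A.
Proof.
have s0 : sym E 0 1 by apply/sym0P; exists 1; [exact: (subring1 hO)|rewrite mpolyC1].
split.
- rewrite -[1]divr1 -(Defs.restrict1 I); apply: (local_ring_mem (d := 0)) => //.
  by have := @xiX 0; rewrite expr0.
- move=> _ _ /local_ringP[d [f [g [hf hg ng ->]]]] /local_ringP[d' [f' [g' [hf' hg' ng' ->]]]].
  have r0 := xi_neq0 hg ng; have r0' := xi_neq0 hg' ng'.
  have -> : rs f / rs g - rs f' / rs g' = rs (f * g' - f' * g) / rs (g * g').
    by rewrite restrictB !Defs.restrictM; exact: (fracB _ _ r0 r0').
  apply: (local_ring_mem (d := d + d')%N); [|exact: symM|exact: xiM].
  by apply: symB; [exact: symM|rewrite addnC; apply: symM].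
move=> _ _ /local_ringP[d [f [g [hf hg ng ->]]]] /local_ringP[d' [f' [g' [hf' hg' ng' ->]]]].
rewrite mulf_div -!Defs.restrictM.
by apply: (local_ring_mem (d := d + d')%N); [exact: symM..|exact: xiM].
Qed.
Let hA := local_ring_subring.

Lemma local_ring_const a : Op a -> A (iota a) /\ forall i, pi i (iota a) = a.
Proof.
move=> /localizeP[b [c [Ob Oc nc ->]]].
have c0 := notp_neq0 hp nc.
have sb : sym E 0 b%:MP by apply/sym0P; exists b.
have sc : sym E 0 c%:MP by apply/sym0P; exists c.
have nxc : ~ xi 0 (rs c%:MP).
  apply: (unit_xi (i := i1)); rewrite ?evaluateC //.
  by rewrite expr0 mul1r; apply: loc_inv.
have -> : iota (b / c) = rs b%:MP / rs c%:MP by rewrite fmorph_div.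
split; first exact: (local_ring_mem (d := 0)).
by move=> i; rewrite (local_evaluationE i sb sc nxc) !evaluateC.
Qed.

Lemma local_evaluation_loc i a : A a -> Op (pi i a).
Proof.
move=> /local_ringP[d [f [g [hf hg ng ->]]]]; rewrite (local_evaluationE i hf hg ng).
have [g0 Og] := xi_unit i hg ng.
have -> : ev i f / ev i g = (ev i f / ev i (lf e0) ^+ d) * (ev i (lf e0) ^+ d / ev i g).
  by rewrite mulrA divfK.
by apply: (subringM hOp) => //; apply: (sym_loc hp (local_gen_all i)).
Qed.

Lemma local_evaluationD i a b : A a -> A b -> pi i (a + b) = pi i a + pi i b.
Proof.
move=> /local_ringP[d [f [g [hf hg ng ->]]]] /local_ringP[d' [f' [g' [hf' hg' ng' ->]]]].
have r0 := xi_neq0 hg ng; have r0' := xi_neq0 hg' ng'.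
have [g0 _] := xi_unit i hg ng; have [g0' _] := xi_unit i hg' ng'.
have -> : rs f / rs g + rs f' / rs g' = rs (f * g' + f' * g) / rs (g * g').
  by rewrite restrictD !Defs.restrictM; exact: (fracD _ _ r0 r0').
rewrite (local_evaluationE i hf hg ng) (local_evaluationE i hf' hg' ng').
have h1 : sym E (d + d') (f * g' + f' * g).
  by apply: symD; [exact: symM|rewrite addnC; apply: symM].
rewrite (local_evaluationE i h1 (symM hg hg') (xiM hg hg' ng ng')).
by rewrite evaluateD !evaluateM; field; rewrite g0 g0'.
Qed.

Lemma local_evaluationM i a b : A a -> A b -> pi i (a * b) = pi i a * pi i b.
Proof.
move=> /local_ringP[d [f [g [hf hg ng ->]]]] /local_ringP[d' [f' [g' [hf' hg' ng' ->]]]].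
rewrite mulf_div -!Defs.restrictM.
rewrite (local_evaluationE i hf hg ng) (local_evaluationE i hf' hg' ng').
rewrite (local_evaluationE i (symM hf hf') (symM hg hg') (xiM hg hg' ng ng')).
by rewrite !evaluateM mulf_div.
Qed.

Lemma local_ringV i a : A a -> pi i a != 0 -> Op (pi i a)^-1 -> A a^-1.
Proof.
move=> /local_ringP[d [f [g [hf hg ng ->]]]].
have [g0 Og] := xi_unit i hg ng.
rewrite (local_evaluationE i hf hg ng) mulf_eq0 negb_or invf_div => /andP[f0 _] Of.
rewrite invf_div; apply: (local_ring_mem (d := d)) => //.
apply: (unit_xi (i := i)) => //.
have -> : ev i (lf e0) ^+ d / ev i f = (ev i (lf e0) ^+ d / ev i g) * (ev i g / ev i f).
  by rewrite mulrA divfK.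
exact: (subringM hOp).
Qed.

Lemma stalkP D v : stalk E D xi v <-> A (v / l0 ^+ D).
Proof.
have l0D := l0d D.
split.
  move=> [d [_ [_ [[f hf <-] [g hg <-] ng ->]]]].
  rewrite -mulrA -invfM -restrictX -Defs.restrictM.
  apply: (local_ring_mem (d := d + D)%N) => //; first by apply: symM => //; apply: symX.
  by apply: xiM => //; [exact: symX|exact: xiX].
move=> /local_ringP[d [f [g [hf hg ng e]]]].
exists d, (rs (f * lf e0 ^+ D)), (rs g); split=> //.
- by exists (f * lf e0 ^+ D) => //; apply: symM => //; apply: symX.
- by exists g.
by rewrite -[v](divfK l0D) e Defs.restrictM restrictX mulrAC.
Qed.

Lemma local_evaluation_section i D f : A (rs f / l0 ^+ D) ->
  pi i (rs f / l0 ^+ D) = ev i f / ev i (lf e0) ^+ D.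
Proof.
move=> /local_ringP[d [f' [g [hf' hg ng e]]]].
rewrite e (local_evaluationE i hf' hg ng).
have [g0 _] := xi_unit i hg ng; have r0 := xi_neq0 hg ng.
apply/eqP; rewrite eqr_div // -evaluateX -!evaluateM; apply/eqP; apply: (evaluate_restrict (hP i)).
rewrite !Defs.restrictM restrictX; exact: esym (frac_cross (l0d D) r0 e).
Qed.

Let ker : set L := [set a | A a /\ pi i1 a = 0].
Let maxM : set L := [set a | A a /\ exists2 o, Op o & pi i1 a = w * o].

Let pi1 i : pi i 1 = 1.
Proof.
have [_ h] := local_ring_const (subring1 hOp).
by rewrite -[RHS](h i) rmorph1.
Qed.
Let pi0 i : pi i 0 = 0.
Proof.
have [_ h] := local_ring_const (subring0 hOp).
by rewrite -[RHS](h i) rmorph0.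
Qed.

Let unit_pi a : A a -> (exists2 o, Op o & pi i1 a = w * o) \/ A a^-1.
Proof.
move=> Aa; have := unit_or_w hOp Ow w0 dvr (local_evaluation_loc i1 Aa).
case=> [h|[h1 h2]]; [left|right].
  by exists (pi i1 a / w) => //; rewrite mulrC divfK.
exact: (local_ringV Aa h1 h2).
Qed.

Lemma local_maximal : maximal_ideal A maxM.
Proof.
split.
- split=> [a []//|]; split.
  + split; first exact: (subring0 hA).
    by exists 0; [exact: (subring0 hOp)|rewrite mulr0 pi0].
  + move=> a b [Aa [o Oo ea]] [Ab [o' Oo' eb]]; split; first exact: (subringD hA).
    exists (o + o'); first exact: (subringD hOp).
    by rewrite local_evaluationD // ea eb mulrDr.
  + move=> a b Aa [Ab [o Oo eb]]; split; first exact: (subringM hA).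
    exists (pi i1 a * o); first by apply: (subringM hOp) => //; apply: local_evaluation_loc.
    by rewrite local_evaluationM // eb mulrCA.
- move=> [_ [o Oo]]; rewrite pi1 => e; apply: wV.
  by rewrite -[w^-1]mulr1 e mulKf.
move=> J [JA [J0 JD JZ]] J1 sub; apply/seteqP; split=> // a Ja.
have Aa := JA _ Ja; split=> //; case: (unit_pi Aa) => // Av.
have [a0|a0] := eqVneq a 0.
  by exists 0; rewrite ?a0 ?pi0 ?mulr0 //; apply: (subring0 hOp).
case: J1; rewrite -(mulVf a0); exact: (JZ).
Qed.

(** After division by powers of [l0], the elements of [A] are quotients of polynomials over [Op] in
    the [rs (lf (e i)) / l0], with [e i] running over generators of [E]. The differentials of these
    finitely many elements therefore generate. *)
Lemma local_derivation : exists m (z : 'I_m -> L), (forall i, A (z i)) /\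
  forall D, derivation_on setT D -> (forall a, D (iota a) = 0) ->
  forall a, A a -> exists2 c : 'I_m -> L, forall i, A (c i)
    & D a = \sum_i c i * D (z i).
Proof.
have [m [e [phi [Ee Ophi _ _ eE]]]] := projE.
pose z i := rs (lf (e i)) / l0.
have Alf e' : E e' -> A (rs (lf e') / l0).
  move=> Ee'; apply: (local_ring_mem (d := 1)) => //; first by apply/sym1P => //; exists e'.
  by have := @xiX 1; rewrite expr1.
exists m, z; split=> [i|D hD DK]; first exact: Alf.
pose Q := der_in A D z.
have Qz i : Q (z i) by apply: (der_in_gen hA); apply: Alf.
have QK a : Op a -> Q (iota a).
  by move=> /local_ring_const[Aa _]; apply: (der_in0 hA).
have QD a b : Q a -> Q b -> Q (a + b) by apply: (der_inD hA hD).
have QM a b : Q a -> Q b -> Q (a * b) by apply: (der_inM hA hD).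
have Q0 : Q 0 by rewrite -(rmorph0 iota); apply: QK; apply: (subring0 hOp).
have Qlf e' : E e' -> Q (rs (lf e') / l0).
  move=> Ee'; have -> : rs (lf e') / l0 = \sum_i iota (phi i e') * z i.
    rewrite {1}(eE e' Ee').
    rewrite (big_morph lf (@linear_formD K n) (id1 := 0)); last first.
      by rewrite -(scale0r (0 : 'rV[K]_n.+1)) linear_formZ scale0r.
    rewrite (big_morph rs (@restrictD K n I) (restrict0 I)) mulr_suml.
    by apply: eq_bigr => i _; rewrite linear_formZ restrictZ cone_scaleE -mulrA.
  apply: (big_ind Q) => // i _; apply: QM => //; apply: QK; apply: (loc_sub hp); exact: Ophi.
have Qs d f : sym E d f -> Q (rs f / l0 ^+ d).
  elim: d f => [|d IH] f.
    move=> /sym0P[c Oc ->]; rewrite expr0 divr1; apply: QK; exact: (loc_sub hp).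
  move: f; apply: symS_ind => [|u v hu hv|e' g Ee' hg].
  - by rewrite restrict0 mul0r.
  - by rewrite restrictD mulrDl; apply: QD.
  rewrite Defs.restrictM exprS -mulf_div; apply: QM; [exact: Qlf|exact: IH].
move=> a /local_ringP[d [f [g [hf hg ng ->]]]].
have r0 := xi_neq0 hg ng.
have ld := l0d d.
have -> : rs f / rs g = (rs f / l0 ^+ d) * (rs g / l0 ^+ d)^-1.
  by rewrite invf_div (frac_comp _ _ ld).
have [|//] := @QM (rs f / l0 ^+ d) (rs g / l0 ^+ d)^-1 (Qs _ _ hf).
apply: (der_inV hA hD); first exact: Qs.
  exact: (mulf_neq0 r0 (invr_neq0 ld)).
by rewrite invf_div -restrictX; apply: (local_ring_mem (symX d Ee0) hg ng).
Qed.

Let kerI : ideal A ker.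
Proof.
split=> [a []//|]; split.
- by split; [exact: (subring0 hA)|exact: pi0].
- move=> a b [Aa ea] [Ab eb]; split; first exact: (subringD hA).
  by rewrite local_evaluationD // ea eb addr0.
- move=> a b Aa [Ab eb]; split; first exact: (subringM hA).
  by rewrite local_evaluationM // eb mulr0.
Qed.

Let ker1 : ~ ker 1.
Proof. by move=> [_ /eqP]; rewrite pi1 oner_eq0. Qed.

Let ker_prime a b : A a -> A b -> ker (a * b) -> ker a \/ ker b.
Proof.
move=> Aa Ab [_ /eqP]; rewrite local_evaluationM // mulf_eq0 => /orP[]/eqP h.
  by left.
by right.
Qed.

(** A factor [u] outside the kernel clears the denominators of the localization, and the theorem on
    symbolic powers removes it. As the maximal ideal of [A] is unique, the generators provided by
    [hreg] are generators of [maxM]. *)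
Lemma local_kernel_power k v : A v ->
  ideal_power (local_localization E xi (P i1)) (local_maximal_ideal E xi (P i1)) k v ->
  ideal_power A ker k v.
Proof.
move=> Av /(localize_ideal_power hA kerI ker1 ker_prime)[u [Au nu hu]].
have pu : pi i1 u != 0 by apply: contra_notN nu => /eqP h; split.
case: hreg => noeth [M [maxiM uniqM [d [g [kd Mg]]]]].
have [m [z [Az hz]]] := local_derivation.
apply: (regular_symbolic_power (iota := iota) (charK0 K) hOp Ow w0 wV dvr (loc_frac hp) hA
  (fun a Oa => proj1 (local_ring_const Oa)) (local_evaluation_loc i1)
  (@local_evaluationD i1) (@local_evaluationM i1)
  (fun a Oa => proj2 (local_ring_const Oa) i1) (@local_ringV i1) noeth
  (cone_field_generated I) Az hz kd _ Au pu Av hu).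
by apply: etrans Mg; apply: uniqM; apply: local_maximal.
Qed.

(** If [f/g] is in the kernel, [f] vanishes at [P i1], hence at the common reduction, so its value
    at any [P i] is divisible by [w] relative to the local generator. A product of [k] such elements
    has a value divisible by [w^k]. *)
Lemma local_kernel_power_eval k v i : ideal_power A ker k v -> Op (pi i v / w ^+ k).
Proof.
have kerA : ker `<=` A by move=> a [].
elim: k v => [|k IH] v.
  by move=> /(ipow_subring hA kerA) Av; rewrite expr0 divr1; apply: local_evaluation_loc.
move=> hv.
suff [] : A v /\ Op (pi i v / w ^+ k.+1) by [].
move: v hv; apply: (ipowS_ind hA (P := fun v => A v /\ Op (pi i v / w ^+ k.+1))) => [|u v [Au hu] [Av hv]|x y kx hy].
- by split; [exact: (subring0 hA)|rewrite pi0 mul0r; apply: (subring0 hOp)].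
- split; first exact: (subringD hA).
  by rewrite local_evaluationD // mulrDl; apply: (subringD hOp).
have Ay := ipow_subring hA kerA hy; have Ax := kerA _ kx.
split; first exact: (subringM hA).
rewrite local_evaluationM // exprS -mulf_div; apply: (subringM hOp); last exact: IH.
case: kx => /local_ringP[d [f [g [hf hg ng ->]]]].
have [g1 _] := xi_unit i1 hg ng; have [g0 Og] := xi_unit i hg ng.
rewrite !(local_evaluationE _ hf hg ng) => /eqP; rewrite mulf_eq0 invr_eq0 (negbTE g1) orbF.
move=> /eqP f1.
have : xi d (rs f).
  rewrite -(hxi i1); apply/(reductionP hp pw w0 hw (hP i1) he1 hf).
  by rewrite f1 !mul0r; apply: (subring0 hOp).
rewrite -(hxi i) => /(reductionP hp pw w0 hw (hP i) (local_gen_all i) hf) Of.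
have -> : ev i f / ev i g / w
    = (ev i f / ev i (lf e0) ^+ d / w) * (ev i (lf e0) ^+ d / ev i g).
  by field; rewrite g0 w0 lnd.
exact: (subringM hOp).
Qed.

Lemma trivialization_neq0 D t : trivialization E xi D t -> t != 0.
Proof.
move=> [_ et].
have [u Au eu] : [set v * t | v in A] (l0 ^+ D).
  by rewrite -et; apply: (stalkP D _).2; rewrite divff ?(l0d D) //; apply: (subring1 hA).
by apply: contraNneq (l0d D) => t0; rewrite -eu t0 mulr0.
Qed.

(** The order is defined with the trivialization [t], the values with [l0^D]; the factor [t / l0^D]
    is in [A] and so preserves powers of the kernel. *)
Lemma vanishing_order D t f k : trivialization E xi D t -> stalk E D xi (rs f) ->
  ideal_power (local_localization E xi (P i1)) (local_maximal_ideal E xi (P i1)) k (rs f / t) ->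
  forall i, Op (ev i f / ev i (lf e0) ^+ D / w ^+ k).
Proof.
move=> htr hf hk i; have t0 := trivialization_neq0 htr; case: htr => ht et.
have l0D := l0d D.
have At : A (t / l0 ^+ D) by apply: (stalkP D t).1.
have Af : A (rs f / t).
  by move: hf; rewrite et => -[v Av <-]; rewrite (mulfK t0).
have := local_kernel_power Af hk => /(ipowZ hA At).
have -> : t / l0 ^+ D * (rs f / t) = rs f / l0 ^+ D by rewrite mulrC (frac_comp _ _ t0).
move=> /(local_kernel_power_eval i); rewrite local_evaluation_section //.
exact: (stalkP D (rs f)).1.
Qed.

Let locS : subring (local_localization E xi (P i1)).
Proof. exact: (localize_subring hA kerI ker1 ker_prime). Qed.

Lemma local_power_le t k l : (k <= l)%N ->
  ideal_power (local_localization E xi (P i1)) (local_maximal_ideal E xi (P i1)) l t ->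
  ideal_power (local_localization E xi (P i1)) (local_maximal_ideal E xi (P i1)) k t.
Proof.
move=> kl; apply: (ipow_le locS) => //.
exact: (localize_max_sub hA kerI ker1 ker_prime).
Qed.

Lemma local_power_scale a t k :
  ideal_power (local_localization E xi (P i1)) (local_maximal_ideal E xi (P i1)) k t ->
  ideal_power (local_localization E xi (P i1)) (local_maximal_ideal E xi (P i1)) k (a *: t).
Proof.
rewrite cone_scaleE; apply: (ipowZ locS).
have [b [c [Ob Oc c0 ->]]] := loc_frac hp a.
rewrite -[rs _]/(iota (b / c)) fmorph_div.
have [Ab _] := local_ring_const Ob; have [Ac ec] := local_ring_const Oc.
apply: (localize_mem Ab Ac).
by move=> [_ /eqP]; rewrite ec (negbTE c0).
Qed.

End LocalRing.

Section GlobalEvaluation.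
Variables (R : realType) (K : fieldExtType rat) (n : nat) (E : set 'rV[K]_n.+1).
Variable I : prime_idealr {mpoly K[n.+1]}.
Local Notation O := (ring_of_integers K).
Hypothesis hE : submodule O E.
Hypothesis projE : fg_projective O E.
Hypothesis genE : lspan setT E = setT.
Variable x : 'rV[K]_n.+1.
Hypothesis x0 : x != 0.

Lemma pull_back_principal d : locally_principal (pull_back E x d).
Proof.
move=> p hp; have [w [pw w0 wV dvr hw]] := dvr_at R hp.
have [e0 he0] := exists_local_gen projE genE hp pw w0 dvr x0.
exists (evaluate x (linear_form e0) ^+ d).
  exact: (pull_back_gen he0).
by move=> y hy; exact: (pull_back_locally_principal hp pw w0 hw he0 hy).
Qed.

Lemma pull_back_neq0 : exists2 e, E e & evaluate x (linear_form e) != 0.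
Proof.
apply: contrapT => h; case/negP: x0; apply/eqP/rowP => k.
have h0 v : E v -> evaluate x (linear_form v) = 0.
  by move=> Ev; apply: contrapT => /eqP nv; apply: h; exists v.
have hk : lspan setT E (delta_mx 0 k) by rewrite genE.
rewrite [RHS]mxE.
have : evaluate x (linear_form (delta_mx 0 k)) = 0.
  apply: (lspan_ind (P := fun v => evaluate x (linear_form v) = 0) _ _ _ hk).
  - by rewrite evaluate_linear big1 // => i _; rewrite mxE mul0r.
  - by move=> u v hu hv; rewrite linear_formD evaluateD hu hv addr0.
  - by move=> a v _ Ev; rewrite linear_formZ evaluateZ h0 // mulr0.
rewrite evaluate_linear (bigD1 k) //= mxE !eqxx mul1r big1 ?addr0 // => j jk.
by rewrite mxE (negbTE jk) andbF mul0r.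
Qed.

(** At each maximal ideal the reduction of [x] is a point of the model, and membership in its stalk
    bounds the denominator of the value; [local_global] glues these local conditions. *)
Lemma global_evaluation D f : rational_point I x ->
  global_sections E D (Defs.restrict I f) -> pull_back E x D (evaluate x f).
Proof.
move=> hx hf; have [e Ee le] := pull_back_neq0.
apply: (@local_global R K _ (evaluate x (linear_form e) ^+ D)).
- exact: pull_back_submodule.
- by exists (linear_form e ^+ D); [exact: symX|rewrite evaluateX].
- exact: expf_neq0.
move=> p hp; have [w [pw w0 wV dvr hw]] := dvr_at R hp.
have [e0 he0] := exists_local_gen projE genE hp pw w0 dvr x0.
have := hf _ (reduction_model_point hE hp pw w0 wV dvr hw hx he0).
move=> /(stalk_loc hp pw w0 dvr hw hx he0)/localizeP[b [c [Ob Oc nc e1]]].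
exists c; split=> //.
have -> : c * evaluate x f = b * evaluate x (linear_form e0) ^+ D.
  have l0 : evaluate x (linear_form e0) ^+ D != 0 by apply: expf_neq0; case: he0.
  by rewrite -[evaluate x f](divfK l0) e1; field; apply: (notp_neq0 hp).
have [_ _ qZ] := pull_back_submodule E x D.
by apply: (qZ) => //; apply: (pull_back_gen he0).
Qed.

End GlobalEvaluation.

(** * Dimensions and interpolation *)

Section Dimension.
Variables (F : fieldType) (V : lmodType F).

Definition lin_indep m (v : 'I_m -> V) : Prop :=
  forall c : 'I_m -> F, \sum_i c i *: v i = 0 -> forall i, c i = 0.

Lemma steinitz m k (s : 'I_m -> V) (v : 'I_k -> V) :
  (forall j, lspan setT (range s) (v j)) -> lin_indep v -> (k <= m)%N.
Proof.
move=> sv iv.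
have h j : exists c : 'I_m -> F, v j = \sum_i c i *: s i.
  by have [c _ ->] := lspan_range (sv j) Logic.I (fun _ _ _ _ => Logic.I); exists c.
pose M : 'M[F]_(k, m) := \matrix_(j, i) projT1 (cid (h j)) i.
have vM j : v j = \sum_i M j i *: s i.
  by under eq_bigr => i _ do rewrite mxE; exact: (projT2 (cid (h j))).
suff : row_free M by rewrite /row_free => /eqP <-; apply: rank_leq_col.
rewrite -kermx_eq0; apply/negPn/negP => /rowV0Pn[u /sub_kermxP uM /eqP u0]; apply: u0.
apply/rowP => j; rewrite [RHS]mxE; apply: (iv (fun j => u 0 j)).
under eq_bigr => i _ do rewrite vM scaler_sumr.
rewrite exchange_big big1 // => i _ /=.
under eq_bigr => j' _ do rewrite scalerA.
rewrite -scaler_suml; have /rowP/(_ i) := uM; rewrite !mxE => ->.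
by rewrite scale0r.
Qed.

Lemma exists_basis (X : set V) m (s : 'I_m -> V) :
  lspan setT X `<=` lspan setT (range s) ->
  exists k (b : 'I_k -> V), (forall i, X (b i)) /\ is_basis (lspan setT X) b.
Proof.
move=> Xs.
pose Q (k : nat) := `[< exists2 b : 'I_k -> V, forall i, X (b i) & lin_indep b >].
have exQ : exists k, Q k.
  exists 0%N; apply/asboolP; exists (fun=> 0); first by case.
  by move=> c _ [].
have ubQ k : Q k -> (k <= m)%N.
  move=> /asboolP[b Xb ib]; apply: (steinitz (s := s) _ ib) => j.
  by apply: Xs; apply: lspan_mem.
case: (ex_maxnP exQ ubQ) => k /asboolP[b Xb ib] kmax.
exists k, b; split=> //; split=> //.
have ls1 : submodule setT (lspan setT (range b)).
  by split; [exact: lspan0|move=> *; exact: lspanD|move=> *; exact: lspanZ].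
apply/seteqP; split; last first.
  apply: lspan_sub; last by move=> _ [i _ <-]; apply: lspan_mem.
  by split; [exact: lspan0|move=> *; exact: lspanD|move=> *; exact: lspanZ].
apply: lspan_sub => // x Xx; apply: contrapT => nx.
have : Q k.+1.
  apply/asboolP; exists (fun i => if unlift ord_max i is Some j then b j else x).
    by move=> i; case: unliftP.
  move=> c; rewrite (bigD1_ord ord_max) //= unlift_none.
  under eq_bigr => j _ do rewrite liftK.
  move=> e; have [c0|c0] := eqVneq (c ord_max) 0.
    move: e; rewrite c0 scale0r add0r => /ib h i.
    by case: (unliftP ord_max i) => [j ->|->].
  case: nx; have -> : x = \sum_j (- (c ord_max)^-1 * c (lift ord_max j)) *: b j.
    under eq_bigr => j _ do rewrite -scalerA.
    rewrite -scaler_sumr scaleNr; move/eqP: e; rewrite addrC addr_eq0 => /eqP ->.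
    by rewrite scalerN opprK scalerA mulVf // scale1r.
  apply: lspan_sum => j; apply: lspan_smul => //; by exists j.
by move=> /kmax; rewrite ltnn.
Qed.

Lemma basis_uniq (W : set V) m k (s : 'I_m -> V) (t : 'I_k -> V) :
  is_basis W s -> is_basis W t -> m = k.
Proof.
move=> [ind Ws] [it Wt]; apply/eqP; rewrite eqn_leq; apply/andP; split.
  by apply: (steinitz (s := t) _ ind) => j; rewrite -Wt Ws; apply: lspan_mem => //; exists j.
by apply: (steinitz (s := s) _ it) => j; rewrite -Ws Wt; apply: lspan_mem => //; exists j.
Qed.

Lemma dimensionE (W : set V) m (s : 'I_m -> V) : is_basis W s -> dimension W = m.
Proof.
move=> hs; rewrite /dimension; case: xgetP => [k -> [t ht]|/(_ m)].
  exact: basis_uniq ht hs.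
by case; exists s.
Qed.

Lemma basis_span (W : set V) m (s : 'I_m -> V) v : is_basis W s -> W v ->
  exists c : 'I_m -> F, v = \sum_i c i *: s i.
Proof.
move=> [_ ->] h; have [c _ ->] := lspan_range h Logic.I (fun _ _ _ _ => Logic.I).
by exists c.
Qed.

Lemma basis_dependent (W : set V) m k (s : 'I_m -> V) (v : 'I_k -> V) : is_basis W s ->
  (m < k)%N -> (forall i, W (v i)) ->
  exists c : 'I_k -> F, (exists i, c i != 0) /\ \sum_i c i *: v i = 0.
Proof.
move=> [ind Ws] mk Wv; apply: contrapT => h.
suff : (k <= m)%N by rewrite leqNgt mk.
apply: (steinitz (s := s)) => [j|c e i]; first by rewrite -Ws.
by apply: contrapT => /eqP ci; apply: h; exists c; split=> //; exists i.
Qed.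

End Dimension.

(** Choose a finite family of rows of maximal rank; the index type [T] may be infinite. Every
    [phi i] is in its row space, so a vector killed by the family is killed by all of them and is
    zero. The family has full column rank, and [r] of its rows form an invertible matrix. *)
Lemma separating_family (F : fieldType) (T : Type) r (phi : T -> 'rV[F]_r) :
  (forall x : 'cV[F]_r, (forall i, phi i *m x = 0) -> x = 0) ->
  exists f : 'I_r -> T, \matrix_a phi (f a) \in unitmx.
Proof.
move=> sep.
pose Q (k : nat) := `[< exists m (g : 'I_m -> T), \rank (\matrix_a phi (g a)) = k >].
have exQ : exists k, Q k.
  have [r0|r0] := posnP r.
    exists 0%N; apply/asboolP; exists 0%N, (fun i : 'I_0 => False_rect T (notF (ltn_ord i))).
    by apply/eqP; rewrite -leqn0; apply: rank_leq_row.
  have [i0 _] : exists i0 : T, True.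
    apply: contrapT => h; have := sep (const_mx 1).
    case/(_ (fun i => False_rect _ (h (ex_intro _ i Logic.I))))/colP/(_ (Ordinal r0)).
    by rewrite !mxE => /eqP; rewrite oner_eq0.
  by exists (\rank (\matrix_(a < 1) phi i0)); apply/asboolP; exists 1%N, (fun=> i0).
have ubQ k : Q k -> (k <= r)%N by move=> /asboolP[m [g <-]]; apply: rank_leq_col.
case: (ex_maxnP exQ ubQ) => k /asboolP[m [g rk]] kmax.
set A := \matrix_a phi (g a) in rk.
have subA i : (phi i <= A)%MS.
  pose g' (a : 'I_(1 + m)) := match fintype.split a with inl _ => i | inr b => g b end.
  pose A' := \matrix_a phi (g' a).
  have AA' : (A <= A')%MS.
    apply/row_subP => b; have -> : row b A = row (rshift 1 b) A'.
      by rewrite !rowK /g' -[rshift _ _]/(unsplit (inr b)) unsplitK.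
    exact: row_sub.
  have iA' : (phi i <= A')%MS.
    have -> : phi i = row (lshift m ord0) A'.
      by rewrite rowK /g' -[lshift _ _]/(unsplit (inl ord0)) unsplitK.
    exact: row_sub.
  apply: submx_trans iA' _; rewrite -(mxrank_leqif_sup AA').2 eqn_leq mxrankS //=.
  by rewrite rk; apply: kmax; apply/asboolP; exists (1 + m)%N, g'.
have fA : row_full A.
  rewrite -cokermx_eq0; apply/eqP/matrixP => a b; rewrite [RHS]mxE.
  have /colP/(_ a) : col b (cokermx A) = 0.
    apply: sep => i; have /submxP[u ->] := subA i.
    by rewrite colE mulmxA -(mulmxA u) mulmx_coker mulmx0 mul0mx.
  by rewrite !mxE.
exists (fun a => g (fullrankfun fA a)).
have -> : \matrix_a phi (g (fullrankfun fA a)) = rowsub (fullrankfun fA) A.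
  by apply/matrixP => a b; rewrite !mxE.
exact: fullrowsub_unit.
Qed.

Lemma rowset_index (K : fieldType) r (g h : 'I_r -> set K) (m : 'I_r -> nat) :
  (forall a, subgroup (h a)) -> (forall a, g a 0) ->
  (forall a, has_index (g a) (h a) (m a)) ->
  exists2 k, has_index [set v : 'rV[K]_r | forall a, g a (v 0 a)]
                       [set v : 'rV[K]_r | forall a, h a (v 0 a)] k
           & (k <= \prod_a m a)%N.
Proof.
move=> sh g0 idx.
have hS a : exists kap : K -> 'I_(m a), forall x y, g a x -> g a y -> kap x = kap y -> h a (x - y).
  have [s [gs sinj scov]] := has_index_ord (idx a).
  have m0 : (0 < m a)%N by apply: has_index_gt0 (idx a).
  pose kap x := odflt (Ordinal m0) [pick t | `[< h a (x - s t) >]].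
  have hk x : g a x -> h a (x - s (kap x)).
    move=> gx; rewrite /kap; case: pickP => [t /asboolP //|nt].
    by have [t ht] := scov x gx; have /asboolP := nt t.
  exists kap => x y gx gy e; have := hk x gx; have := hk y gy; rewrite e => hy hx.
  by case: (sh a) => _ sB; have := sB _ _ hx hy; rewrite opprB addrA subrK.
pose T : finType := {dffun forall a : 'I_r, 'I_(m a)}.
have sub : subgroup [set v : 'rV[K]_r | forall a, h a (v 0 a)].
  split=> [a|x y hx hy a]; first by rewrite mxE; case: (sh a).
  by rewrite !mxE; case: (sh a) => _; apply.
have [] := @index_sep_has _ [set v : 'rV[K]_r | forall a, g a (v 0 a)] _ (\prod_a m a)%N sub.
  exists T, (fun v : 'rV[K]_r => finfun (fun a => projT1 (cid (hS a)) (v 0 a)) : T); split.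
    move=> x y gx gy e a; rewrite !mxE.
    apply: (projT2 (cid (hS a))) => //.
    by have := congr1 (fun f : {dffun forall a : 'I_r, 'I_(m a)} => f a) e; rewrite !ffunE.
  rewrite card_dep_ffun foldr_muln big_image /=.
  by apply/eq_leq/eq_bigr => a _; rewrite card_ord.
by move=> hi hle; exists (card_quotient [set v : 'rV[K]_r | forall a, g a (v 0 a)]
  [set v : 'rV[K]_r | forall a, h a (v 0 a)]).
Qed.

Section LocPowerIndex.
Variables (K : fieldType) (O : set K) (w : K) (q : nat).
Hypotheses (hO : subring O) (Ow : O w) (w0 : w != 0).
Hypothesis idx1 : has_index O [set w * x | x in O] q.

Let grp e : subgroup [set w ^+ e * x | x in O].
Proof.
split; first by exists 0; [exact: (subring0 hO)|rewrite mulr0].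
by move=> _ _ [x Ox <-] [y Oy <-]; exists (x - y); [exact: (subringB hO)|rewrite mulrBr].
Qed.

Lemma loc_power_index e : has_index O [set w ^+ e * x | x in O] (q ^ e).
Proof.
elim: e => [|e IH].
  have -> : [set w ^+ 0 * x | x in O] = O.
    apply/seteqP; split=> [_ [x Ox <-]|x Ox]; first by rewrite expr0 mul1r.
    by exists x; rewrite ?expr0 ?mul1r.
  exists unit, (fun=> 0); split; [by move=> _; apply: (subring0 hO)|by case=> -[]| |exact: card_unit].
  by move=> x Ox; exists tt; rewrite subr0.
have gO : subgroup O by split; [exact: (subring0 hO)|exact: (subringB hO)].
rewrite expnSr; apply: (@has_index_tower _ O [set w ^+ e * x | x in O]) => //.
- by move=> _ [x Ox <-]; apply: (subringM hO) => //; apply: (subringX hO).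
- by move=> _ [x Ox <-]; exists (w * x); [exact: (subringM hO)|rewrite mulrA -exprSr].
have -> : [set w ^+ e.+1 * x | x in O] = [set w ^+ e * x | x in [set w * x | x in O]].
  apply/seteqP; split=> [_ [x Ox <-]|_ [_ [x Ox <-] <-]].
    by exists (w * x); [exists x|rewrite mulrA -exprSr].
  by exists x => //; rewrite mulrA -exprSr.
apply: has_index_image => //.
- by move=> x y _ _; rewrite mulrBr.
- by move=> x _ /eqP; rewrite mulf_eq0 expf_eq0 (negbTE w0) andbF => /eqP.
- by move=> _ [x Ox <-]; apply: (subringM hO).
Qed.

End LocPowerIndex.

(** * Sections of degree D *)

Lemma common_denominator_OK (K : fieldExtType rat) m (c : 'I_m -> K) :
  exists2 N : nat, (0 < N)%N & forall i, ring_of_integers K (N%:R * c i).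
Proof.
have hO := OK_subring K.
have h i : exists N : nat, (0 < N)%N /\ ring_of_integers K (N%:R * c i).
  by have [N N0 ON] := OK_multiple (c i); exists N.
pose N i := projT1 (cid (h i)).
have N0 i : (0 < N i)%N by case: (projT2 (cid (h i))).
exists (\prod_i N i)%N; first by apply: prodn_gt0.
move=> i; rewrite natr_prod (bigD1 i) //= mulrAC; apply: (subringM hO).
  by case: (projT2 (cid (h i))).
by apply: (subring_prod hO) => j _; apply: (subring_nat hO).
Qed.

Section Sections.
Variables (K : fieldExtType rat) (n : nat) (E : set 'rV[K]_n.+1).
Variable I : prime_idealr {mpoly K[n.+1]}.
Local Notation O := (ring_of_integers K).
Local Notation L := (cone_field I).
Local Notation rs := (Defs.restrict I).
Let hO : subring O := OK_subring K.
Variables (D : nat) (F : set L).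
Hypothesis hF : saturated_sections E D F.
Local Notation W := (restriction_image D : set L).

Lemma cone_scaleAl c (u v : L) : c *: (u * v) = (c *: u) * v.
Proof. by rewrite !cone_scaleE mulrA. Qed.

Lemma lift_sectionK v : W v -> rs (lift_section D v) = v.
Proof.
move=> [f hf e].
apply: (@xgetPex _ 0 [set f : dhomog n.+1 K D | rs f = v]).
by exists (DHomog hf).
Qed.

Lemma sections_submodule : submodule setT W.
Proof.
case: hF => _ _ _ <-; split; [exact: lspan0|move=> *; exact: lspanD|move=> *; exact: lspanZ].
Qed.

Lemma lspan_sections A : lspan A F `<=` W.
Proof.
case: hF => _ _ _ <- v [m [c [x [_ Fx ->]]]]; exists m, c, x; split=> //.
Qed.

Lemma sections_clear v : W v -> exists c, [/\ O c, c != 0 & F (c *: v)].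
Proof.
case: hF => _ [F0 FD FZ] _ <-; apply: (lspan_ind (P := fun v => exists c, [/\ O c, c != 0 & F (c *: v)])).
- by exists 1; rewrite scaler0 oner_neq0; split=> //; apply: (subring1 hO).
- move=> u u' [c [Oc c0 Fc]] [c' [Oc' c0' Fc']]; exists (c * c'); split.
  + exact: (subringM hO).
  + exact: mulf_neq0.
  rewrite scalerDr; apply: (FD); last by rewrite -scalerA; apply: (FZ).
  by rewrite mulrC -scalerA; apply: (FZ).
move=> a x _ Fx.
have [N N0 ON] := OK_multiple a; exists N%:R; split.
- exact: (subring_nat hO).
- by case: N N0 {ON} => // N _; apply: charK0.
by rewrite scalerA; apply: (FZ).
Qed.

Section Evaluate.
Variable x : 'rV[K]_n.+1.
Hypothesis hx : rational_point I x.

Lemma evaluate_liftD u v : W u -> W v -> evaluate x (lift_section D (u + v))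
  = evaluate x (lift_section D u) + evaluate x (lift_section D v).
Proof.
move=> Wu Wv; have [_ WD _] := sections_submodule.
rewrite -evaluateD; apply: (evaluate_restrict hx).
by rewrite restrictD !lift_sectionK //; apply: (WD).
Qed.

Lemma evaluate_liftZ c v : W v ->
  evaluate x (lift_section D (c *: v)) = c * evaluate x (lift_section D v).
Proof.
move=> Wv; have [_ _ WZ] := sections_submodule.
rewrite -evaluateZ; apply: (evaluate_restrict hx).
by rewrite restrictZ !lift_sectionK //; apply: (WZ).
Qed.

End Evaluate.

Variables (r : nat) (s : 'I_r -> L).
Hypothesis hs : is_basis W s.
Variables (x : 'I_r -> 'rV[K]_n.+1) (sa : 'I_r -> K).
Hypothesis hx : forall a, rational_point I (x a).
Hypothesis sa0 : forall a, sa a != 0.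

Definition eval_mx : 'M[K]_r := \matrix_(b, a) evaluate (x a) (lift_section D (s b)).
Hypothesis Delta0 : \det eval_mx != 0.

(** Since [sa a] is taken in the fibre [x_a(E)], dividing by [sa a ^ D] turns the D-th power of that
    fibre into a submodule of [K] containing [O]. *)
Definition eval_row (v : L) : 'rV[K]_r :=
  \row_a (evaluate (x a) (lift_section D v) / sa a ^+ D).

Definition norm_mx : 'M[K]_r := \matrix_b eval_row (s b).

Lemma det_norm_mx : \det norm_mx = \det eval_mx / \prod_a sa a ^+ D.
Proof.
have -> : norm_mx = eval_mx *m diag_mx (\row_a (sa a ^+ D)^-1).
  by apply/matrixP => b a; rewrite mul_mx_diag !mxE.
rewrite det_mulmx det_diag -prodfV; congr (_ * _).
by apply: eq_bigr => a _; rewrite mxE.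
Qed.

Lemma norm_mx_neq0 : \det norm_mx != 0.
Proof.
rewrite det_norm_mx mulf_neq0 // invr_neq0 //; apply/prodf_neq0 => a _.
exact: expf_neq0.
Qed.

Lemma eval_rowD u v : W u -> W v -> eval_row (u + v) = eval_row u + eval_row v.
Proof.
by move=> Wu Wv; apply/rowP => a; rewrite !mxE (evaluate_liftD (hx a) Wu Wv) mulrDl.
Qed.

Lemma eval_rowZ c v : W v -> eval_row (c *: v) = c *: eval_row v.
Proof.
by move=> Wv; apply/rowP => a; rewrite !mxE (evaluate_liftZ (hx a) c Wv) mulrA.
Qed.

Lemma eval_row_sum m (c : 'I_m -> K) (v : 'I_m -> L) : (forall i, W (v i)) ->
  W (\sum_i c i *: v i) /\ eval_row (\sum_i c i *: v i) = \sum_i c i *: eval_row (v i).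
Proof.
move=> Wv; have [W0 WD WZ] := sections_submodule.
apply: (big_ind2 (fun y z => W y /\ eval_row y = z)).
- split=> //; have := eval_rowZ 0 W0; rewrite !scale0r => e.
  exact: e.
- by move=> u u' v' v'' [Wu <-] [Wv' <-]; rewrite eval_rowD //; split=> //; apply: (WD).
- by move=> i _; rewrite eval_rowZ //; split=> //; apply: (WZ).
Qed.

Lemma basis_sections b : W (s b).
Proof. by case: hs => _ ->; apply: lspan_mem => //; exists b. Qed.

Lemma eval_row_basis (c : 'I_r -> K) :
  eval_row (\sum_b c b *: s b) = (\row_b c b) *m norm_mx.
Proof.
have [_ ->] := eval_row_sum c basis_sections.
rewrite mulmx_sum_row; apply: eq_bigr => b _.
by rewrite rowK mxE.
Qed.

Lemma eval_row_eq0 v : W v -> eval_row v = 0 -> v = 0.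
Proof.
move=> /(basis_span hs)[c ->]; rewrite eval_row_basis => e.
have u : norm_mx \in unitmx by rewrite unitmxE unitfE norm_mx_neq0.
have c0 : \row_b c b = 0 by rewrite -(mulmxK u (\row_b c b)) e mul0mx.
rewrite big1 // => b _; have /rowP/(_ b) := c0; rewrite !mxE => ->.
by rewrite scale0r.
Qed.

Lemma eval_rowB u v : W u -> W v -> eval_row (u - v) = eval_row u - eval_row v.
Proof.
move=> Wu Wv; have [_ _ WZ] := sections_submodule.
by rewrite -scaleN1r eval_rowD //; [rewrite eval_rowZ // scaleN1r|apply: (WZ)].
Qed.

Lemma eval_row_inj u v : W u -> W v -> eval_row u = eval_row v -> u = v.
Proof.
move=> Wu Wv e; have [_ WD WZ] := sections_submodule.
apply/eqP; rewrite -subr_eq0; apply/eqP; apply: eval_row_eq0.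
  by rewrite -scaleN1r; apply: (WD) => //; apply: (WZ).
by rewrite eval_rowB // e subrr.
Qed.

End Sections.

(** * Orders of vanishing at a prime *)

Section PrimeFiltration.
Variables (R : realType) (K : fieldExtType rat) (n : nat) (E : set 'rV[K]_n.+1).
Variable I : prime_idealr {mpoly K[n.+1]}.
Local Notation O := (ring_of_integers K).
Local Notation lf := (@linear_form K n).
Local Notation L := (cone_field I).
Local Notation rs := (Defs.restrict I).
Let hO : subring O := OK_subring K.
Hypothesis hE : submodule O E.
Hypothesis projE : fg_projective O E.
Hypothesis genE : lspan setT E = setT.
Variables (p : set K) (w : K).
Local Notation Op := (localize O p).
Hypotheses (hp : maximal_ideal O p) (pw : p w) (w0 : w != 0) (wV : ~ Op w^-1).
Hypothesis dvr : forall a, Op a -> a != 0 ->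
  exists k u, [/\ Op u, Op u^-1 & a = u * w ^+ k].
Hypothesis hw : forall y, p y -> Op (y / w).
Let hOp : subring Op := loc_subring hp.
Let Ow : Op w := loc_sub hp (maxi_sub hp pw).
Variables (T : Type) (P : T -> 'rV[K]_n.+1) (xi : nat -> set L) (i1 : T).
Hypothesis hP : forall i, rational_point I (P i).
Hypothesis hxi : forall i, reduction E I p (P i) = xi.
Variable e0 : 'rV[K]_n.+1.
Hypothesis he1 : local_gen E p (P i1) e0.
Hypothesis hreg : regular_local (local_ring E xi).
Variables (D : nat) (F : set L).
Hypothesis hF : saturated_sections E D F.
Variable t : L.
Hypothesis ht : trivialization E xi D t.
Variables (r : nat) (s : 'I_r -> L).
Local Notation W := (restriction_image D : set L).
Hypothesis hs : is_basis W s.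
Variables (pt : 'I_r -> T) (sa : 'I_r -> K).
Local Notation x := (fun a => P (pt a)).
Hypothesis sa0 : forall a, sa a != 0.
Hypothesis Delta0 : \det (eval_mx D s x) != 0.

Local Notation ipow := (ideal_power (local_localization E xi (P i1))
  (local_maximal_ideal E xi (P i1))).
Local Notation Tr := (eval_row D x sa).
Local Notation q := (card_quotient O p).

Definition order_rank k :=
  dimension (lspan (setT : set K) (trivialized_sections p F t `&` ipow k)).

(** Sections over [K] of order at least [k] along [P i1]. At level 0 no condition is imposed, so
    that level is all of [W] by definition. *)
Definition order_sections k : set L := [set v | W v /\ ((0 < k)%N -> ipow k (v / t))].

Let t0 : t != 0 := trivialization_neq0 hE projE genE hp pw w0 wV dvr hw hP hxi he1 ht.
Let ipow_scale a u k : ipow k u -> ipow k (a *: u) :=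
  @local_power_scale _ _ _ _ hE projE genE _ _ hp pw w0 wV dvr hw _ _ _ _ hP hxi _ he1 a u k.

Let Wsub := sections_submodule hF.
Let W0 : W 0. Proof. by case: Wsub. Qed.
Let WD u v : W u -> W v -> W (u + v). Proof. by case: Wsub => _ + _; apply. Qed.
Let WZ c v : W v -> W (c *: v). Proof. by case: Wsub => _ _ + h; apply. Qed.

Let ordZ k c v : order_sections k v -> order_sections k (c *: v).
Proof.
move=> [Wv hv]; split; first exact: WZ.
by move=> k0; rewrite -cone_scaleAl; apply: ipow_scale; apply: hv.
Qed.
Let ordD k u v : order_sections k u -> order_sections k v -> order_sections k (u + v).
Proof.
move=> [Wu hu] [Wv hv]; split; first exact: WD.
by move=> k0; rewrite mulrDl; apply: ipowD; [exact: hu|exact: hv].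
Qed.
Let ord0' k : order_sections k 0.
Proof. by split=> // k0; rewrite mul0r; apply: ipow_zero. Qed.

Let ord_sum k m (c : 'I_m -> K) (v : 'I_m -> L) :
  (forall i, order_sections k (v i)) -> order_sections k (\sum_i c i *: v i).
Proof.
move=> hv; apply: (big_ind (order_sections k)); first exact: ord0'.
  by move=> y z; apply: ordD.
by move=> i _; apply: ordZ.
Qed.

(** Clearing denominators, a section over [K] of order [k] has a nonzero multiple in [F], of the
    same order. The span over [K] that defines [order_rank k] is therefore the full space of
    sections of order [k]. *)
Lemma order_basis k : exists b : 'I_(if k is 0 then r else order_rank k) -> L,
  is_basis (order_sections k) b.
Proof.
case: k => [|k].
  exists s; have -> : order_sections 0 = W by apply/seteqP; split=> [v []|v Wv].
  exact: hs.
pose Y := trivialized_sections p F t `&` ipow k.+1.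
have YW v : lspan (setT : set K) Y v -> order_sections k.+1 (v * t).
  move=> hv; apply: (lspan_ind (V := L) (P := fun v : L => order_sections k.+1 (v * t)) _ _ _ hv).
  - by rewrite mul0r.
  - by move=> u u' hu hu'; rewrite mulrDl; apply: ordD.
  move=> c _ _ [[u Fu <-] hu]; rewrite -cone_scaleAl; apply: ordZ.
  rewrite (divfK t0); split; first exact: (lspan_sections hF Fu).
  by move=> _.
have Ys : lspan setT Y `<=` lspan setT (range (fun b => s b / t)).
  move=> v /YW[/(basis_span hs)[c ec] _].
  rewrite -[v](mulfK t0) ec mulr_suml; apply: lspan_sum => b.
  by rewrite -cone_scaleAl; apply: lspan_smul => //; exists b.
have [m [b [Yb hb]]] := exists_basis Ys.
have -> : order_rank k.+1 = m by apply: dimensionE hb.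
exists (fun i => b i * t); split.
  move=> c e; case: hb => + _; apply.
  rewrite -[LHS](mulfK t0) mulr_suml -[RHS](mul0r t^-1); congr (_ / _).
  by rewrite -[RHS]e; apply: eq_bigr => i _; rewrite cone_scaleAl.
apply/seteqP; split=> [v [Wv hv]|].
  have [c [Oc c0 Fc]] := sections_clear hF Wv.
  have Yc : Y ((c *: v) / t).
    split; last by rewrite -cone_scaleAl; apply: ipow_scale; apply: hv.
    exists (c *: v) => //; apply: lspan_mem => //; exact: (subring1 hOp).
  have : lspan setT Y (v / t).
    rewrite -[v / t]scale1r -(mulVf c0) -scalerA cone_scaleAl.
    exact: lspan_smul.
  move=> /(basis_span hb)[d ed].
  rewrite -[v](divfK t0) ed mulr_suml; apply: lspan_sum => i.
  by rewrite -cone_scaleAl; apply: lspan_smul => //; exists i.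
apply: lspan_sub; first by split; [exact: ord0'|exact: ordD|move=> c u _; exact: ordZ].
by move=> _ [i _ <-]; apply: YW; apply: lspan_mem.
Qed.

Let ordS k : order_sections k.+1 `<=` order_sections k.
Proof.
move=> v [Wv hv]; split=> // k0.
apply: (local_power_le hE projE genE hp pw w0 wV dvr hw hP hxi he1 (leqnSn k)).
exact: hv.
Qed.

Definition rk k := if k is 0 then r else order_rank k.

Lemma order_rankS k : (rk k.+1 <= rk k)%N.
Proof.
have [b hb] := order_basis k; have [b' hb'] := order_basis k.+1.
case: (hb) => _ eb; case: (hb') => ib' eb'.
apply: (steinitz (s := b) _ ib') => i; rewrite -eb; apply: ordS; rewrite eb'.
by apply: lspan_mem => //; exists i.
Qed.

Let gam a := evaluate (x a) (lf e0) ^+ D / sa a ^+ D.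
Let G : set 'rV[K]_r := [set v | forall a, Op (v 0 a / gam a)].

Let gam0 a : gam a != 0.
Proof.
have [_ l0 _] := local_gen_all hE projE genE hp pw w0 wV dvr hw hP hxi he1 (pt a).
exact: mulf_neq0 (expf_neq0 D l0) (invr_neq0 (expf_neq0 D (sa0 a))).
Qed.

Let lF : set L := lspan Op F.
Let lF0 : lF 0. Proof. exact: lspan0. Qed.
Let lFD u v : lF u -> lF v -> lF (u + v). Proof. exact: lspanD. Qed.
Let lFZ c v : Op c -> lF v -> lF (c *: v).
Proof. by move=> Oc; apply: lspanZ => // a b; apply: (subringM hOp). Qed.
Let lFW v : lF v -> W v. Proof. exact: (lspan_sections hF). Qed.

Let lF_stalk v : lF v -> stalk E D xi v.
Proof.
have st := stalkP hE projE genE hp pw w0 wV dvr hw hP hxi he1 D.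
have hA := local_ring_subring hE projE genE hp pw w0 wV dvr hw hP hxi he1.
move=> hv; apply: (st v).2.
apply: (lspan_ind (V := L) (P := fun v : L => local_ring E xi (v / rs (lf e0) ^+ D)) _ _ _ hv).
- by rewrite mul0r; apply: (subring0 hA).
- by move=> u u' hu hu'; rewrite mulrDl; apply: (subringD hA).
move=> c u Oc Fu; rewrite -cone_scaleAl cone_scaleE; apply: (subringM hA).
  exact: (proj1 (local_ring_const hE projE genE hp pw w0 wV dvr hw hP hxi he1 Oc)).
apply: (st u).1; case: hF => Fg _ _ _; rewrite -(hxi i1).
exact: Fg Fu _ (reduction_model_point hE hp pw w0 wV dvr hw (hP i1) he1).
Qed.

Definition order_image k : set 'rV[K]_r :=
  Tr @` [set v | lF v /\ ((0 < k)%N -> ipow k (v / t))].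

Let hPx a : rational_point I (x a). Proof. exact: hP. Qed.
Let TrZ := eval_rowZ hF sa hPx.
Let TrD := eval_rowD hF sa hPx.

Lemma order_image_submodule k : submodule Op (order_image k).
Proof.
split.
- exists 0; first by split=> // k0; rewrite mul0r; apply: ipow_zero.
  by have := TrZ 0 W0; rewrite !scale0r.
- move=> _ _ [u [lu hu] <-] [v [lv hv] <-]; exists (u + v); last by rewrite TrD //; apply: lFW.
  split; first exact: lFD.
  by move=> k0; rewrite mulrDl; apply: ipowD; [exact: hu|exact: hv].
- move=> c _ Oc [v [lv hv] <-]; exists (c *: v); last by rewrite TrZ //; apply: lFW.
  split; first exact: lFZ.
  by move=> k0; rewrite -cone_scaleAl; apply: ipow_scale; apply: hv.
Qed.

(** For positive [k] this is [vanishing_order] at each of the points, rewritten with the local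
    generators [gam a] of the normalized fibres; at level 0 it is the integrality of evaluation on
    the local ring. *)
Lemma order_image_sub k : order_image k `<=` wpow w G k.
Proof.
move=> _ [v [lv hv] <-]; have wk0 : w ^+ k != 0 by apply: expf_neq0.
exists (w ^- k *: Tr v); last by rewrite scalerA divff // scale1r.
move=> a; have vE := lift_sectionK (lFW lv).
have sv : stalk E D xi (rs (lift_section D v)) by rewrite vE; apply: lF_stalk.
have key : Op (evaluate (x a) (lift_section D v) / evaluate (x a) (lf e0) ^+ D / w ^+ k).
  case: k wk0 hv => [|k] wk0 hv.
    rewrite expr0 divr1.
    have st := (stalkP hE projE genE hp pw w0 wV dvr hw hP hxi he1 D _).1 sv.
    have := local_evaluation_loc hE projE genE hp pw w0 wV dvr hw hP hxi he1 (pt a) st.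
    by rewrite (local_evaluation_section hE projE genE hp pw w0 wV dvr hw hP hxi he1 (pt a) st).
  apply: (vanishing_order hE projE genE hp pw w0 wV dvr hw hP hxi he1 hreg ht sv).
  by rewrite vE; apply: hv.
have [_ l0 _] := local_gen_all hE projE genE hp pw w0 wV dvr hw hP hxi he1 (pt a).
rewrite !mxE /gam.
have -> : w ^- k * (evaluate (x a) (lift_section D v) / sa a ^+ D)
    / (evaluate (x a) (lf e0) ^+ D / sa a ^+ D)
    = evaluate (x a) (lift_section D v) / evaluate (x a) (lf e0) ^+ D / w ^+ k.
  by field; rewrite wk0 !expf_neq0.
exact: key.
Qed.

Lemma order_image_sat k a v : a != 0 -> order_image k v ->
  order_image k.+1 (a *: v) -> order_image k.+1 v.
Proof.
move=> a0 [y [ly hy] <-] [y' [ly' hy'] e].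
have e' : y' = a *: y.
  apply: (eval_row_inj hF hs hPx sa0 Delta0 (lFW ly')); first exact: WZ (lFW ly).
  by rewrite e TrZ //; apply: lFW.
exists y => //; split=> // k0.
rewrite -[y]scale1r -(mulVf a0) -scalerA -e' -cone_scaleAl; apply: ipow_scale.
exact: hy'.
Qed.

(** Together with a basis of the sections of order [k + 1], the given sections outnumber the
    dimension in order [k], so there is a relation; it involves the given ones because the basis is
    independent. An integer [d] brings its coefficients into [O], which keeps the combination in the
    localization of [F]. *)
Lemma order_image_rank k (v : 'I_(rk k - rk k.+1).+1 -> 'rV[K]_r) :
  (forall i, order_image k (v i)) -> exists c, (exists i, c i != 0)
    /\ order_image k.+1 (\sum_i c i *: v i).
Proof.
set m := (rk k - rk k.+1).+1 in v * => hv.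
have hv' i : exists y, (lF y /\ ((0 < k)%N -> ipow k (y / t))) /\ Tr y = v i.
  by have [y hy e] := hv i; exists y.
pose y i := projT1 (cid (hv' i)).
have hy i : lF (y i) /\ ((0 < k)%N -> ipow k (y i / t)) by case: (projT2 (cid (hv' i))).
have yv i : Tr (y i) = v i by case: (projT2 (cid (hv' i))).
have [b hb] := order_basis k; have [b' hb'] := order_basis k.+1.
pose z (i : 'I_(m + rk k.+1)) := match fintype.split i with inl j => y j | inr j => b' j end.
have hz i : order_sections k (z i).
  rewrite /z; case: fintype.split => j.
    by have [h1 h2] := hy j; split=> //; apply: lFW.
  by apply: ordS; case: hb' => _ ->; apply: lspan_mem => //; exists j.
have lt : (rk k < m + rk k.+1)%N by rewrite /m; have := order_rankS k; lia.
have [c [[i ci] e]] := basis_dependent hb lt hz.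
pose c1 j := c (lshift _ j); pose c2 j := c (rshift _ j).
have {e} e : \sum_j c1 j *: y j = \sum_j (- c2 j) *: b' j.
  move: e; rewrite big_split_ord /=.
  under eq_bigr => j _ do rewrite /z -[lshift _ _]/(unsplit (inl j)) unsplitK.
  under [X in _ + X]eq_bigr => j _ do rewrite /z -[rshift _ _]/(unsplit (inr j)) unsplitK.
  move/eqP; rewrite addr_eq0 => /eqP ->; rewrite -sumrN.
  by apply: eq_bigr => j _; rewrite scaleNr.
have [j cj] : exists j, c1 j != 0.
  apply: contrapT => h.
  have c10 j : c1 j = 0 by apply: contrapT => /eqP nj; apply: h; exists j.
  have c20 j : c2 j = 0.
    have [ib' _] := hb'; apply/eqP; rewrite -oppr_eq0; apply/eqP.
    by apply: (ib' (fun j => - c2 j)); rewrite -e big1 // => j' _; rewrite c10 scale0r.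
  move: ci; rewrite -(splitK i); case: (fintype.split i) => j' /=.
    by rewrite -[c _]/(c1 j') c10 eqxx.
  by rewrite -[c _]/(c2 j') c20 eqxx.
have [d' d0' Od] := common_denominator_OK c1; pose d : K := d'%:R.
have d0 : d != 0 by rewrite /d; case: d' d0' {Od d} => // d' _; apply: charK0.
exists (fun j => d * c1 j); split; first by exists j; rewrite mulf_neq0.
exists (\sum_j (d * c1 j) *: y j); last first.
  have [_ ->] := eval_row_sum hF sa hPx (fun j => d * c1 j) (fun j => lFW (proj1 (hy j))).
  by apply: eq_bigr => j' _; rewrite yv.
split.
  apply: (big_ind lF) => // j' _; apply: lFZ; last by case: (hy j').
  exact: (loc_sub hp).
have : order_sections k.+1 (\sum_j (d * c1 j) *: y j).
  have -> : \sum_j (d * c1 j) *: y j = d *: \sum_j (- c2 j) *: b' j.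
    by rewrite -e scaler_sumr; apply: eq_bigr => j' _; rewrite scalerA.
  apply: ordZ; apply: ord_sum => j'; case: hb' => _ ->; exact: lspan_mem.
by case.
Qed.

Lemma local_row_submodule : submodule Op G.
Proof.
split=> [a|u v hu hv a|c v Oc hv a]; rewrite mxE.
- by rewrite mul0r; apply: (subring0 hOp).
- by rewrite mulrDl; apply: (subringD hOp); [exact: hu|exact: hv].
- by rewrite -mulrA; apply: (subringM hOp) => //; exact: hv.
Qed.

Lemma local_row_index e : has_index G (wpow w G e) (#|'I_q| ^ (r * e)).
Proof.
have [rho [Orho rinj rsurj _]] := residue_reps R hp pw w0 hw.
have idx1 : has_index Op [set w * y | y in Op] q.
  exists 'I_q, rho; split.
  - by move=> u; apply: (loc_sub hp).
  - by move=> u u' [y Oy ey]; apply: rinj; rewrite -ey mulrAC divff // mul1r.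
  - by move=> y /rsurj[u hu]; exists u; exists ((y - rho u) / w) => //; rewrite mulrC divfK.
  - exact: card_ord.
have [s0 [Os0 s0inj s0surj]] := has_index_ord (loc_power_index hOp Ow w0 idx1 e).
rewrite card_ord (mulnC r) expnM.
have -> : wpow w G e = [set u : 'rV[K]_r | forall a, [set w ^+ e * y * gam a | y in Op] (u 0 a)].
  have we : w ^+ e != 0 by apply: expf_neq0.
  apply/seteqP; split=> [_ [u Gu <-] a|u hu].
    by exists (u 0 a / gam a); [exact: Gu|rewrite [RHS]mxE -[LHS]mulrA (divfK (gam0 a))].
  exists (w ^- e *: u); last by rewrite scalerA divff // scale1r.
  move=> a; have [y Oy ey] := hu a; by rewrite mxE -ey mulrA (mulfK (gam0 a)) (mulKf we).
apply: (@has_index_ffun K r 'rV[K]_r (fun a => [set y | Op (y / gam a)])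
  (fun a => [set w ^+ e * y * gam a | y in Op]) (fun u a => u 0 a) (q ^ e)%N
  'I_(q ^ e) (fun a u => s0 u * gam a)).
- by move=> f; exists (\row_a f a) => a; rewrite mxE.
- by move=> u v a; rewrite !mxE.
- by move=> a u; rewrite /= mulfK.
- move=> a u u' [y Oy ey]; apply: s0inj; exists y => //.
  by apply: (mulIf (gam0 a)); rewrite ey mulrBl.
- move=> a y Oy; have [u [z Oz ez]] := s0surj _ Oy; exists u, z => //.
  by rewrite ez mulrBl (divfK (gam0 a)).
- exact: card_ord.
Qed.

(** The subgroup [N] is the image of the localized sections plus [w^e G]. It contains [w^e G], as
    the gluing of local indices requires, and the filtration by order bounds its index from
    below. *)
Lemma prime_index e : exists N a, [/\ subgroup N,
  [set w ^+ e *: v | v in G] `<=` N, Tr @` F `<=` N, has_index G N a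
  & (q ^ (\sum_(1 <= k < e.+1) order_rank k) <= a)%N].
Proof.
have [rho [Orho rinj rsurj _]] := residue_reps R hp pw w0 hw.
have [a ha qa] := filtration_index hOp Ow w0 wV dvr (loc_frac hp) rsurj
  (rk := rk) (M := order_image) local_row_submodule (local_row_index e)
  (fun k _ => order_image_submodule k) (fun k _ => @order_image_sub k)
  (fun k b v _ => @order_image_sat k b v) (erefl _) (fun k _ => order_rankS k)
  (fun k v _ => @order_image_rank k v).
have [M0 MD MZ] := order_image_submodule 0.
have [G0 GD GZ] := local_row_submodule.
exists [set y | exists u v, [/\ order_image 0 u, G v & y = u + w ^+ e *: v]], a; split=> //.
- split; first by exists 0, 0; rewrite scaler0 addr0.
  have ON1 : Op (-1) by apply: (subringN hOp); apply: (subring1 hOp).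
  move=> _ _ [u [v [hu hv ->]]] [u' [v' [hu' hv' ->]]].
  exists (u - u'), (v - v'); rewrite scalerBr opprD addrACA.
  by split=> //; rewrite -scaleN1r; [apply: (MD) => //; apply: (MZ)|apply: (GD) => //; apply: (GZ)].
- by move=> _ [v Gv <-]; exists 0, v; rewrite add0r.
- move=> _ [v Fv <-]; exists (Tr v), 0; rewrite scaler0 addr0; split=> //.
  by exists v => //; split=> //; apply: lspan_mem => //; apply: (subring1 hOp).
move: qa; rewrite card_ord.
suff -> : (\sum_(1 <= k < e.+1) rk k = \sum_(1 <= k < e.+1) order_rank k)%N by [].
by apply: eq_big_nat => -[|k].
Qed.

End PrimeFiltration.

(** * The arithmetic inequality *)

Section PullBackIndex.
Variables (R : realType) (K : fieldExtType rat) (n : nat) (E : set 'rV[K]_n.+1).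
Local Notation O := (ring_of_integers K).
Let hO : subring O := OK_subring K.
Hypothesis hE : submodule O E.
Hypothesis projE : fg_projective O E.
Hypothesis genE : lspan setT E = setT.
Variables (x : 'rV[K]_n.+1) (sa : K).
Hypothesis x0 : x != 0.
Hypothesis sa0 : sa != 0.
Hypothesis hsa : pull_back E x 1 sa.
Local Notation B := (pull_back E x).

Let saO_subgroup d : subgroup [set sa ^+ d * o | o in O].
Proof.
split; first by exists 0; [exact: (subring0 hO)|rewrite mulr0].
by move=> _ _ [u Ou <-] [v Ov <-]; exists (u - v); [exact: (subringB hO)|rewrite mulrBr].
Qed.

Lemma pull_back_index : has_index (B 1) [set sa * o | o in O]
  (card_quotient (B 1 : set K) [set sa * o | o in O]).
Proof.
have [m [e [phi [Ee Ophi _ _ eE]]]] := projE.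
have [N N0 ON] := common_denominator_OK (fun i => evaluate x (linear_form (e i)) / sa).
have N0' : N%:R != 0 :> K by case: N N0 {ON} => // N _; apply: charK0.
have OB y : B 1 y -> O (N%:R * (y / sa)).
  move=> [_ /(sym1P hE)[v Ev ->] <-].
  have -> : evaluate x (linear_form v) = \sum_i phi i v * evaluate x (linear_form (e i)).
    rewrite {1}(eE v Ev) evaluate_linear.
    under [RHS]eq_bigr => i _ do rewrite evaluate_linear mulr_sumr.
    rewrite exchange_big; apply: eq_bigr => k _ /=.
    by rewrite summxE mulr_suml; apply: eq_bigr => i _; rewrite mxE mulrA.
  rewrite mulr_suml mulr_sumr; apply: (subring_sum hO) => i _.
  by rewrite -mulrA mulrCA; apply: (subringM hO); [exact: Ophi|exact: ON].
have [T [kap hkap]] := OK_sep_nat K R N0.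
have sg := saO_subgroup 1; rewrite expr1 in sg.
have [] := @index_sep_has _ (B 1 : set K) _ #|T| sg; last by [].
exists T, (fun y => kap (N%:R * (y / sa))); split=> // y z By Bz /(hkap _ _ (OB _ By) (OB _ Bz))[o Oo e'].
exists o => //; apply: (mulfI (invr_neq0 sa0)); rewrite mulKf //.
apply: (mulfI N0'); rewrite -e'; ring.
Qed.

Lemma pull_back_power_index D : exists2 m, has_index [set y | B D (y * sa ^+ D)] O m
  & (m <= card_quotient (B 1 : set K) [set (sa * o)%R | o in O] ^ D)%N.
Proof.
have sD : sa ^+ D != 0 by apply: expf_neq0.
have [m hm mle] := power_index R D sa0 hsa (pull_back0 E x) (pull_back_submodule E x)
  (pull_backS hE x) (pull_back_principal R projE genE x0) pull_back_index.
exists m => //.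
have -> : [set y | B D (y * sa ^+ D)] = [set y / sa ^+ D | y in (B D : set K)].
  apply/seteqP; split=> [y By|_ [y By <-]]; last by rewrite /= divfK.
  by exists (y * sa ^+ D) => //; rewrite mulfK.
have -> : O = [set y / sa ^+ D | y in [set sa ^+ D * o | o in O]].
  apply/seteqP; split=> [y By|_ [_ [y By <-] <-]]; last by rewrite mulrC mulKf.
  by exists (sa ^+ D * y); [exists y|rewrite mulrC mulKf].
have [B0 BD BZ] := pull_back_submodule E x D.
apply: has_index_image => //.
- exact: submodule_subgroupO (pull_back_submodule E x D).
- by move=> u v _ _; rewrite mulrBl.
- by move=> u _ /eqP; rewrite mulf_eq0 invr_eq0 (negbTE sD) orbF => /eqP.
move=> _ [o Oo <-]; rewrite mulrC; apply: (BZ) => //.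
elim: {B0 BD BZ sD hm mle} D => [|D IH].
  by rewrite expr0 pull_back0; apply: (subring1 hO).
by rewrite exprS -[D.+1]/(1 + D)%N; apply: pull_backM.
Qed.

End PullBackIndex.

Section GlobalInequality.
Variables (R : realType) (K : fieldExtType rat) (n : nat) (E : set 'rV[K]_n.+1).
Variable I : prime_idealr {mpoly K[n.+1]}.
Local Notation O := (ring_of_integers K).
Local Notation lf := (@linear_form K n).
Local Notation L := (cone_field I).
Local Notation rs := (Defs.restrict I).
Local Notation dK := (\dim {:K}).
Let hO : subring O := OK_subring K.
Hypothesis hE : submodule O E.
Hypothesis projE : fg_projective O E.
Hypothesis genE : lspan setT E = setT.
Variables (J : finType) (p : J -> set K).
Hypothesis hp : forall j, maximal_ideal O (p j).
Hypothesis hpinj : injective p.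
Variables (T : Type) (P : T -> 'rV[K]_n.+1) (xi : J -> nat -> set L) (i1 : T).
Hypothesis hP : forall i, rational_point I (P i).
Hypothesis hxi : forall i j, reduction E I (p j) (P i) = xi j.
Hypothesis hreg : forall j, regular_local (local_ring E (xi j)).
Variables (D : nat) (F : set L).
Hypothesis hF : saturated_sections E D F.
Variable t : J -> L.
Hypothesis ht : forall j, trivialization E (xi j) D (t j).
Variables (r : nat) (s : 'I_r -> L).
Local Notation W := (restriction_image D : set L).
Hypothesis hs : is_basis W s.
Hypothesis Fs : forall b, F (s b).
Variables (pt : 'I_r -> T) (sa : 'I_r -> K).
Local Notation x := (fun a => P (pt a)).
Hypothesis sa0 : forall a, sa a != 0.
Hypothesis hsa : forall a, pull_back E (x a) 1 (sa a).
Hypothesis Delta0 : \det (eval_mx D s x) != 0.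
Variables (th : K) (Oth : O th).
Hypothesis hth : forall y : K, exists g : {poly rat}, y = horner_alg th g.
Variable emb : 'I_dK -> embedding K R.
Hypothesis emb_inj : injective (fun k => emb k th).

Local Notation Tr := (eval_row D x sa).
Local Notation q j := (card_quotient O (p j)).
Local Notation S := (lspan O (range s)).
Local Notation nb a := (card_quotient (pull_back E (x a) 1 : set K) [set sa a * o | o in O]).

Let hPx a : rational_point I (x a). Proof. exact: hP. Qed.
Let x0 a : x a != 0. Proof. by case: (hPx a). Qed.
Let FW v : F v -> W v.
Proof.
by move=> Fv; apply: (lspan_sections hF (A := O)); apply: lspan_mem => //; apply: (subring1 hO).
Qed.
Let Fsub : submodule O F. Proof. by case: hF. Qed.
Let Fgrp : subgroup F.
Proof.
case: Fsub => F0 FD FZ; split=> // u v Fu Fv; rewrite -scaleN1r; apply: (FD) => //.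
by apply: (FZ) => //; apply: (subringN hO); apply: (subring1 hO).
Qed.
Let SF : S `<=` F.
Proof. by apply: lspan_sub => // _ [b _ <-]. Qed.
Let Sgrp : subgroup S.
Proof.
split; first exact: lspan0.
move=> u v Su Sv; rewrite -scaleN1r; apply: lspanD => //; apply: lspanZ => //.
  by move=> a b; apply: (subringM hO).
by apply: (subringN hO); apply: (subring1 hO).
Qed.

Let TrB u v : F u -> F v -> Tr (u - v) = Tr u - Tr v.
Proof. by move=> Fu Fv; apply: (eval_rowB hF sa hPx); apply: FW. Qed.
Let Tr_eq0 v : F v -> Tr v = 0 -> v = 0.
Proof. by move=> Fv; apply: (eval_row_eq0 hF hs hPx sa0 Delta0); apply: FW. Qed.

Lemma eval_row_lattice : [set v *m norm_mx D s x sa | v in @Orow K r] = Tr @` S.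
Proof.
apply/seteqP; split=> [_ [v Ov <-]|_ [v Sv <-]].
  exists (\sum_b v 0 b *: s b); last first.
    rewrite (eval_row_basis hF hs sa hPx); congr (_ *m _).
    by apply/rowP => b; rewrite mxE.
  by apply: lspan_sum => b; apply: lspan_smul; [exact: Ov|exists b].
have [c Oc ->] := lspan_range Sv (subring0 hO) (fun a b => @subringD _ _ hO a b).
exists (\row_b c b); first by move=> b; rewrite mxE; apply: Oc.
by rewrite (eval_row_basis hF hs sa hPx).
Qed.

(** In the chain formed by [Tr S], [Tr F] and the sum [rowset g] of the normalized fibre powers, the
    lower index is that of [S] in [F] and the upper one is at least the product of the local
    indices. Since [Tr S] is the image of [O^r] under [norm_mx], [global_index] bounds the product
    of both by the norm of its determinant. *)
Lemma global_inequality e :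
  [/\ (0 < card_quotient F S)%N, forall a, (0 < nb a)%N &
  (card_quotient F S * \prod_j q j ^ (\sum_(1 <= k < e.+1)
     order_rank E (p j) P (xi j) i1 F (t j) k))%:R
  <= (\prod_a nb a ^ D)%:R * \prod_k Normc.normc (emb k (\det (norm_mx D s x sa))) :> R].
Proof.
have hdvr j := dvr_at R (hp j).
pose w j := projT1 (cid (hdvr j)).
have pw j : p j (w j) by case: (projT2 (cid (hdvr j))).
have w0 j : w j != 0 by case: (projT2 (cid (hdvr j))).
have wV j : ~ localize O (p j) (w j)^-1 by case: (projT2 (cid (hdvr j))).
have dvr j : forall a, localize O (p j) a -> a != 0 -> exists k u,
    [/\ localize O (p j) u, localize O (p j) u^-1 & a = u * w j ^+ k].
  by case: (projT2 (cid (hdvr j))).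
have hw j : forall y, p j y -> localize O (p j) (y / w j) by case: (projT2 (cid (hdvr j))).
have hgen j := exists_local_gen projE genE (hp j) (pw j) (w0 j) (dvr j) (proj1 (hP i1)).
pose e0 j := projT1 (cid (hgen j)).
have he0 j : local_gen E (p j) (P i1) (e0 j) := projT2 (cid (hgen j)).
have he j i := local_gen_all hE projE genE (hp j) (pw j) (w0 j) (wV j) (dvr j) (hw j) hP
  (fun i => hxi i j) (he0 j) i.
pose g a : set K := [set y | pull_back E (x a) D (y * sa a ^+ D)].
pose gam j a := evaluate (x a) (lf (e0 j)) ^+ D / sa a ^+ D.
have sD a : sa a ^+ D != 0 by apply: expf_neq0.
have lD j a : evaluate (x a) (lf (e0 j)) ^+ D != 0.
  by apply: expf_neq0; case: (he j (pt a)).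
have hg a : submodule O (g a : set K^o).
  have [B0 BD BZ] := pull_back_submodule E (x a) D; split.
  - by rewrite /g /= mul0r.
  - by move=> u v hu hv; rewrite /g /= mulrDl; apply: (BD).
  - by move=> c u Oc hu; rewrite /g /= -[c *: u]/(c * u) -mulrA; apply: (BZ).
have ggam j a : g a (gam j a).
  by rewrite /g /gam /= divfK //; apply: (pull_back_gen (he j (pt a))).
have gam0 j a : gam j a != 0 := mulf_neq0 (lD j a) (invr_neq0 (sD a)).
have gloc j a y : g a y -> localize O (p j) (y / gam j a).
  move=> gy; have := pull_back_loc (hp j) (he j (pt a)) gy.
  by rewrite /gam invf_div mulrA.
have saD a : pull_back E (x a) D (sa a ^+ D).
  elim: (D) => [|d IH]; first by rewrite expr0 pull_back0; apply: (subring1 hO).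
  by rewrite exprS -[d.+1]/(1 + d)%N; apply: pull_backM.
have OG : @Orow K r `<=` rowset g.
  move=> v Ov a; have [_ _ BZ] := pull_back_submodule E (x a) D.
  by apply: (BZ) => //; apply: Ov.
pose M := Tr @` F.
have Tr0 : Tr (0 : L) = 0.
  by have [F0 _] := Fgrp; rewrite -{1}(subrr (0 : L)) (TrB F0 F0) subrr.
have Mgrp : subgroup M.
  split; first by exists 0; [case: Fgrp|exact: Tr0].
  by move=> _ _ [u Fu <-] [v Fv <-]; exists (u - v); [case: Fgrp => _; apply|rewrite TrB].
have Ggrp : subgroup (rowset g).
  split=> [a|u v hu hv a]; first by rewrite mxE; case: (hg a).
  have [h0 hB] := submodule_subgroupO (hg a).
  by rewrite !mxE; apply: (hB); [exact: hu|exact: hv].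
have MG : M `<=` rowset g.
  move=> _ [v Fv <-] a; rewrite /g /= mxE divfK //.
  apply: (global_evaluation R hE projE genE (x0 a) (hPx a)).
  by rewrite (lift_sectionK (FW Fv)); case: hF => Fg _ _ _; apply: Fg.
have [g0 hg0 g0le] : exists2 g0, has_index (rowset g) (@Orow K r) g0 & (g0 <= \prod_a nb a ^ D)%N.
  have hm a : exists m, has_index (g a) O m /\ (m <= nb a ^ D)%N.
    by have [m h1 h2] := pull_back_power_index R hE projE genE (x0 a) (sa0 a) (hsa a) D; exists m.
  pose m a := projT1 (cid (hm a)).
  have [k hk kle] : exists2 k, has_index (rowset g) (@Orow K r) k & (k <= \prod_a m a)%N.
    apply: (rowset_index (h := fun=> O)) => a.
    + by split; [exact: (subring0 hO)|exact: (subringB hO)].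
    + by case: (hg a).
    + by case: (projT2 (cid (hm a))).
  exists k => //; apply: leq_trans kle _; apply: leq_prod => a _.
  by case: (projT2 (cid (hm a))).
have [c c0 hc] := OK_lattice Oth hth emb_inj.
have TM : [set v *m norm_mx D s x sa | v in @Orow K r] `<=` M.
  by rewrite eval_row_lattice => _ [v Sv <-]; exists v => //; apply: SF.
have [m1 [m2 [i1m i2m le]]] := global_index Oth hth emb_inj
  (norm_mx_neq0 sa0 Delta0) c0 hc Ggrp Mgrp OG MG TM hg0.
have hN j := prime_index R hE projE genE (hp j) (pw j) (w0 j) (wV j) (dvr j) (hw j) hP
  (fun i => hxi i j) (he0 j) (hreg j) hF (ht j) hs (pt := pt) sa0 Delta0 e.
pose N j := projT1 (cid (hN j)); have hN' j := projT2 (cid (hN j)).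
pose na j := projT1 (cid (hN' j)); have hna j := projT2 (cid (hN' j)).
have crt : (\prod_j na j <= m1)%N.
  apply: (crt_index (N := N) (e := e) hp hpinj w0 hw hg ggam gam0 gloc Mgrp _ _ _ _ i1m) => j.
  - by case: (hna j).
  - by case: (hna j).
  - by case: (hna j).
  - by case: (hna j).
have crt2 : (\prod_j q j ^ (\sum_(1 <= k < e.+1)
     order_rank E (p j) P (xi j) i1 F (t j) k) <= m1)%N.
  apply: leq_trans crt; apply: leq_prod => j _; by case: (hna j).
have TSgrp : subgroup (Tr @` S).
  have [S0 SB] := Sgrp.
  split; first by exists 0.
  move=> _ _ [u Su <-] [v Sv <-]; exists (u - v); first exact: (SB).
  by rewrite TrB //; apply: SF.
have idxF : has_index F S m2.
  have isep : index_sep F S m2.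
    rewrite eval_row_lattice in i2m.
    have [Tt [kap [hk cT]]] := has_index_sep TSgrp (proj1 Mgrp) i2m.
    exists Tt, (fun v => kap (Tr v)); split=> // u v Fu Fv ek.
    have [y Sy ey] := hk (Tr u) (Tr v) (ex_intro2 _ _ u Fu erefl) (ex_intro2 _ _ v Fv erefl) ek.
    have Fuv : F (u - v) by case: Fgrp => _; apply.
    have -> : u - v = y; last by [].
    apply/eqP; rewrite -subr_eq0; apply/eqP; apply: Tr_eq0.
      by case: Fgrp => _; apply=> //; apply: SF.
    by rewrite TrB //; [rewrite TrB // -ey subrr|apply: SF].
  have [hF1 _] := index_sep_has Sgrp isep.
  have := has_index_image Fgrp TrB Tr_eq0 SF hF1.
  rewrite eval_row_lattice in i2m => h2.
  by rewrite (has_index_uniq TSgrp (proj1 Mgrp) i2m h2).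
have cF : card_quotient F S = m2 by apply: card_quotientE => //; case: Fgrp.
split.
- by rewrite cF; apply: has_index_gt0 idxF; case: Fgrp.
- move=> a; have [B0 _ _] := pull_back_submodule E (x a) 1.
  exact: (has_index_gt0 B0 (@pull_back_index R K n E hE projE (x a) (sa a) (sa0 a))).
rewrite cF; apply: le_trans (le_trans _ le) _.
  by rewrite ler_nat mulnC leq_mul2r crt2 orbT.
by rewrite ler_wpM2r ?ler_nat // prodr_ge0 // => k _; apply: normc_ge0.
Qed.

End GlobalInequality.

(** * Degrees and heights *)

Section Logarithms.
Variable R : realType.

Lemma ln_prod (T : finType) (f : T -> R) : (forall i, 0 < f i) ->
  0 < \prod_i f i /\ ln (\prod_i f i) = \sum_i ln (f i).
Proof.
move=> f0; elim/big_rec2: _ => [|i y z _ [z0 e]]; first by rewrite ln1 ltr01.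
by rewrite lnM ?posrE // e mulr_gt0.
Qed.

Lemma nneseries_eventually0 (u : nat -> nat) e : (forall k, (e < k)%N -> u k = 0%N) ->
  (\sum_(1 <= k <oo) (u k)%:R%:E = (\sum_(1 <= k < e.+1) u k)%:R%:E :> \bar R)%E.
Proof.
move=> u0; apply: (lim_near_cst (@ereal_hausdorff R)).
exists e.+1 => // m /= em.
rewrite (@big_cat_nat _ _ _ e.+1) //= [X in (_ + X)%E]big_nat_cond [X in (_ + X)%E]big1 ?adde0.
  by rewrite sumEFin natr_sum.
by move=> k /andP[/andP[ek _] _]; rewrite u0.
Qed.

Variables (J : finType) (u : J -> nat -> nat) (l : J -> R) (C : R).
Hypothesis uS : forall j k, (u j k.+2 <= u j k.+1)%N.
Hypothesis l2 : forall j, ln 2 <= l j.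
Hypothesis bnd : forall e, \sum_j (\sum_(1 <= k < e.+1) u j k)%:R * l j <= C.

(** If [u j k] is positive, so are the ranks at levels 1 to [k], and their sum is at least [k];
    hence [k ln 2 <= C]. *)
Lemma bounded_ranks : exists e, forall j k, (e < k)%N -> u j k = 0%N.
Proof.
have ln2 : 0 < ln 2 :> R by rewrite ln_gt0 // ltr1n.
have C0 : 0 <= C.
  apply: le_trans (bnd 0); apply: sumr_ge0 => j _.
  by rewrite mulr_ge0 // (le_trans (ltW ln2)).
exists (Num.bound (C / ln 2)) => j k ek.
have k0 : (0 < k)%N by apply: leq_ltn_trans ek.
have dec i m : (u j (i + m).+1 <= u j i.+1)%N.
  by elim: m => [|m IH]; rewrite ?addn0 // addnS; apply: leq_trans IH.
apply/eqP; rewrite -leqn0 leqNgt; apply/negP => uk.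
have sk : (k <= \sum_(1 <= i < k.+1) u j i)%N.
  apply: leq_trans (_ : _ <= \sum_(1 <= i < k.+1) 1)%N _.
    by rewrite sum_nat_const_nat subn1 muln1.
  rewrite [leqLHS]big_nat_cond [leqRHS]big_nat_cond; apply: leq_sum => -[|i] /andP[/andP[_ ik] _] //.
  apply: leq_trans uk _; move: (dec i (k.-1 - i)%N).
  by rewrite subnKC ?prednK //; lia.
have : k%:R * ln 2 <= C.
  apply: le_trans (bnd k); rewrite (bigD1 j) //=.
  have h1 : k%:R * ln 2 <= (\sum_(1 <= i < k.+1) u j i)%:R * l j.
    by apply: ler_pM; rewrite ?ler_nat // ltW.
  apply: le_trans h1 _; rewrite lerDl; apply: sumr_ge0 => j' _; rewrite mulr_ge0 //.
  by rewrite (le_trans (ltW ln2)).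
rewrite -ler_pdivlMr // leNgt => /negP; apply.
have := archi_boundP (divr_ge0 C0 (ltW ln2)) => h.
by apply: lt_le_trans h _; rewrite ler_nat ltnW.
Qed.

End Logarithms.

Section Degrees.
Variables (R : realType) (K : fieldExtType rat) (n : nat) (E : set 'rV[K]_n.+1).
Variable I : prime_idealr {mpoly K[n.+1]}.
Local Notation O := (ring_of_integers K).
Local Notation C := R[i].
Local Notation L := (cone_field I).
Local Notation rs := (Defs.restrict I).
Local Notation dK := (\dim {:K}).
Let hO : subring O := OK_subring K.
Hypothesis hE : submodule O E.
Hypothesis projE : fg_projective O E.
Hypothesis genE : lspan setT E = setT.
Variable emb : 'I_dK -> embedding K R.
Hypothesis emb_inj : injective emb.
Hypothesis emb_surj : forall sigma, exists k, sigma = emb k.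
Variable h : embedding K R -> {dot 'rV[C]_n.+1 for conjc}.

Lemma sum_embeddings (f : embedding K R -> R) :
  \sum_(sigma \in [set: embedding K R]) f sigma = \sum_k f (emb k).
Proof.
rewrite (fsbigE (map emb (enum 'I_dK))).
- rewrite big_map; under eq_bigl => k do rewrite mem_set //.
  exact: big_enum.
- by rewrite map_inj_uniq // enum_uniq.
- by [].
move=> sigma _; have [k ->] := emb_surj sigma.
by rewrite map_f // mem_enum.
Qed.

Local Notation nu k x := (quotient_norm (h (emb k)) (fun i => emb k (x 0 i)) 1).

Lemma embedded_point_neq0 k (x : 'rV[K]_n.+1) : x != 0 -> exists i, emb k (x 0 i) != 0.
Proof. by move=> /rV0Pn[i xi]; exists i; rewrite fmorph_eq0. Qed.

(** The one basis element that the definition of the degree selects is kept as [sa], and the values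
    at [x] are later normalized by it. The metric on the fibre being a multiple of the absolute
    value, its Gram determinant splits into the two logarithms. *)
Lemma height_witness (x : 'rV[K]_n.+1) : x != 0 -> exists sa : K,
  [/\ sa != 0, pull_back E x 1 sa &
  height E h x * dK%:R =
   ln (card_quotient (pull_back E x 1 : set K) [set sa * o | o in O])%:R
   - \sum_k (ln (nu k x) + ln (Normc.normc (emb k sa)))].
Proof.
move=> x0; have [e Ee e0] := pull_back_neq0 genE x0.
pose s1 : K^o := evaluate x (linear_form e).
have Bs1 : pull_back E x 1 s1 by exists (linear_form e) => //; apply/(sym1P hE); exists e.
have s1n : s1 != 0 by [].
have bas1 : is_basis (lspan setT (pull_back E x 1)) (fun _ : 'I_1 => s1).
  split.
    move=> c; rewrite big_ord1 => /eqP; rewrite scaler_eq0 (negbTE s1n) orbF => /eqP c0 i.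
    by rewrite (ord1 i).
  have all (X : set K^o) y : X s1 -> lspan setT X y.
    move=> Xs; have -> : y = (y / s1) *: s1 by rewrite -[_ *: _]/(y / s1 * s1) divfK.
    exact: lspan_smul.
  by apply/seteqP; split=> y _; apply: all => //; exists ord0.
rewrite /height divfK; last by rewrite pnatr_eq0 -lt0n dimK_gt0.
rewrite /arakelov_degree.
set Q := (X in xget 0 X).
have [r [s [Bs hs ->]]] : Q (xget 0 Q).
  by apply: xgetPex; eexists; exists 1%N, (fun _ : 'I_1 => s1).
have r1 : r = 1%N := basis_uniq hs bas1.
subst r; exists (s ord0).
have ss : s = fun=> s ord0 by apply/funext => i; rewrite (ord1 i).
have s0 : s ord0 != 0.
  apply/eqP => s0; have [ind _] := hs.
  have := ind (fun=> 1); rewrite big_ord1 s0 scaler0 => /(_ erefl ord0)/eqP.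
  by rewrite oner_eq0.
split=> //; congr (ln (card_quotient _ _)%:R - _).
  apply/seteqP; split=> [y /lspan_range|_ [o Oo <-]].
    move=> /(_ (subring0 hO) (fun a b => @subringD _ _ hO a b))[c Oc ->].
    by exists (c ord0) => //; rewrite big_ord1 mulrC.
  by rewrite mulrC; apply: lspan_smul => //; exists ord0.
rewrite sum_embeddings mulr_sumr; apply: eq_bigr => k _.
rewrite det_mx11 mxE (quotient_polarization _ (embedded_point_neq0 k x0)) -mulrA normc_sq -rmorphM /=.
have np := quotient_norm_gt0 (h (emb k)) (embedded_point_neq0 k x0).
have sp : 0 < Normc.normc (emb k (s ord0)) by apply: normc_gt0; rewrite fmorph_eq0.
have -> : s 0 = s ord0 by congr s; apply: val_inj.
by rewrite lnM ?posrE ?exprn_gt0 // !lnXn // -mulrnDl -[X in _ * X]mulr_natl mulKf.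
Qed.

Variables (D : nat) (F : set L).
Variable john : embedding K R -> {dot dhomog n.+1 C D for conjc}.
Hypothesis hF : saturated_sections E D F.
Local Notation W := (restriction_image D : set L).

Lemma sections_basis : exists r (s : 'I_r -> L), (forall b, F (s b)) /\ is_basis W s.
Proof.
have lF : lspan setT F = W by case: hF.
have WF : lspan setT F `<=` lspan setT (range
    (fun i : 'I_(\dim {:dhomog n.+1 K D}) => rs (vbasis {:dhomog n.+1 K D})`_i)).
  move=> v; rewrite lF => -[f hf <-].
  have [f' ->] : exists f' : dhomog n.+1 K D, f = f' by exists (DHomog hf).
  rewrite {1}(coord_vbasis (memvf f')).
  set X := (Y in lspan _ Y).
  have XS (g : dhomog n.+1 K D) : (exists m (c : 'I_m -> K) (u : 'I_m -> dhomog n.+1 K D),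
      g = \sum_i c i *: u i /\ forall i, X (rs (u i))) -> lspan setT X (rs g).
    move=> [m [c [u [-> Xu]]]].
    elim/big_rec: _ => [|i g' _ IH]; first by rewrite dhomog0E restrict0; apply: lspan0.
    rewrite dhomogDE restrictD; apply: lspanD => //.
    by rewrite dhomogZE restrictZ; apply: lspan_smul.
  apply: XS; exists (\dim {:dhomog n.+1 K D}), (fun i => coord (vbasis {:dhomog n.+1 K D}) i f'),
    (fun i => (vbasis {:dhomog n.+1 K D})`_i); split=> // i.
  by exists i.
have [r [s [Fs hs]]] := exists_basis WF.
by exists r, s; split=> //; rewrite -lF.
Qed.

(** The basis is the one selected inside the definition of the degree; the determinant and the
    indices are then formed with the same basis. *)
Lemma degree_witness : exists r (s : 'I_r -> L),
  [/\ forall b, F (s b), is_basis W s, dimension (lspan (setT : set K) F) = r &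
  arakelov_degree F (FD_product john) =
   ln (card_quotient F (lspan O (range s)))%:R
   - 2^-1 * \sum_k ln (complex.Re (\det (\matrix_(i, l) FD_product john (emb k) (s i) (s l))))].
Proof.
have lF : lspan setT F = W by case: hF.
have [r1 [s1 [Fs1 hs1]]] := sections_basis.
rewrite /arakelov_degree; set Q := (X in xget 0 X).
have [r [s [Bs hs ->]]] : Q (xget 0 Q).
  by apply: xgetPex; eexists; exists r1, s1; split=> //; rewrite lF.
exists r, s; rewrite sum_embeddings; split=> //; first by rewrite -lF.
exact: dimensionE hs.
Qed.

Lemma sections_rank_gt0 r (s : 'I_r -> L) : is_basis W s ->
  (exists k : 'I_n.+1, ('X_k : {mpoly K[n.+1]}) \notin I) -> (0 < r)%N.
Proof.
move=> hs [k nk]; rewrite lt0n; apply/eqP => r0.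
have Wk : W (rs ('X_k ^+ D)).
  exists ('X_k ^+ D) => //=; elim: (D) => [|d IH]; first by rewrite expr0; apply: dhomog1.
  rewrite exprS -[d.+1]/(1 + d)%N; apply: dhomogM => //.
  by rewrite dhomogX /= mdeg1.
have [c] := basis_span hs Wk.
rewrite big1; last by move=> i; have := ltn_ord i; rewrite {2}r0.
move/eqP; rewrite restrictX expf_eq0 restrict_eq0 (negbTE nk) andbF.
by [].
Qed.

End Degrees.

(** * The slope inequality *)

Section SlopeInequality.
Variables (R : realType) (K : fieldExtType rat) (n : nat) (E : set 'rV[K]_n.+1).
Variable I : prime_idealr {mpoly K[n.+1]}.
Local Notation O := (ring_of_integers K).
Local Notation C := R[i].
Local Notation L := (cone_field I).
Local Notation rs := (Defs.restrict I).
Local Notation dK := (\dim {:K}).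
Let hO : subring O := OK_subring K.
Variable h : embedding K R -> {dot 'rV[C]_n.+1 for conjc}.
Hypothesis hE : submodule O E.
Hypothesis projE : fg_projective O E.
Hypothesis genE : lspan setT E = setT.
Variables (J : finType) (p : J -> set K).
Hypothesis hp : forall j, maximal_ideal O (p j).
Hypothesis hpinj : injective p.
Variables (T : Type) (P : T -> 'rV[K]_n.+1) (xi : J -> nat -> set L) (i1 : T).
Hypothesis hP : forall i, rational_point I (P i).
Hypothesis hxi : forall i j, reduction E I (p j) (P i) = xi j.
Hypothesis hreg : forall j, regular_local (local_ring E (xi j)).
Variables (D : nat) (F : set L).
Variable john : embedding K R -> {dot dhomog n.+1 C D for conjc}.
Hypothesis hjohn : forall sigma, is_john_norm (h sigma) (john sigma).
Hypothesis hF : saturated_sections E D F.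
Variable t : J -> L.
Hypothesis ht : forall j, trivialization E (xi j) D (t j).
Local Notation W := (restriction_image D : set L).
Hypothesis sep : forall s : dhomog n.+1 K D, (forall i, evaluate (P i) s = 0) ->
  (s : {mpoly K[n.+1]}) \in I.

(** A combination of the basis that vanishes at all the [P i] is zero by [sep], so the rows of
    values separate vectors of coefficients. *)
Lemma interpolation_points r (s : 'I_r -> L) : is_basis W s ->
  exists pt : 'I_r -> T, \det (eval_mx D s (fun a => P (pt a))) != 0.
Proof.
move=> hs; pose phi i : 'rV[K]_r := \row_b evaluate (P i) (lift_section D (s b)).
have [v hv|pt upt] := separating_family (phi := phi).
  have Ws := basis_sections hs.
  pose u := \sum_b v b 0 *: s b.
  have Wu : W u.
    have [W0 WD WZ] := sections_submodule hF.
    by apply: (big_ind W) => [//|y z|b _]; [exact: (WD)|exact: (WZ)].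
  have evu i : evaluate (P i) (lift_section D u) = 0.
    have /rowP/(_ ord0) := hv i; rewrite [RHS]mxE mxE => <-.
    have [W0 WD WZ] := sections_submodule hF.
    have [_ ->] : W u /\ evaluate (P i) (lift_section D u)
        = \sum_b v b 0 * evaluate (P i) (lift_section D (s b)).
      apply: (big_ind2 (fun y z => W y /\ evaluate (P i) (lift_section D y) = z)).
      - by split=> //; have := evaluate_liftZ hF (hP i) 0 W0; rewrite scale0r mul0r.
      - move=> y z y' z' [Wy <-] [Wy' <-]; split; first exact: (WD).
        exact: (evaluate_liftD hF (hP i)).
      - move=> b _; split; first exact: (WZ).
        exact: (evaluate_liftZ hF (hP i)).
    by apply: eq_bigr => b _; rewrite mxE mulrC.
  have u0 : u = 0.
    rewrite -(lift_sectionK Wu); apply/eqP; rewrite restrict_eq0; exact: sep.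
  apply/colP => b; rewrite [RHS]mxE; have [ind _] := hs.
  exact: (ind (fun b => v b 0)).
exists pt; rewrite -unitfE -unitmxE -unitmx_tr.
suff -> : (eval_mx D s (fun a => P (pt a)))^T = \matrix_a phi (pt a) by [].
by apply/matrixP => a b; rewrite !mxE.
Qed.

(** Logarithms of the finite and the archimedean inequality are added. The conjugates of the
    determinant occur in both with opposite effect and cancel, which is the product formula; those
    of [sa] cancel between [norm_mx] and the heights. *)
Lemma slope_inequality : exists r (pt : 'I_r -> T),
  [/\ dimension (lspan (setT : set K) F) = r,
     (exists k : 'I_n.+1, ('X_k : {mpoly K[n.+1]}) \notin I) -> (0 < r)%N
   & forall e, arakelov_degree F (FD_product john)
     + \sum_j (\sum_(1 <= k < e.+1) order_rank E (p j) P (xi j) i1 F (t j) k)%:R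
              * ln (card_quotient O (p j))%:R
     <= D%:R * \sum_a height E h (P (pt a)) * dK%:R].
Proof.
have [th Oth hth] := primitive_element K.
have [emb [emb_inj emb_surj emb_th]] := embeddings hth R.
have [r [s [Fs hs dimr degE]]] := degree_witness emb_inj emb_surj john hF.
have [pt Delta0] := interpolation_points hs.
exists r, pt; split=> // [|e]; first exact: sections_rank_gt0 hs.
pose x a := P (pt a).
have x0 a : x a != 0 by case: (hP (pt a)).
have hsa a := height_witness hE genE emb_inj emb_surj h (x0 a).
pose sa a := projT1 (cid (hsa a)).
have sa0 a : sa a != 0 by case: (projT2 (cid (hsa a))).
have Bsa a : pull_back E (x a) 1 (sa a) by case: (projT2 (cid (hsa a))).
have htE a : height E h (x a) * dK%:R =
   ln (card_quotient (pull_back E (x a) 1 : set K) [set sa a * o | o in O])%:R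
   - \sum_k (ln (quotient_norm (h (emb k)) (fun i => emb k (x a 0 i)) 1)
             + ln (Normc.normc (emb k (sa a)))) by case: (projT2 (cid (hsa a))).
pose nu k a := quotient_norm (h (emb k)) (fun i => emb k (x a 0 i)) 1.
pose ns k a : R := Normc.normc (emb k (sa a)).
pose nD k : R := Normc.normc (emb k (\det (eval_mx D s x))).
have nu0 k a : 0 < nu k a by apply: quotient_norm_gt0; apply: embedded_point_neq0.
have ns0 k a : 0 < ns k a by apply: normc_gt0; rewrite fmorph_eq0; exact: sa0.
have nD0 k : 0 < nD k by apply: normc_gt0; rewrite fmorph_eq0; exact: Delta0.
have [cF0 nb0 ineq] := global_inequality hE projE genE hp hpinj i1 hP hxi hreg hF ht
  hs Fs sa0 Bsa Delta0 Oth hth emb_th e.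
pose nb a := card_quotient (pull_back E (x a) 1 : set K) [set sa a * o | o in O].
pose rk j := (\sum_(1 <= k < e.+1) order_rank E (p j) P (xi j) i1 F (t j) k)%N.
have q0 j : 0 < (card_quotient O (p j))%:R :> R.
  by rewrite ltr0n; apply: ltnW (residue_gt1 R (hp j)).
have normcX (z : C) m : Normc.normc (z ^+ m) = Normc.normc z ^+ m.
  by elim: m => [|m IH]; rewrite ?expr0 ?Normc.normc1 // !exprS Normc.normcM IH.
have lnorm k : 0 < Normc.normc (emb k (\det (norm_mx D s x sa))) /\
    ln (Normc.normc (emb k (\det (norm_mx D s x sa))))
    = ln (nD k) - D%:R * \sum_a ln (ns k a).
  rewrite det_norm_mx fmorph_div rmorph_prod Normc.normcM Normc.normcV -/(nD k).
  rewrite (big_morph _ (@Normc.normcM R) (Normc.normc1 R)).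
  have [pp lp] := ln_prod (fun a => exprn_gt0 D (ns0 k a)).
  have -> : \prod_a Normc.normc (emb k (sa a ^+ D)) = \prod_a ns k a ^+ D.
    by apply: eq_bigr => a _; rewrite rmorphXn normcX.
  split; first by rewrite divr_gt0.
  rewrite ln_div ?posrE // lp mulr_sumr; congr (_ - _).
  by apply: eq_bigr => a _; rewrite lnXn // mulr_natl.
have lq : \sum_j (rk j)%:R * ln (card_quotient O (p j))%:R
    = ln (\prod_j (card_quotient O (p j))%:R ^+ rk j) :> R.
  have [_ ->] := ln_prod (fun j => exprn_gt0 (rk j) (q0 j)).
  by apply: eq_bigr => j _; rewrite lnXn // mulr_natl.
have log1 : ln (card_quotient F (lspan O (range s)))%:R
    + \sum_j (rk j)%:R * ln (card_quotient O (p j))%:R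
    <= D%:R * (\sum_a ln (nb a)%:R)
       + \sum_k (ln (nD k) - D%:R * \sum_a ln (ns k a)) :> R.
  have [qp _] := ln_prod (fun j => exprn_gt0 (rk j) (q0 j)).
  have nbp a : 0 < (nb a)%:R :> R by rewrite ltr0n nb0.
  have [np lnp] := ln_prod (fun a => exprn_gt0 D (nbp a)).
  have [kp lkp] := ln_prod (fun k => proj1 (lnorm k)).
  have cFp : 0 < (card_quotient F (lspan O (range s)))%:R :> R by rewrite ltr0n.
  rewrite lq -lnM ?posrE //.
  have -> : D%:R * (\sum_a ln (nb a)%:R) = ln (\prod_a (nb a)%:R ^+ D) :> R.
    by rewrite lnp mulr_sumr; apply: eq_bigr => a _; rewrite lnXn // mulr_natl.
  have -> : \sum_k (ln (nD k) - D%:R * \sum_a ln (ns k a))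
      = ln (\prod_k Normc.normc (emb k (\det (norm_mx D s x sa)))).
    by rewrite lkp; apply: eq_bigr => k _; have [_ ->] := lnorm k.
  rewrite -lnM ?posrE // ler_ln ?posrE ?mulr_gt0 //.
  move: ineq; rewrite natrM !natr_prod.
  under eq_bigr => j _ do rewrite natrX.
  by under [X in _ -> _ <= X * _]eq_bigr => a _ do rewrite -natrX.
have log2 k : 2 * (ln (nD k) + D%:R * \sum_a ln (nu k a))
    <= ln (complex.Re (\det (\matrix_(i, l) FD_product john (emb k) (s i) (s l)))).
  have := archimedean_bound hjohn (emb k) (fun a => hP (pt a)) Delta0.
  rewrite -/(nD k).
  have [np lnp] := ln_prod (fun a => exprn_gt0 D (nu0 k a)).
  have pos : 0 < (nD k * \prod_a nu k a ^+ D) ^+ 2 by rewrite exprn_gt0 // mulr_gt0.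
  move=> le; have pos2 := lt_le_trans pos le.
  have : ln ((nD k * \prod_a nu k a ^+ D) ^+ 2) <= ln (complex.Re
      (\det (\matrix_(i, l) FD_product john (emb k) (s i) (s l)))).
    by rewrite ler_ln ?posrE.
  move=> {}le; move: le; rewrite lnXn ?mulr_gt0 // lnM ?posrE // lnp => le.
  have -> : D%:R * \sum_a ln (nu k a) = \sum_a ln (nu k a ^+ D).
    by rewrite mulr_sumr; apply: eq_bigr => a _; rewrite lnXn // mulr_natl.
  by rewrite mulr_natl.
have log3 : \sum_a height E h (P (pt a)) * dK%:R
    = \sum_a ln (nb a)%:R - (\sum_k \sum_a ln (nu k a) + \sum_k \sum_a ln (ns k a)).
  rewrite -big_split /= (eq_bigr _ (fun a _ => htE a)) sumrB; congr (_ - _).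
  rewrite exchange_big; apply: eq_bigr => k _ /=.
  by rewrite -big_split.
have := ler_sum (index_enum _) (fun k _ => log2 k) (P := xpredT).
rewrite -mulr_sumr big_split /= -mulr_sumr => log2'.
move: log1; rewrite sumrB -mulr_sumr => log1.
rewrite degE log3 -/rk.
(* [Sk], [Ss] and [Sn] are the sums over the embeddings of the logarithms for the determinant, for
   the [sa a] and for the metrics at the points; [Gm] is that of the Gram determinants. *)
have combine (u v N Sk Ss Sn Gm d : R) : u + v <= d * N + (Sk - d * Ss) ->
    2 * (Sk + d * Sn) <= Gm -> u - 2^-1 * Gm + v <= d * (N - (Sn + Ss)) by lra.
exact: combine log1 log2'.
Qed.

End SlopeInequality.

Theorem theorem3p4 (R : realType) (K : fieldExtType rat) (n : nat)
  (E : set 'rV[K]_n.+1)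
  (h : embedding K R -> {dot 'rV[R[i]]_n.+1 for conjc})
  (hE : hermitian_bundle E h)
  (X : prime_idealr {mpoly K[n.+1]}) (hX : integral_subscheme X)
  (J : finType) (p : J -> set K)
  (hp : forall j, maximal_ideal (ring_of_integers K) (p j))
  (hpinj : injective p)
  (I : Type) (P : I -> 'rV[K]_n.+1) (hP : forall i, rational_point X (P i))
  (xi : J -> nat -> set (cone_field X))
  (hxi : forall i j, reduction E X (p j) (P i) = xi j)
  (hreg : forall j, regular_local (local_ring E (xi j)))
  (D : nat) (hD : (0 < D)%N)
  (john : embedding K R -> {dot dhomog n.+1 R[i] D for conjc})
  (hjohn : forall sigma, is_john_norm (h sigma) (john sigma))
  (F : set (cone_field X)) (hF : is_FD E D F)
  (i1 : I) (t : J -> cone_field X)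
  (ht : forall j, trivialization E (xi j) D (t j)) :
  let r1 := dimension (lspan (setT : set K) F) in
  (ereal_sup (range (fun i => (height E h (P i))%:E))
   < (slope F (FD_product john) / D%:R - ln r1%:R / (2 * D%:R))%:E
     + ((\dim {:K})%:R^-1)%:E *
       \sum_(j : J) (R_invariant E (p j) (xi j) (P i1) R F (t j)
          * (ln (card_quotient (ring_of_integers K) (p j))%:R
             / (D%:R * r1%:R))%:E))%E ->
  exists s : dhomog n.+1 K D,
    (forall i, evaluate (P i) s = 0) /\ (s : {mpoly K[n.+1]}) \notin X.
Proof.
move=> r1 hlt; apply: contrapT => nos.
have sep (s : dhomog n.+1 K D) : (forall i, evaluate (P i) s = 0) ->
    (s : {mpoly K[n.+1]}) \in X.
  by move=> s0; apply/negPn/negP => ns; apply: nos; exists s.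
case: hE => subE projE genE _; case: hF => satF _; case: hX => _ hX.
have [r [pt [dimr rpos ineq]]] := slope_inequality subE projE genE hp hpinj i1 hP hxi hreg
  hjohn satF ht sep.
have {}rpos := rpos hX.
pose q j := (card_quotient (ring_of_integers K) (p j))%:R : R.
pose u j k := order_rank E (p j) P (xi j) i1 F (t j) k.
have uS j k : (u j k.+2 <= u j k.+1)%N.
  have [w [pw w0 wV dvr hw]] := dvr_at R (hp j).
  have [e0 he0] := exists_local_gen projE genE (hp j) pw w0 dvr (proj1 (hP i1)).
  have [m [s [_ hs]]] := sections_basis satF.
  exact: (order_rankS subE projE genE (hp j) pw w0 wV dvr hw hP (fun i => hxi i j) he0
    satF (ht j) hs k.+1).
have q2 j : ln 2 <= ln (q j) by rewrite ler_ln ?posrE ?ltr0n // ?ler_nat;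
  have := residue_gt1 R (hp j); lia.
set H := \sum_a _ in ineq.
(* The right-hand side does not involve [e]. This uniform bound makes the ranks vanish eventually,
   so that [R_invariant] is a finite real number. *)
have bnd e : \sum_j (\sum_(1 <= k < e.+1) u j k)%:R * ln (q j)
    <= D%:R * H - arakelov_degree F (FD_product john).
  by rewrite lerBrDl; apply: ineq.
have [e u0] := bounded_ranks uS q2 bnd.
pose Rj j := (\sum_(1 <= k < e.+1) u j k)%:R : R.
have RE j : R_invariant E (p j) (xi j) (P i1) R F (t j) = (Rj j)%:E.
  exact: (nneseries_eventually0 R (u0 j)).
pose d : R := (\dim {:K})%:R.
have d0 : 0 < d by rewrite ltr0n dimK_gt0.
have r0 : 0 < r%:R :> R by rewrite ltr0n.
have D0 : 0 < D%:R :> R by rewrite ltr0n.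
pose y : R := slope F (FD_product john) / D%:R - ln r%:R / (2 * D%:R)
  + d^-1 * \sum_j Rj j * (ln (q j) / (D%:R * r%:R)).
have hy i : height E h (P i) < y.
  have le : ((height E h (P i))%:E <= ereal_sup (range (fun i => (height E h (P i))%:E)))%E.
    by apply: ereal_sup_ubound; exists i.
  rewrite -lte_fin; apply: le_lt_trans le _.
  apply: lt_le_trans hlt _; rewrite /r1 dimr.
  under eq_bigr => j _ do rewrite RE -EFinM.
  by rewrite sumEFin -EFinM -EFinD.
(* Strictness comes from a single term, which exists because [r] is positive. *)
have sumlt : \sum_a height E h (P (pt a)) < r%:R * y.
  rewrite -[X in X%:R * y]card_ord mulr_natl -sumr_const -subr_gt0 -sumrB.
  rewrite (bigD1 (Ordinal rpos)) //= ltr_pwDl ?subr_gt0 //.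
  by apply: sumr_ge0 => a _; rewrite subr_ge0 ltW.
have := ineq e; rewrite /H -mulr_suml.
set S := \sum_a _ in sumlt *.
have -> : \sum_j (\sum_(1 <= k < e.+1) order_rank E (p j) P (xi j) i1 F (t j) k)%:R
    * ln (card_quotient (ring_of_integers K) (p j))%:R
    = D%:R * r%:R * \sum_j Rj j * (ln (q j) / (D%:R * r%:R)).
  rewrite mulr_sumr; apply: eq_bigr => j _; rewrite -/(q j) -/(u j) -/(Rj j).
  by field; rewrite !gt_eqF.
set Q := \sum_j _ in y hy sumlt *.
(* Since [r] is at least 1, the term in [ln r] has the right sign for the final comparison. *)
have lnr : 0 <= ln r%:R :> R by rewrite ln_ge0 // ler1n.
rewrite leNgt => /negP; apply.
have : D%:R * d * S < D%:R * d * (r%:R * y) by rewrite ltr_pM2l // mulr_gt0.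
rewrite -/d (mulrC S d) (mulrA D%:R d S) => lt; apply: lt_le_trans lt _.
rewrite /y /slope dimr -/d.
have -> : D%:R * d * (r%:R * (arakelov_degree F (FD_product john) / (d * r%:R) / D%:R
    - ln r%:R / (2 * D%:R) + d^-1 * Q))
  = arakelov_degree F (FD_product john) - 2^-1 * (d * r%:R * ln r%:R) + D%:R * r%:R * Q.
  by field; rewrite !gt_eqF.
rewrite lerD2r gerBl ?mulr_ge0 ?invr_ge0 // ltW.
Qed.
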